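(* For every $\epsilon>0$ there is an algorithm for the fault-tolerant knapsack median problem that outputs a feasible solution of cost at most $(143.34+O(\epsilon))$ times the optimum, and whose running time is polynomial in the input size and $1/\epsilon$.
   Context: Fault-tolerant knapsack median (FTKpMed): the input consists of a set of clients $\mathcal{C}$, a set of facilities $\mathcal{F}$, a finite metric $d$ on $\mathcal{C}\cup\mathcal{F}$, an opening cost $f_i\ge 0$ and a weight $w_i\ge 0$ for each facility $i$, a budget $W\ge 0$, and a uniform requirement $r\in\mathbb{Z}_+$. A feasible solution is a set $F\subseteq\mathcal{F}$ of opened facilities (each facility opened at most once) with $\sum_{i\in F}w_i\le W$; each client is assigned its $r$ nearest open facilities. The cost is $\sum_{i\in F}f_i+\sum_{j\in\mathcal{C}}d_r(j,F)$, where $d_r(j,F)=\min_{F'\subseteq F,\,|F'|=r}\sum_{i\in F'}d(i,j)$. The goal is to minimize the cost. *)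

(* Defs.v *)
From mathcomp Require Import all_boot all_order all_algebra.

Set Implicit Arguments.
Unset Strict Implicit.
Unset Printing Implicit Defensive.

Import Order.TTheory GRing.Theory Num.Theory.

(* Computation model: the random access machine of Aho, Hopcroft and Ullman
   under the logarithmic cost criterion, with structured control flow.
   Registers hold natural numbers; executing an instruction costs the total
   bit length of the register addresses and operands that it handles. *)

Definition memory := nat -> nat.

Definition bitlen (n : nat) : nat := (trunc_log 2 n).+1.

Inductive arith := Add | Sub | Mul | Div.

Definition eval_arith (o : arith) : nat -> nat -> nat :=
  match o with Add => addn | Sub => subn | Mul => muln | Div => divn end.

Inductive prog :=
  | Const (i c : nat)               (* M[i] := c             *)
  | Op (o : arith) (i j k : nat)    (* M[i] := M[j] o M[k]   *)
  | Read (i j : nat)                (* M[i] := M[M[j]]       *)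
  | Write (i j : nat)               (* M[M[i]] := M[j]       *)
  | Seq (a b : prog)
  | If (i : nat) (a b : prog)       (* branches on M[i] != 0 *)
  | While (i : nat) (a : prog).     (* loops while M[i] != 0 *)

(* [exec a s t s'] : started on memory s, program a halts with memory s' after
   a run of total cost t. *)
Inductive exec : prog -> memory -> nat -> memory -> Prop :=
  | ExecConst i c s :
      exec (Const i c) s (bitlen i + bitlen c) [eta s with i |-> c]
  | ExecOp o i j k s :
      exec (Op o i j k) s
        (bitlen i + bitlen j + bitlen k + bitlen (s j) + bitlen (s k))
        [eta s with i |-> eval_arith o (s j) (s k)]
  | ExecRead i j s :
      exec (Read i j) s
        (bitlen i + bitlen j + bitlen (s j) + bitlen (s (s j)))
        [eta s with i |-> s (s j)]
  | ExecWrite i j s :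
      exec (Write i j) s
        (bitlen i + bitlen j + bitlen (s i) + bitlen (s j))
        [eta s with s i |-> s j]
  | ExecSeq a b s t1 s1 t2 s2 :
      exec a s t1 s1 -> exec b s1 t2 s2 -> exec (Seq a b) s (t1 + t2) s2
  | ExecIfTrue i a b s t s' :
      s i != 0 -> exec a s t s' ->
      exec (If i a b) s (bitlen i + bitlen (s i) + t) s'
  | ExecIfFalse i a b s t s' :
      s i = 0 -> exec b s t s' ->
      exec (If i a b) s (bitlen i + bitlen (s i) + t) s'
  | ExecWhileTrue i a s t1 s1 t2 s2 :
      s i != 0 -> exec a s t1 s1 -> exec (While i a) s1 t2 s2 ->
      exec (While i a) s (bitlen i + bitlen (s i) + t1 + t2) s2
  | ExecWhileFalse i a s :
      s i = 0 -> exec (While i a) s (bitlen i + bitlen (s i)) s.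

Lemma exec_deterministic a s t1 s1 t2 s2 :
  exec a s t1 s1 -> exec a s t2 s2 -> t1 = t2 /\ s1 = s2.
Proof.
move=> e1; elim: e1 t2 s2 => {a s t1 s1}.
- by move=> i c s t2 s2 e; inversion e.
- by move=> o i j k s t2 s2 e; inversion e.
- by move=> i j s t2 s2 e; inversion e.
- by move=> i j s t2 s2 e; inversion e.
- move=> a b s t1 s1 t2 s2 _ IHa _ IHb t s' e.
  inversion e as [| | | |? ? ? u1 m1 u2 m2 ea eb| | | |]; subst.
  case: (IHa _ _ ea) => -> eqs; rewrite -eqs in eb.
  by case: (IHb _ _ eb) => -> ->.
- move=> i a b s t s' si _ IH t2 s2 e.
  inversion e as [| | | | |? ? ? ? ? ? ne ea|? ? ? ? ? ? z ea| |]; subst.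
    by case: (IH _ _ ea) => -> ->.
  by rewrite z in si.
- move=> i a b s t s' si _ IH t2 s2 e.
  inversion e as [| | | | |? ? ? ? ? ? ne ea|? ? ? ? ? ? z ea| |]; subst.
    by rewrite si in ne.
  by case: (IH _ _ ea) => -> ->.
- move=> i a s t1 s1 t2 s2 si _ IHa _ IHw t s' e.
  inversion e as [| | | | | | |? ? ? ? ? ? ? ne ea ew|? ? ? z]; subst.
    case: (IHa _ _ ea) => -> eqs; rewrite -eqs in ew.
    by case: (IHw _ _ ew) => -> ->.
  by rewrite z in si.
- move=> i a s si t2 s2 e.
  inversion e as [| | | | | | |? ? ? ? ? ? ? ne ea ew|? ? ? z]; subst => //.
  by rewrite si in ne.
Qed.

(* Register 0 holds the length of the input word, which occupies the registers
   from 1 on; all other registers are initially 0. *)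
Definition init (x : seq nat) : memory := nth 0 (size x :: x).

Definition input_size (x : seq nat) : nat := \sum_(a <- x) bitlen a.

Local Open Scope ring_scope.

(* Clients and facilities are subsets, not necessarily disjoint, of the points
   'I_n of a finite metric space.  The values of fcost and weight outside of
   the set of facilities are irrelevant. *)
Record ftkpmed := FTKpMed {
  npoints : nat;
  clients : {set 'I_npoints};
  facilities : {set 'I_npoints};
  dist : 'I_npoints -> 'I_npoints -> rat;
  fcost : 'I_npoints -> rat;
  weight : 'I_npoints -> rat;
  budget : rat;
  req : nat }.

Definition is_metric (T : Type) (d : T -> T -> rat) : Prop :=
  [/\ forall x y, 0 <= d x y,
      forall x y, d x y = 0 <-> x = y,
      forall x y, d x y = d y x
    & forall x y z, d x z <= d x y + d y z].

Definition valid (I : ftkpmed) : Prop :=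
  [/\ clients I :|: facilities I = [set: 'I_(npoints I)],
      is_metric (@dist I),
      forall i, i \in facilities I -> 0 <= fcost i /\ 0 <= weight i,
      0 <= budget I
    & (0 < req I)%N].

(* The minimum of \sum_(i in F') d(i, j) over the r-subsets F' of F.  The
   default value of the iterated minimum is the sum over the whole of F; as
   distances are nonnegative it dominates all the terms, so that it does not
   affect the minimum as soon as F has at least r elements. *)
Definition dist_r (I : ftkpmed) (j : 'I_(npoints I)) (F : {set 'I_(npoints I)})
    : rat :=
  \big[Order.min / \sum_(i in F) dist i j]_(F' : {set 'I_(npoints I)} |
      (F' \subset F) && (#|F'| == req I)) \sum_(i in F') dist i j.

Definition cost (I : ftkpmed) (F : {set 'I_(npoints I)}) : rat :=
  \sum_(i in F) fcost i + \sum_(j in clients I) dist_r j F.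

(* The last condition says that every client can be assigned r distinct open
   facilities, i.e., that the minimum in dist_r ranges over a nonempty set. *)
Definition feasible (I : ftkpmed) (F : {set 'I_(npoints I)}) : Prop :=
  [/\ F \subset facilities I,
      \sum_(i in F) weight i <= budget I
    & forall j, j \in clients I -> (req I <= #|F|)%N].

Definition is_optimum (I : ftkpmed) (v : rat) : Prop :=
  (exists2 F : {set 'I_(npoints I)}, feasible F & cost F = v) /\
  (forall F : {set 'I_(npoints I)}, feasible F -> v <= cost F).

(* Only used for nonnegative rationals. *)
Definition encode_rat (q : rat) : seq nat := [:: `|numq q|%N; `|denq q|%N].

Definition encode (I : ftkpmed) : seq nat :=
  [:: npoints I; req I] ++ encode_rat (budget I)
  ++ [seq nat_of_bool (i \in clients I) | i <- enum 'I_(npoints I)]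
  ++ [seq nat_of_bool (i \in facilities I) | i <- enum 'I_(npoints I)]
  ++ flatten [seq encode_rat (fcost i) ++ encode_rat (weight i)
             | i <- enum (facilities I)]
  ++ flatten [seq encode_rat (dist i j)
             | i <- enum 'I_(npoints I), j <- enum 'I_(npoints I)].

(* The output is read off as a characteristic vector in registers 0 to n-1. *)
Definition output (I : ftkpmed) (s : memory) : {set 'I_(npoints I)} :=
  [set i : 'I_(npoints I) | s i != 0%N].

(* Main.v *)
Require Import Defs.
From mathcomp Require Import all_boot all_order all_algebra reals zify ring.

Set Implicit Arguments.
Unset Strict Implicit.
Unset Printing Implicit Defensive.

Import Order.TTheory GRing.Theory Num.Theory.
Local Open Scope nat_scope.

(** Every [eps] is served by one algorithm with ratio 122 < 143.34.

    After clearing denominators, the optimum is guessed up to a factor 2 by a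
    power of two [V].  Facilities of cost more than [V] are discarded, and a
    client [j] may only use a facility at distance [rho] if
    [\sum_k (rho - d(j, k))^+ <= V]: the distance to the [r]-th nearest open
    facility is 1-Lipschitz, so that an optimal solution satisfies this.  The
    standard linear relaxation, perturbed so as to have an interior, is solved
    by a perceptron that doubles the weight of a constraint violated too often;
    the number of doublings is bounded by the bit length of an interior point.

    The fractional solution is rounded iteratively.  Distances are rounded up to
    powers of two; every client [j] has a radius [D_j], the open and the closed
    balls [B_j] and [F_j] around it, with [y(B_j) <= r <= y(F_j)] as an
    invariant, and the balls [F_k] of the core clients are disjoint.  Moving
    along a direction that changes at most four coordinates, keeps the tight
    core constraints and the knapsack constraint, and does not increase the
    potential [f(y) + \sum_j (r D_j - \sum_i (D_j - d_ij)^+ y_i)], makes another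
    constraint tight; when [y(B_j) = r], the radius is halved.  In the end at
    most two coordinates are fractional, and rounding them to the lighter one
    costs at most a constant multiple of [V]: the clients for which the closed
    facility is near are within a fraction of the largest of their radii of each
    other, so that the condition on the distances bounds the sum of the radii. *)

(** * Weakest preconditions for the random access machine *)

(** Bit cost is measured, so that every intermediate object is an integer structure whose length has
    to be bounded. This is why the relaxation is solved by additions and exact rank-one updates of
    an adjugate, and why a fractional vector is a list of numerators over one denominator. The
    answer must keep the budget exactly although the relaxation is perturbed; as the data are
    integral, it is enough to keep the weight strictly below [W + 1]. The constant is 122 = 2 * 61
    with 61 = 20 * 2 + 21. Distances at most double when they become powers of two, so that the
    potential starts near [2 * V]. A client served through a core client pays up to 5 times its
    radius, hence the service cost is 5 times the potential plus 5 times the loss from the closed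
    facility. That loss is at most 3 times the potential, from clients for which this facility is
    far, plus [4 * V] from the others. With [V] for the facility opened instead, this makes 20 times
    the potential plus [21 * V]. The last factor 2 is the granularity of the guess; the margin below
    143.34 is why a coarse guess suffices. *)

Definition runs (A : prog) (s : memory) (Q : nat -> memory -> Prop) : Prop :=
  exists t s', exec A s t s' /\ Q t s'.

Lemma runs_mono A s (Q Q' : nat -> memory -> Prop) :
  (forall t s', Q t s' -> Q' t s') -> runs A s Q -> runs A s Q'.
Proof. by move=> h [t [s' [e q]]]; exists t, s'; split=> //; apply: h. Qed.

Lemma runs_seq A B s Q :
  runs A s (fun t1 s1 => runs B s1 (fun t2 s2 => Q (t1 + t2) s2)) ->
  runs (Seq A B) s Q.
Proof.
move=> [t1 [s1 [e1 [t2 [s2 [e2 q]]]]]].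
by exists (t1 + t2), s2; split=> //; apply: ExecSeq e1 e2.
Qed.

Lemma runs_const i c s (Q : nat -> memory -> Prop) :
  (forall s', s' i = c -> (forall j, j != i -> s' j = s j) ->
     Q (bitlen i + bitlen c) s') ->
  runs (Const i c) s Q.
Proof.
move=> h; eexists; eexists; split; first exact: ExecConst.
by apply: h => [|j /negPf] /=; [rewrite eqxx | move=> ->].
Qed.

Lemma runs_op o i j k s (Q : nat -> memory -> Prop) :
  (forall s', s' i = eval_arith o (s j) (s k) ->
     (forall l, l != i -> s' l = s l) ->
     Q (bitlen i + bitlen j + bitlen k + bitlen (s j) + bitlen (s k)) s') ->
  runs (Op o i j k) s Q.
Proof.
move=> h; eexists; eexists; split; first exact: ExecOp.
by apply: h => [|l /negPf] /=; [rewrite eqxx | move=> ->].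
Qed.

Lemma runs_if i A B s Q :
  runs (if s i != 0 then A else B) s
    (fun t s' => Q (bitlen i + bitlen (s i) + t) s') ->
  runs (If i A B) s Q.
Proof.
case: eqP => /= [z|/eqP nz] [t [s' [e q]]];
  exists (bitlen i + bitlen (s i) + t), s'; split=> //.
  exact: ExecIfFalse.
exact: ExecIfTrue.
Qed.

Lemma runs_while_false i A s (Q : nat -> memory -> Prop) :
  s i = 0 -> Q (bitlen i + bitlen (s i)) s -> runs (While i A) s Q.
Proof.
move=> z q; exists (bitlen i + bitlen (s i)), s.
by split=> //; apply: ExecWhileFalse.
Qed.

Lemma runs_while_true i A s Q :
  s i != 0 ->
  runs A s (fun t1 s1 => runs (While i A) s1
     (fun t2 s2 => Q (bitlen i + bitlen (s i) + t1 + t2) s2)) ->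
  runs (While i A) s Q.
Proof.
move=> nz [t1 [s1 [e1 [t2 [s2 [e2 q]]]]]].
by eexists; eexists; split; last exact: q; apply: ExecWhileTrue e1 e2.
Qed.

Definition copy (i j : nat) : prog := Seq (Const i 0) (Op Add i j i).

Definition ccost (i j : nat) : nat := 4 * (bitlen i + bitlen j + 1).

Lemma bitlen_gt0 n : 0 < bitlen n. Proof. by []. Qed.

Lemma runs_copy i j s (Q : nat -> memory -> Prop) : j != i ->
  (forall t s', t <= ccost i j * bitlen (s j) -> s' i = s j ->
     (forall l, l != i -> s' l = s l) -> Q t s') ->
  runs (copy i j) s Q.
Proof.
move=> ji h; apply: runs_seq; apply: runs_const => s1 e1 f1.
apply: runs_op => s2 e2 f2; apply: h.
- rewrite (f1 _ ji) e1 /ccost; have := bitlen_gt0 (s j).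
  have -> : bitlen 0 = 1 by [].
  by move: (bitlen (s j)) (bitlen i) (bitlen j) => x y z; nia.
- by rewrite e2 /= (f1 _ ji) e1 addn0.
- by move=> l li; rewrite f2 // f1.
Qed.

(** * Bit lengths and polynomial bounds *)

Lemma bitlenP n : n < 2 ^ bitlen n.
Proof. by rewrite /bitlen; apply: trunc_log_ltn. Qed.

Lemma bitlen_le n k : n < 2 ^ k -> bitlen n <= k.+1.
Proof.
move=> h; rewrite /bitlen ltnS.
case: n h => [|n] h; first by rewrite trunc_log0.
have := trunc_logP (isT : 1 < 2) (isT : 0 < n.+1) => h2.
by rewrite ltnW // -(ltn_exp2l _ _ (isT : 1 < 2)); apply: leq_ltn_trans h2 h.
Qed.

Lemma bitlen_leS n k : 0 < k -> n < 2 ^ k -> bitlen n <= k.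
Proof.
move=> k0 h; rewrite /bitlen.
case: n h => [|n] h; first by rewrite trunc_log0.
have h2 := trunc_logP (isT : 1 < 2) (isT : 0 < n.+1).
by rewrite -(ltn_exp2l _ _ (isT : 1 < 2)); apply: leq_ltn_trans h2 h.
Qed.

Lemma bitlen_mono m n : m <= n -> bitlen m <= bitlen n.
Proof.
by move=> h; apply: bitlen_leS => //; apply: leq_ltn_trans h (bitlenP n).
Qed.

Lemma bitlen_add m n : bitlen (m + n) <= bitlen m + bitlen n.
Proof.
have hm := bitlenP m; have hn := bitlenP n.
apply: bitlen_leS; first by rewrite addn_gt0 bitlen_gt0.
rewrite expnD /bitlen !expnS in hm hn *.
have := expn_gt0 2 (trunc_log 2 m); have := expn_gt0 2 (trunc_log 2 n).
by move: (2 ^ _) (2 ^ _) hm hn => x y; nia.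
Qed.

Lemma bitlen_mul m n : bitlen (m * n) <= bitlen m + bitlen n.
Proof.
apply: bitlen_leS; first by rewrite addn_gt0 bitlen_gt0.
have hm := bitlenP m; have hn := bitlenP n.
by rewrite expnD; apply: ltn_mul.
Qed.

Lemma bitlen_arith o m n : bitlen (eval_arith o m n) <= bitlen m + bitlen n.
Proof.
case: o => /=.
- exact: bitlen_add.
- by apply: leq_trans (bitlen_mono (leq_subr _ _)) (leq_addr _ _).
- exact: bitlen_mul.
- by apply: leq_trans (bitlen_mono (leq_div _ _)) (leq_addr _ _).
Qed.

Lemma bitlen_self n : bitlen n <= n.+1.
Proof. by apply: bitlen_le; apply: ltn_expl. Qed.

Lemma leq_exp2r_ m n k : m <= n -> m ^ k <= n ^ k.
Proof. by move=> h; case: k => // k; rewrite leq_exp2r. Qed.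

(** The bound is only asked for on [P]: a program for coded data may run arbitrarily long on numbers
    that code nothing. *)
Definition pbd (P : nat -> nat -> Prop) (g : nat -> nat -> nat) : Prop :=
  exists c k, forall x y, P x y -> g x y <= c * (bitlen x + bitlen y) ^ k.

Lemma sz_gt0 x y : 0 < bitlen x + bitlen y.
Proof. by rewrite addn_gt0 bitlen_gt0. Qed.

Section Pbd.

Variable P : nat -> nat -> Prop.

Lemma pbd_le g h : (forall x y, P x y -> g x y <= h x y) -> pbd P h -> pbd P g.
Proof.
move=> le [c [k e]]; exists c, k => x y p.
exact: leq_trans (le x y p) (e x y p).
Qed.

Lemma pbd_const c : pbd P (fun _ _ => c).
Proof. by exists c, 0 => x y _; rewrite expn0 muln1. Qed.

Lemma pbd_sz : pbd P (fun x y => bitlen x + bitlen y).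
Proof. by exists 1, 1 => x y _; rewrite expn1 mul1n. Qed.

Lemma pbd_add g h : pbd P g -> pbd P h -> pbd P (fun x y => g x y + h x y).
Proof.
move=> [c [k e]] [c' [k' e']]; exists (c + c'), (k + k') => x y p.
rewrite mulnDl; apply: leq_add.
  apply: leq_trans (e x y p) _.
  by rewrite leq_mul2l leq_pexp2l ?leq_addr ?orbT ?sz_gt0.
apply: leq_trans (e' x y p) _.
by rewrite leq_mul2l leq_pexp2l ?leq_addl ?orbT ?sz_gt0.
Qed.

Lemma pbd_mul g h : pbd P g -> pbd P h -> pbd P (fun x y => g x y * h x y).
Proof.
move=> [c [k e]] [c' [k' e']]; exists (c * c'), (k + k') => x y p.
by rewrite expnD mulnACA leq_mul ?e ?e'.
Qed.

Lemma pbd_x : pbd P (fun x _ => bitlen x).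
Proof. by apply: pbd_le pbd_sz => x y _; rewrite leq_addr. Qed.

Lemma pbd_y : pbd P (fun _ y => bitlen y).
Proof. by apply: pbd_le pbd_sz => x y _; rewrite leq_addl. Qed.

Lemma pbd_exp g k : pbd P g -> pbd P (fun x y => g x y ^ k).
Proof.
move=> pg; elim: k => [|k IH]; first exact: pbd_const.
by apply: pbd_le (pbd_mul pg IH) => x y _; rewrite expnS.
Qed.

Lemma pbd_comp (Q : nat -> nat -> Prop) T g1 g2 : pbd Q T ->
  (forall x y, P x y -> Q (g1 x y) (g2 x y)) ->
  pbd P (fun x y => bitlen (g1 x y)) ->
  pbd P (fun x y => bitlen (g2 x y)) -> pbd P (fun x y => T (g1 x y) (g2 x y)).
Proof.
move=> [c [k e]] PQ p1 p2.
apply: pbd_le (pbd_mul (pbd_const c) (pbd_exp k (pbd_add p1 p2))) => x y p.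
exact/e/PQ.
Qed.

End Pbd.

(** * Polynomial-time functions of two registers *)

(** A program at base [b] owns all registers from [b] on and preserves those below, so that a caller
    protects its data by invoking a subprogram at a larger base. *)
Definition impl (P : nat -> nat -> Prop) (A : prog) (b : nat)
    (f T : nat -> nat -> nat) : Prop :=
  forall s, P (s b) (s b.+1) -> runs A s (fun t s' =>
    [/\ s' b = f (s b) (s b.+1), forall i, i < b -> s' i = s i
      & t <= T (s b) (s b.+1)]).

(** Without indirect writes the registers that a program can change are bounded by its text, which
    is what [exec_frame] exploits. *)
Fixpoint nw (A : prog) : bool :=
  match A with
  | Write _ _ => false
  | Seq a b | If _ a b => nw a && nw b
  | While _ a => nw a
  | _ => true
  end.

(** The bound on the length of the value is kept beside the program, because the cost of whatever
    runs next on this value depends on it. *)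
Definition PT2 (P : nat -> nat -> Prop) (f : nat -> nat -> nat) : Prop :=
  pbd P (fun x y => bitlen (f x y)) /\
  forall b, exists A T, pbd P T /\ (impl P A b f T /\ nw A).

Section PT2.

Variable P : nat -> nat -> Prop.

Lemma PT2_ext f g : (forall x y, P x y -> f x y = g x y) -> PT2 P f -> PT2 P g.
Proof.
move=> e [pf h]; split; first by apply: pbd_le pf => x y p; rewrite e.
move=> b; have [A [T [pT [i nA]]]] := h b; exists A, T; split=> //; split=> // s p.
by apply: runs_mono (i s p) => t s' [h1 h2 h3]; split; rewrite -?e.
Qed.

Lemma PT2_arith o : PT2 P (eval_arith o).
Proof.
split; first by apply: pbd_le (pbd_sz P) => x y _; apply: bitlen_arith.
move=> b; exists (Op o b b b.+1).
exists (fun x y => bitlen b + bitlen b + bitlen b.+1 + (bitlen x + bitlen y)).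
split; first by apply: pbd_add (pbd_sz P); apply: pbd_const.
split=> // s _; apply: runs_op => s' e h; split; first exact: e.
  by move=> i ib; apply: h; rewrite ltn_eqF.
by rewrite !addnA.
Qed.

Lemma PT2_const c : PT2 P (fun _ _ => c).
Proof.
split; first exact: pbd_const.
move=> b; exists (Const b c), (fun _ _ => bitlen b + bitlen c).
split; first exact: pbd_const.
split=> // s _; apply: runs_const => s' e h; split=> // i ib.
by apply: h; rewrite ltn_eqF.
Qed.

Lemma PT2_fst : PT2 P (fun x _ => x).
Proof.
split; first exact: pbd_x.
move=> b; exists (Const b.+1 0), (fun _ _ => bitlen b.+1 + bitlen 0).
split; first exact: pbd_const.
split=> // s _; apply: runs_const => s' e h.
split; [| |by []]; first by rewrite h // neq_ltn ltnSn.
by move=> i ib; apply: h; rewrite ltn_eqF // ltnS ltnW.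
Qed.

Lemma PT2_snd : PT2 P (fun _ y => y).
Proof.
split; first exact: pbd_y.
move=> b; exists (copy b b.+1), (fun _ y => ccost b b.+1 * bitlen y).
split; first by apply: pbd_mul (pbd_y P); apply: pbd_const.
split=> // s _; apply: runs_copy; first by rewrite neq_ltn ltnSn orbT.
move=> t s' ht e h; split=> // i ib; apply: h; by rewrite ltn_eqF.
Qed.

Ltac reg := solve [lia | apply/eqP; lia | apply/eqP => ?; lia].

(** The arguments stay in [b] and [b + 1]; the value of [g1] waits in [b + 2] while [g2] runs at
    base [b + 3], so that both values end up adjacent for [f]. *)
Lemma PT2_comp (Q : nat -> nat -> Prop) f g1 g2 :
  (forall x y, P x y -> Q (g1 x y) (g2 x y)) ->
  PT2 Q f -> PT2 P g1 -> PT2 P g2 -> PT2 P (fun x y => f (g1 x y) (g2 x y)).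
Proof.
move=> PQ [pf hf] [p1 h1] [p2 h2]; split; first exact: (pbd_comp pf PQ p1 p2).
move=> b.
have [F [TF [pTF [iF nF]]]] := hf (b + 2).
have [A1 [T1 [pT1 [i1 nA1]]]] := h1 (b + 2).
have [A2 [T2 [pT2 [i2 nA2]]]] := h2 (b + 3).
exists (Seq (copy (b + 2) b) (Seq (copy (b + 3) (b + 1)) (Seq A1
       (Seq (copy (b + 3) b) (Seq (copy (b + 4) (b + 1)) (Seq A2
       (Seq F (copy b (b + 2))))))))).
exists (fun x y => ccost (b + 2) b * bitlen x + (ccost (b + 3) (b + 1) * bitlen y
  + (T1 x y + (ccost (b + 3) b * bitlen x + (ccost (b + 4) (b + 1) * bitlen y
  + (T2 x y + (TF (g1 x y) (g2 x y)
  + ccost b (b + 2) * bitlen (f (g1 x y) (g2 x y))))))))).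
split.
  have px c : pbd P (fun x _ => c * bitlen x) by apply: pbd_mul (pbd_x P); apply: pbd_const.
  have py c : pbd P (fun _ y => c * bitlen y) by apply: pbd_mul (pbd_y P); apply: pbd_const.
  do !apply: pbd_add => //.
    exact: (pbd_comp pTF PQ).
  apply: pbd_mul; first exact: pbd_const.
  exact: (pbd_comp pf PQ p1 p2).
split; last by rewrite /= nA1 nA2 nF.
move=> s p.
apply: runs_seq; apply: runs_copy => [|t1 s1 c1 e1 k1]; first by reg.
apply: runs_seq; apply: runs_copy => [|t2 s2 c2 e2 k2]; first by reg.
have E1 : s1 (b + 1) = s b.+1 by rewrite k1 ?addn1 //; reg.
have X2 : s2 (b + 2) = s b by rewrite k2 //; reg.
have Y2 : s2 (b + 2).+1 = s b.+1.
  by rewrite (_ : (b + 2).+1 = b + 3) ?e2 ?E1 //; lia.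
have p2' : P (s2 (b + 2)) (s2 (b + 2).+1) by rewrite X2 Y2.
apply: runs_seq; apply: runs_mono (i1 s2 p2') => t3 s3 [e3 k3 c3].
apply: runs_seq; apply: runs_copy => [|t4 s4 c4 e4 k4]; first by reg.
apply: runs_seq; apply: runs_copy => [|t5 s5 c5 e5 k5]; first by reg.
have S2 i : i < b + 2 -> s2 i = s i by move=> hi; rewrite k2 ?k1 //; reg.
have S3 i : i < b + 2 -> s3 i = s i by move=> hi; rewrite k3 ?S2.
have V3 : s3 (b + 2) = g1 (s b) (s b.+1) by rewrite e3 X2 Y2.
have X5 : s5 (b + 3) = s b by rewrite k5 ?e4 ?S3 //; reg.
have Y5 : s5 (b + 3).+1 = s b.+1.
  rewrite (_ : (b + 3).+1 = b + 4) ?e5; last by lia.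
  by rewrite k4 ?S3 ?addn1 //; reg.
have S5 i : i < b + 3 -> s5 i = s3 i by move=> hi; rewrite k5 ?k4 //; reg.
have p5' : P (s5 (b + 3)) (s5 (b + 3).+1) by rewrite X5 Y5.
apply: runs_seq; apply: runs_mono (i2 s5 p5') => t6 s6 [e6 k6 c6].
have X6 : s6 (b + 2) = g1 (s b) (s b.+1) by rewrite k6 ?S5 ?V3 //; reg.
have Y6 : s6 (b + 2).+1 = g2 (s b) (s b.+1).
  by rewrite (_ : (b + 2).+1 = b + 3) ?e6 ?X5 ?Y5 //; lia.
have p6' : Q (s6 (b + 2)) (s6 (b + 2).+1) by rewrite X6 Y6; apply: PQ.
apply: runs_seq; apply: runs_mono (iF s6 p6') => t7 s7 [e7 k7 c7].
apply: runs_copy => [|t8 s8 c8 e8 k8]; first by reg.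
have V7 : s7 (b + 2) = f (g1 (s b) (s b.+1)) (g2 (s b) (s b.+1)).
  by rewrite e7 X6 Y6.
split.
- by rewrite e8.
- by move=> i ib; rewrite k8 ?k7 ?k6 ?S5 ?S3 //; reg.
- rewrite X2 Y2 in c3; rewrite X5 Y5 in c6; rewrite X6 Y6 in c7.
  rewrite V7 in c8; rewrite E1 in c2; rewrite S3 // in c4; last by reg.
  have E4 : s4 (b + 1) = s b.+1 by rewrite k4 ?S3 ?addn1 //; reg.
  rewrite E4 in c5.
  by do !apply: leq_add.
Qed.

Lemma pbd_split c g h : pbd (fun x y => P x y /\ c x y != 0) g ->
  pbd (fun x y => P x y /\ c x y = 0) h ->
  pbd P (fun x y => if c x y != 0 then g x y else h x y).
Proof.
move=> [c1 [k1 e1]] [c2 [k2 e2]]; exists (c1 + c2), (k1 + k2) => x y p.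
have u := sz_gt0 x y; case: eqP => /= [z|/eqP z].
  apply: leq_trans (e2 x y (conj p z)) _.
  by apply: leq_mul; rewrite ?leq_addl ?leq_pexp2l ?leq_addl.
apply: leq_trans (e1 x y (conj p z)) _.
by apply: leq_mul; rewrite ?leq_addr ?leq_pexp2l ?leq_addr.
Qed.

Lemma PT2_if c f g : PT2 P c ->
  PT2 (fun x y => P x y /\ c x y != 0) f ->
  PT2 (fun x y => P x y /\ c x y = 0) g ->
  PT2 P (fun x y => if c x y != 0 then f x y else g x y).
Proof.
move=> [pc hc] [pf hf] [pg hg]; split.
  by apply: pbd_le (pbd_split pf pg) => x y _; case: ifP.
move=> b.
have [C [TC [pTC [iC nC]]]] := hc (b + 2).
have [F [TF [pTF [iF nF]]]] := hf b.
have [G [TG [pTG [iG nG]]]] := hg b.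
exists (Seq (copy (b + 2) b) (Seq (copy (b + 3) (b + 1)) (Seq C
       (If (b + 2) F G)))).
exists (fun x y => ccost (b + 2) b * bitlen x + (ccost (b + 3) (b + 1) * bitlen y
  + (TC x y + (bitlen (b + 2) + bitlen (c x y)
  + (if c x y != 0 then TF x y else TG x y))))).
split.
  have px c' : pbd P (fun x _ => c' * bitlen x).
    by apply: pbd_mul (pbd_x P); apply: pbd_const.
  have py c' : pbd P (fun _ y => c' * bitlen y).
    by apply: pbd_mul (pbd_y P); apply: pbd_const.
  by do !apply: pbd_add => //; [apply: pbd_const | apply: pbd_split].
split; last by rewrite /= nC nF nG.
move=> s p.
apply: runs_seq; apply: runs_copy => [|t1 s1 c1 e1 k1]; first by reg.
apply: runs_seq; apply: runs_copy => [|t2 s2 c2 e2 k2]; first by reg.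
have E1 : s1 (b + 1) = s b.+1 by rewrite k1 ?addn1 //; reg.
have X2 : s2 (b + 2) = s b by rewrite k2 //; reg.
have Y2 : s2 (b + 2).+1 = s b.+1.
  by rewrite (_ : (b + 2).+1 = b + 3) ?e2 ?E1 //; lia.
have p2' : P (s2 (b + 2)) (s2 (b + 2).+1) by rewrite X2 Y2.
apply: runs_seq; apply: runs_mono (iC s2 p2') => t3 s3 [e3 k3 c3].
have S3 i : i < b + 2 -> s3 i = s i by move=> hi; rewrite k3 ?k2 ?k1 //; reg.
have V3 : s3 (b + 2) = c (s b) (s b.+1) by rewrite e3 X2 Y2.
rewrite X2 Y2 in c3; rewrite E1 in c2.
apply: runs_if; rewrite V3.
have Sb : s3 b = s b by apply: S3; reg.
have Sb1 : s3 b.+1 = s b.+1 by apply: S3; reg.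
case: eqP => /= [z|/eqP z].
  have p3 : P (s3 b) (s3 b.+1) /\ c (s3 b) (s3 b.+1) = 0 by rewrite Sb Sb1.
  apply: runs_mono (iG s3 p3) => t4 s4 [e4 k4 c4]; rewrite Sb Sb1 in e4 c4.
  split=> //; first by move=> i ib; rewrite k4 ?S3 //; reg.
  by do !apply: leq_add => //.
have p3 : P (s3 b) (s3 b.+1) /\ c (s3 b) (s3 b.+1) != 0 by rewrite Sb Sb1.
apply: runs_mono (iF s3 p3) => t4 s4 [e4 k4 c4]; rewrite Sb Sb1 in e4 c4.
split=> //; first by move=> i ib; rewrite k4 ?S3 //; reg.
by do !apply: leq_add => //.
Qed.

Fixpoint wh (f c : nat -> nat -> nat) (n x y : nat) : nat :=
  if n is n'.+1 then
    if c x y != 0 then wh f c n' x (f x y) else y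
  else y.

(* [N] bounds the number of iterations and [S] the bit length of the states;
   neither has to be computed by the machine. *)
Lemma PT2_while (Q : nat -> nat -> Prop) f c (N S : nat -> nat -> nat) :
  PT2 Q f -> PT2 Q c -> pbd P N -> pbd P S ->
  (forall x y i, P x y -> i <= N x y ->
     Q x (wh f c i x y) /\ bitlen (wh f c i x y) <= S x y) ->
  (forall x y, P x y -> c x (wh f c (N x y) x y) = 0) ->
  PT2 P (fun x y => wh f c (N x y) x y).
Proof.
move=> [pf hf] [pc hc] pN pS hS hN; split.
  by apply: pbd_le pS => x y p; apply: (hS x y _ p _).2.
move=> b.
have [F [TF [[cF [kF pTF]] [iF nF]]]] := hf (b + 2).
have [C [TC [[cC [kC pTC]] [iC nC]]]] := hc (b + 2).
have [cc [kc pcc]] := pc; have [cf [kf pcf]] := pf.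
set CC := Seq (copy (b + 2) b) (Seq (copy (b + 3) (b + 1)) C).
set FF := Seq (copy (b + 2) b) (Seq (copy (b + 3) (b + 1)) (Seq F
            (copy (b + 1) (b + 2)))).
(* Argument and state together have length at most [u] in every round, so that the cost of a round
   is bounded in terms of [u] alone. *)
pose u x y := bitlen x + S x y.
pose KC x y := ccost (b + 2) b * u x y + (ccost (b + 3) (b + 1) * u x y
  + cC * u x y ^ kC).
pose KF x y := ccost (b + 2) b * u x y + (ccost (b + 3) (b + 1) * u x y
  + (cF * u x y ^ kF + ccost (b + 1) (b + 2) * (cf * u x y ^ kf))).
pose KW x y := bitlen (b + 2) + cc * u x y ^ kc.
pose R x y := KW x y + (KF x y + KC x y).
exists (Seq CC (Seq (While (b + 2) (Seq FF CC)) (copy b (b + 1)))).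
exists (fun x y => KC x y + ((N x y * R x y + KW x y) + ccost b (b + 1) * u x y)).
have pu : pbd P u by apply: pbd_add pS; exact: pbd_x.
have pKW : pbd P KW.
  apply: pbd_add; first exact: pbd_const.
  apply: pbd_mul; [exact: pbd_const|exact: pbd_exp].
have pKC : pbd P KC.
  by do !apply: pbd_add; apply: pbd_mul; do ?[exact: pbd_const | exact: pbd_exp].
have pKF : pbd P KF.
  do !apply: pbd_add; apply: pbd_mul; do ?[exact: pbd_const | exact: pbd_exp] => //.
  by apply: pbd_mul; do ?[exact: pbd_const | exact: pbd_exp].
split.
  apply: pbd_add => //; apply: pbd_add.
    by apply: (pbd_add _ pKW); apply: (pbd_mul pN); apply: (pbd_add pKW); apply: pbd_add.
  by apply: pbd_mul => //; apply: pbd_const.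
split; last by rewrite /= nF nC.
have runCC s U : Q (s b) (s b.+1) -> bitlen (s b) + bitlen (s b.+1) <= U ->
  runs CC s (fun t s' => [/\ s' (b + 2) = c (s b) (s b.+1),
    forall i, i < b + 2 -> s' i = s i
    & t <= ccost (b + 2) b * U + (ccost (b + 3) (b + 1) * U + cC * U ^ kC)]).
  move=> q hU.
  apply: runs_seq; apply: runs_copy => [|t1 s1 c1 e1 k1]; first by reg.
  apply: runs_seq; apply: runs_copy => [|t2 s2 c2 e2 k2]; first by reg.
  have E1 : s1 (b + 1) = s b.+1 by rewrite k1 ?addn1 //; reg.
  have X2 : s2 (b + 2) = s b by rewrite k2 //; reg.
  have Y2 : s2 (b + 2).+1 = s b.+1.
    by rewrite (_ : (b + 2).+1 = b + 3) ?e2 ?E1 //; lia.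
  have q2 : Q (s2 (b + 2)) (s2 (b + 2).+1) by rewrite X2 Y2.
  apply: runs_mono (iC s2 q2) => t3 s3 [e3 k3 c3].
  split; first by rewrite e3 X2 Y2.
    by move=> i hi; rewrite k3 ?k2 ?k1 //; reg.
  rewrite X2 Y2 in c3; rewrite E1 in c2.
  apply: leq_add; first by apply: leq_trans c1 _; rewrite leq_mul2l; lia.
  apply: leq_add; first by apply: leq_trans c2 _; rewrite leq_mul2l; lia.
  apply: leq_trans c3 (leq_trans (pTC _ _ q) _).
  by rewrite leq_mul2l leq_exp2r_ ?orbT.
have runFF s U : Q (s b) (s b.+1) -> bitlen (s b) + bitlen (s b.+1) <= U ->
  runs FF s (fun t s' => [/\ s' b.+1 = f (s b) (s b.+1),
    forall i, i <= b -> s' i = s i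
    & t <= ccost (b + 2) b * U + (ccost (b + 3) (b + 1) * U + (cF * U ^ kF
          + ccost (b + 1) (b + 2) * (cf * U ^ kf)))]).
  move=> q hU.
  apply: runs_seq; apply: runs_copy => [|t1 s1 c1 e1 k1]; first by reg.
  apply: runs_seq; apply: runs_copy => [|t2 s2 c2 e2 k2]; first by reg.
  have E1 : s1 (b + 1) = s b.+1 by rewrite k1 ?addn1 //; reg.
  have X2 : s2 (b + 2) = s b by rewrite k2 //; reg.
  have Y2 : s2 (b + 2).+1 = s b.+1.
    by rewrite (_ : (b + 2).+1 = b + 3) ?e2 ?E1 //; lia.
  have q2 : Q (s2 (b + 2)) (s2 (b + 2).+1) by rewrite X2 Y2.
  apply: runs_seq; apply: runs_mono (iF s2 q2) => t3 s3 [e3 k3 c3].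
  apply: runs_copy => [|t4 s4 c4 e4 k4]; first by reg.
  rewrite X2 Y2 in e3 c3; rewrite E1 in c2; rewrite e3 in c4 e4.
  split; first by move: e4; rewrite addn1.
    by move=> i hi; rewrite k4 ?k3 ?k2 ?k1 //; reg.
  apply: leq_add; first by apply: leq_trans c1 _; rewrite leq_mul2l; lia.
  apply: leq_add; first by apply: leq_trans c2 _; rewrite leq_mul2l; lia.
  apply: leq_add.
    apply: leq_trans c3 (leq_trans (pTF _ _ q) _).
    by rewrite leq_mul2l leq_exp2r_ ?orbT.
  apply: leq_trans c4 _; rewrite leq_mul2l; apply/orP; right.
  by apply: leq_trans (pcf _ _ q) _; rewrite leq_mul2l leq_exp2r_ ?orbT.
have loop n s x y U : s b = x -> s b.+1 = y -> s (b + 2) = c x y ->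
    (forall i, i <= n -> Q x (wh f c i x y) /\
       bitlen x + bitlen (wh f c i x y) <= U) ->
    c x (wh f c n x y) = 0 ->
    runs (While (b + 2) (Seq FF CC)) s (fun t s' =>
      [/\ s' b.+1 = wh f c n x y, forall i, i < b -> s' i = s i
        & t <= n * ((bitlen (b + 2) + cc * U ^ kc) +
            ((ccost (b + 2) b * U + (ccost (b + 3) (b + 1) * U + (cF * U ^ kF
              + ccost (b + 1) (b + 2) * (cf * U ^ kf)))) +
             (ccost (b + 2) b * U + (ccost (b + 3) (b + 1) * U + cC * U ^ kC))))
            + (bitlen (b + 2) + cc * U ^ kc)]).
  elim: n s y => [|n IH] s y sx sy sc hU h0.
    rewrite /= in h0; apply: runs_while_false; first by rewrite sc.
    split=> //=; rewrite sc mul0n add0n leq_add2l.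
    by apply: leq_trans (pcc _ _ (hU 0 isT).1) _; rewrite leq_mul2l leq_exp2r_ ?orbT ?(hU 0 _).2.
  have hc0 : bitlen (c x y) <= cc * U ^ kc.
    by apply: leq_trans (pcc _ _ (hU 0 isT).1) _; rewrite leq_mul2l leq_exp2r_ ?orbT ?(hU 0 _).2.
  case: (eqVneq (c x y) 0) => [z|nz].
    apply: runs_while_false; first by rewrite sc.
    split=> //; first by rewrite /= z.
    by rewrite sc; apply: leq_trans (leq_addl _ _); rewrite leq_add2l.
  apply: runs_while_true; first by rewrite sc.
  have hU0 : bitlen (s b) + bitlen (s b.+1) <= U.
    by rewrite sx sy; apply: (hU 0 _).2.
  have q0 : Q (s b) (s b.+1) by rewrite sx sy; apply: (hU 0 _).1.
  apply: runs_seq; apply: runs_mono (runFF s U q0 hU0) => t1 s1 [e1 k1 c1].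
  have hy1 : s1 b.+1 = f x y by rewrite e1 sx sy.
  have hx1 : s1 b = x by rewrite k1.
  have hU1 : bitlen (s1 b) + bitlen (s1 b.+1) <= U.
    by rewrite hx1 hy1; have := (hU 1 isT).2; rewrite /= nz.
  have q1 : Q (s1 b) (s1 b.+1).
    by rewrite hx1 hy1; have := (hU 1 isT).1; rewrite /= nz.
  apply: runs_mono (runCC s1 U q1 hU1) => t2 s2 [e2 k2 c2].
  have := IH s2 (f x y); case.
  - by rewrite k2 //; reg.
  - by rewrite k2 //; reg.
  - by rewrite e2 hx1 hy1.
  - by move=> i hi; have := hU i.+1 hi; rewrite /= nz.
  - by move: h0; rewrite /= nz.
  move=> t3 [s3 [ex3 [e3 k3 c3]]]; exists t3, s3; split=> //; split.
  - by rewrite e3 /= nz.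
  - by move=> i ib; rewrite k3 // k2 ?k1 //; reg.
  - have h1 : bitlen (b + 2) + bitlen (s (b + 2)) <= bitlen (b + 2) + cc * U ^ kc.
      by rewrite sc leq_add2l.
    move: c1 c2 c3 h1; rewrite mulSn; move: (n * _) => nn.
    move: (bitlen (s _)) (bitlen (b + 2)) (cc * _) (cF * _) (cC * _).
    move: (ccost _ _ * U) (ccost _ _ * U) (ccost _ _ * (_ * _)) => *; lia.
move=> s; set x := s b; set y := s b.+1 => p.
have hu i : i <= N x y -> Q x (wh f c i x y) /\
    bitlen x + bitlen (wh f c i x y) <= u x y.
  by move=> hi; rewrite leq_add2l; apply: hS.
apply: runs_seq; apply: runs_mono (runCC s (u x y) (hu 0 isT).1 (hu 0 isT).2) => t1 s1 [e1 k1 c1].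
have b1 : s1 b = x by rewrite k1 //; reg.
have b2 : s1 b.+1 = y by rewrite k1 //; reg.
apply: runs_seq.
apply: runs_mono (loop (N x y) s1 x y (u x y) b1 b2 e1 hu (hN x y p)) => t2 s2 [e2 k2 c2].
apply: runs_copy => [|t3 s3 c3 e3 k3]; first by reg.
have e2' : s2 (b + 1) = wh f c (N x y) x y by rewrite addn1.
rewrite e2' in c3 e3; split=> //.
  by move=> i ib; rewrite k3 ?k2 ?k1 //; reg.
apply: leq_add => //; apply: leq_add => //.
apply: leq_trans c3 _; rewrite leq_mul2l.
by rewrite (leq_trans _ (hu (N x y) (leqnn _)).2) ?orbT // addnC leq_addr.
Qed.

End PT2.

(** * Pairing *)

Lemma wh_search f c x k n y : k <= n ->
  (forall i, i < k -> c x (iter i (f x) y) != 0) ->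
  c x (iter k (f x) y) = 0 -> wh f c n x y = iter k (f x) y.
Proof.
elim: k n y => [|k IH] [|n] y //=; first by move=> _ _ ->.
rewrite ltnS => kn h h0; rewrite (h 0 isT); rewrite -iterS iterSr.
apply: IH => // [i ik|]; last by rewrite -iterSr.
by rewrite -iterSr; apply: h.
Qed.

Lemma wh_iter f c n x y : exists2 k, k <= n & wh f c n x y = iter k (f x) y.
Proof.
elim: n y => [|n IH] y /=; first by exists 0.
case: ifP => _; last by exists 0.
by have [k kn ->] := IH (f x y); exists k.+1 => //; rewrite iterSr.
Qed.

Lemma wh_stop f c n x y :
  (forall z, c x z = 0 -> c x (f x z) = 0) ->
  c x (iter n (f x) y) = 0 -> c x (wh f c n x y) = 0.
Proof.
move=> st; elim: n y => [|n IH] y //=.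
case: eqP => //= nz; rewrite -iterS iterSr; exact: IH.
Qed.

Definition dbl (_ p : nat) : nat := p + p.

Lemma iter_dbl x i p : iter i (dbl x) p = p * 2 ^ i.
Proof.
by elim: i => [|i IH]; rewrite ?expn0 ?muln1 //= IH /dbl addnn expnS mulnCA mul2n.
Qed.

Definition pw (n : nat) : nat := if n == 0 then 1 else 2 ^ bitlen n.

(** Nonzero exactly when [x] is nonzero and divisible by [2 * p], so that doubling [p] from 1 stops
    at the largest power of two dividing [x]. The factor [x] stops the search at once on 0. *)
Definition tzc (x p : nat) : nat := x * (1 - (x - x %/ (p + p) * (p + p))).

Definition tz (x : nat) : nat := wh dbl tzc (bitlen x) x 1.

Definition allp (x y : nat) := True.

Lemma PT2_add P f g : PT2 P f -> PT2 P g -> PT2 P (fun x y => f x y + g x y).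
Proof. by move=> pf pg; exact: (PT2_comp (Q := allp) _ (PT2_arith _ Add) pf pg). Qed.
Lemma PT2_sub P f g : PT2 P f -> PT2 P g -> PT2 P (fun x y => f x y - g x y).
Proof. by move=> pf pg; exact: (PT2_comp (Q := allp) _ (PT2_arith _ Defs.Sub) pf pg). Qed.
Lemma PT2_mul P f g : PT2 P f -> PT2 P g -> PT2 P (fun x y => f x y * g x y).
Proof. by move=> pf pg; exact: (PT2_comp (Q := allp) _ (PT2_arith _ Mul) pf pg). Qed.
Lemma PT2_div P f g : PT2 P f -> PT2 P g -> PT2 P (fun x y => f x y %/ g x y).
Proof. by move=> pf pg; exact: (PT2_comp (Q := allp) _ (PT2_arith _ Div) pf pg). Qed.

Lemma PT2_dbl P : PT2 P dbl.
Proof. by apply: PT2_add; apply: PT2_snd. Qed.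

Lemma bitlen_dbls x y i : i <= bitlen x ->
  bitlen (iter i (dbl x) y) <= bitlen y + (bitlen x).+1.
Proof.
move=> h; rewrite iter_dbl; apply: leq_trans (bitlen_mul _ _) _.
rewrite leq_add2l; apply: leq_trans (bitlen_mono (leq_pexp2l (isT : 0 < 2) h)) _.
by apply: bitlen_leS => //; rewrite ltn_exp2l.
Qed.

Lemma PT2_search c : PT2 allp c ->
  (forall x y, c x (wh dbl c (bitlen x) x y) = 0) ->
  PT2 allp (fun x y => wh dbl c (bitlen x) x y).
Proof.
move=> pc h; pose S x y := bitlen y + (bitlen x).+1.
apply: (@PT2_while _ allp dbl c (fun x _ => bitlen x) S) => //.
- exact: PT2_dbl.
- exact: pbd_x.
- apply: pbd_add; first exact: pbd_y.
  by apply: pbd_le (pbd_add (pbd_x _) (pbd_const _ 1)) => x y _; rewrite addn1.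
- move=> x y i _ hi; split=> //; have [k ki ->] := wh_iter dbl c i x y.
  by apply: bitlen_dbls; apply: leq_trans hi.
Qed.

Lemma PT2_pw P : PT2 P (fun x _ => pw x).
Proof.
have Q : PT2 allp (fun x y => wh dbl divn (bitlen x) x y).
  apply: PT2_search; first exact: (PT2_arith _ Div).
  move=> x y; apply: wh_stop => [z|].
    case: z => [|z]; first by rewrite /dbl !divn0.
    by move=> /eqP; rewrite /dbl eqn0Ngt divn_gt0 // -ltnNge => h; apply: divn_small; lia.
  rewrite iter_dbl; case: y => [|y]; first by rewrite mul0n divn0.
  by apply: divn_small; apply: leq_trans (bitlenP x) _; rewrite mulSn leq_addr.
apply: (PT2_ext _ (PT2_comp _ Q (PT2_fst P) (PT2_const P 1))) => // x _ _.
rewrite /pw; case: eqP => [->|/eqP x0] //.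
rewrite (@wh_search dbl divn x (bitlen x)) // ?iter_dbl ?mul1n //.
  move=> i ix; rewrite iter_dbl mul1n -lt0n divn_gt0 ?expn_gt0 //.
  apply: leq_trans (trunc_logP (isT : 1 < 2) _); last by rewrite lt0n.
  by rewrite leq_exp2l.
by apply: divn_small; apply: bitlenP.
Qed.

Lemma PT2_tz P : PT2 P (fun x _ => tz x).
Proof.
have Q : PT2 allp (fun x y => wh dbl tzc (bitlen x) x y).
  have hd : PT2 allp (fun x y => y + y) by apply: PT2_add; apply: PT2_snd.
  apply: PT2_search.
    apply: PT2_mul; first exact: PT2_fst.
    apply: PT2_sub; first exact: PT2_const.
    apply: PT2_sub; first exact: PT2_fst.
    by apply: PT2_mul => //; apply: PT2_div => //; apply: PT2_fst.
  have modE x p : tzc x p = x * (1 - x %% (p + p)).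
    by rewrite /tzc {2}(divn_eq x (p + p)) addKn.
  move=> x y; apply: wh_stop => [z|].
    rewrite !modE /dbl; case: x => // x /eqP.
    rewrite muln_eq0 /= subn_eq0 => h; apply/eqP; rewrite muln_eq0 /= subn_eq0.
    rewrite lt0n; apply: contraTneq h => e; rewrite -leqNgt leqn0.
    move/eqP: e; rewrite -!/(dvdn _ _) => e; apply: dvdn_trans e.
    exact: dvdn_add.
  rewrite iter_dbl modE; case: x => // x; apply/eqP; rewrite muln_eq0 /= subn_eq0.
  case: y => [|y]; first by rewrite mul0n modn0.
  rewrite modn_small //.
  have := bitlenP x.+1; rewrite mulSn; move: (2 ^ _) (y * _) => a b; lia.
by apply: (PT2_ext _ (PT2_comp _ Q (PT2_fst P) (PT2_const P 1))).
Qed.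

Lemma pwE n : exists k, pw n = 2 ^ k.
Proof. by rewrite /pw; case: eqP; [exists 0 | exists (bitlen n)]. Qed.

Lemma pw_gt0 n : 0 < pw n.
Proof. by have [k ->] := pwE n; rewrite expn_gt0. Qed.

Lemma ltn_pw n : n < pw n.
Proof. by rewrite /pw; case: eqP => [->|] // _; apply: bitlenP. Qed.

(** The lowest set bit of the code is [pw a], which tells the width of the field that holds [a]; [b]
    stands above that field. The length of [b] enters the length of the code with coefficient one,
    so that the right-nested pairs coding a list grow linearly in its number of entries. *)
Definition cp (a b : nat) : nat := (b * pw a + a) * (pw a + pw a) + pw a.
Definition c1 (x : nat) : nat :=
  x %/ (tz x + tz x) - x %/ (tz x + tz x) %/ tz x * tz x.
Definition c2 (x : nat) : nat := x %/ (tz x + tz x) %/ tz x.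

Lemma cp_gt0 a b : 0 < cp a b.
Proof. by rewrite /cp addn_gt0 pw_gt0 orbT. Qed.

Lemma tz_cp a b : tz (cp a b) = pw a.
Proof.
have [k kE] := pwE a.
have modE x p : tzc x p = x * (1 - x %% (p + p)).
  by rewrite /tzc {2}(divn_eq x (p + p)) addKn.
have X : cp a b = (b * pw a + a) * 2 ^ k.+1 + 2 ^ k.
  by rewrite /cp kE expnS mul2n addnn.
rewrite /tz (@wh_search dbl tzc _ k) ?iter_dbl ?mul1n ?kE //.
- rewrite -(leq_exp2l _ _ (isT : 1 < 2)) -kE ltnW //.
  apply: leq_ltn_trans (bitlenP (cp a b)); rewrite /cp leq_addl //.
- move=> i ik; rewrite iter_dbl mul1n modE X addnn -mul2n -expnS.
  rewrite -lt0n muln_gt0 addn_gt0 expn_gt0 orbT /= subn_gt0 ltnS leqn0.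
  apply: dvdn_add; last exact: dvdn_exp2l.
  by apply: dvdn_mull; apply: dvdn_exp2l; rewrite ltnW.
- rewrite modE X addnn -mul2n -expnS modnMDl modn_small ?ltn_exp2l //.
  by case: (2 ^ k) (expn_gt0 2 k) => // u _; rewrite subSS sub0n muln0.
Qed.

Lemma c1_cp a b : c1 (cp a b) = a.
Proof.
rewrite /c1 tz_cp /cp.
have p0 := pw_gt0 a; have pa := ltn_pw a.
have h : pw a < pw a + pw a by lia.
have h0 : 0 < pw a + pw a by lia.
rewrite divnMDl // (divn_small h) addn0 divnMDl // (divn_small pa) addn0.
by rewrite addKn.
Qed.

Lemma c2_cp a b : c2 (cp a b) = b.
Proof.
rewrite /c2 tz_cp /cp.
have p0 := pw_gt0 a; have pa := ltn_pw a.
have h : pw a < pw a + pw a by lia.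
have h0 : 0 < pw a + pw a by lia.
by rewrite divnMDl // (divn_small h) addn0 divnMDl // (divn_small pa) addn0.
Qed.

Lemma PT2_cp P f g : PT2 P f -> PT2 P g -> PT2 P (fun x y => cp (f x y) (g x y)).
Proof.
have hp : PT2 allp (fun x _ => pw x) by apply: PT2_pw.
have hpp : PT2 allp (fun x _ => pw x + pw x) by apply: PT2_add.
apply: (@PT2_comp P allp cp f g) => //; rewrite /cp.
apply: PT2_add => //; apply: PT2_mul => //; apply: PT2_add; last exact: PT2_fst.
by apply: PT2_mul => //; apply: PT2_snd.
Qed.

Lemma PT2_c2 P f : PT2 P f -> PT2 P (fun x y => c2 (f x y)).
Proof.
move=> pf; have ht : PT2 allp (fun x _ => tz x) by apply: PT2_tz.
apply: (@PT2_comp P allp (fun x _ => c2 x) f f) => //.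
do 2!apply: PT2_div => //; first exact: PT2_fst.
by apply: PT2_add.
Qed.

Lemma PT2_c1 P f : PT2 P f -> PT2 P (fun x y => c1 (f x y)).
Proof.
move=> pf; have ht : PT2 allp (fun x _ => tz x) by apply: PT2_tz.
apply: (@PT2_comp P allp (fun x _ => c1 x) f f) => //.
have h : PT2 allp (fun x _ => x %/ (tz x + tz x)).
  by apply: PT2_div; [exact: PT2_fst | apply: PT2_add].
by apply: PT2_sub => //; apply: PT2_mul => //; apply: PT2_div.
Qed.

Lemma bitlen_cp a b : bitlen (cp a b) <= bitlen b + 2 * bitlen a + 4.
Proof.
have h : cp a b < 2 ^ (bitlen b + 2 * bitlen a + 4).
  have hb := bitlenP b; have ha := bitlenP a; have hp : pw a <= 2 ^ bitlen a.
    by rewrite /pw; case: eqP => // _; rewrite expn_gt0.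
  rewrite mul2n -addnn !expnD /cp.
  move: hb ha hp (pw_gt0 a); move: (2 ^ bitlen a) (2 ^ bitlen b) (pw a) => u v w.
  move=> h1 h2 h3 h4; rewrite (_ : 2 ^ 4 = 16) //.
  have k1 : b * w + a <= v * u.
    have: b * w <= (v - 1) * u by apply: leq_mul => //; lia.
    by rewrite mulnBl mul1n; nia.
  have k2 : (b * w + a) * (w + w) <= v * u * (u + u) by apply: leq_mul; lia.
  have k3 : u <= v * (u * u) by nia.
  nia.
by apply: bitlen_leS => //; rewrite addn_gt0 orbT.
Qed.

(** * Polynomial-time functions on structured data *)

Class Enc (T : Type) := enc : T -> nat.
Instance enc_nat : Enc nat := id.
Instance enc_bool : Enc bool := nat_of_bool.
Instance enc_prod (X Y : Type) (eX : Enc X) (eY : Enc Y) : Enc (X * Y) :=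
  fun p => cp (enc p.1) (enc p.2).
(** A pair is never coded by 0, so that emptiness of a list is a test for zero. *)
Instance enc_seq (X : Type) (eX : Enc X) : Enc (seq X) :=
  fun l => foldr (fun a c => cp (enc a) c) 0 l.

Definition sz {X : Type} {eX : Enc X} (x : X) : nat := bitlen (enc x).

(** Only the values of [g] on codes matter, and its time bound is claimed only there. *)
Definition PT {X Y : Type} {eX : Enc X} {eY : Enc Y} (f : X -> Y) : Prop :=
  exists2 g : nat -> nat, PT2 (fun x _ => exists a : X, x = enc a) (fun x _ => g x)
  & forall a, g (enc a) = enc (f a).

Definition pb {X : Type} {eX : Enc X} (g : X -> nat) : Prop :=
  exists c k, forall x, g x <= c * sz x ^ k.

Section Pb.
Context {X : Type} {eX : Enc X}.

Lemma szp (x : X) : 0 < sz x. Proof. exact: bitlen_gt0. Qed.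

Lemma pb_le (g h : X -> nat) : (forall x, g x <= h x) -> pb h -> pb g.
Proof. by move=> le [c [k e]]; exists c, k => x; apply: leq_trans (e x). Qed.

Lemma pb_const c : pb (fun _ : X => c).
Proof. by exists c, 0 => x; rewrite expn0 muln1. Qed.

Lemma pb_sz : pb (fun x : X => sz x).
Proof. by exists 1, 1 => x; rewrite expn1 mul1n. Qed.

Lemma pb_add (g h : X -> nat) : pb g -> pb h -> pb (fun x => g x + h x).
Proof.
move=> [c [k e]] [c' [k' e']]; exists (c + c'), (k + k') => x; rewrite mulnDl.
apply: leq_add; [apply: leq_trans (e x) _|apply: leq_trans (e' x) _];
  by rewrite leq_mul2l leq_pexp2l ?leq_addr ?leq_addl ?orbT ?szp.
Qed.

Lemma pb_mul (g h : X -> nat) : pb g -> pb h -> pb (fun x => g x * h x).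
Proof.
move=> [c [k e]] [c' [k' e']]; exists (c * c'), (k + k') => x.
by rewrite expnD mulnACA leq_mul.
Qed.

Lemma pb_exp (g : X -> nat) k : pb g -> pb (fun x => g x ^ k).
Proof.
move=> pg; elim: k => [|k IH]; first exact: pb_const.
by apply: pb_le (pb_mul pg IH) => x; rewrite expnS.
Qed.

End Pb.

Lemma PT_sz {X Y : Type} {eX : Enc X} {eY : Enc Y} (f : X -> Y) :
  PT f -> pb (fun x => sz (f x)).
Proof.
move=> [g [[c [k e]] _] gE].
apply: pb_le (pb_mul (pb_const c) (pb_exp k (pb_add pb_sz (pb_const 1)))) => x.
by have := e (enc x) 0 (ex_intro _ x erefl); rewrite gE.
Qed.

Section PTbase.
Context {X : Type} {eX : Enc X}.

Lemma PT_ext {Y : Type} {eY : Enc Y} (f g : X -> Y) :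
  (forall x, f x = g x) -> PT f -> PT g.
Proof. by move=> e [h ph hE]; exists h => // a; rewrite hE e. Qed.

Lemma PT_id : PT (fun x : X => x).
Proof. by exists id => //; apply: PT2_fst. Qed.

Lemma PT_const {Y : Type} {eY : Enc Y} (y : Y) : PT (fun _ : X => y).
Proof. by exists (fun _ => enc y) => //; apply: PT2_const. Qed.

Lemma PT_comp {Y Z : Type} {eY : Enc Y} {eZ : Enc Z} (f : Y -> Z) (g : X -> Y) :
  PT f -> PT g -> PT (fun x => f (g x)).
Proof.
move=> [f' pf fE] [g' pg gE]; exists (fun x => f' (g' x)) => [|a]; last by rewrite gE fE.
apply: (PT2_comp _ pf pg pg) => x _ [a ->]; rewrite gE; by exists (g a).
Qed.

Lemma PT_code1 {Y Z : Type} {eY : Enc Y} {eZ : Enc Z} (h : nat -> nat) (f : X -> Y)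
    (r : X -> Z) : PT2 allp (fun x _ => h x) -> PT f ->
  (forall x, h (enc (f x)) = enc (r x)) -> PT r.
Proof.
move=> ph [f' pf fE] hE; exists (fun x => h (f' x)) => [|a]; last by rewrite fE hE.
exact: (PT2_comp (Q := allp) _ ph pf pf).
Qed.

Lemma PT_code2 {Y Z V : Type} {eY : Enc Y} {eZ : Enc Z} {eV : Enc V}
    (h : nat -> nat -> nat) (f : X -> Y) (g : X -> Z) (r : X -> V) :
  PT2 allp h -> PT f -> PT g ->
  (forall x, h (enc (f x)) (enc (g x)) = enc (r x)) -> PT r.
Proof.
move=> ph [f' pf fE] [g' pg gE] hE.
exists (fun x => h (f' x) (g' x)) => [|a]; last by rewrite fE gE hE.
exact: (PT2_comp (Q := allp) _ ph pf pg).
Qed.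

Lemma PT_pair {Y Z : Type} {eY : Enc Y} {eZ : Enc Z} (f : X -> Y) (g : X -> Z) :
  PT f -> PT g -> PT (fun x => (f x, g x)).
Proof.
move=> pf pg; apply: (PT_code2 (h := cp) _ pf pg) => //.
by apply: PT2_cp; [apply: PT2_fst | apply: PT2_snd].
Qed.

Lemma PT_fst {Y Z : Type} {eY : Enc Y} {eZ : Enc Z} (f : X -> Y * Z) :
  PT f -> PT (fun x => (f x).1).
Proof.
move=> pf; apply: (PT_code1 (h := c1) _ pf); last by move=> x; apply: c1_cp.
exact/PT2_c1/PT2_fst.
Qed.

Lemma PT_snd {Y Z : Type} {eY : Enc Y} {eZ : Enc Z} (f : X -> Y * Z) :
  PT f -> PT (fun x => (f x).2).
Proof.
move=> pf; apply: (PT_code1 (h := c2) _ pf); last by move=> x; apply: c2_cp.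
exact/PT2_c2/PT2_fst.
Qed.

Lemma PT_add (f g : X -> nat) : PT f -> PT g -> PT (fun x => f x + g x).
Proof. by move=> pf pg; apply: (PT_code2 (PT2_arith _ Add) pf pg). Qed.
Lemma PT_sub (f g : X -> nat) : PT f -> PT g -> PT (fun x => f x - g x).
Proof. by move=> pf pg; apply: (PT_code2 (PT2_arith _ Defs.Sub) pf pg). Qed.
Lemma PT_mul (f g : X -> nat) : PT f -> PT g -> PT (fun x => f x * g x).
Proof. by move=> pf pg; apply: (PT_code2 (PT2_arith _ Mul) pf pg). Qed.
Lemma PT_div (f g : X -> nat) : PT f -> PT g -> PT (fun x => f x %/ g x).
Proof. by move=> pf pg; apply: (PT_code2 (PT2_arith _ Div) pf pg). Qed.
Lemma PT_pw (f : X -> nat) : PT f -> PT (fun x => pw (f x)).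
Proof. by move=> pf; apply: (PT_code1 (PT2_pw _) pf). Qed.

Lemma PT_S (f : X -> nat) : PT f -> PT (fun x => (f x).+1).
Proof.
move=> pf; apply: PT_ext (PT_add pf (PT_const 1)) => x; exact: addn1.
Qed.

Lemma PT_mod (f g : X -> nat) : PT f -> PT g -> PT (fun x => f x %% g x).
Proof.
move=> pf pg; apply: PT_ext (PT_sub pf (PT_mul (PT_div pf pg) pg)) => x.
by rewrite {1}(divn_eq (f x) (g x)) addKn.
Qed.

Lemma PT_leq (f g : X -> nat) : PT f -> PT g -> PT (fun x => f x <= g x).
Proof.
move=> pf pg; apply: (PT_code1 (h := subn 1) _ (PT_sub pf pg)).
  by apply: PT2_sub; [apply: PT2_const | apply: PT2_fst].
move=> x; rewrite /enc /enc_nat /enc_bool /leq; by case: (f x - g x) => // n; rewrite subSS.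
Qed.

Lemma PT_neg (f : X -> bool) : PT f -> PT (fun x => ~~ f x).
Proof.
move=> pf; apply: (PT_code1 (h := subn 1) _ pf).
  by apply: PT2_sub; [apply: PT2_const | apply: PT2_fst].
by move=> x; case: (f x).
Qed.

Lemma PT_and (f g : X -> bool) : PT f -> PT g -> PT (fun x => f x && g x).
Proof.
move=> pf pg; apply: (PT_code2 (PT2_arith _ Mul) pf pg) => x.
by case: (f x) (g x) => [] [].
Qed.

Lemma PT_or (f g : X -> bool) : PT f -> PT g -> PT (fun x => f x || g x).
Proof.
move=> pf pg; apply: PT_ext (PT_neg (PT_and (PT_neg pf) (PT_neg pg))) => x.
by rewrite -negb_or negbK.
Qed.

Lemma PT_ltn (f g : X -> nat) : PT f -> PT g -> PT (fun x => f x < g x).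
Proof. by move=> pf pg; apply: PT_leq => //; apply: PT_S. Qed.

Lemma PT_eqn (f g : X -> nat) : PT f -> PT g -> PT (fun x => f x == g x).
Proof.
move=> pf pg; apply: PT_ext (PT_and (PT_leq pf pg) (PT_leq pg pf)) => x.
by rewrite eqn_leq.
Qed.

Lemma PT_eqb (f g : X -> bool) : PT f -> PT g -> PT (fun x => f x == g x).
Proof.
move=> pf pg.
apply: PT_ext (PT_or (PT_and pf pg) (PT_and (PT_neg pf) (PT_neg pg))) => x.
by case: (f x) (g x) => [] [].
Qed.

Lemma PT_nat_of_bool (f : X -> bool) : PT f -> PT (fun x => nat_of_bool (f x)).
Proof. by move=> [g pg gE]; exists g. Qed.

Lemma PT_if {Y : Type} {eY : Enc Y} (c : X -> bool) (f g : X -> Y) :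
  PT c -> PT f -> PT g -> PT (fun x => if c x then f x else g x).
Proof.
move=> [c' pc cE] [f' pf fE] [g' pg gE].
exists (fun x => if c' x != 0 then f' x else g' x) => [|a].
  apply: (PT2_if pc).
    apply: (PT2_ext (f := fun x _ => f' x)) => //.
    by apply: (PT2_comp _ pf (PT2_fst _) (PT2_fst _)) => x y [].
  by apply: (PT2_comp _ pg (PT2_fst _) (PT2_fst _)) => x y [].
by rewrite cE fE gE; case: (c a).
Qed.

Lemma PT_cons {Y : Type} {eY : Enc Y} (f : X -> Y) (g : X -> seq Y) :
  PT f -> PT g -> PT (fun x => f x :: g x).
Proof.
move=> pf pg; apply: (PT_code2 (h := cp) _ pf pg) => //.
by apply: PT2_cp; [apply: PT2_fst | apply: PT2_snd].
Qed.

Lemma enc_seq0 {Y : Type} {eY : Enc Y} (l : seq Y) : (enc l == 0) = nilp l.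
Proof. by case: l => // a l; rewrite /enc /= eqn0Ngt cp_gt0. Qed.

Lemma PT_nilp {Y : Type} {eY : Enc Y} (f : X -> seq Y) : PT f -> PT (fun x => nilp (f x)).
Proof.
move=> pf; apply: (PT_code1 (h := subn 1) _ pf).
  by apply: PT2_sub; [apply: PT2_const | apply: PT2_fst].
move=> x; rewrite -enc_seq0 /enc /enc_bool; by case: (enc_seq _ (f x)) => // n.
Qed.

Lemma PT_behead {Y : Type} {eY : Enc Y} (f : X -> seq Y) :
  PT f -> PT (fun x => behead (f x)).
Proof.
move=> pf.
apply: (PT_code1 (h := fun x => if x != 0 then c2 x else 0) _ pf).
  apply: (PT2_if (PT2_fst _)); last exact: PT2_const.
  exact/PT2_c2/PT2_fst.
by move=> x; rewrite enc_seq0; case: (f x) => //= a l; apply: c2_cp.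
Qed.

Lemma PT_head {Y : Type} {eY : Enc Y} (a0 : Y) (f : X -> seq Y) :
  PT f -> PT (fun x => head a0 (f x)).
Proof.
move=> pf.
apply: (PT_code1 (h := fun x => if x != 0 then c1 x else enc a0) _ pf).
  apply: (PT2_if (PT2_fst _)); last exact: PT2_const.
  exact/PT2_c1/PT2_fst.
by move=> x; rewrite enc_seq0; case: (f x) => //= a l; apply: c1_cp.
Qed.

End PTbase.

Lemma PT_match {X Y Z : Type} {eX : Enc X} {eY : Enc Y} {eZ : Enc Z}
    (l : X -> seq Y) (h : X -> Z) (g : X -> Y -> seq Y -> Z) :
  PT l -> PT h -> PT (fun p : X * (Y * seq Y) => g p.1 p.2.1 p.2.2) ->
  PT (fun x => match l x with [::] => h x | a :: l' => g x a l' end).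
Proof.
move=> [l' pl lE] [h' ph hE] [g' pg gE].
exists (fun x => if l' x != 0 then g' (cp x (l' x)) else h' x) => [|a].
  apply: (PT2_if pl); last by apply: (PT2_comp _ ph (PT2_fst _) (PT2_fst _)) => x y [].
  have q : PT2 (fun x y : nat => (exists a : X, x = enc a) /\ l' x != 0)
             (fun x _ : nat => cp x (l' x)).
    apply: PT2_cp; first exact: PT2_fst.
    by apply: (PT2_comp _ pl (PT2_fst _) (PT2_fst _)) => x y [].
  apply: (PT2_comp _ pg q q) => x _ [[a ->]]; rewrite lE enc_seq0.
  by case: (l a) => // b s _; exists (a, (b, s)).
rewrite lE hE enc_seq0; case: (l a) => // b s /=.
exact: (gE (a, (b, s))).
Qed.

(** The result is specified as the first iterate at which the test fails. The bound [B] on the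
    lengths of the iterates does not follow from the time of one step: squaring is fast, yet
    repeated squaring has values of exponential length. *)
Lemma PT_while {X S : Type} {eX : Enc X} {eS : Enc S} (f : X -> S -> S)
    (c : X -> S -> bool) (s0 : X -> S) (N : X -> nat) (r : X -> S) :
  PT (fun p : X * S => f p.1 p.2) -> PT (fun p : X * S => c p.1 p.2) -> PT s0 ->
  pb N -> (exists2 B, pb B & forall x i, i <= N x -> sz (iter i (f x) (s0 x)) <= B x) ->
  (forall x, exists2 i, i <= N x & [/\ r x = iter i (f x) (s0 x),
     ~~ c x (r x) & forall k, k < i -> c x (iter k (f x) (s0 x))]) ->
  PT r.
Proof.
move=> [f' pf fE] [c' pc cE] [s' ps sE] [cN [kN hN]] [B [cB [kB hB]] bB] hr.
pose F x y := f' (cp x y); pose C x y := c' (cp x y).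
pose P (x y : nat) := exists2 a : X, x = @enc X eX a & y = @enc S eS (s0 a).
pose Q (x y : nat) := exists (a : X) (s : S), x = @enc X eX a /\ y = @enc S eS s.
have qF : PT2 Q F.
  have q := PT2_cp (PT2_fst Q) (PT2_snd Q).
  by apply: (PT2_comp _ pf q q) => _ _ [a [s [-> ->]]]; exists (a, s).
have qC : PT2 Q C.
  have q := PT2_cp (PT2_fst Q) (PT2_snd Q).
  by apply: (PT2_comp _ pc q q) => _ _ [a [s [-> ->]]]; exists (a, s).
have FE (a : X) (s : S) : F (enc a) (enc s) = enc (f a s) by exact: (fE (a, s)).
have CE (a : X) (s : S) : C (enc a) (enc s) = c a s by exact: (cE (a, s)).
have iE (a : X) (s : S) i : iter i (F (enc a)) (enc s) = enc (iter i (f a) s).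
  by elim: i => //= i ->; rewrite FE.
pose NN x (y : nat) := cN * bitlen x ^ kN.
have small a i : exists2 k, k <= N a &
    wh F C i (enc a) (enc (s0 a)) = enc (iter k (f a) (s0 a)).
  have [k kN' [rE st go]] := hr a.
  case: (leqP k i) => ki.
    exists k => //; rewrite -iE; apply: wh_search => // [j jk|].
      by rewrite iE CE go.
    by rewrite iE CE -rE; case: (c a _) st.
  have [j ji ->] := wh_iter F C i (enc a) (enc (s0 a)).
  by exists j; rewrite ?iE //; apply: leq_trans kN'; apply: leq_trans ji (ltnW ki).
have whE a i : N a <= i -> wh F C i (enc a) (enc (s0 a)) = enc (r a).
  move=> Ni; have [k kN' [rE st go]] := hr a.
  rewrite (@wh_search F C _ k) ?iE -?rE //; first exact: leq_trans Ni.
    by move=> j jk; rewrite iE CE go.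
  by rewrite CE; case: (c a _) st.
have PW : PT2 P (fun x y => wh F C (NN x y) x y).
  apply: (PT2_while (Q := Q) (S := fun x _ => cB * bitlen x ^ kB)) => //.
  - apply: pbd_mul; [exact: pbd_const | exact/pbd_exp/pbd_x].
  - apply: pbd_mul; [exact: pbd_const | exact/pbd_exp/pbd_x].
  - move=> _ _ i [a -> ->] _; have [k kN' ->] := small a i; split.
      by exists a, (iter k (f a) (s0 a)).
    exact: leq_trans (bB a k kN') (hB a).
  - move=> _ _ [a -> ->]; rewrite whE ?hN //; have [k _ [_ st _]] := hr a.
    by rewrite CE; case: (c a _) st.
exists (fun x => wh F C (NN x (s' x)) x (s' x)) => [|a]; last by rewrite sE whE ?hN.
apply: (PT2_comp _ PW (PT2_fst _) ps) => x _ [a ->].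
by exists a; rewrite ?sE.
Qed.

(** * Loops over lists *)

Lemma bitlen_lt a b : a.*2 <= b -> 0 < a -> bitlen a < bitlen b.
Proof.
move=> h a0; rewrite ltnNge; apply/negP => k.
have := bitlenP b; have := trunc_logP (isT : 1 < 2) a0.
have := leq_pexp2l (isT : 0 < 2) k; rewrite /bitlen !expnS -/(bitlen a) => h1 h2 h3.
by move: h1 h2 h3 h; move: (2 ^ _) (2 ^ _) => u v; lia.
Qed.

Lemma cp_gel a b : a < cp a b.
Proof.
by rewrite /cp; have := ltn_pw a; have := pw_gt0 a; nia.
Qed.

Lemma cp_ger a b : b.*2 < cp a b.
Proof.
rewrite /cp -muln2; have p0 := pw_gt0 a.
have: b * 2 <= (b * pw a + a) * (pw a + pw a).
  by apply: leq_mul; [rewrite -[X in X <= _]addn0 leq_add ?leq_pmulr | lia].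
by lia.
Qed.

Lemma bitlen_cpl a b : bitlen a <= bitlen (cp a b).
Proof. exact/bitlen_mono/ltnW/cp_gel. Qed.

Lemma bitlen_cpr a b : bitlen b <= bitlen (cp a b).
Proof. by apply: bitlen_mono; have := cp_ger a b; lia. Qed.

Section SeqSize.
Context {A : Type} {eA : Enc A}.
Implicit Types (l : seq A) (a : A).

Lemma enc_cons a l : enc (a :: l) = cp (enc a) (enc l). Proof. by []. Qed.

Lemma szc a l : sz (a :: l) <= sz l + 2 * sz a + 4.
Proof. exact: bitlen_cp. Qed.

Lemma sz_head a l : sz a <= sz (a :: l). Proof. exact: bitlen_cpl. Qed.
Lemma sz_tail a l : sz l <= sz (a :: l). Proof. exact: bitlen_cpr. Qed.

Lemma size_sz l : size l <= sz l.
Proof.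
elim: l => [|a l IH] //=; rewrite /sz enc_cons; case: l IH => [|b l] IH.
  exact: bitlen_gt0.
apply: leq_ltn_trans IH _; apply: bitlen_lt; last exact: cp_gt0.
exact/ltnW/cp_ger.
Qed.

Lemma sz_drop i l : sz (drop i l) <= sz l.
Proof.
elim: l i => [|a l IH] [|i] //=; exact: leq_trans (IH i) (sz_tail a l).
Qed.

Lemma sz_le l M : (forall i, i < size l -> forall a0, sz (nth a0 l i) <= M) ->
  sz l <= size l * (2 * M + 4) + 1.
Proof.
elim: l => [|a l IH] h //; apply: leq_trans (szc a l) _.
have h1 : sz a <= M := h 0 isT a; have := IH (fun i => h i.+1).
by rewrite [size (a :: l)]/= [(size l).+1 * _]mulSn; move: (size l * _) => u; lia.
Qed.

Lemma sz_nth a0 l i : i < size l -> sz (nth a0 l i) <= sz l.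
Proof.
elim: l i => [|a l IH] [|i] //= h; first exact: sz_head.
exact: leq_trans (IH i h) (sz_tail a l).
Qed.

End SeqSize.

Lemma sz_pair {A B : Type} {eA : Enc A} {eB : Enc B} (a : A) (b : B) :
  sz (a, b) <= sz b + 2 * sz a + 4.
Proof. exact: bitlen_cp. Qed.

Ltac pbs := repeat first [assumption | simple apply pb_const | simple apply pb_sz
  | simple apply pb_add | simple apply pb_mul | simple apply pb_exp | simple apply PT_sz].

Lemma PT_iter {X : Type} {eX : Enc X} {S : Type} {eS : Enc S} (n : X -> nat) (f : X -> S -> S) (s0 : X -> S) :
  PT n -> pb n -> PT (fun p : X * S => f p.1 p.2) -> PT s0 ->
  (exists2 B, pb B & forall x i, i <= n x -> sz (iter i (f x) (s0 x)) <= B x) ->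
  PT (fun x => iter (n x) (f x) (s0 x)).
Proof.
move=> pn bn pf ps [B pB hB].
have itE x i : iter i (fun q : nat * S => (q.1 - 1, f x q.2)) (n x, s0 x) =
    (n x - i, iter i (f x) (s0 x)).
  by elim: i => [|i IH] /=; rewrite ?subn0 // IH /=; congr (_, _); lia.
have h : PT (fun x => (0, iter (n x) (f x) (s0 x))).
  apply: (@PT_while _ _ _ _ (fun x (q : nat * S) => (q.1 - 1, f x q.2))
           (fun _ q => 0 < q.1) (fun x => (n x, s0 x)) n) => //.
  - apply: PT_pair; first by apply: PT_sub (PT_const _); apply/PT_fst/PT_snd/PT_id.
    apply: (PT_comp (f := fun p : X * S => f p.1 p.2)
              (g := fun p : X * (nat * S) => (p.1, p.2.2)) pf).
    by apply: PT_pair; [apply/PT_fst/PT_id | apply/PT_snd/PT_snd/PT_id].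
  - by apply: PT_ltn; [apply: PT_const | apply/PT_fst/PT_snd/PT_id].
  - exact: PT_pair.
  - exists (fun x => B x + 2 * sz (n x) + 4); first by pbs.
    move=> x i hi; rewrite itE; apply: leq_trans (sz_pair _ _) _.
    rewrite leq_add2r; apply: leq_add; first exact: hB.
    by rewrite leq_mul2l /=; apply: bitlen_mono; rewrite /enc /enc_nat leq_subr.
  - move=> x; exists (n x) => //; split; rewrite ?itE ?subnn //.
    by move=> k hk; rewrite itE /= subn_gt0.
by apply: PT_ext (PT_snd h).
Qed.

Lemma PT_foldl {X : Type} {eX : Enc X} {S A : Type} {eS : Enc S} {eA : Enc A} (f : X -> S -> A -> S)
    (s0 : X -> S) (l : X -> seq A) :
  PT (fun p : X * (S * A) => f p.1 p.2.1 p.2.2) -> PT s0 -> PT l ->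
  (exists2 B, pb B & forall x i, i <= size (l x) ->
     sz (foldl (f x) (s0 x) (take i (l x))) <= B x) ->
  PT (fun x => foldl (f x) (s0 x) (l x)).
Proof.
move=> pf ps pl [B pB hB].
pose g x (q : seq A * S) := match q.1 with [::] => q
  | a :: l' => (l', f x q.2 a) end.
have itE x i : i <= size (l x) -> iter i (g x) (l x, s0 x) =
    (drop i (l x), foldl (f x) (s0 x) (take i (l x))).
  elim: i => [|i IH] h /=; first by rewrite drop0 take0.
  rewrite IH 1?ltnW //; case E : (drop i (l x)) => [|a l'].
    by move: (size_drop i (l x)); rewrite E /= => /eqP; rewrite eq_sym subn_eq0; lia.
  have Ea : a = nth a (l x) i by rewrite -[i]addn0 -nth_drop E.
  rewrite /g /= -addn1 addnC -drop_drop E /= drop0.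
  by rewrite addnC addn1 (take_nth a h) foldl_rcons -Ea.
have h : PT (fun x => ([::] : seq A, foldl (f x) (s0 x) (l x))).
  apply: (@PT_while _ _ _ _ g (fun _ q => ~~ nilp q.1) (fun x => (l x, s0 x))
    (fun x => size (l x))) => //.
  - apply: (PT_match (l := fun p : X * (seq A * S) => p.2.1) (h := fun p => p.2)
      (g := fun p a l' => (l', f p.1 p.2.2 a))).
    + exact/PT_fst/PT_snd/PT_id.
    + exact/PT_snd/PT_id.
    + apply: PT_pair; first exact/PT_snd/PT_snd/PT_id.
      apply: (PT_comp (f := fun p : X * (S * A) => f p.1 p.2.1 p.2.2)
        (g := fun p : X * (seq A * S) * (A * seq A) => (p.1.1, (p.1.2.2, p.2.1))) pf).
      apply: PT_pair; first exact/PT_fst/PT_fst/PT_id.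
      by apply: PT_pair; [exact/PT_snd/PT_snd/PT_fst/PT_id | exact/PT_fst/PT_snd/PT_id].
  - exact/PT_neg/PT_nilp/PT_fst/PT_snd/PT_id.
  - exact: PT_pair.
  - by apply: pb_le (PT_sz pl) => x; apply: size_sz.
  - exists (fun x => B x + 2 * sz (l x) + 4); first by pbs.
    move=> x i hi; rewrite itE //; apply: leq_trans (sz_pair _ _) _.
    rewrite leq_add2r; apply: leq_add; first exact: hB.
    by rewrite leq_mul2l sz_drop.
  - move=> x; exists (size (l x)) => //; rewrite itE // drop_size take_size.
    split=> // k hk; rewrite itE 1?ltnW //= /nilp size_drop subn_eq0 -ltnNge //.
by apply: PT_ext (PT_snd h).
Qed.

Lemma PT_rev {X : Type} {eX : Enc X} {A : Type} {eA : Enc A} (l : X -> seq A) : PT l -> PT (fun x => rev (l x)).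
Proof.
move=> pl.
have h : PT (fun x => foldl (fun s a => a :: s) [::] (l x)).
  apply: (@PT_foldl X _ _ _ _ _ (fun _ s a => a :: s) (fun _ => [::]) l) => //.
  - by apply: PT_cons; [exact/PT_snd/PT_snd/PT_id | exact/PT_fst/PT_snd/PT_id].
  - exact: PT_const.
  - exists (fun x => sz (l x) * (2 * sz (l x) + 4) + 1); first by pbs.
    move=> x i hi.
    have -> s : foldl (fun s a => a :: s) [::] s = rev s :> seq A.
      by rewrite /rev; elim: s [::] => //= a s IH t; rewrite IH.
    apply: leq_trans (sz_le (M := sz (l x)) _) _.
      move=> k; rewrite size_rev => hk a0; rewrite nth_rev // nth_take.
        by apply: sz_nth; move: hk; rewrite size_takel //; lia.
      by move: hk; rewrite size_takel //; lia.
    rewrite leq_add2r leq_mul2r size_rev size_takel //.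
    by rewrite (leq_trans hi) ?orbT // size_sz.
apply: PT_ext h => x; rewrite /rev.
by elim: (l x) [::] => //= a s IH t; rewrite IH.
Qed.

Lemma PT_map {X : Type} {eX : Enc X} {A B : Type} {eA : Enc A} {eB : Enc B} (f : X -> A -> B) (l : X -> seq A) :
  PT (fun p : X * A => f p.1 p.2) -> PT l -> PT (fun x => map (f x) (l x)).
Proof.
move=> pf pl.
have h : PT (fun x => foldl (fun s a => f x a :: s) [::] (l x)).
  apply: (@PT_foldl X _ _ _ _ _ (fun x s a => f x a :: s) (fun _ => [::]) l) => //.
  - apply: PT_cons; last exact/PT_fst/PT_snd/PT_id.
    apply: (PT_comp (f := fun p : X * A => f p.1 p.2)
      (g := fun p : X * (seq B * A) => (p.1, p.2.2)) pf).
    by apply: PT_pair; [exact/PT_fst/PT_id | exact/PT_snd/PT_snd/PT_id].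
  - exact: PT_const.
  - have [c [k hc]] := PT_sz pf.
    pose (M := fun x : X => c * (sz (l x) + 2 * sz x + 4) ^ k).
    have pM : pb M.
      apply: pb_mul; first exact: pb_const.
      apply: pb_exp; pbs.
    exists (fun x => sz (l x) * (2 * M x + 4) + 1); first by pbs.
    move=> x i hi.
    have -> s : foldl (fun s a => f x a :: s) [::] s = rev (map (f x) s).
      by rewrite /rev; elim: s [::] => //= a s IH t; rewrite IH.
    apply: leq_trans (sz_le (M := M x) _) _.
      move=> j; rewrite size_rev size_map => hj b0.
      case E : (l x) => [|a0 l']; first by rewrite E in hj.
      rewrite nth_rev ?size_map -?E //.
      rewrite (nth_map a0); last by lia.
      apply: leq_trans (hc (x, _)) _; rewrite leq_mul2l leq_exp2r_ ?orbT //.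
      apply: leq_trans (sz_pair _ _) _; rewrite leq_add2r leq_add2r.
      rewrite nth_take; last by move: hj; rewrite size_takel //; lia.
      by apply: sz_nth; move: hj; rewrite size_takel //; lia.
    rewrite leq_add2r leq_mul2r size_rev size_map size_takel //.
    by rewrite (leq_trans hi) ?orbT // size_sz.
apply: PT_ext (PT_rev h) => x.
have -> s : foldl (fun s a => f x a :: s) [::] s = rev (map (f x) s).
  by rewrite /rev; elim: s [::] => //= a s IH t; rewrite IH.
exact: revK.
Qed.

Lemma sz_cat {A : Type} {eA : Enc A} (l1 l2 : seq A) :
  sz (l1 ++ l2) <= sz l2 + size l1 * (2 * sz l1 + 4).
Proof.
elim: l1 => [|a l IH]; first by rewrite mul0n addn0.
rewrite [size _]/= [(a :: l) ++ _]/=.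
apply: leq_trans (szc _ _) _; rewrite [(size l).+1 * _]mulSn.
have h1 := @sz_tail A eA a l; have h2 := @sz_head A eA a l.
have: size l * (2 * sz l + 4) <= size l * (2 * sz (a :: l) + 4).
  by apply: leq_mul => //; rewrite leq_add2r leq_mul2l h1.
by move: IH h1 h2; move: (size l * _) (size l * _) => u v; lia.
Qed.

Lemma PT_cat {X : Type} {eX : Enc X} {A : Type} {eA : Enc A} (l1 l2 : X -> seq A) :
  PT l1 -> PT l2 -> PT (fun x => l1 x ++ l2 x).
Proof.
move=> p1 p2.
have E (s t : seq A) : foldl (fun s a => a :: s) t s = rev s ++ t.
  elim: s t => //= a s IH t; rewrite IH rev_cons cat_rcons //.
have h : PT (fun x => foldl (fun s a => a :: s) (l2 x) (rev (l1 x))).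
  apply: (@PT_foldl X _ _ _ _ _ (fun _ s a => a :: s) l2 (fun x => rev (l1 x))) => //.
  - by apply: PT_cons; [exact/PT_snd/PT_snd/PT_id | exact/PT_fst/PT_snd/PT_id].
  - exact: PT_rev.
  - exists (fun x => sz (l2 x) + sz (l1 x) * (2 * sz (l1 x) + 4)); first by pbs.
    move=> x i; rewrite size_rev => hi; rewrite E take_rev revK.
    apply: leq_trans (sz_cat _ _) _; rewrite leq_add2l; apply: leq_mul.
      by rewrite size_drop; apply: leq_trans (size_sz (l1 x)); lia.
    by rewrite leq_add2r leq_mul2l sz_drop.
by apply: PT_ext h => x; rewrite E revK.
Qed.

Lemma PT_flatten {X : Type} {eX : Enc X} {A : Type} {eA : Enc A} (l : X -> seq (seq A)) :
  PT l -> PT (fun x => flatten (l x)).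
Proof.
move=> pl.
have E (s : seq (seq A)) t : foldl cat t s = t ++ flatten s.
  by elim: s t => [|a s IH] t /=; rewrite ?cats0 // IH catA.
have h : PT (fun x => foldl cat [::] (l x)).
  apply: (@PT_foldl X _ _ _ _ _ (fun _ s a => s ++ a) (fun _ => [::]) l) => //.
  - by apply: PT_cat; [exact/PT_fst/PT_snd/PT_id | exact/PT_snd/PT_snd/PT_id].
  - exact: PT_const.
  - pose (K := fun x : X => sz (l x) * (2 * sz (l x) + 4)).
    have pK : pb K by rewrite /K; pbs.
    exists (fun x => sz (l x) * K x + 1); first by pbs.
    move=> x i hi; rewrite E cat0s.
    have: forall s : seq (seq A), (forall k, k < size s -> sz (nth [::] s k) <= sz (l x)) ->
        sz (flatten s) <= size s * K x + 1.
      elim=> [|a s IH] hs //; rewrite [flatten _]/= [size _]/=.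
      apply: leq_trans (sz_cat _ _) _.
      have h1 := IH (fun k => hs k.+1); have h0 : @sz _ (enc_seq eA) a <= sz (l x) := hs 0 isT.
      have: size a * (2 * sz a + 4) <= K x.
        apply: leq_mul; first exact: leq_trans (size_sz a) h0.
        by rewrite leq_add2r leq_mul2l h0.
      by rewrite [(size s).+1 * _]mulSn; move: h1; move: (size s * _) (size a * _) => u v; lia.
    move=> /(_ (take i (l x))) h; apply: leq_trans (h _) _.
      move=> k hk; rewrite size_takel // in hk; rewrite nth_take //.
      by apply: sz_nth; lia.
    by rewrite leq_add2r leq_mul2r size_takel // (leq_trans hi) ?orbT // size_sz.
by apply: PT_ext h => x; rewrite E.
Qed.

Lemma PT_filter {X : Type} {eX : Enc X} {A : Type} {eA : Enc A} (p : X -> A -> bool) (l : X -> seq A) :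
  PT (fun q : X * A => p q.1 q.2) -> PT l -> PT (fun x => filter (p x) (l x)).
Proof.
move=> pp pl.
have h : PT (fun x => flatten (map (fun a => if p x a then [:: a] else [::]) (l x))).
  apply: PT_flatten; apply: PT_map => //.
  apply: PT_if => //; last exact: PT_const.
  by apply: PT_cons; [exact/PT_snd/PT_id | exact: PT_const].
by apply: PT_ext h => x; elim: (l x) => //= a s IH; rewrite IH; case: (p x a).
Qed.

Lemma PT_has {X : Type} {eX : Enc X} {A : Type} {eA : Enc A} (p : X -> A -> bool) (l : X -> seq A) :
  PT (fun q : X * A => p q.1 q.2) -> PT l -> PT (fun x => has (p x) (l x)).
Proof.
move=> pp pl; apply: PT_ext (PT_neg (PT_nilp (PT_filter pp pl))) => x.
by rewrite /nilp size_filter has_count lt0n.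
Qed.

Lemma PT_all {X : Type} {eX : Enc X} {A : Type} {eA : Enc A} (p : X -> A -> bool) (l : X -> seq A) :
  PT (fun q : X * A => p q.1 q.2) -> PT l -> PT (fun x => all (p x) (l x)).
Proof.
move=> pp pl; have q : PT (fun q : X * A => ~~ p q.1 q.2) by apply: PT_neg.
apply: PT_ext (PT_neg (PT_has (p := fun x a => ~~ p x a) q pl)) => x.
by rewrite -all_predC; apply: eq_all => a; rewrite /= negbK.
Qed.

Lemma PT_mem {X : Type} {eX : Enc X} (f : X -> nat) (l : X -> seq nat) : PT f -> PT l ->
  PT (fun x => f x \in l x).
Proof.
move=> pf pl.
have q : PT (fun q : X * nat => q.2 == f q.1).
  by apply: PT_eqn; [exact/PT_snd/PT_id | exact: (PT_comp pf (PT_fst PT_id))].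
apply: PT_ext (PT_has (p := fun x a => a == f x) q pl) => x.
by rewrite has_pred1.
Qed.

Lemma sum_bitlen (I : Type) (s : seq I) (F : I -> nat) M :
  (forall a0 k, k < size s -> bitlen (F (nth a0 s k)) <= M) ->
  bitlen (\sum_(i <- s) F i) <= size s * M + 1.
Proof.
elim: s => [|a s IH] h; first by rewrite big_nil.
rewrite big_cons /=; apply: leq_trans (bitlen_add _ _) _; rewrite mulSn -addnA.
apply: leq_add; first exact: (h a 0 isT).
by apply: IH => a0 k hk; apply: (h a0 k.+1).
Qed.

Lemma PT_sum {X : Type} {eX : Enc X} {A : Type} {eA : Enc A} (f : X -> A -> nat) (l : X -> seq A) :
  PT (fun p : X * A => f p.1 p.2) -> PT l -> PT (fun x => \sum_(a <- l x) f x a).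
Proof.
move=> pf pl; have pm := PT_map pf pl.
have E (s : seq nat) t : foldl addn t s = t + \sum_(i <- s) i.
  elim: s t => [|a s IH] t /=; first by rewrite big_nil addn0.
  by rewrite IH big_cons addnA.
have h : PT (fun x => foldl addn 0 (map (f x) (l x))).
  apply: (@PT_foldl X _ _ _ _ _ (fun _ s a => s + a) (fun _ => 0)) => //.
  - by apply: PT_add; [exact/PT_fst/PT_snd/PT_id | exact/PT_snd/PT_snd/PT_id].
  - exact: PT_const.
  - exists (fun x => sz (map (f x) (l x)) * sz (map (f x) (l x)) + 1).
      by have := PT_sz pm => ?; pbs.
    move=> x i hi; set m := map _ _ in hi *; rewrite E add0n.
    apply: leq_trans (sum_bitlen (M := sz m) _) _.
      move=> a0 k; rewrite size_takel // => hk; rewrite nth_take //.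
      by apply: (@sz_nth nat _ _ m); lia.
    by rewrite leq_add2r leq_mul2r size_takel // (leq_trans hi) ?orbT // size_sz.
by apply: PT_ext h => x; rewrite E add0n big_map.
Qed.

Lemma PT_size {X : Type} {eX : Enc X} {A : Type} {eA : Enc A} (l : X -> seq A) : PT l -> PT (fun x => size (l x)).
Proof.
move=> pl; have h := @PT_sum X eX A eA (fun _ _ => 1) l (PT_const 1) pl.
by apply: PT_ext h => x; rewrite sum1_size.
Qed.

Lemma pb_size {X : Type} {eX : Enc X} {A : Type} {eA : Enc A} (l : X -> seq A) : PT l -> pb (fun x => size (l x)).
Proof. by move=> pl; apply: pb_le (PT_sz pl) => x; apply: size_sz. Qed.

Lemma PT_drop {X : Type} {eX : Enc X} {A : Type} {eA : Enc A} (i : X -> nat) (l : X -> seq A) :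
  PT i -> PT l -> PT (fun x => drop (i x) (l x)).
Proof.
move=> pi pl; have ps := PT_size pl.
(* The index is written in binary and may exceed the length of the list by far; truncated it bounds
   a loop. *)
pose n x := if i x <= size (l x) then i x else size (l x).
have pn : PT n by apply: PT_if => //; apply: PT_leq.
have E k (s : seq A) : iter k behead s = drop k s.
  by elim: k s => [|k IH] s; rewrite ?drop0 // iterSr IH; case: s.
have h : PT (fun x => iter (n x) behead (l x)).
  apply: (@PT_iter X _ _ _ n (fun _ s => behead s) l) => //.
  - by apply: pb_le (pb_size pl) => x; rewrite /n; case: ifP.
  - exact/PT_behead/PT_snd/PT_id.
  - exists (fun x => sz (l x)); first by pbs.
    by move=> x k _; rewrite E sz_drop.
apply: PT_ext h => x; rewrite E /n; case: leqP => // h.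
by rewrite drop_size drop_oversize // ltnW.
Qed.

Lemma PT_nth {X : Type} {eX : Enc X} {A : Type} {eA : Enc A} (a0 : A) (l : X -> seq A) (i : X -> nat) :
  PT l -> PT i -> PT (fun x => nth a0 (l x) (i x)).
Proof.
move=> pl pi; apply: PT_ext (PT_head a0 (PT_drop pi pl)) => x.
by rewrite -nth0 nth_drop addn0.
Qed.

Lemma PT_iota {X : Type} {eX : Enc X} (m n : X -> nat) : PT m -> PT n -> pb n -> PT (fun x => iota (m x) (n x)).
Proof.
move=> pm pn bn.
have E (x : X) k t : iter k (fun q : nat * seq nat => (q.1.+1, q.1 :: q.2)) (t, [::]) =
    (t + k, rev (iota t k)).
  elim: k => [|k IH]; first by rewrite addn0.
  by rewrite iterS IH -[in RHS](addn1 k) iotaD rev_cat addnA addn1.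
have h : PT (fun x => iter (n x) (fun q : nat * seq nat => (q.1.+1, q.1 :: q.2)) (m x, [::])).
  apply: (@PT_iter X _ _ _ n (fun _ q => (q.1.+1, q.1 :: q.2)) (fun x => (m x, [::]))) => //.
  - apply: PT_pair; first exact/PT_S/PT_fst/PT_snd/PT_id.
    by apply: PT_cons; [exact/PT_fst/PT_snd/PT_id | exact/PT_snd/PT_snd/PT_id].
  - by apply: PT_pair => //; apply: PT_const.
  - pose (M := fun x : X => sz (m x) + sz (n x)).
    have pM : pb M by rewrite /M; pbs.
    exists (fun x => (n x * (2 * M x + 4) + 1) + 2 * M x + 4); first by pbs.
    move=> x i hi; rewrite E //; apply: leq_trans (sz_pair _ _) _.
    have hM j : j <= m x + i -> sz j <= M x.
      move=> hj; apply: leq_trans (bitlen_add (m x) (n x)); apply: bitlen_mono.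
      by rewrite /enc /enc_nat; lia.
    rewrite leq_add2r; apply: leq_add; last by rewrite leq_mul2l /= hM.
    apply: leq_trans (sz_le (M := M x) _) _.
      move=> k; rewrite size_rev size_iota => hk a0.
      rewrite nth_rev ?size_iota // nth_iota; last by lia.
      by apply: hM; lia.
    by rewrite leq_add2r leq_mul2r size_rev size_iota hi orbT.
by apply: PT_ext (PT_rev (PT_snd h)) => x; rewrite E // revK.
Qed.

(** * Signed integers *)

Instance enc_int : Enc int :=
  fun z => match z with Posz n => n.*2 | Negz n => n.*2.+1 end.

Definition mkz (b : bool) (n : nat) : int := if b then (- Posz n)%R else Posz n.

Definition zquo (z : int) (q : nat) : int := mkz (z < 0)%R (`|z|%N %/ q).

Lemma zquoK (a : int) q : 0 < q -> zquo (a * Posz q)%R q = a.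
Proof.
move=> q0; rewrite /zquo abszM absz_nat mulnK // /mkz pmulr_llt0 ?ltz_nat //.
by case: ltP => h; lia.
Qed.

Section PTint.
Context {X : Type} {eX : Enc X}.

Lemma PT_mkz (b : X -> bool) (n : X -> nat) : PT b -> PT n -> PT (fun x => mkz (b x) (n x)).
Proof.
move=> pb pn; apply: (PT_code2 (h := fun b n => (n + n) - b) _ pb pn).
  by apply: PT2_sub; [apply: PT2_add; apply: PT2_snd | apply: PT2_fst].
move=> x; rewrite /enc /enc_bool /enc_nat /enc_int /mkz; case: (b x) => /=.
  by case: (n x) => // m; rewrite -NegzE /=; lia.
by lia.
Qed.

Lemma PT_absz (f : X -> int) : PT f -> PT (fun x => `|f x|%N).
Proof.
move=> pf; apply: (PT_code1 (h := fun c => (c + 1) %/ 2) _ pf).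
  apply: PT2_div; last exact: PT2_const.
  by apply: PT2_add; [exact: PT2_fst | exact: PT2_const].
move=> x; rewrite /enc /enc_int /enc_nat; case: (f x) => n.
  by rewrite absz_nat; lia.
by rewrite NegzE; lia.
Qed.

Lemma PT_negz (f : X -> int) : PT f -> PT (fun x => (f x < 0)%R).
Proof.
move=> pf; apply: (PT_code1 (h := fun c => c - c %/ 2 * 2) _ pf).
  apply: PT2_sub; first exact: PT2_fst.
  apply: PT2_mul; last exact: PT2_const.
  by apply: PT2_div; [exact: PT2_fst | exact: PT2_const].
by move=> x; rewrite /enc /enc_int /enc_bool; case: (f x) => n; rewrite ?ltz_nat; lia.
Qed.

Lemma PT_posz (f : X -> nat) : PT f -> PT (fun x => Posz (f x)).
Proof. by move=> pf; apply: PT_ext (PT_mkz (PT_const false) pf) => x. Qed.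

Lemma PT_addz (f g : X -> int) : PT f -> PT g -> PT (fun x => (f x + g x)%R).
Proof.
move=> pf pg.
pose pp (h : X -> int) x := if (h x < 0)%R then 0 else `|h x|%N.
pose nn (h : X -> int) x := if (h x < 0)%R then `|h x|%N else 0.
have ppP h : PT h -> PT (pp h).
  by move=> ph; apply: PT_if; [exact: PT_negz | exact: PT_const | exact: PT_absz].
have nnP h : PT h -> PT (nn h).
  by move=> ph; apply: PT_if; [exact: PT_negz | exact: PT_absz | exact: PT_const].
have h1 : PT (fun x => pp f x + pp g x) by apply: PT_add; apply: ppP.
have h2 : PT (fun x => nn f x + nn g x) by apply: PT_add; apply: nnP.
apply: PT_ext (PT_mkz (PT_ltn h1 h2) (PT_add (PT_sub h1 h2) (PT_sub h2 h1))) => x.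
by rewrite /mkz /pp /nn; case: ltP => ?; case: ltP => ?; case: ltnP => ?; lia.
Qed.

Lemma PT_oppz (f : X -> int) : PT f -> PT (fun x => (- f x)%R).
Proof.
move=> pf; apply: PT_ext (PT_mkz (PT_neg (PT_negz pf)) (PT_absz pf)) => x.
by rewrite /mkz; case: ltP => /= ?; lia.
Qed.

Lemma PT_subz (f g : X -> int) : PT f -> PT g -> PT (fun x => (f x - g x)%R).
Proof. by move=> pf pg; apply: PT_addz => //; apply: PT_oppz. Qed.

Lemma PT_mulz (f g : X -> int) : PT f -> PT g -> PT (fun x => (f x * g x)%R).
Proof.
move=> pf pg.
have h := PT_neg (PT_eqb (PT_negz pf) (PT_negz pg)).
apply: PT_ext (PT_mkz h (PT_mul (PT_absz pf) (PT_absz pg))) => x.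
rewrite /mkz PoszM !abszE; case: (ltP (f x) 0%R) => hf; case: (ltP (g x) 0%R) => hg /=.
- by rewrite !ltr0_norm // mulrNN.
- by rewrite ltr0_norm // ger0_norm // mulNr opprK.
- by rewrite ger0_norm // ltr0_norm // mulrN opprK.
- by rewrite !ger0_norm.
Qed.

Lemma PT_zquo (f : X -> int) (g : X -> nat) : PT f -> PT g ->
  PT (fun x => zquo (f x) (g x)).
Proof.
move=> pf pg; apply: PT_mkz; first exact: PT_negz.
by apply: PT_div => //; apply: PT_absz.
Qed.

Lemma PT_lez (f g : X -> int) : PT f -> PT g -> PT (fun x => (f x <= g x)%R).
Proof.
move=> pf pg; apply: PT_ext (PT_neg (PT_negz (PT_subz pg pf))) => x.
by rewrite subr_lt0 -leNgt.
Qed.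

Lemma PT_ltz (f g : X -> int) : PT f -> PT g -> PT (fun x => (f x < g x)%R).
Proof.
by move=> pf pg; apply: PT_ext (PT_neg (PT_lez pg pf)) => x; rewrite -ltNge.
Qed.

Lemma PT_eqz (f g : X -> int) : PT f -> PT g -> PT (fun x => f x == g x).
Proof.
move=> pf pg; apply: PT_ext (PT_and (PT_lez pf pg) (PT_lez pg pf)) => x.
by rewrite eq_le.
Qed.

End PTint.

Lemma sz_int (z : int) M : `|z|%N <= M -> sz z <= bitlen M + 2.
Proof.
move=> h; apply: (@leq_trans (bitlen (M * 2))).
  apply: bitlen_mono; rewrite /enc /enc_int; case: z h => n; rewrite ?absz_nat ?NegzE; lia.
exact: leq_trans (bitlen_mul _ _) _.
Qed.

Lemma PT_sumz {X A : Type} {eX : Enc X} {eA : Enc A} (f : X -> A -> int) (l : X -> seq A) :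
  PT (fun p : X * A => f p.1 p.2) -> PT l -> PT (fun x => (\sum_(a <- l x) f x a)%R).
Proof.
move=> pf pl.
pose pp x a := if (f x a < 0)%R then 0 else `|f x a|%N.
pose nn x a := if (f x a < 0)%R then `|f x a|%N else 0.
have pp1 : PT (fun p : X * A => pp p.1 p.2).
  by apply: PT_if; [exact: PT_negz | exact: PT_const | exact: PT_absz].
have nn1 : PT (fun p : X * A => nn p.1 p.2).
  by apply: PT_if; [exact: PT_negz | exact: PT_absz | exact: PT_const].
apply: PT_ext (PT_subz (PT_posz (PT_sum pp1 pl)) (PT_posz (PT_sum nn1 pl))) => x.
elim: (l x) => [|a s IH]; first by rewrite !big_nil.
by rewrite !big_cons -IH /pp /nn; case: ltP => h; lia.
Qed.

(** * Strict linear feasibility by a rescaled perceptron *)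

Section QuadraticForms.
Local Open Scope ring_scope.
Variable d : nat.
Implicit Types (Q N : 'M[int]_d) (u v : 'rV[int]_d).

Definition bf Q u v : int := (u *m Q *m v^T) 0 0.
Definition dd u v : int := (u *m v^T) 0 0.

Lemma bfDl Q u u' v : bf Q (u + u') v = bf Q u v + bf Q u' v.
Proof. by rewrite /bf !mulmxDl mxE. Qed.
Lemma bfDr Q u v v' : bf Q u (v + v') = bf Q u v + bf Q u v'.
Proof. by rewrite /bf raddfD mulmxDr mxE. Qed.
Lemma bfZl Q a u v : bf Q (a *: u) v = a * bf Q u v.
Proof. by rewrite /bf -!scalemxAl mxE. Qed.
Lemma bfZr Q a u v : bf Q u (a *: v) = a * bf Q u v.
Proof. by rewrite /bf linearZ -scalemxAr mxE. Qed.
Lemma ddDl u u' v : dd (u + u') v = dd u v + dd u' v.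
Proof. by rewrite /dd mulmxDl mxE. Qed.
Lemma ddZl a u v : dd (a *: u) v = a * dd u v.
Proof. by rewrite /dd -scalemxAl mxE. Qed.
Lemma ddC u v : dd u v = dd v u.
Proof. by rewrite /dd -[u in LHS]trmxK -trmx_mul mxE. Qed.
Lemma bf_sym Q u v : Q^T = Q -> bf Q u v = bf Q v u.
Proof.
move=> e; have e2 : (u *m Q *m v^T)^T = v *m Q *m u^T.
  by rewrite !trmx_mul trmxK e mulmxA.
by rewrite /bf -e2 [RHS]mxE.
Qed.

Definition psd Q := forall u, 0 <= bf Q u u.

(** The discriminant argument without division: the form is evaluated at [c u - b v], at [a v - b u]
    if [c] vanishes, and at [u + v] and [u - v] if [a] vanishes too. *)
Lemma bf_CS Q u v : Q^T = Q -> psd Q -> bf Q u v ^+ 2 <= bf Q u u * bf Q v v.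
Proof.
move=> sQ pQ; set a := bf Q u u; set b := bf Q u v; set c := bf Q v v.
have h x y : 0 <= x ^+ 2 * a + 2%:R * x * y * b + y ^+ 2 * c.
  have := pQ (x *: u + y *: v); rewrite !(bfDl, bfDr, bfZl, bfZr) (bf_sym v u sQ).
  rewrite -/a -/b -/c; congr (0 <= _); ring.
have a0 : 0 <= a := pQ u; have c0 : 0 <= c := pQ v.
case: (ltP 0 c) => [cp | cn].
  have e : c ^+ 2 * a + 2%:R * c * (- b) * b + (- b) ^+ 2 * c = c * (a * c - b ^+ 2) by ring.
  by have := h c (- b); rewrite e pmulr_rge0 // subr_ge0.
have cz : c = 0 by apply/eqP; rewrite eq_le cn c0.
case: (ltP 0 a) => [ap | an].
  have e : (- b) ^+ 2 * a + 2%:R * (- b) * a * b + a ^+ 2 * c = a * (a * c - b ^+ 2) by ring.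
  by have := h (- b) a; rewrite e pmulr_rge0 // subr_ge0.
have az : a = 0 by apply/eqP; rewrite eq_le an a0.
have h1 := h 1 1; have h2 := h 1 (-1); rewrite az cz in h1 h2 *.
have -> : b = 0 by lia.
by rewrite expr2 !mulr0.
Qed.

Section Inverse.
Variables (Q N : 'M[int]_d) (q : int).
Hypotheses (sQ : Q^T = Q) (sN : N^T = N) (pQ : psd Q) (q0 : 0 < q).
Hypothesis (NQ : N *m Q = q%:M).

Lemma bf_inv z : q * bf N z z = bf Q (z *m N) (z *m N).
Proof.
rewrite /bf trmx_mul sN -!mulmxA (mulmxA Q) (mulmxA N) (mulmxA N) NQ.
by rewrite mul_scalar_mx -scalemxAl -scalemxAr [RHS]mxE.
Qed.

Lemma psd_inv : psd N.
Proof. by move=> z; rewrite -(pmulr_rge0 _ q0) bf_inv. Qed.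

(** Cauchy-Schwarz between the dual norms given by [Q] and by its inverse [N / q]. *)
Lemma inv_CS z v : q * dd z v ^+ 2 <= bf N z z * bf Q v v.
Proof.
rewrite -(ler_pM2l q0) mulrA -expr2 -exprMn.
have -> : q * dd z v = bf Q (z *m N) v.
  by rewrite /bf /dd -(mulmxA z N Q) NQ mul_mx_scalar -scalemxAl [RHS]mxE.
apply: le_trans (bf_CS _ _ sQ pQ) _.
by rewrite -bf_inv mulrA.
Qed.

(** For [w = u N] the hypothesis reads [c N(u,u)^2 <= q N(u,u)]. *)
Lemma inv_bound (c : int) u : 0 <= c -> (forall w, c * dd w u ^+ 2 <= bf Q w w) ->
  c * bf N u u <= q.
Proof.
move=> c0 h; have a0 := psd_inv u; have := h (u *m N); rewrite -bf_inv.
have -> : dd (u *m N) u = bf N u u by [].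
move: a0; rewrite le_eqVlt => /orP[/eqP <- _|a0]; first by rewrite mulr0 ltW.
by rewrite expr2 mulrA ler_pM2r.
Qed.

End Inverse.

(** The matrix determinant lemma: the determinant of one bordered matrix is computed by two block
    factorisations, the second one scaled by [\det Q] in order to stay in the integers. *)
Lemma det_rank1 Q (u : 'cV[int]_d) v : \det Q != 0 ->
  \det (Q + u *m v) = \det Q + (v *m \adj Q *m u) 0 0.
Proof.
move=> q0; set q := \det Q in q0 *.
pose L := block_mx (1%:M : 'M[int]_1) (- v) u Q.
have e1 : \det L = \det (Q + u *m v).
  have -> : L = block_mx 1%:M 0 u 1%:M *m block_mx 1%:M (- v) 0 (Q + u *m v).
    rewrite mulmx_block !(mul1mx, mul0mx, mulmx0, mulmx1, addr0, mulmxN).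
    by rewrite addrC addrK.
  by rewrite det_mulmx det_lblock det_ublock !det1 !mul1r.
pose R := block_mx (q%:M : 'M[int]_1) 0 (- (\adj Q *m u)) (1%:M : 'M[int]_d).
have e2 : \det L * q = (q + (v *m \adj Q *m u) 0 0) * q.
  have -> : \det L * q = \det (L *m R).
    by rewrite det_mulmx det_lblock det1 mulr1 det_scalar expr1.
  rewrite mulmx_block !(mul1mx, mulmx0, mulmx1, add0r, mulNmx, mulmxN, opprK).
  rewrite (mulmxA Q) mul_mx_adj mul_scalar_mx mul_mx_scalar subrr det_ublock.
  by rewrite det_mx11 mxE [X in X + _]mxE eqxx mulr1n mulmxA.
by apply: (mulIf q0); rewrite -e1.
Qed.

(** The Sherman-Morrison formula for adjugates. Free of fractions, it shows that the entries of the
    new adjugate are exact quotients by [\det Q]. *)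
Lemma adj_rank1 Q u (c : int) : Q^T = Q -> \det Q != 0 ->
  let Q' := Q + c *: (u^T *m u) in
  let h := u *m \adj Q in
  \det Q' = \det Q + c * bf (\adj Q) u u /\
  (\det Q' != 0 -> \det Q *: \adj Q' = \det Q' *: \adj Q - c *: (h^T *m h)).
Proof.
move=> sQ q0 Q' h.
have sN : (\adj Q)^T = \adj Q by rewrite trmx_adj sQ.
have e : \det Q' = \det Q + c * bf (\adj Q) u u.
  rewrite /Q' -[c *: _]/(c *: (u^T *m u)) scalemxAl det_rank1 //.
  by rewrite -scalemxAr mxE.
split=> // q'0; set X := _ - _.
have XQ : X *m Q' = (\det Q * \det Q')%:M.
  have hQ : h *m Q = \det Q *: u by rewrite -mulmxA mul_adj_mx mul_mx_scalar.
  have hu : h *m u^T = (bf (\adj Q) u u)%:M by rewrite [LHS]mx11_scalar.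
  have adjQ' : \adj Q *m u^T = h^T by rewrite trmx_mul sN.
  rewrite /X mulmxBl /Q' !mulmxDr -!scalemxAl -!scalemxAr.
  rewrite mul_adj_mx (mulmxA (\adj Q)) adjQ'.
  rewrite -(mulmxA h^T h Q) hQ -(mulmxA h^T h) (mulmxA h u^T) hu mul_scalar_mx.
  rewrite -!scalemxAr !scalerA e.
  rewrite scale_scalar_mx mulrC -[RHS]addr0 -addrA; congr (_ + _).
  rewrite -!scalerDl -scalerBl -[RHS](scale0r (h^T *m u)); congr (_ *: _); ring.
have : (X - \det Q *: \adj Q') *m Q' = 0.
  by rewrite mulmxBl XQ -scalemxAl mul_adj_mx scale_scalar_mx subrr.
move=> /(congr1 (mulmx^~ (\adj Q'))); rewrite mul0mx -mulmxA mul_mx_adj mul_mx_scalar.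
move=> /eqP; rewrite scalemx_eq0 (negPf q'0) subr_eq0 => /eqP ->.
by [].
Qed.

End QuadraticForms.

(** * The algorithm on integer lists and its convergence *)

Definition lrow d (l : seq int) : 'rV[int]_d := \row_i nth 0%R l i.
Definition lmat d (N : seq (seq int)) : 'M[int]_d :=
  \matrix_(i < d, j < d) nth 0%R (nth [::] N i) j.
Definition dot d (u v : seq int) : int :=
  (\sum_(i <- iota 0 d) nth 0 u i * nth 0 v i)%R.

Lemma sum_iota (V : zmodType) d (F : nat -> V) :
  (\sum_(i <- iota 0 d) F i = \sum_(i < d) F i)%R.
Proof. by rewrite -{1}(subn0 d) -/(index_iota 0 d) big_mkord. Qed.

Lemma dotE d u v : dot d u v = dd (lrow d u) (lrow d v).
Proof.
by rewrite /dot sum_iota /dd mxE; apply: eq_bigr => i _; rewrite !mxE.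
Qed.

(** The scale factors [D_k] of the rows; the adjugate [N] and the determinant [q] of the form [Qf];
    the accumulated vector [z]; and, for each row, how often it was added since the last
    doubling. *)
Definition lpstate := ((seq nat * (seq (seq int) * nat)) * (seq int * seq nat))%type.

Definition lp_u d (N : seq (seq int)) (z : seq int) : seq int :=
  mkseq (fun i => dot d (nth [::] N i) z) d.

Definition lp_viol d (M : seq (seq int)) (u : seq int) : seq nat :=
  [seq k <- iota 0 (size M) | (dot d (nth [::] M k) u <= 0)%R].

Definition lp_q d (q : nat) (D : nat) (r h : seq int) : nat :=
  q + 3 * D * D * `|dot d r h|.

Definition lp_N d (N : seq (seq int)) (q q' D : nat) (h : seq int) : seq (seq int) :=
  mkseq (fun i => mkseq (fun j =>
    zquo (Posz q' * nth 0%R (nth [::] N i) j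
          - Posz (3 * D * D) * nth 0%R h i * nth 0%R h j)%R q) d) d.

(** A perceptron step in the metric of [Qf], with [N z] as the candidate. A row that was violated
    [th] times has a small value at every feasible point, compared with the norm of that point.
    Doubling its factor [D] changes the form by the rank-one term with coefficient
    [(2 D)^2 - D^2 = 3 D^2], and the perceptron restarts. *)
Definition lp_next d th (M : seq (seq int)) (st : lpstate) (k : nat) : lpstate :=
  let: ((Dl, (N, q)), (z, cnt)) := st in
  let r := nth [::] M k in
  let D := nth 0 Dl k in
  if (nth 0 cnt k).+1 == th then
    let h := lp_u d N r in
    let q' := lp_q d q D r h in
    ((mkseq (fun l => if l == k then 2 * D else nth 0 Dl l) (size M),
      (lp_N d N q q' D h, q')),
     (nseq d 0%R, nseq (size M) 0))
  else ((Dl, (N, q)),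
        (mkseq (fun i => nth 0 z i + D%:Z * nth 0 r i)%R d,
         mkseq (fun l => nth 0 cnt l + (l == k)) (size M))).

Definition lp_step d th (M : seq (seq int)) (st : lpstate) : lpstate :=
  match lp_viol d M (lp_u d st.1.2.1 st.2.1) with
  | [::] => st
  | k :: _ => lp_next d th M st k
  end.

Definition lp_init d (m B : nat) : lpstate :=
  ((nseq m 1, (mkseq (fun i => mkseq (fun j =>
      if i == j then Posz (B ^ d.-1) else 0%R) d) d, B ^ d)),
   (nseq d 0%R, nseq m 0)).

Section Perceptron.
Local Open Scope ring_scope.
Variables (d B : nat) (M : seq (seq int)).
Let m := size M.
(** In [feas_next] the product [m * m.+1] is what Cauchy-Schwarz loses, and the 4 pays for one
    doubling of a squared factor. *)
Let th := (4 * m * m.+1)%N.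
Let Mr (k : nat) : 'rV[int]_d := lrow d (nth [::] M k).
Hypothesis m0 : (0 < m)%N.
Hypothesis B0 : (0 < B)%N.
Hypothesis Brow : forall k u, (k < m)%N -> dd u (Mr k) ^+ 2 <= B%:Z * dd u u.

(** By [Brow] the scalar part dominates each single [M_k^T M_k], which makes up for the [- 1]: the
    form is at least [D_k^2 M_k^T M_k] for every [k]. With all factors equal to 1 it is a scalar
    matrix, whose adjugate is known. *)
Definition Qf (Dl : seq nat) : 'M[int]_d :=
  (B%:Z)%:M + \sum_(k < m) ((nth 0%N Dl k)%:Z ^+ 2 - 1) *: ((Mr k)^T *m Mr k).

Lemma dd_ge0 (u : 'rV[int]_d) : 0 <= dd u u.
Proof. by rewrite /dd mxE sumr_ge0 // => i _; rewrite mxE -expr2 sqr_ge0. Qed.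

Lemma bf_Qf Dl u v : bf (Qf Dl) u v = B%:Z * dd u v +
  \sum_(k < m) ((nth 0%N Dl k)%:Z ^+ 2 - 1) * (dd u (Mr k) * dd (Mr k) v).
Proof.
rewrite /bf /Qf mulmxDr mulmxDl mxE mul_mx_scalar -scalemxAl mxE; congr (_ + _).
rewrite mulmx_sumr mulmx_suml summxE; apply: eq_bigr => k _.
rewrite -scalemxAr -scalemxAl mxE; congr (_ * _).
rewrite mulmxA -(mulmxA (u *m _)).
by rewrite [u *m (Mr k)^T]mx11_scalar mul_scalar_mx [LHS]mxE.
Qed.

Lemma Qf_sym Dl : (Qf Dl)^T = Qf Dl.
Proof.
rewrite /Qf linearD /= tr_scalar_mx; congr (_ + _); rewrite linear_sum /=.
by apply: eq_bigr => k _; rewrite linearZ /= trmx_mul trmxK.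
Qed.

Definition Dpos (Dl : seq nat) := forall k, (k < m)%N -> (0 < nth 0%N Dl k)%N.

Lemma D2_ge0 Dl k : Dpos Dl -> (k < m)%N -> 0 <= (nth 0%N Dl k)%:Z ^+ 2 - 1 :> int.
Proof. by move=> h km; have := h k km; case: (nth _ _ _) => // n _; nia. Qed.

Lemma Qf_ge Dl u (k : nat) : Dpos Dl -> (k < m)%N ->
  (nth 0%N Dl k)%:Z ^+ 2 * dd u (Mr k) ^+ 2 <= bf (Qf Dl) u u.
Proof.
move=> hD km; rewrite bf_Qf (bigD1 (Ordinal km)) //= (ddC (Mr k)) -expr2.
have := Brow u km; set a := dd u (Mr k) ^+ 2; set b := B%:Z * _.
set S := \sum_(i < m | _) _ => h.
have S0 : 0 <= S.
  apply: sumr_ge0 => i _; rewrite (ddC (Mr i)) -expr2 mulr_ge0 ?sqr_ge0 //.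
  exact: D2_ge0.
by rewrite mulrBl mul1r; lia.
Qed.

Lemma Qf_ge1 Dl u : Dpos Dl -> dd u u <= bf (Qf Dl) u u.
Proof.
move=> hD; rewrite bf_Qf; apply: le_trans (_ : B%:Z * dd u u <= _).
  by rewrite ler_peMl ?dd_ge0 //; lia.
rewrite lerDl; apply: sumr_ge0 => i _.
by rewrite (ddC (Mr i)) -expr2 mulr_ge0 ?sqr_ge0 // D2_ge0.
Qed.

Lemma Qf_psd Dl : Dpos Dl -> psd (Qf Dl).
Proof. by move=> hD u; apply: le_trans (dd_ge0 u) (Qf_ge1 u hD). Qed.

Definition cnts (cnt : seq nat) : nat := (\sum_(k < m) nth 0 cnt k)%N.

(** The bound on the norm of [z] is the usual perceptron estimate, the squared norm growing by at
    most one per addition, multiplied by [q] since [N] is [q] times the inverse of the form. *)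
Definition lp_inv (st : lpstate) : Prop :=
  let: ((Dl, (N, q)), (z, cnt)) := st in
  [/\ Dpos Dl, lmat d N = \adj (Qf Dl), q%:Z = \det (Qf Dl) & (0 < q)%N] /\
  [/\ lrow d z = \sum_(k < m) ((nth 0%N cnt k)%:Z * (nth 0%N Dl k)%:Z) *: Mr k,
      bf (lmat d N) (lrow d z) (lrow d z) <= q%:Z * (cnts cnt)%:Z
    & forall k, (k < m)%N -> (nth 0 cnt k < th)%N].

Lemma th_gt1 : (1 < th)%N. Proof. by rewrite /th; nia. Qed.

Lemma lrow_mkseq f : lrow d (mkseq f d) = \row_(i < d) f i.
Proof. by apply/rowP => i; rewrite !mxE nth_mkseq. Qed.

Lemma lrow_nseq0 : lrow d (nseq d 0) = 0.
Proof. by apply/rowP => i; rewrite !mxE nth_nseq if_same. Qed.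

Lemma lp_init_inv : lp_inv (lp_init d m B).
Proof.
have QE : Qf (nseq m 1%N) = (B%:Z)%:M.
  rewrite /Qf big1 ?addr0 // => k _; rewrite nth_nseq ltn_ord.
  by rewrite (_ : 1 ^+ 2 - 1 = 0 :> int) // scale0r.
have BX e : (B ^ e)%N%:Z = B%:Z ^+ e by rewrite -!natz natrX.
split; split.
- by move=> k km; rewrite nth_nseq km.
- rewrite QE.
  have -> : \adj ((B%:Z)%:M : 'M[int]_d) = ((B ^ d.-1)%N%:Z)%:M.
    case: d => [|d']; first by apply/matrixP => [[]].
    have : \adj ((B%:Z)%:M : 'M[int]_d'.+1) *m (B%:Z)%:M = (B%:Z ^+ d'.+1)%:M.
      by rewrite mul_adj_mx det_scalar.
    rewrite mul_mx_scalar exprS -scale_scalar_mx => /eqP.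
    rewrite -subr_eq0 -scalerBr scalemx_eq0 subr_eq0 => /orP[/eqP ?|/eqP ->]; first by lia.
    by rewrite BX.
  apply/matrixP => i j; rewrite !mxE !nth_mkseq //.
  by rewrite -val_eqE /=; case: eqP => _; rewrite ?mulr1n ?mulr0n.
- by rewrite QE det_scalar BX.
- by rewrite expn_gt0 B0.
- rewrite lrow_nseq0 big1 // => k _; rewrite nth_nseq if_same mul0r scale0r //.
- by rewrite lrow_nseq0 /bf !mul0mx mxE mulr_ge0.
- by move=> k km; rewrite nth_nseq if_same; have := th_gt1; lia.
Qed.

Lemma lrow_u N z : lrow d (lp_u d N z) = lrow d z *m (lmat d N)^T.
Proof.
apply/rowP => i; rewrite mxE nth_mkseq // dotE /dd !mxE; apply: eq_bigr => j _.
by rewrite !mxE mulrC.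
Qed.

Lemma dot_u N z k : (lmat d N)^T = lmat d N ->
  dot d (nth [::] M k) (lp_u d N z) = bf (lmat d N) (lrow d z) (Mr k).
Proof. by move=> sN; rewrite dotE ddC lrow_u sN. Qed.

Section Step.
Variables (Dl : seq nat) (N : seq (seq int)) (q : nat) (z : seq int) (cnt : seq nat).
Let st : lpstate := ((Dl, (N, q)), (z, cnt)).
Hypothesis inv : lp_inv st.

Let hD : Dpos Dl. Proof. by case: inv => [[]]. Qed.
Let hN : lmat d N = \adj (Qf Dl). Proof. by case: inv => [[]]. Qed.
Let hq : q%:Z = \det (Qf Dl). Proof. by case: inv => [[]]. Qed.
Let q0 : (0 < q)%N. Proof. by case: inv => [[]]. Qed.
Let hz : lrow d z = \sum_(k < m) ((nth 0%N cnt k)%:Z * (nth 0%N Dl k)%:Z) *: Mr k.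
Proof. by case: inv => _ []. Qed.
Let hb : bf (lmat d N) (lrow d z) (lrow d z) <= q%:Z * (cnts cnt)%:Z.
Proof. by case: inv => _ []. Qed.
Let hc : forall k, (k < m)%N -> (nth 0 cnt k < th)%N.
Proof. by case: inv => _ []. Qed.

Lemma inv_sym : (lmat d N)^T = lmat d N.
Proof. by rewrite hN trmx_adj Qf_sym. Qed.

Lemma inv_NQ : lmat d N *m Qf Dl = (q%:Z)%:M.
Proof. by rewrite hN mul_adj_mx hq. Qed.

Let q0z : 0 < q%:Z. Proof. by lia. Qed.

Lemma inv_row k : (k < m)%N ->
  (nth 0%N Dl k)%:Z ^+ 2 * bf (lmat d N) (Mr k) (Mr k) <= q%:Z.
Proof.
move=> km; apply: (inv_bound inv_sym (Qf_psd hD) q0z inv_NQ); first exact: sqr_ge0.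
by move=> w; apply: Qf_ge.
Qed.

Lemma inv_row_ge0 u : 0 <= bf (lmat d N) u u.
Proof. exact: (psd_inv inv_sym (Qf_psd hD) q0z inv_NQ). Qed.

(** Serves to bound the length of a state. The form dominates the identity, hence the diagonal of
    [N] is at most [q]; Cauchy-Schwarz for the semidefinite [N] extends this to all entries. *)
Lemma inv_entry i j : (i < d)%N -> (j < d)%N ->
  (`|nth 0%R (nth [::] N i) j|%N <= q)%N.
Proof.
move=> hi hj; pose e (l : nat) : 'rV[int]_d := \row_(t < d) (t == l :> nat)%:R.
have bfe (a b : nat) (ha : (a < d)%N) (hb' : (b < d)%N) :
    bf (lmat d N) (e a) (e b) = nth 0 (nth [::] N a) b.
  rewrite /bf mxE (bigD1 (Ordinal hb')) //= big1 ?addr0; last first.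
    by move=> t; rewrite -val_eqE /= => /negPf tb; rewrite !mxE tb mulr0.
  rewrite !mxE eqxx mulr1 (bigD1 (Ordinal ha)) //= big1 ?addr0; last first.
    by move=> t; rewrite -val_eqE /= => /negPf tb; rewrite !mxE tb mul0r.
  by rewrite !mxE eqxx mul1r.
have dde w (a : nat) (ha : (a < d)%N) : dd w (e a) = w 0 (Ordinal ha).
  rewrite /dd mxE (bigD1 (Ordinal ha)) //= big1 ?addr0; last first.
    by move=> t; rewrite -val_eqE /= => /negPf tb; rewrite !mxE tb mulr0.
  by rewrite !mxE eqxx mulr1.
have diag a (ha : (a < d)%N) : bf (lmat d N) (e a) (e a) <= q%:Z.
  rewrite -[X in X <= _]mul1r.
  apply: (inv_bound inv_sym (Qf_psd hD) q0z inv_NQ) => // w; rewrite mul1r (dde _ _ ha).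
  apply: le_trans (Qf_ge1 w hD); rewrite /dd mxE (bigD1 (Ordinal ha)) //= mxE -expr2.
  by rewrite lerDl; apply: sumr_ge0 => t _; rewrite mxE -expr2 sqr_ge0.
have h := bf_CS (e i) (e j) inv_sym inv_row_ge0.
have h1 := diag i hi; have h2 := diag j hj; rewrite !bfe // in h h1 h2.
have p1 := inv_row_ge0 (e i); have p2 := inv_row_ge0 (e j); rewrite !bfe // in p1 p2.
have h3 : nth 0 (nth [::] N i) j ^+ 2 <= q%:Z ^+ 2.
  by apply: le_trans h _; rewrite expr2 ler_pM.
by move: h3; rewrite -[X in X <= _]real_normK ?num_real // ler_sqr ?nnegrE //; lia.
Qed.

(** The cross term is at most 0 because row [k] is violated, and the new square is at most [q] by
    [inv_row]. *)
Lemma inv_add k : (k < m)%N -> (dot d (nth [::] M k) (lp_u d N z) <= 0)%R ->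
  let z' := lrow d z + (nth 0%N Dl k)%:Z *: Mr k in
  bf (lmat d N) z' z' <= q%:Z * (cnts cnt).+1%:Z.
Proof.
move=> km; rewrite (dot_u _ _ inv_sym) => neg /=.
rewrite !(bfDl, bfDr, bfZl, bfZr) (bf_sym (Mr k) (lrow d z) inv_sym).
have := inv_row km; have := hb; set a := bf _ (lrow d z) (lrow d z).
set b := bf _ _ (Mr k) in neg *; set c := bf _ (Mr k) _; set D := (nth 0%N Dl k)%:Z.
move=> h1 h2; have D0 : 0 <= D by [].
have h3 : D * b <= 0 by apply: mulr_ge0_le0.
have -> : (cnts cnt).+1%:Z = (cnts cnt)%:Z + 1 by lia.
rewrite mulrDr mulr1; rewrite expr2 -mulrA in h2; lia.
Qed.

Lemma cnts_bound : (cnts cnt + m <= m * th)%N.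
Proof.
have -> : (m * th = \sum_(k < m) th)%N by rewrite sum_nat_const card_ord.
have -> : (cnts cnt + m = \sum_(k < m) (nth 0 cnt k).+1)%N.
  rewrite /cnts -[X in (_ + X)%N]card_ord -sum1_card -big_split /=.
  by apply: eq_bigr => i _; rewrite addn1.
by apply: leq_sum => k _; apply: hc.
Qed.

Lemma Qf_upd k : (k < m)%N ->
  Qf (mkseq (fun l => if l == k then 2 * nth 0%N Dl k else nth 0%N Dl l)%N (size M)) =
  Qf Dl + (3 * nth 0 Dl k * nth 0 Dl k)%N%:Z *: ((Mr k)^T *m Mr k).
Proof.
move=> km; rewrite /Qf -addrA; congr (_ + _).
rewrite (bigD1 (Ordinal km)) //= [in RHS](bigD1 (Ordinal km)) //= nth_mkseq // eqxx.
rewrite addrAC -scalerDl; congr (_ *: _ + _); first by rewrite !PoszM; ring.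
apply: eq_bigr => l lk; rewrite nth_mkseq ?ltn_ord //.
by move: lk; rewrite -val_eqE /= => /negPf ->.
Qed.

(** Keeps the length of the determinant linear in the number of steps. *)
Lemma lp_q_le k : (k < m)%N ->
  (lp_q d q (nth 0 Dl k) (nth [::] M k) (lp_u d N (nth [::] M k)) <= 4 * q)%N.
Proof.
move=> km; rewrite /lp_q dot_u ?inv_sym // -/(Mr k).
have := inv_row km; have := inv_row_ge0 (Mr k); set b := bf _ _ _.
move: (nth 0%N Dl k) => D b0 h; rewrite -lez_nat PoszD !PoszM abszE ger0_norm //.
have -> : 4 = 1 + 3 :> int by []; rewrite mulrDl mul1r lerD2l -!mulrA ler_wpM2l //.
by rewrite mulrA -expr2.
Qed.

Lemma next_inv k : (k < m)%N -> (dot d (nth [::] M k) (lp_u d N z) <= 0)%R ->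
  lp_inv (lp_next d th M st k).
Proof.
move=> km neg; rewrite /lp_next /=; case: eqP => hth; last first.
  split; split=> //.
  - rewrite lrow_mkseq.
    have -> : \row_(i < d) (nth 0 z i + (nth 0%N Dl k)%:Z * nth 0 (nth [::] M k) i) =
        lrow d z + (nth 0%N Dl k)%:Z *: Mr k by apply/rowP => i; rewrite !mxE.
    rewrite hz (bigD1 (Ordinal km)) //= [in RHS](bigD1 (Ordinal km)) //=.
    rewrite nth_mkseq // eqxx addrAC -scalerDl; congr (_ *: _ + _).
      by rewrite PoszD mulrDl mul1r.
    apply: eq_bigr => l lk; rewrite nth_mkseq ?ltn_ord //.
    by move: lk; rewrite -val_eqE /= => /negPf ->; rewrite addn0.
  - rewrite lrow_mkseq.
    have -> : \row_(i < d) (nth 0 z i + (nth 0%N Dl k)%:Z * nth 0 (nth [::] M k) i) =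
        lrow d z + (nth 0%N Dl k)%:Z *: Mr k by apply/rowP => i; rewrite !mxE.
    apply: le_trans (inv_add km neg) _; apply: ler_wpM2l => //; rewrite lez_nat.
    rewrite /cnts (bigD1 (Ordinal km)) //= [in X in (_ <= X)%N](bigD1 (Ordinal km)) //=.
    rewrite nth_mkseq // eqxx addn1 addSn ltnS leq_add2l.
    by apply: leq_sum => l lk; rewrite nth_mkseq ?ltn_ord // leq_addr.
  - move=> l lm; rewrite nth_mkseq //; have := hc lm; case: eqP => [->|] //=.
      by move: hth; rewrite addn1; lia.
    by rewrite addn0.
have Qu := Qf_upd km; set Dl' := mkseq _ _ in Qu *.
have detQ : \det (Qf Dl) != 0 by rewrite -hq; lia.
have [e1 e2] := adj_rank1 (Mr k) (3 * nth 0 Dl k * nth 0 Dl k)%N%:Z (Qf_sym Dl) detQ.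
rewrite -!Qu -!hN -!hq in e1 e2.
set h := lp_u d N (nth [::] M k).
have hE : lrow d h = Mr k *m lmat d N by rewrite lrow_u inv_sym.
have qE : (lp_q d q (nth 0 Dl k) (nth [::] M k) h)%:Z = \det (Qf Dl').
  rewrite e1 /lp_q PoszD PoszM abszE dot_u ?inv_sym // ger0_norm //.
  exact: inv_row_ge0.
set q' := lp_q _ _ _ _ _ in qE *.
have q'0 : (0 < q')%N by rewrite /q' /lp_q addn_gt0 q0.
have {}e2 := e2; rewrite -qE in e2.
split; split=> //.
- move=> l lm; rewrite nth_mkseq //; case: eqP => _; last exact: hD.
  by have := hD km; lia.
- have q'n : q'%:Z != 0 by lia.
  have e3 := e2 q'n; rewrite -hE in e3.
  move: (\adj (Qf Dl')) e3 => A /matrixP e3; apply/matrixP => i j.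
  rewrite mxE /lp_N nth_mkseq // nth_mkseq //.
  have := e3 i j; rewrite !mxE big_ord1 !mxE => E.
  (* By [e3] the numerator equals [q] times the entry of the new adjugate, so that the quotient is
     exact. *)
  by rewrite -(@zquoK (A i j) q) // [in RHS]mulrC E -mulrA.
- by rewrite lrow_nseq0 big1 // => l _; rewrite nth_nseq if_same mul0r scale0r.
- by rewrite lrow_nseq0 /bf !mul0mx mxE mulr_ge0.
- by move=> l lm; rewrite nth_nseq if_same; have := th_gt1; lia.
Qed.

(** A doubling resets the counters, whose sum stays below [m * th]; this is why it is worth
    [m * th]. *)
Definition phi (st : lpstate) : nat :=
  (m * th * (\sum_(k < m) trunc_log 2 (nth 0 st.1.1 k)) + cnts st.2.2)%N.

Lemma phi_next k : (k < m)%N -> (phi st < phi (lp_next d th M st k))%N.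
Proof.
move=> km; rewrite /lp_next /= /phi; case: eqP => hth /=.
  have -> : (\sum_(l < m) trunc_log 2 (nth 0 (mkseq (fun l => if l == k then
      2 * nth 0 Dl k else nth 0 Dl l) (size M)) l) =
      (\sum_(l < m) trunc_log 2 (nth 0 Dl l)).+1)%N.
    rewrite (bigD1 (Ordinal km)) //= [in RHS](bigD1 (Ordinal km)) //= -addSn.
    rewrite nth_mkseq // eqxx mul2n trunc_log2_double ?hD //; congr (_ + _)%N.
    apply: eq_bigr => l lk; rewrite nth_mkseq ?ltn_ord //.
    by move: lk; rewrite -val_eqE /= => /negPf ->.
  move: (\sum_(k0 < m) _)%N => S; rewrite (mulnS (m * th)).
  by have := cnts_bound; move: (m * th * S)%N (m * th)%N m0 => u v; lia.
rewrite ltn_add2l /cnts (bigD1 (Ordinal km)) //=.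
rewrite [in X in (_ < X)%N](bigD1 (Ordinal km)) //= nth_mkseq // eqxx addn1 addSn ltnS.
by rewrite leq_add2l; apply: leq_sum => l lk; rewrite nth_mkseq ?ltn_ord // leq_addr.
Qed.

Variables (v0 : 'rV[int]_d) (G : int).
Hypothesis v0_feas : forall k, (k < m)%N -> 1 <= dd (Mr k) v0.
Hypothesis v0_G : B%:Z * dd v0 v0 <= G.

Definition lp_feas (Dl : seq nat) : Prop :=
  forall k, (k < m)%N -> ((nth 0%N Dl k)%:Z * dd (Mr k) v0) ^+ 2 <= G.

(** Let [s] be the value of row [k] at [v0]. After [th] additions of this row [th D s <= z v0]. By
    Cauchy-Schwarz [(z v0)^2] is at most the number of additions, which is at most [m th], times
    [Qf(v0, v0) <= (m + 1) G]. With the choice of [th] this gives [4 (D s)^2 <= G], which is the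
    claim for the doubled factor. *)
Lemma feas_next k : (k < m)%N -> (dot d (nth [::] M k) (lp_u d N z) <= 0)%R ->
  lp_feas Dl -> lp_feas (lp_next d th M st k).1.1.
Proof.
move=> km neg F; rewrite /lp_next /=; case: eqP => hth //= l lm.
rewrite nth_mkseq //; case: eqP => [->|_]; last exact: F.
set D := nth 0%N Dl k; set s := dd (Mr k) v0.
have bz := inv_add km neg; set z' := (_ + _) in bz.
have cs := inv_CS (Qf_sym Dl) inv_sym (Qf_psd hD) q0z inv_NQ z' v0.
have s1 (l' : 'I_m) : 1 <= dd (Mr l') v0 by apply: v0_feas.
have zl : th%:Z * (D%:Z * s) <= dd z' v0.
  rewrite /z' ddDl ddZl hz.
  have -> : dd (\sum_(k0 < m) ((nth 0%N cnt k0)%:Z * (nth 0%N Dl k0)%:Z) *: Mr k0) v0 =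
     \sum_(k0 < m) ((nth 0%N cnt k0)%:Z * (nth 0%N Dl k0)%:Z) * dd (Mr k0) v0.
    rewrite /dd mulmx_suml summxE; apply: eq_bigr => i _.
    by rewrite -scalemxAl mxE.
  rewrite (bigD1 (Ordinal km)) //= -/D -/s -hth.
  have : 0 <= \sum_(i < m | i != Ordinal km)
      (nth 0%N cnt i)%:Z * (nth 0%N Dl i)%:Z * dd (Mr i) v0.
    by apply: sumr_ge0 => i _; have := s1 i => h; rewrite !mulr_ge0 //; lia.
  set S := \sum_(i < m | _) _ => S0.
  have -> : (nth 0%N cnt k).+1%:Z = (nth 0%N cnt k)%:Z + 1 by lia.
  rewrite mulrDl mul1r mulrA; lia.
have Ds0 : 0 <= D%:Z * s by rewrite mulr_ge0 //; have := v0_feas km; lia.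
(* The scalar part contributes at most [G] by [v0_G], and each of the [m] rows at most [G] by
   feasibility. *)
have bQ : bf (Qf Dl) v0 v0 <= (m.+1)%:Z * G.
  have -> : m.+1%:Z = m%:Z + 1 by lia.
  rewrite bf_Qf addrC mulrDl mul1r; apply: lerD v0_G.
  have -> : m%:Z * G = \sum_(i < m) G by rewrite sumr_const card_ord -mulr_natl natz.
  apply: ler_sum => i _; rewrite (ddC v0) -expr2.
  apply: le_trans (F i (ltn_ord i)); rewrite exprMn.
  by rewrite mulrBl mul1r lerBlDr lerDl sqr_ge0.
have G0 : 0 <= G by apply: le_trans v0_G; rewrite mulr_ge0 ?dd_ge0.
have key : (th%:Z * (D%:Z * s)) ^+ 2 <= (m * th)%N%:Z * ((m.+1)%:Z * G).
  have h1 : (th%:Z * (D%:Z * s)) ^+ 2 <= dd z' v0 ^+ 2.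
    by rewrite ler_sqr ?nnegrE //; [rewrite mulr_ge0 | apply: le_trans zl; rewrite mulr_ge0].
  have h2 : q%:Z * dd z' v0 ^+ 2 <= (q%:Z * (cnts cnt).+1%:Z) * ((m.+1)%:Z * G).
    apply: le_trans cs _; apply: ler_pM => //; first exact: inv_row_ge0.
    exact: (Qf_psd hD).
  rewrite -mulrA ler_pM2l // in h2; apply: le_trans h1 (le_trans h2 _).
  apply: ler_wpM2r; first by rewrite mulr_ge0.
  by rewrite lez_nat; have := cnts_bound; move: m0; lia.
have thE : th%:Z = 4 * (m%:Z * (m.+1)%:Z) by rewrite /th !PoszM mulrA.
have thp : 0 < th%:Z by have := th_gt1; lia.
have mp : 0 < m%:Z * (m.+1)%:Z by rewrite mulr_gt0 //; lia.
move: key; rewrite exprMn PoszM.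
have -> : m%:Z * th%:Z * ((m.+1)%:Z * G) = th%:Z * (m%:Z * (m.+1)%:Z * G) by ring.
rewrite expr2 -[X in X <= _]mulrA ler_pM2l // thE.
have -> : 4 * (m%:Z * (m.+1)%:Z) * (D%:Z * s) ^+ 2 =
   m%:Z * (m.+1)%:Z * ((2 * D)%N%:Z * s) ^+ 2 by rewrite PoszM; ring.
by rewrite ler_pM2l.
Qed.

(** Since [s >= 1], feasibility yields [D_k <= (D_k s)^2 <= G], so that a row is doubled at most
    [bitlen G] times. *)
Lemma phi_bound : lp_feas Dl -> (phi st < m * th * (m * bitlen `|G|).+1)%N.
Proof.
move=> F; rewrite /phi mulnS addnC /=; apply: (@leq_ltn_trans
  (cnts cnt + m * th * (m * bitlen `|G|))%N); last first.
  by rewrite ltn_add2r; have := cnts_bound; move: m0; lia.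
rewrite leq_add2l leq_mul2l; apply/orP; right.
have -> : (m * bitlen `|G| = \sum_(k < m) bitlen `|G|)%N.
  by rewrite sum_nat_const card_ord.
apply: leq_sum => k _; rewrite /bitlen; apply: leq_trans (leqnSn _).
apply: leq_trunc_log.
have := F k (ltn_ord k); have := v0_feas (ltn_ord k); have := hD (ltn_ord k).
set s := dd _ _; case: (nth 0%N Dl k) => // D _ s1.
have: D.+1%:Z <= (D.+1%:Z * s) ^+ 2.
  have: D.+1%:Z <= D.+1%:Z * s by rewrite ler_peMr.
  by move: (_ * s) => x hx; apply: le_trans hx _; rewrite expr2; nia.
by move=> h1 h2; have := le_trans h1 h2; lia.
Qed.

End Step.

Lemma lp_step_inv st : lp_inv st -> lp_inv (lp_step d th M st).
Proof.
move=> inv; rewrite /lp_step; case E: (lp_viol _ _ _) => [|k ks] //.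
have: k \in lp_viol d M (lp_u d st.1.2.1 st.2.1) by rewrite E mem_head.
rewrite mem_filter mem_iota add0n => /andP[neg km].
by case: st inv E neg => [[Dl [N q]] [z cnt]] inv _ neg; apply: next_inv.
Qed.

Lemma lp_iter_inv n : lp_inv (iter n (lp_step d th M) (lp_init d m B)).
Proof. by elim: n => [|n IH]; [exact: lp_init_inv | exact: lp_step_inv]. Qed.

Definition lp_sol (st : lpstate) : seq int := lp_u d st.1.2.1 st.2.1.
Definition lp_done (st : lpstate) : bool := nilp (lp_viol d M (lp_sol st)).

Lemma lp_done_pos st k : lp_done st -> (k < m)%N -> 0 < dot d (nth [::] M k) (lp_sol st).
Proof.
rewrite /lp_done => /nilP E km; rewrite ltNge; apply/negP => h.
suff: k \in lp_viol d M (lp_sol st) by rewrite E.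
by rewrite mem_filter h mem_iota add0n.
Qed.

Lemma lp_converges v0 (G : int) n :
  (forall k, (k < m)%N -> 1 <= dd (Mr k) v0) -> B%:Z * dd v0 v0 <= G ->
  (m * th * (m * bitlen `|G|).+1 <= n)%N ->
  lp_done (iter n (lp_step d th M) (lp_init d m B)).
Proof.
move=> h1 h2 hn; apply/negPn/negP => nd.
pose st i := iter i (lp_step d th M) (lp_init d m B).
have fix_done i : lp_done (st i) -> st i.+1 = st i.
  by rewrite /lp_done /st iterS /lp_step => /nilP ->.
have ndi i : (i <= n)%N -> ~~ lp_done (st i).
  move=> hi; apply: contra nd => di; rewrite -(subnKC hi).
  by elim: (n - i)%N => [|j IH]; rewrite ?addn0 // addnS -/(st _) fix_done.
have F0 : lp_feas v0 G (nseq m 1%N).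
  move=> k km; rewrite nth_nseq km mul1r ddC; apply: le_trans (Brow _ km) h2.
have step i : (i < n)%N -> lp_feas v0 G (st i).1.1 ->
    lp_feas v0 G (st i.+1).1.1 /\ (phi (st i) < phi (st i.+1))%N.
  move=> hi; have := ndi i (ltnW hi); have := lp_iter_inv i; rewrite -/(st i) /st iterS.
  rewrite -/(st i) /lp_done /lp_sol /lp_step.
  case E: (lp_viol _ _ _) => [|k ks] // inv _ F.
  have: k \in lp_viol d M (lp_u d (st i).1.2.1 (st i).2.1) by rewrite E mem_head.
  rewrite mem_filter mem_iota add0n => /andP[neg km].
  move: F inv neg; case: (st i) => [[Dl [N q]] [z cnt]] F inv neg; split.
    exact: (feas_next inv h1 h2).
  exact: (phi_next inv).
have all i : (i <= n)%N -> lp_feas v0 G (st i).1.1 /\ (i <= phi (st i))%N.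
  elim: i => [|i IH] hi; first by [].
  have [F P] := IH (ltnW hi); have [F' P'] := step i hi F; split=> //.
  exact: leq_ltn_trans P P'.
have [F P] := all n (leqnn n); have := lp_iter_inv n; rewrite -/(st n).
case E: (st n) F P => [[Dl [N q]] [z cnt]] F P inv.
by have := phi_bound inv h1 h2 F; rewrite ltnNge (leq_trans hn P).
Qed.

End Perceptron.

(** * The feasibility solver runs in polynomial time *)

Ltac ptstep :=
  first [ assumption | exact PT_id | simple apply PT_const
  | simple apply PT_fst | simple apply PT_snd | simple apply PT_pair
  | simple apply PT_nat_of_bool | simple apply PT_posz
  | simple apply PT_add | simple apply PT_sub | simple apply PT_mul
  | simple apply PT_div | simple apply PT_mod | simple apply PT_pw
  | simple apply PT_S | simple apply PT_leq | simple apply PT_neg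
  | simple apply PT_and | simple apply PT_or | simple apply PT_eqn
  | simple apply PT_eqb | simple apply PT_eqz
  | simple apply PT_cons | simple apply PT_nilp
  | simple apply PT_behead | simple apply PT_head | simple apply PT_cat
  | simple apply PT_size | simple apply PT_nth | simple apply PT_mem
  | simple apply PT_addz | simple apply PT_mulz | simple apply PT_oppz
  | simple apply PT_lez | simple apply PT_ltz | simple apply PT_absz
  | simple apply PT_zquo | simple apply PT_filter | simple apply PT_map
  | simple apply PT_has | simple apply PT_all | simple apply PT_sum
  | simple apply PT_sumz | simple apply PT_flatten | simple apply PT_if
  | match goal with H : PT ?f |- PT _ => apply: (PT_comp H) end ].
Ltac pt := repeat ptstep.

Section PTlp.
Context {X : Type} {eX : Enc X}.

Lemma PT_mkseq {A : Type} {eA : Enc A} (n : X -> nat) (f : X -> nat -> A) :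
  PT (fun x => iota 0 (n x)) -> PT (fun q : X * nat => f q.1 q.2) ->
  PT (fun x => mkseq (f x) (n x)).
Proof. by move=> pn pf; apply: PT_map. Qed.

(** Computability of [iota 0 (n x)] expresses at once that [n] is computable and that it is bounded
    by a polynomial, as is required of dimensions and exponents. *)
Lemma PT_of_iota (n : X -> nat) : PT (fun x => iota 0 (n x)) -> PT n.
Proof. by move=> pn; apply: PT_ext (PT_size pn) => x; rewrite size_iota. Qed.

Lemma PT_iota_size {A : Type} {eA : Enc A} (l : X -> seq A) : PT l ->
  PT (fun x => iota 0 (size (l x))).
Proof.
by move=> pl; apply: PT_iota; [exact: PT_const | exact: PT_size | exact: pb_size].
Qed.

Lemma pb_of_iota (n : X -> nat) : PT (fun x => iota 0 (n x)) -> pb n.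
Proof. by move=> pn; apply: pb_le (pb_size pn) => x; rewrite size_iota. Qed.

Lemma PT_expn (b e : X -> nat) : PT b -> PT (fun x => iota 0 (e x)) ->
  PT (fun x => b x ^ e x).
Proof.
move=> pb_ pe; have qe := PT_of_iota pe.
have h : PT (fun x => iter (e x) (muln (b x)) 1).
  apply: (@PT_iter X _ _ _ e (fun x s => b x * s) (fun _ => 1)) => //.
  - exact: pb_of_iota.
  - by pt.
  - exact: PT_const.
  - exists (fun x => e x * sz (b x) + 1).
      have := pb_of_iota pe => ?; by pbs.
    move=> x i hi; apply: (@leq_trans (i * sz (b x) + 1)).
      elim: i {hi} => [|i IH] //; rewrite iterS; apply: leq_trans (bitlen_mul _ _) _.
      by rewrite [i.+1 * _]mulSn -addnA leq_add2l.
    by rewrite leq_add2r leq_mul2r hi orbT.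
apply: PT_ext h => x; elim: (e x) => //= k ->; by rewrite expnS.
Qed.

Lemma PT_nseq {A : Type} {eA : Enc A} (n : X -> nat) (a : A) :
  PT (fun x => iota 0 (n x)) -> PT (fun x => nseq (n x) a).
Proof.
move=> pn; apply: PT_ext (PT_map (f := fun _ _ => a) (PT_const a) pn) => x.
by elim: (n x) 0 => //= k IH j; rewrite IH.
Qed.

End PTlp.

Lemma PT_dot {X : Type} {eX : Enc X} (d : X -> nat) (u v : X -> seq int) :
  PT (fun x => iota 0 (d x)) -> PT u -> PT v -> PT (fun x => dot (d x) (u x) (v x)).
Proof. by move=> pd pu pv; rewrite /dot; pt. Qed.

Lemma PT_lp_u {X : Type} {eX : Enc X} (d : X -> nat) N z :
  PT (fun x => iota 0 (d x)) -> PT N -> PT z -> PT (fun x => lp_u (d x) (N x) (z x)).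
Proof.
move=> pd pN pz; apply: (PT_mkseq (f := fun x i => dot (d x) (nth [::] (N x) i) (z x))) => //.
by apply: PT_dot; pt; apply: (PT_comp pd); pt.
Qed.

Lemma PT_lp_viol {X : Type} {eX : Enc X} (d : X -> nat) M u :
  PT (fun x => iota 0 (d x)) -> PT M -> PT u -> PT (fun x => lp_viol (d x) (M x) (u x)).
Proof.
move=> pd pM pu.
apply: (PT_filter (p := fun x k => (dot (d x) (nth [::] (M x) k) (u x) <= 0)%R)).
  by apply: PT_lez; [apply: PT_dot; pt; apply: (PT_comp pd) | ]; pt.
exact: PT_iota_size.
Qed.

Lemma PT_lp_q {X : Type} {eX : Enc X} (d q D : X -> nat) r h :
  PT (fun x => iota 0 (d x)) -> PT q -> PT D -> PT r -> PT h ->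
  PT (fun x => lp_q (d x) (q x) (D x) (r x) (h x)).
Proof. by move=> pd pq pD pr ph; rewrite /lp_q; pt; apply: PT_dot. Qed.

Lemma PT_lp_N {X : Type} {eX : Enc X} (d q q' D : X -> nat) N h :
  PT (fun x => iota 0 (d x)) -> PT q -> PT q' -> PT D -> PT N -> PT h ->
  PT (fun x => lp_N (d x) (N x) (q x) (q' x) (D x) (h x)).
Proof.
move=> pd pq pq' pD pN ph.
apply: (PT_mkseq (f := fun x i => mkseq (fun j =>
    zquo (Posz (q' x) * nth 0%R (nth [::] (N x) i) j
          - Posz (3 * D x * D x) * nth 0%R (h x) i * nth 0%R (h x) j)%R (q x)) (d x))) => //.
apply: (PT_mkseq (n := fun p : X * nat => d p.1) (f := fun p j =>
    zquo (Posz (q' p.1) * nth 0%R (nth [::] (N p.1) p.2) j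
    - Posz (3 * D p.1 * D p.1) * nth 0%R (h p.1) p.2 * nth 0%R (h p.1) j)%R (q p.1))).
  by apply: (PT_comp pd); pt.
by pt.
Qed.

Lemma PT_lp_next {X : Type} {eX : Enc X} (d th k : X -> nat) M st :
  PT (fun x => iota 0 (d x)) -> PT th -> PT M -> PT st -> PT k ->
  PT (fun x => lp_next (d x) (th x) (M x) (st x) (k x)).
Proof.
move=> pd pth pM pst pk.
pose r x := nth [::] (M x) (k x); pose D x := nth 0 (st x).1.1 (k x).
pose h x := lp_u (d x) (st x).1.2.1 (r x).
pose q' x := lp_q (d x) (st x).1.2.2 (D x) (r x) (h x).
have pr : PT r by rewrite /r; pt.
have pD : PT D by rewrite /D; pt.
have ph : PT h by apply: PT_lp_u => //; pt.
have pq' : PT q' by apply: PT_lp_q => //; pt.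
have pms := PT_iota_size pM.
have h1 : PT (fun x => mkseq (fun l => if l == k x then 2 * D x else nth 0 (st x).1.1 l)
    (size (M x))).
  apply: (PT_mkseq (f := fun x l => if l == k x then 2 * D x else nth 0 (st x).1.1 l)) => //.
  by pt.
have h2 : PT (fun x => lp_N (d x) (st x).1.2.1 (st x).1.2.2 (q' x) (D x) (h x)).
  by apply: PT_lp_N => //; pt.
have h3 : PT (fun x => nseq (d x) 0%R : seq int) by apply: PT_nseq.
have h4 : PT (fun x => nseq (size (M x)) 0) by apply: PT_nseq.
have h5 : PT (fun x => mkseq (fun i => nth 0 (st x).2.1 i + Posz (D x) * nth 0 (r x) i)%R (d x)).
  apply: (PT_mkseq (f := fun x i => nth 0 (st x).2.1 i + Posz (D x) * nth 0 (r x) i)%R) => //.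
  by pt.
have h6 : PT (fun x => mkseq (fun l => nth 0 (st x).2.2 l + (l == k x)) (size (M x))).
  apply: (PT_mkseq (f := fun x l => nth 0 (st x).2.2 l + (l == k x))) => //.
  by pt.
have c : PT (fun x => (nth 0 (st x).2.2 (k x)).+1 == th x) by pt.
have F := PT_if c (PT_pair (PT_pair h1 (PT_pair h2 pq')) (PT_pair h3 h4))
  (PT_pair (PT_fst pst) (PT_pair h5 h6)).
apply: PT_ext F => x; rewrite /lp_next /q' /h /D /r.
by case: (st x) => [[Dl [N q]] [z cnt]] /=.
Qed.

Lemma PT_lp_step {X : Type} {eX : Enc X} (d th : X -> nat) M st :
  PT (fun x => iota 0 (d x)) -> PT th -> PT M -> PT st ->
  PT (fun x => lp_step (d x) (th x) (M x) (st x)).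
Proof.
move=> pd pth pM pst.
apply: (PT_match (l := fun x => lp_viol (d x) (M x) (lp_u (d x) (st x).1.2.1 (st x).2.1))
  (h := st) (g := fun x k _ => lp_next (d x) (th x) (M x) (st x) k)) => //.
  by apply: PT_lp_viol => //; apply: PT_lp_u => //; pt.
by apply: PT_lp_next; pt; apply: (PT_comp pd); pt.
Qed.

Lemma PT_lp_init {X : Type} {eX : Enc X} (d m B : X -> nat) :
  PT (fun x => iota 0 (d x)) -> PT (fun x => iota 0 (m x)) -> PT B ->
  PT (fun x => lp_init (d x) (m x) (B x)).
Proof.
move=> pd pm pB; rewrite /lp_init.
have qd := PT_of_iota pd.
have pd1 : PT (fun x => iota 0 (d x).-1).
  apply: PT_iota; first exact: PT_const.
    by apply: PT_ext (PT_sub qd (PT_const 1)) => x; rewrite subn1.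
  by apply: pb_le (pb_of_iota pd) => x; apply: leq_pred.
have pe := PT_expn pB pd; have pe1 := PT_expn pB pd1.
apply: PT_pair; apply: PT_pair; try exact: PT_nseq.
apply: PT_pair => //.
apply: (PT_mkseq (f := fun x i => mkseq (fun j => if i == j then Posz (B x ^ (d x).-1)
   else 0%R) (d x))) => //.
apply: (PT_mkseq (n := fun p : X * nat => d p.1) (f := fun p j => if p.2 == j then
   Posz (B p.1 ^ (d p.1).-1) else 0%R)).
  by apply: (PT_comp pd); pt.
have pe2 : PT (fun p : X * nat * nat => B p.1.1 ^ (d p.1.1).-1).
  by apply: (PT_comp pe1); pt.
by pt.
Qed.

(** At once a bound for the squared norm of each row, as in [Brow], and for each single entry; the
    successor makes it positive. *)
Definition lpB d (M : seq (seq int)) : nat :=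
  (\sum_(r <- M) \sum_(i <- iota 0 d) `|nth 0%R r i| * `|nth 0%R r i|).+1.

Lemma PT_lpB {X : Type} {eX : Enc X} (d : X -> nat) M :
  PT (fun x => iota 0 (d x)) -> PT M -> PT (fun x => lpB (d x) (M x)).
Proof.
move=> pd pM; rewrite /lpB; pt; by apply: (PT_comp pd); pt.
Qed.

Definition lpth (m : nat) : nat := 4 * m * m.+1.

Definition lp_run d nit (M : seq (seq int)) : lpstate :=
  iter nit (lp_step d (lpth (size M)) M) (lp_init d (size M) (lpB d M)).

Lemma lpS_arith d m K sDl sN sq sz_ sc sNq sDNq szc :
  sDNq <= sNq + 2 * sDl + 4 -> sNq <= sq + 2 * sN + 4 -> szc <= sc + 2 * sz_ + 4 ->
  sq <= K -> sN <= d * (2 * (d * (2 * K + 4) + 1) + 4) + 1 ->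
  sDl <= m * (2 * K + 4) + 1 -> sc <= m * (2 * K + 4) + 1 ->
  sz_ <= d * (2 * K + 4) + 1 ->
  szc + 2 * sDNq + 4 <= 100 * (d + m + 1) * (d + 1) * (K + 5).
Proof.
have aux x : x * (2 * K + 4) + 1 <= 2 * ((x + 1) * (K + 5)) by nia.
pose P := K + 5; pose T := (d + m + 1) * (d + 1) * P.
have t1 : (m + 1) * P <= T by rewrite /T; apply: leq_mul => //; nia.
have t2 : (d + 1) * P <= T by rewrite /T; apply: leq_mul => //; nia.
have t3 : d * ((d + 1) * P) <= T by rewrite mulnA /T; apply: leq_mul => //; nia.
have t4 : P <= T by apply: leq_trans t1; rewrite leq_pmull // addn1.
have p0 : 5 <= P by rewrite /P leq_addl.
have R1 := aux d; have R2 := aux m.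
have zN1 : d * (2 * (d * (2 * K + 4) + 1) + 4) <= 8 * (d * ((d + 1) * P)).
  have -> : 8 * (d * ((d + 1) * P)) = d * (8 * ((d + 1) * P)) by lia.
  rewrite leq_mul2l; apply/orP; right.
  have h : P <= (d + 1) * P by rewrite leq_pmull // addn1.
  by move: R1 h p0; rewrite -/P; move: (d * _) ((d + 1) * P) => u v; lia.
have -> : 100 * (d + m + 1) * (d + 1) * (K + 5) = 100 * T by rewrite /T -!mulnA.
have KP : K <= P by rewrite /P leq_addr.
rewrite -/P in R1 R2; move: zN1 R1 R2 t1 t2 t3 t4 p0 KP.
move: (d * (2 * (d * (2 * K + 4) + 1) + 4)) (d * (2 * K + 4)) (m * (2 * K + 4)).
clearbody T; clearbody P.
move: (d * ((d + 1) * P)) ((d + 1) * P) ((m + 1) * P) => *; lia.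
Qed.

Section Bounds.
Variables (d : nat) (M : seq (seq int)).
Let m := size M.
Let B := lpB d M.

Lemma lpB_gt0 : 0 < B. Proof. by []. Qed.

Lemma lpB_entry k i : k < m -> i < d -> `|nth 0%R (nth [::] M k) i| <= B.
Proof.
move=> km id_; rewrite /B /lpB (big_nth [::]) big_mkord (bigD1 (Ordinal km)) //=.
rewrite -[d in iota 0 d]subn0 -/(index_iota 0 d) big_mkord (bigD1 (Ordinal id_)) //=.
set u := (\sum_(i0 < d | _) _); set v := (\sum_(i0 < m | _) _).
by move: u v (`|_|) => u v [|n] //; nia.
Qed.

Lemma lpB_row k (u : 'rV[int]_d) : k < m ->
  (dd u (lrow d (nth [::] M k)) ^+ 2 <= Posz B * dd u u)%R.
Proof.
move=> km; have e (v w : 'rV[int]_d) : bf 1%:M v w = dd v w by rewrite /bf /dd mulmx1.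
have p1 : psd (1%:M : 'M[int]_d) by move=> v; rewrite e dd_ge0.
have := bf_CS u (lrow d (nth [::] M k)) (trmx1 _ _) p1; rewrite !e => h.
apply: le_trans h _; rewrite mulrC; apply: ler_wpM2r; first exact: dd_ge0.
rewrite -dotE /dot /B /lpB (big_nth [::]) big_mkord (bigD1 (Ordinal km)) //=.
apply: (@le_trans _ _ (Posz (\sum_(i <- iota 0 d)
   `|nth 0%R (nth [::] M k) i| * `|nth 0%R (nth [::] M k) i|))); last first.
  by rewrite lez_nat leqW // leq_addr.
rewrite le_eqVlt; apply/orP; left; apply/eqP; elim: (iota 0 d) => [|i s IH].
  by rewrite !big_nil.
rewrite !big_cons PoszD -IH PoszM !abszE -normrM ger0_norm //.
by rewrite -expr2 sqr_ge0.
Qed.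

(** The numbers grow exponentially with the number [n] of steps, hence their lengths linearly. *)
Definition lp_bnd (n : nat) (st : lpstate) : Prop :=
  let: ((Dl, (N, q)), (z, cnt)) := st in
  [/\ size Dl = m, size N = d, size z = d & size cnt = m] /\
  [/\ forall i, i < d -> size (nth [::] N i) = d,
      forall k, k < m -> nth 0 Dl k <= 2 ^ n,
      q <= B ^ d * 4 ^ n,
      forall i, i < d -> `|nth 0%R z i| <= n * (2 ^ n * B)
    & forall k, k < m -> nth 0 cnt k <= n].

Lemma lp_bnd_iter n : 0 < m -> lp_bnd n (lp_run d n M).
Proof.
move=> m0; rewrite /lp_run -/m -/B.
elim: n => [|n IH].
  rewrite /lp_init /=; split; split; rewrite ?size_nseq ?size_mkseq //.
  - by move=> i id_; rewrite nth_mkseq // size_mkseq.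
  - by move=> k km; rewrite nth_nseq km.
  - by rewrite muln1.
  - by move=> i id_; rewrite nth_nseq if_same.
  - by move=> k km; rewrite nth_nseq if_same.
have inv := lp_iter_inv m0 lpB_gt0 lpB_row n.
rewrite -/(lpth m) in inv; rewrite iterS.
case: (iter n _ _) IH inv => [[Dl [N q]] [z cnt]] [[s1 s2 s3 s4] [b1 b2 b3 b4 b5]] inv.
have m4 : q <= B ^ d * 4 ^ n.+1.
  by apply: leq_trans b3 _; rewrite leq_mul2l leq_exp2l ?leqnSn ?orbT.
have m2 k : k < m -> nth 0 Dl k <= 2 ^ n.+1.
  by move=> km; apply: leq_trans (b2 k km) _; rewrite leq_exp2l.
rewrite /lp_step /=; case E: (lp_viol _ _ _) => [|k ks].
  split; split=> //.
  - move=> i id_; apply: leq_trans (b4 i id_) _; apply: leq_mul => //.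
    by rewrite leq_mul2r leq_exp2l ?leqnSn ?orbT.
  - by move=> k km; apply: leq_trans (b5 k km) _.
have: k \in lp_viol d M (lp_u d N z) by rewrite E mem_head.
rewrite mem_filter mem_iota add0n => /andP[neg km].
rewrite /lp_next; case: eqP => hth; split; split; rewrite ?size_nseq ?size_mkseq //.
- by move=> i id_; rewrite nth_mkseq // size_mkseq.
- move=> l lm; rewrite nth_mkseq //; case: eqP => _; last exact: m2.
  by rewrite expnS leq_mul2l b2.
- apply: leq_trans (lp_q_le m0 lpB_gt0 lpB_row inv km) _.
  by rewrite expnS mulnCA leq_mul2l b3.
- by move=> i id_; rewrite nth_nseq if_same.
- by move=> l lm; rewrite nth_nseq if_same.
- move=> i id_; rewrite nth_mkseq //.
  have h1 := b4 i id_; have h2 := b2 k km; have h3 := lpB_entry km id_.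
  set a := nth 0%R z i in h1 *; set e := nth 0%R (nth [::] M k) i in h3 *.
  set D := nth 0 Dl k in h2 *.
  have h4 : `|(a + Posz D * e)%R|%N <= `|a| + D * `|e|.
    by rewrite -[D * _]/(`|Posz D| * `|e|) -abszM; move: (_ * e)%R => b; lia.
  apply: leq_trans h4 _; rewrite mulSn expnS.
  have h5 : D * `|e| <= 2 ^ n * B by apply: leq_mul.
  have h6 : n * (2 ^ n * B) <= n * (2 * 2 ^ n * B) by rewrite leq_mul2l; apply/orP; right; nia.
  have h7 : 2 ^ n * B <= 2 * 2 ^ n * B by nia.
  by apply: leq_trans (leq_add h1 h5) _; rewrite addnC; apply: leq_add.
- move=> l lm; rewrite nth_mkseq //; have := b5 l lm; case: (l == k); lia.
Qed.

Definition lpK (n : nat) : nat := 3 * n + d * bitlen B + bitlen B + 20.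
Definition lpS (n : nat) : nat :=
  100 * (d + m + 1) * (d + 1) * (lpK n + 5).

Lemma bitlen_exp b e : bitlen (b ^ e) <= e * bitlen b + 1.
Proof.
elim: e => [|e IH] //; rewrite expnS; apply: leq_trans (bitlen_mul _ _) _.
by rewrite [e.+1 * _]mulSn -addnA leq_add2l.
Qed.

Lemma lp_sz n nit : n <= nit -> sz (lp_run d n M) <= lpS nit + sz (lp_run d 0 M).
Proof.
move=> hn; case: (posnP m) => [m0|m0].
  have -> : lp_run d n M = lp_run d 0 M; last exact: leq_addl.
  elim: n {hn} => // n IH; rewrite {1}/lp_run iterS -/(lp_run d n M) IH.
  have mi : iota 0 (size M) = [::] by rewrite -/m m0.
  by rewrite /lp_step /lp_viol mi.
have := lp_bnd_iter n m0.
have inv := lp_iter_inv m0 lpB_gt0 lpB_row n; rewrite -/(lpth m) in inv.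
rewrite -/(lp_run d n M) in inv.
case: (lp_run d n M) inv => [[Dl [N q]] [z cnt]] inv.
move=> [[s1 s2 s3 s4] [b1 b2 b3 b4 b5]]; set K := lpK nit.
apply: leq_trans (leq_addr _ _).
have q2 k b : bitlen (b ^ k) <= k * bitlen b + 1 := bitlen_exp b k.
have q22 : bitlen (2 ^ n) <= n + 1.
  by apply: bitlen_leS; rewrite ?addn1 // ltn_exp2l.
have hK : 3 * n + d * bitlen B + bitlen B + 20 <= K.
  by rewrite /K /lpK !leq_add2r leq_mul2l hn.
have eD i : i < size Dl -> forall a0, sz (nth a0 Dl i) <= K.
  rewrite s1 => im a0; rewrite (set_nth_default 0) ?s1 //.
  apply: leq_trans (bitlen_mono (b2 i im)) (leq_trans q22 _); lia.
have ec i : i < size cnt -> forall a0, sz (nth a0 cnt i) <= K.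
  rewrite s4 => im a0; rewrite (set_nth_default 0) ?s4 //.
  apply: leq_trans (bitlen_mono (b5 i im)) (leq_trans (bitlen_self _) _); lia.
have bq : bitlen q <= d * bitlen B + 3 * n + 2.
  apply: leq_trans (bitlen_mono b3) (leq_trans (bitlen_mul _ _) _).
  have h1 := q2 d B; have h2 := q2 n 4; rewrite (_ : bitlen 4 = 3) // in h2; lia.
have ez i : i < size z -> forall a0, sz (nth a0 z i) <= K.
  rewrite s3 => im a0; rewrite (set_nth_default 0%R) ?s3 //.
  apply: leq_trans (sz_int (b4 i im)) _.
  have h1 := bitlen_mul n (2 ^ n * B); have h2 := bitlen_mul (2 ^ n) B.
  have h3 := bitlen_self n; lia.
pose R := d * (2 * K + 4) + 1.
have eN i : i < size N -> forall a0, sz (nth a0 N i) <= R.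
  rewrite s2 => im a0; rewrite (set_nth_default [::]) ?s2 //.
  rewrite /R -(b1 i im); apply: sz_le => j jm b0; rewrite (b1 i im) in jm.
  rewrite (set_nth_default 0%R) ?b1 //.
  have h : `|nth 0%R (nth [::] N i) j|%N <= q.
    by eapply inv_entry; try exact inv; try exact im; try exact jm; try exact m0;
      try exact lpB_gt0; try exact lpB_row.
  apply: leq_trans (sz_int h) _; lia.
have zD := sz_le eD; have zc := sz_le ec; have zz := sz_le ez; have zN := sz_le eN.
rewrite s1 in zD; rewrite s4 in zc; rewrite s3 in zz; rewrite s2 in zN.
apply: leq_trans (sz_pair _ _) _.
have zq : sz q <= K by apply: leq_trans bq _; lia.
rewrite /lpS -/K.
by apply: (lpS_arith _ _ _ zq zN zD zc zz); apply: sz_pair.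
Qed.

End Bounds.

Lemma PT_lp_run {X : Type} {eX : Enc X} (d nit : X -> nat) M :
  PT (fun x => iota 0 (d x)) -> PT nit -> pb nit -> PT M ->
  PT (fun x => lp_run (d x) (nit x) (M x)).
Proof.
move=> pd pn bn pM; have bd := pb_of_iota pd; have bm := pb_size pM.
have pB := PT_lpB pd pM.
have p0 : PT (fun x => lp_init (d x) (size (M x)) (lpB (d x) (M x))).
  by apply: PT_lp_init => //; apply: PT_iota_size.
apply: (@PT_iter X _ _ _ nit (fun x st => lp_step (d x) (lpth (size (M x))) (M x) st)
  (fun x => lp_init (d x) (size (M x)) (lpB (d x) (M x)))) => //.
  by apply: PT_lp_step; rewrite ?/lpth; pt.
exists (fun x => lpS (d x) (M x) (nit x) + sz (lp_run (d x) 0 (M x))).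
  have bB : pb (fun x => bitlen (lpB (d x) (M x))) by exact: (PT_sz pB).
  have b0 := PT_sz p0.
  by rewrite /lpS /lpK; apply: pb_add => //; pbs.
by move=> x i hi; apply: lp_sz.
Qed.

(** * Iterative rounding *)

Module Rounding.

Definition dir := (((nat * nat) * (nat * nat)) * (int * int))%type.
(** The quotients [Y_i / Z] form the fractional solution; then come the radii and the list of core
    clients. *)
Definition rstate := ((nat * seq nat) * (seq nat * seq nat))%type.

Definition ysum (Y : seq nat) (l : seq nat) : nat := \sum_(i <- l) nth 0 Y i.

Definition unitv (p : nat * nat) (i : nat) : int :=
  (Posz (i == p.1) - Posz (i == p.2))%R.
Definition gdir (g : dir) (i : nat) : int :=
  (g.2.1 * unitv g.1.1 i + g.2.2 * unitv g.1.2 i)%R.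

Section Defs.
Variables (n r : nat) (C fac : seq nat) (A : nat -> seq nat).
Variables (dp : nat -> nat -> nat) (f w : nat -> nat).

Definition Fs (Dl : seq nat) (j : nat) := [seq i <- A j | dp i j <= nth 0 Dl j].
Definition Bs (Dl : seq nat) (j : nat) := [seq i <- A j | dp i j < nth 0 Dl j].

Definition meet (Dl : seq nat) (j k : nat) : bool :=
  has (fun i => i \in Fs Dl k) (Fs Dl j).

(** Applied when the radius of [j] is new. A core client of no larger radius that meets [j] keeps
    [j] out of the core. Otherwise [j] enters and expels the core clients that it meets; their radii
    are larger and thus, being powers of two, at least twice as large. *)
Definition upd (Dl core : seq nat) (j : nat) : seq nat :=
  let core1 := [seq k <- core | k != j] in
  if has (fun k => (nth 0 Dl k <= nth 0 Dl j) && meet Dl j k) core1 then core1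
  else j :: [seq k <- core1 | ~~ meet Dl j k].

Definition frac (Z : nat) (Y : seq nat) : seq nat :=
  [seq i <- fac | (0 < nth 0 Y i) && (nth 0 Y i < Z)].

Definition tight (Z : nat) (Y Dl core : seq nat) : seq nat :=
  [seq k <- core | ysum Y (Fs Dl k) == r * Z].

(* The index [n], which is not a facility, plays the role of the absent second
   end of a move that changes one coordinate only. *)
Definition moves (st : rstate) : seq (nat * nat) :=
  let: ((Z, Y), (Dl, core)) := st in
  let fr := frac Z Y in let tg := tight Z Y Dl core in
  flatten [seq [seq (a, b) | b <- [seq b <- n :: fr | (a != b) &&
     all (fun k => (a \in Fs Dl k) == (b \in Fs Dl k)) tg]] | a <- fr].

Definition wt (p : nat * nat) : int := (Posz (w p.1) - Posz (w p.2))%R.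

(** Either one move of weight 0, or two moves whose coefficients cancel their weights. In the second
    case the direction is nonzero at [v.1], which is no end of [u]. *)
Definition cand (ms : seq (nat * nat)) : seq dir :=
  [seq ((u, u), (1%R, 0%R)) | u <- [seq u <- ms | wt u == 0%R]] ++
  flatten [seq [seq ((u, v), (wt v, (- wt u)%R)) | v <- [seq v <- ms |
      [&& wt u != 0%R, v.1 != u.1 & v.1 != u.2]]] | u <- ms].

(** The derivative of the potential [Phi] in the direction [g]. *)
Definition rate (Dl : seq nat) (g : nat -> int) : int :=
  (\sum_(i <- fac) Posz (f i) * g i
   - \sum_(j <- C) \sum_(i <- A j) Posz (nth 0%N Dl j - dp i j) * g i)%R.

Definition orient (Dl : seq nat) (g : dir) : dir :=
  if (rate Dl (gdir g) <= 0)%R then g else (g.1, ((- g.2.1)%R, (- g.2.2)%R)).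

Definition gsum (g : nat -> int) (l : seq nat) : int := (\sum_(i <- l) g i)%R.

(** Slacks, each with the speed at which the direction uses it up, of [y_i <= 1], [y_i >= 0],
    [y(F_k) >= r] for core clients and [y(B_j) <= r]. *)
Definition slacks (st : rstate) (g : nat -> int) : seq (nat * int) :=
  let: ((Z, Y), (Dl, core)) := st in
  [seq (Z - nth 0 Y i, g i) | i <- frac Z Y] ++
  [seq (nth 0 Y i, (- g i)%R) | i <- frac Z Y] ++
  [seq (ysum Y (Fs Dl k) - r * Z, (- gsum g (Fs Dl k))%R) | k <- core] ++
  [seq (r * Z - ysum Y (Bs Dl j), gsum g (Bs Dl j)) | j <- C].

(** The ratio test, with quotients compared by cross multiplication. *)
Definition best (cs : seq (nat * int)) : nat * int :=
  let cp := [seq c <- cs | (0 < c.2)%R] in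
  head (0, 1%R) [seq c <- cp | all (fun c' => (Posz c.1 * c'.2 <= Posz c'.1 * c.2)%R) cp].

(** The step length is [c.1 / c.2]; multiplying the common denominator by [c.2] keeps all numerators
    integral. *)
Definition move (st : rstate) (g : dir) : rstate :=
  let c := best (slacks st (gdir g)) in
  ((`|c.2|%N * st.1.1, mkseq (fun i => `|(c.2 * Posz (nth 0%N st.1.2 i) + Posz c.1 * gdir g i)%R|%N) n),
   st.2).

Definition full (st : rstate) : seq nat :=
  [seq j <- C | r * st.1.1 <= ysum st.1.2 (Bs st.2.1 j)].

Definition shrink (st : rstate) (j : nat) : rstate :=
  let Dl := mkseq (fun k => if k == j then nth 0 st.2.1 j %/ 2 else nth 0 st.2.1 k) n in
  (st.1, (Dl, upd Dl st.2.2 j)).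

Definition rstep (st : rstate) : rstate :=
  match full st with
  | j :: _ => shrink st j
  | [::] => match cand (moves st) with
            | [::] => st
            | g :: _ => move st (orient st.2.1 g)
            end
  end.

(** A single fractional facility is closed. This is harmless, as it lies in no tight core ball: in a
    tight ball it would have a fractional companion. *)
Definition rout (st : rstate) : seq nat :=
  [seq i <- fac | nth 0 st.1.2 i == st.1.1] ++
  match frac st.1.1 st.1.2 with
  | [:: a; b] => [:: if w a <= w b then a else b]
  | _ => [::]
  end.

End Defs.

(** * Powers of two, counting, and sums along a direction *)

Definition pow20 (x : nat) : bool := (x == 0) || (x == 2 ^ trunc_log 2 x).

Lemma pow20_lt x y : pow20 x -> pow20 y -> x < y -> 2 * x <= y.
Proof.
move=> /orP[/eqP->|/eqP ->] //.
case/orP=> [/eqP->|/eqP ->] //; rewrite ltn_exp2l // => h.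
by rewrite -expnS leq_exp2l.
Qed.

(** A radius 1 is halved to 0, which is one reason to admit 0; the other is that distances
    vanish. *)
Lemma pow20_half x : pow20 x -> pow20 (x %/ 2).
Proof.
move=> /orP[/eqP->|/eqP ->] //; case: (trunc_log 2 x) => [|k] //.
by rewrite expnS mulKn // /pow20 trunc_expnK // eqxx orbT.
Qed.

Lemma pow20_dbl x : pow20 x -> pow20 (2 * x).
Proof.
move=> /orP[/eqP->|/eqP ->] //.
by rewrite -expnS /pow20 trunc_expnK // eqxx orbT.
Qed.

(** The open ball of radius [D] is thus the closed ball of radius [D %/ 2]. *)
Lemma pow20_ltE x y : pow20 x -> pow20 y -> 0 < y -> (x < y) = (x <= y %/ 2).
Proof.
move=> px py y0; apply/idP/idP => [/(pow20_lt px py) h|]; last by lia.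
by rewrite leq_divRL // mulnC.
Qed.

Lemma count_le (T : eqType) (p1 p2 : pred T) (l : seq T) :
  (forall y, y \in l -> p1 y -> p2 y) -> count p1 l <= count p2 l.
Proof.
elim: l => // y l IH s /=; apply: leq_add.
  by have := s y (mem_head _ _); case: (p1 y) => // ->.
by apply: IH => z zl; apply: s; rewrite in_cons zl orbT.
Qed.

Lemma count_lt (T : eqType) (p1 p2 : pred T) (l : seq T) x :
  (forall y, y \in l -> p1 y -> p2 y) -> x \in l -> ~~ p1 x -> p2 x ->
  count p1 l < count p2 l.
Proof.
elim: l => // y l IH s; rewrite in_cons => /orP[/eqP->|xl] n1 p2x /=.
  rewrite (negPf n1) p2x add0n add1n ltnS.
  by apply: count_le => z zl; apply: s; rewrite in_cons zl orbT.
have h1 : p1 y <= p2 y by have := s y (mem_head _ _); case: (p1 y) => // ->.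
rewrite -addnS; apply: leq_add => //; apply: IH => // z zl.
by apply: s; rewrite in_cons zl orbT.
Qed.

Section SumLemmas.
Implicit Types (l : seq nat) (g : nat -> int).

Lemma sum_unitv l p : uniq l ->
  (\sum_(i <- l) unitv p i = Posz (p.1 \in l) - Posz (p.2 \in l))%R.
Proof.
have e a : uniq l -> (\sum_(i <- l) Posz (i == a) = Posz (a \in l))%R.
  elim: l => [|x l IH] /=; first by rewrite big_nil.
  move=> /andP[xl ul]; rewrite big_cons IH // in_cons eq_sym.
  by case: eqP => [->|] //=; rewrite ?(negPf xl).
by move=> ul; rewrite /unitv sumrB !e.
Qed.

Lemma sum_wunitv l (h : nat -> nat) p : uniq l -> p.1 \in l ->
  (p.2 \in l) || (h p.2 == 0) ->
  (\sum_(i <- l) Posz (h i) * unitv p i = Posz (h p.1) - Posz (h p.2))%R.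
Proof.
have e a : uniq l -> (\sum_(i <- l) Posz (h i) * Posz (i == a) = Posz (h a) * Posz (a \in l))%R.
  elim: l => [|x l IH] /=; first by rewrite big_nil mulr0.
  move=> /andP[xl ul]; rewrite big_cons IH // in_cons eq_sym.
  by case: eqP => [->|] //=; rewrite ?(negPf xl) ?mulr0 ?addr0 ?add0r.
move=> ul h1 h2; rewrite /unitv; under eq_bigr do rewrite mulrBr.
rewrite sumrB !e // h1 mulr1; congr (_ - _)%R.
by case/orP: h2 => [->|/eqP->]; rewrite ?mulr1 ?mul0r.
Qed.

Lemma gsumE (g : dir) l : uniq l ->
  (gsum (gdir g) l = g.2.1 * (Posz (g.1.1.1 \in l) - Posz (g.1.1.2 \in l))
     + g.2.2 * (Posz (g.1.2.1 \in l) - Posz (g.1.2.2 \in l)))%R.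
Proof.
move=> ul; rewrite /gsum /gdir big_split /= -!mulr_sumr.
by rewrite !sum_unitv.
Qed.

End SumLemmas.

(** * The invariant of the rounding and its preservation *)

Section Rounding.
Variables (n r V W a b : nat) (C fac : seq nat) (A : nat -> seq nat).
Variables (dp d : nat -> nat -> nat) (f w : nat -> nat).
Hypotheses (r0 : 0 < r) (uC : uniq C) (ufac : uniq fac).
Hypotheses (Cn : forall j, j \in C -> j < n) (facn : forall i, i \in fac -> i < n).
Hypothesis Afac : forall j i, i \in A j -> i \in fac.
Hypothesis uA : forall j, uniq (A j).
Hypothesis wn : w n = 0.
Hypothesis fV : forall i, i \in fac -> f i <= V.
Hypothesis dp2 : forall i j, pow20 (dp i j).
Hypothesis ddp : forall i j, d i j <= dp i j.
Hypothesis dsym : forall i j, i < n -> j < n -> d i j = d j i.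
Hypothesis dtri : forall i j k, i < n -> j < n -> k < n -> d i k <= d i j + d j k.
Hypothesis dii : forall i, d i i = 0.
Hypothesis a0 : 0 < a.

Notation Fs := (Fs A dp).
Notation Bs := (Bs A dp).

Lemma uBs Dl j : uniq (Bs Dl j). Proof. exact/filter_uniq/uA. Qed.
Lemma Fsfac Dl j i : i \in Fs Dl j -> i \in fac.
Proof. by rewrite mem_filter => /andP[_]; apply: Afac. Qed.
Lemma Bsfac Dl j i : i \in Bs Dl j -> i \in fac.
Proof. by rewrite mem_filter => /andP[_]; apply: Afac. Qed.

(** A facility in the closed ball of [k] is then within [5 D_i] of [i]. The 3 makes the relation
    survive an expulsion: if [k] gives way to [j], then [2 D_j <= D_k] and [d(i,j) + 3 D_j <= d(i,k)
    + D_k + 4 D_j <= d(i,k) + 3 D_k]. The 5 admits a core client of no larger radius that meets [i],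
    since [D_i + D_k + 3 D_k <= 5 D_i]. *)
Definition rel (Dl : seq nat) (i k : nat) : bool :=
  d i k + 3 * nth 0 Dl k <= 5 * nth 0 Dl i.

Definition disj (Dl : seq nat) (j k : nat) : Prop := forall i, i \in Fs Dl j -> i \in Fs Dl k -> False.

Lemma meetP Dl j k : reflect (exists2 i, i \in Fs Dl j & i \in Fs Dl k) (meet A dp Dl j k).
Proof. exact: hasP. Qed.

(** Scaled by [Z], the fractional distance of [j] to its open ball, where the mass missing there up
    to [r] is charged at the radius. *)
Definition Tj (Z : nat) (Y Dl : seq nat) (j : nat) : int :=
  (Posz (r * nth 0%N Dl j * Z) -
   \sum_(i <- A j) Posz ((nth 0%N Dl j - dp i j) * nth 0%N Y i))%R.

Definition Phi (Z : nat) (Y Dl : seq nat) : int :=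
  (\sum_(i <- fac) Posz (f i * nth 0%N Y i) + \sum_(j <- C) Tj Z Y Dl j)%R.

Definition core_ok (Z : nat) (Y Dl core : seq nat) : Prop :=
  [/\ uniq core, forall k, k \in core -> k \in C /\ r * Z <= ysum Y (Fs Dl k)
    & forall k l, k \in core -> l \in core -> k != l -> disj Dl k l].

(** What remains of the restriction on the pairs of a client and a facility. A radius starts as a
    rounded distance, at most twice the true one, hence the two factors 2; a smaller radius only
    helps. *)
Definition Dok (Dl : seq nat) : Prop := forall j, j \in C ->
  pow20 (nth 0 Dl j) /\ \sum_(k <- C) (nth 0 Dl j - 2 * d j k) <= 2 * V.

(** The quotient [b / a] bounds the potential. The weight is kept strictly below [W + 1] rather than
    below [W], which is as good for an integral solution. *)
Definition RI (st : rstate) : Prop :=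
  let: ((Z, Y), (Dl, core)) := st in
  [/\ 0 < Z, forall i, i \in fac -> nth 0 Y i <= Z, core_ok Z Y Dl core,
      forall j, j \in C -> ysum Y (Bs Dl j) <= r * Z
    & forall j, j \in C -> exists2 k, k \in core & rel Dl j k] /\
  [/\ (Posz a * Phi Z Y Dl <= Posz (b * Z))%R,
      \sum_(i <- fac) w i * nth 0 Y i < W.+1 * Z & Dok Dl].

Lemma meet_dist Dl j k : j \in C -> k \in C -> meet A dp Dl j k ->
  d j k <= nth 0 Dl j + nth 0 Dl k.
Proof.
move=> jC kC /meetP[i hj hk].
have ifc := facn (Fsfac hj); have jn := Cn jC; have kn := Cn kC.
move: hj hk; rewrite !mem_filter => /andP[h1 _] /andP[h2 _].
apply: leq_trans (dtri jn ifc kn) _; rewrite (dsym jn ifc).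
by apply: leq_add; [apply: leq_trans (ddp i j) h1 | apply: leq_trans (ddp i k) h2].
Qed.

(** Stated for a part [P] of the clients, so that it covers both the update of a complete core and
    the client by client construction of the first one. *)
Lemma upd_ok (P : pred nat) Z Y Dl core j :
  j \in C -> Dok Dl -> {subset P <= C} ->
  core_ok Z Y Dl [seq k <- core | k != j] ->
  r * Z <= ysum Y (Fs Dl j) ->
  (j \in core -> forall k, k \in core -> k != j -> disj Dl j k) ->
  (forall i, P i -> i != j -> (exists2 k, (k \in core) && (k != j) & rel Dl i k) \/
     (j \in core /\ rel Dl i j)) ->
  let core' := upd A dp Dl core j in
  core_ok Z Y Dl core' /\ (forall i, P i || (i == j) -> exists2 k, k \in core' & rel Dl i k).
Proof.
move=> jC hD PC [u1 c1 c2] hj jdisj hP /=; rewrite /upd.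
set core1 := [seq k <- core | k != j] in u1 c1 c2 *.
case: ifP => [/hasP[k0 k0c /andP[Dk mk]]|nh].
  have jnc : j \notin core.
    apply/negP => jc; move: (k0c); rewrite mem_filter => /andP[kj kc].
    by have /meetP[i h1 h2] := mk; apply: (jdisj jc k0 kc kj i).
  split=> // i; case: (eqVneq i j) => [-> _|ij].
    exists k0 => //; rewrite /rel; have [k0C _] := c1 _ k0c.
    by have := meet_dist jC k0C mk; lia.
  rewrite orbF => Pi; case: (hP i Pi ij) => [[k kc kr]|[]]; last by rewrite (negPf jnc).
  by exists k => //; rewrite mem_filter andbC.
have sub k : k \in [seq k <- core1 | ~~ meet A dp Dl j k] -> k \in core1.
  by rewrite mem_filter => /andP[].
have jn1 : j \notin core1 by rewrite mem_filter eqxx.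
split.
  split.
  - rewrite /= filter_uniq // andbT; apply/negP => /sub; exact/negP.
  - move=> k; rewrite in_cons => /orP[/eqP->|/sub /c1] //.
  - have jd k : k \in [seq k <- core1 | ~~ meet A dp Dl j k] -> disj Dl j k.
      rewrite mem_filter => /andP[/meetP nm _] i h1 h2; apply: nm; by exists i.
    move=> k l; rewrite !in_cons => /orP[/eqP->|kc] /orP[/eqP->|lc] kl.
    + by rewrite eqxx in kl.
    + exact: jd.
    + by move=> i h1 h2; apply: (jd _ kc i).
    + by apply: c2 => //; apply: sub.
have relj i : i \in C -> (exists2 k, (k \in core) && (k != j) & rel Dl i k) ->
    exists2 k, k \in j :: [seq k <- core1 | ~~ meet A dp Dl j k] & rel Dl i k.
  move=> iC [k /andP[kc kj] kr].
  have k1 : k \in core1 by rewrite mem_filter kj.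
  case mk: (meet A dp Dl j k); last first.
    by exists k => //; rewrite in_cons mem_filter mk k1 orbT.
  exists j; first exact: mem_head.
  have nDk : nth 0 Dl j < nth 0 Dl k.
    rewrite ltnNge; apply/negP => h; move/negP: nh; apply; apply/hasP; exists k => //.
    by rewrite h mk.
  have [kC _] := c1 _ k1.
  have h2 := pow20_lt (hD j jC).1 (hD k kC).1 nDk.
  have h3 := meet_dist jC kC mk; rewrite (dsym (Cn jC) (Cn kC)) in h3.
  have h4 := dtri (Cn iC) (Cn kC) (Cn jC).
  by move: kr; rewrite /rel; lia.
move=> i; case: (eqVneq i j) => [-> _|ij].
  by exists j; rewrite ?mem_head // /rel dii; lia.
rewrite orbF => Pi; case: (hP i Pi ij) => [h|[jc kr]].
  by apply: relj => //; apply: PC.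
by exists j => //; apply: mem_head.
Qed.

Lemma mem_Fs_half (Dl Dl' : seq nat) j : j \in C -> Dok Dl -> 0 < nth 0 Dl j ->
  nth 0 Dl' j = nth 0 Dl j %/ 2 -> Fs Dl' j = Bs Dl j.
Proof.
move=> jC hD D0 e; apply: eq_filter => i; rewrite e.
by rewrite (pow20_ltE (dp2 i j) (hD j jC).1 D0).
Qed.

Lemma ysum_sub Y l1 l2 : uniq l1 -> {subset l1 <= l2} -> ysum Y l1 <= ysum Y l2.
Proof.
move=> u s; rewrite /ysum.
have h : forall l l' : seq nat, uniq l -> {subset l <= l'} ->
    \sum_(i <- l) nth 0 Y i <= \sum_(i <- l') nth 0 Y i.
  elim=> [|x l IH] l'; first by rewrite big_nil.
  move=> /= /andP[xl ul] sl; rewrite big_cons.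
  have xl' : x \in l' by apply: sl; apply: mem_head.
  rewrite (perm_big _ (perm_to_rem xl')) big_cons leq_add2l; apply: IH => // y yl.
  have yl' : y \in l' by apply: sl; rewrite in_cons yl orbT.
  have yx : y != x by apply: contraNneq xl => <-.
  by have := perm_mem (perm_to_rem xl') y; rewrite yl' in_cons (negPf yx) => /esym.
exact: h.
Qed.

Lemma shrink_RI st j : RI st -> j \in full r C A dp st -> RI (shrink n A dp st j).
Proof.
case: st => [[Z Y] [Dl core]] [[Z0 YZ [cu c1 c2] hB h5] [hPhi hW hD]].
rewrite mem_filter /= => /andP[hf jC].
have BE : ysum Y (Bs Dl j) = r * Z by apply/eqP; rewrite eqn_leq hf hB.
have D0 : 0 < nth 0 Dl j.
  rewrite lt0n; apply/eqP => e; move: BE.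
  have -> : Bs Dl j = [::] by rewrite /Bs e; elim: (A j) => //=.
  by rewrite /ysum big_nil; nia.
rewrite /shrink /=; set Dl' := mkseq _ n.
have e1 : nth 0 Dl' j = nth 0 Dl j %/ 2 by rewrite nth_mkseq ?eqxx ?Cn.
have e2 k : k \in C -> k != j -> nth 0 Dl' k = nth 0 Dl k.
  by move=> kC /negPf kj; rewrite nth_mkseq ?kj ?Cn.
have FE k : k \in C -> k != j -> Fs Dl' k = Fs Dl k.
  by move=> kC kj; apply: eq_filter => i; rewrite e2.
have BsE k : k \in C -> k != j -> Bs Dl' k = Bs Dl k.
  by move=> kC kj; apply: eq_filter => i; rewrite e2.
have Fj : Fs Dl' j = Bs Dl j by exact: mem_Fs_half.
have Dle : nth 0 Dl' j <= nth 0 Dl j by rewrite e1; lia.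
have hD' : Dok Dl'.
  move=> k kC; case: (eqVneq k j) => [->|kj]; last by rewrite e2 //; apply: hD.
  split; first by rewrite e1 pow20_half // (hD j jC).1.
  apply: leq_trans (hD j jC).2; apply: leq_sum => i _; lia.
have FF k i : k \in C -> i \in Fs Dl' k -> i \in Fs Dl k.
  move=> kC; case: (eqVneq k j) => [->|kj]; last by rewrite FE.
  rewrite Fj !mem_filter => /andP[h ->]; rewrite andbT; exact: ltnW.
have [ok5 h5'] : core_ok Z Y Dl' (upd A dp Dl' core j) /\ (forall i, (i \in C) || (i == j) ->
    exists2 k, k \in upd A dp Dl' core j & rel Dl' i k).
  apply: (@upd_ok (mem C)) => //.
  - split; first exact: filter_uniq.
      move=> k; rewrite mem_filter => /andP[kj kc]; have [kC h] := c1 k kc.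
      by split=> //; rewrite FE.
    move=> k l; rewrite !mem_filter => /andP[kj kc] /andP[lj lc] kl i h1 h2.
    by apply: (c2 k l kc lc kl i); apply: FF => //; [apply: (c1 k kc).1 | apply: (c1 l lc).1].
  - by rewrite Fj BE.
  - move=> jc k kc kj i h1 h2; rewrite eq_sym in kj.
    by apply: (c2 j k jc kc kj i); apply: FF => //; apply: (c1 k kc).1.
  - move=> i iC ij; have [k kc kr] := h5 i iC.
    case: (eqVneq k j) => [kj|kj].
      by right; rewrite -kj; split=> //; move: kr; rewrite /rel (e2 i) // kj; lia.
    by left; exists k; rewrite ?kc // /rel (e2 i) // (e2 k) // (c1 k kc).1.
split; split=> //.
- move=> k kC; case: (eqVneq k j) => [->|kj]; last by rewrite BsE // hB.
  rewrite -BE -Fj; apply: ysum_sub; first exact: uBs.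
  by move=> i; rewrite !mem_filter => /andP[/ltnW -> ->].
- by move=> k kC; apply: h5'; rewrite kC.
(* Halving lowers [r D_j] by [r (D - D %/ 2)]. The subtracted sum falls by the same amount, as the
   open ball has mass exactly [r] and all its members are within [D %/ 2]. *)
- rewrite (_ : Phi Z Y Dl' = Phi Z Y Dl) //; rewrite /Phi; congr (_ + _)%R.
  apply: eq_big_seq => k kC; case: (eqVneq k j) => [->|kj]; last by rewrite /Tj e2.
  rewrite /Tj e1; set D := nth 0 Dl j.
  have pD : pow20 D := (hD j jC).1.
  have s : (\sum_(i <- A j) Posz ((D - dp i j) * nth 0%N Y i) =
      \sum_(i <- A j) Posz ((D %/ 2 - dp i j) * nth 0%N Y i) +
      Posz ((D - D %/ 2) * (r * Z)))%R.
    rewrite -BE /ysum /Bs big_filter big_distrr /=.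
    elim: (A j) => [|i l IH]; first by rewrite !big_nil.
    rewrite !big_cons IH; have := pow20_ltE (dp2 i j) pD D0; rewrite -/D => E.
    case: ifP => h; rewrite h in E; last by move/esym/negbT: E; rewrite -ltnNge; lia.
    have -> : (D - dp i j) * nth 0 Y i =
        (D %/ 2 - dp i j) * nth 0 Y i + (D - D %/ 2) * nth 0 Y i.
      by rewrite -mulnDl; congr (_ * _); move/esym: E; lia.
    by rewrite !PoszD; ring.
  rewrite s; lia.
Qed.

Section Move.
Variables (Z : nat) (Y Dl core : seq nat) (g : dir).
Let st : rstate := ((Z, Y), (Dl, core)).
Let G := gdir g.
Hypothesis inv : RI st.
Hypothesis nofull : full r C A dp st = [::].
Hypothesis g1 : forall i, i \in fac -> G i != 0%R -> i \in frac fac Z Y.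
Hypothesis g2 : (\sum_(i <- fac) Posz (w i) * G i = 0)%R.
Hypothesis g3 : forall k, k \in tight r A dp Z Y Dl core -> gsum G (Fs Dl k) = 0%R.
Hypothesis g4 : exists2 i, i \in frac fac Z Y & G i != 0%R.
Hypothesis g5 : (rate C fac A dp f Dl G <= 0)%R.

Let cs := slacks r C fac A dp st G.
Let c := best cs.

Lemma bestP : c \in cs /\ (0 < c.2)%R /\
  forall c', c' \in cs -> (Posz c.1 * c'.2 <= Posz c'.1 * c.2)%R.
Proof.
pose cp := [seq c <- cs | (0 < c.2)%R].
(* A coordinate that changes approaches 0 or 1, so that some speed is positive and the default of
   [head] is never taken. *)
have cp0 : exists c0, c0 \in cp.
  case: g4 => i ifr Gi; case: (ltP 0%R (G i)) => Gp.
    exists (Z - nth 0 Y i, G i); rewrite mem_filter /= Gp mem_cat; apply/orP; left.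
    by apply/mapP; exists i.
  exists (nth 0 Y i, (- G i)%R); rewrite mem_filter /= oppr_gt0 lt_neqAle Gi Gp.
  by rewrite !mem_cat; apply/orP; right; apply/orP; left; apply/mapP; exists i.
have ex : exists2 c0, c0 \in cp & forall c', c' \in cp ->
    (Posz c0.1 * c'.2 <= Posz c'.1 * c0.2)%R.
  have pos x : x \in cp -> (0 < x.2)%R by rewrite mem_filter => /andP[].
  elim: cp cp0 pos => [[? //]|x l IH _ pos].
  case: l IH pos => [|y l] IH pos.
    by exists x; rewrite ?mem_head // => c'; rewrite mem_seq1 => /eqP ->.
  have [|z zl hz] := IH (ex_intro _ y (mem_head _ _)).
    by move=> z zl; apply: pos; rewrite in_cons zl orbT.
  have px := pos x (mem_head _ _).
  have pz : (0 < z.2)%R by apply: pos; rewrite in_cons zl orbT.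
  case: (leP (Posz x.1 * z.2)%R (Posz z.1 * x.2)%R) => h.
    exists x; first exact: mem_head.
    move=> c'; rewrite in_cons => /orP[/eqP->|cl] //.
    have pc : (0 < c'.2)%R by apply: pos; rewrite in_cons cl orbT.
    have := hz c' cl => h2; rewrite -(ler_pM2r pz).
    apply: (@le_trans _ _ (Posz z.1 * x.2 * c'.2)%R).
      by rewrite mulrAC ler_pM2r.
    by rewrite mulrAC [X in (_ <= X)%R]mulrAC ler_pM2r.
  exists z; first by rewrite in_cons zl orbT.
  by move=> c'; rewrite in_cons => /orP[/eqP->|/hz] //; apply: ltW.
have [c0 c0cp hc0] := ex.
have cin : c \in [seq c <- cp | all (fun c' => (Posz c.1 * c'.2 <= Posz c'.1 * c.2)%R) cp].
  rewrite /c /best -/cp; case E: [seq _ <- cp | _] => [|x l]; last exact: mem_head.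
  suff: c0 \in [::] by [].
  by rewrite -E mem_filter c0cp andbT; apply/allP.
move: cin; rewrite mem_filter => /andP[/allP hall]; rewrite mem_filter => /andP[cp' ccs].
split=> //; split=> // c' c'cs; case: (ltP 0%R c'.2) => h.
  by apply: hall; rewrite mem_filter h.
apply: (@le_trans _ _ 0%R); first by rewrite mulr_ge0_le0.
by rewrite mulr_ge0 // ltW.
Qed.

Let q := `|c.2|%N.
Let p := c.1.
Let qE : Posz q = c.2.
Proof. by rewrite /q abszE gtr0_norm //; case: bestP => _ []. Qed.
Let q0 : 0 < q. Proof. by rewrite -ltz_nat qE; case: bestP => _ []. Qed.

Let Y' := (move n r C fac A dp st g).1.2.

Lemma slackP c' : c' \in cs -> (0 <= Posz q * Posz c'.1 - Posz p * c'.2)%R.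
Proof.
by case: bestP => _ [_ h] /h; rewrite -qE subr_ge0 [(Posz q * _)%R]mulrC.
Qed.

Lemma nthY' i : i \in fac ->
  Posz (nth 0 Y' i) = (Posz q * Posz (nth 0%N Y i) + Posz p * G i)%R.
Proof.
move=> ifc; rewrite /Y' /move /= nth_mkseq ?facn // -/G -/cs -/c -qE abszE ger0_norm //.
case: (eqVneq (G i) 0%R) => [->|Gi]; first by rewrite mulr0 addr0 mulr_ge0.
have ifr := g1 ifc Gi.
have : (nth 0 Y i, (- G i)%R) \in cs.
  by rewrite !mem_cat; apply/orP; right; apply/orP; left; apply/mapP; exists i.
by move=> /slackP /=; rewrite mulrN opprK.
Qed.

Lemma sumY' (h : nat -> nat) l : {subset l <= fac} ->
  (\sum_(i <- l) Posz (h i * nth 0%N Y' i) =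
   Posz q * \sum_(i <- l) Posz (h i * nth 0%N Y i)
   + Posz p * \sum_(i <- l) Posz (h i) * G i)%R.
Proof.
move=> sl; rewrite !mulr_sumr -big_split /=; apply: eq_big_seq => i /sl ifc.
by rewrite PoszM nthY' // PoszM; ring.
Qed.

Lemma ysumY' l : {subset l <= fac} ->
  Posz (ysum Y' l) = (Posz q * Posz (ysum Y l) + Posz p * gsum G l)%R.
Proof.
move=> sl; have := sumY' (fun _ => 1) sl.
have e (y : seq nat) : (\sum_(i <- l) Posz (1 * nth 0%N y i) = Posz (ysum y l))%R.
  rewrite /ysum; elim: (l) => [|x s IH]; first by rewrite !big_nil.
  by rewrite !big_cons IH mul1n PoszD.
by rewrite !e /gsum => ->; congr (_ + _ * _)%R; apply: eq_bigr => i _; rewrite mul1r.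
Qed.

Lemma move_RI : RI (move n r C fac A dp st g).
Proof.
have [[Z0 YZ [cu c1 c2] hB h5] [hPhi hW hD]] := inv.
have mE : move n r C fac A dp st g = ((q * Z, Y'), (Dl, core)) by [].
have sF k : {subset Fs Dl k <= fac} by move=> i; apply: Fsfac.
have sB k : {subset Bs Dl k <= fac} by move=> i; apply: Bsfac.
rewrite mE; split; split=> //.
- by rewrite muln_gt0 q0.
- move=> i ifc; rewrite -lez_nat nthY' // PoszM.
  case: (eqVneq (G i) 0%R) => [->|Gi].
    by rewrite mulr0 addr0 -PoszM lez_nat leq_mul2l YZ ?orbT.
  have ifr := g1 ifc Gi.
  have : (Z - nth 0 Y i, G i) \in cs.
    by rewrite mem_cat; apply/orP; left; apply/mapP; exists i.
  move=> /slackP /=; have := YZ i ifc => h; rewrite -subzn // mulrBr; lia.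
- split=> // k kc; have [kC h] := c1 k kc; split=> //.
  rewrite -lez_nat ysumY' //.
  have : (ysum Y (Fs Dl k) - r * Z, (- gsum G (Fs Dl k))%R) \in cs.
    rewrite !mem_cat; do 2 (apply/orP; right); apply/orP; left; apply/mapP; by exists k.
  move=> /slackP /=; rewrite -subzn // mulrBr mulrN opprK !PoszM; lia.
- move=> j jC; have h := hB j jC; rewrite -lez_nat ysumY' //.
  have : (r * Z - ysum Y (Bs Dl j), gsum G (Bs Dl j)) \in cs.
    rewrite !mem_cat; do 3 (apply/orP; right); apply/mapP; by exists j.
  move=> /slackP /=; rewrite -subzn // mulrBr !PoszM; lia.
- suff e : Phi (q * Z) Y' Dl = (Posz q * Phi Z Y Dl + Posz p * rate C fac A dp f Dl G)%R.
    rewrite e; apply: (@le_trans _ _ (Posz q * (Posz a * Phi Z Y Dl))%R).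
      rewrite [X in (_ <= X)%R]mulrCA ler_pM2l ?ltz_nat // gerDl.
      by rewrite mulr_ge0_le0.
    have := ler_wpM2l (isT : (0 <= Posz q)%R) hPhi; rewrite -PoszM.
    by rewrite (_ : q * (b * Z) = b * (q * Z)) //; lia.
  rewrite /Phi sumY' // /rate /Tj.
  have -> : (\sum_(j <- C) (Posz (r * nth 0%N Dl j * (q * Z)) -
      \sum_(i <- A j) Posz ((nth 0%N Dl j - dp i j) * nth 0%N Y' i)) =
      Posz q * (\sum_(j <- C) (Posz (r * nth 0%N Dl j * Z) -
        \sum_(i <- A j) Posz ((nth 0%N Dl j - dp i j) * nth 0%N Y i))) -
      Posz p * (\sum_(j <- C) \sum_(i <- A j) Posz (nth 0%N Dl j - dp i j) * G i))%R.
    rewrite !mulr_sumr -sumrB; apply: eq_bigr => j _.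
    rewrite (sumY' (fun i => nth 0 Dl j - dp i j)); last by move=> i; apply: Afac.
    rewrite !PoszM; ring.
  ring.
- rewrite -ltz_nat.
  have e (y : seq nat) : (Posz (\sum_(i <- fac) w i * nth 0 y i) =
      \sum_(i <- fac) Posz (w i * nth 0%N y i))%R.
    elim: (fac) => [|x s IH]; first by rewrite !big_nil.
    by rewrite !big_cons PoszD IH.
  rewrite e sumY' // g2 mulr0 addr0 -e -PoszM ltz_nat.
  by rewrite (_ : W.+1 * (q * Z) = q * (W.+1 * Z)) ?ltn_pmul2l //; lia.
Qed.

(** Counts constraints that are not tight. A move makes one of them tight and loses none of the
    tight ones, which its direction respects. *)
Definition mu (Z : nat) (Y Dl core : seq nat) : nat :=
  size (frac fac Z Y) + count (fun k => ysum Y (Fs Dl k) != r * Z) core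
  + count (fun j => ysum Y (Bs Dl j) < r * Z) C.

Lemma move_mu : mu (q * Z) Y' Dl core < mu Z Y Dl core.
Proof.
have [[Z0 YZ [cu c1 c2] hB h5] [hPhi hW hD]] := inv.
have sF k : {subset Fs Dl k <= fac} by move=> i; apply: Fsfac.
have sB k : {subset Bs Dl k <= fac} by move=> i; apply: Bsfac.
have zz i : i \in fac -> G i = 0%R -> nth 0 Y' i = q * nth 0 Y i.
  by move=> ifc Gi; have := nthY' ifc; rewrite Gi mulr0 addr0 -PoszM => -[].
have f1 i : i \in fac -> (0 < nth 0 Y' i) && (nth 0 Y' i < q * Z) ->
    (0 < nth 0 Y i) && (nth 0 Y i < Z).
  move=> ifc; case: (eqVneq (G i) 0%R) => [/(zz i ifc) ->|Gi].
    by rewrite muln_gt0 q0 ltn_pmul2l.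
  by have := g1 ifc Gi; rewrite mem_filter => /andP[].
have f2 k : k \in core -> ysum Y' (Fs Dl k) != r * (q * Z) -> ysum Y (Fs Dl k) != r * Z.
  move=> kc; apply: contraNneq => e.
  have kt : k \in tight r A dp Z Y Dl core by rewrite mem_filter e eqxx.
  rewrite -eqz_nat ysumY' // g3 // mulr0 addr0 e -PoszM; apply/eqP; congr Posz; lia.
(* A move is made only if no client is full, so that the third count is maximal beforehand. *)
have nf j : j \in C -> ysum Y (Bs Dl j) < r * Z.
  move=> jC; rewrite ltnNge; apply/negP => h.
  by have : j \in full r C A dp st; [rewrite mem_filter h | rewrite nofull].
have w1 : size (frac fac (q * Z) Y') <= size (frac fac Z Y).
  by rewrite !size_filter; apply: count_le.
have w2 : count (fun k => ysum Y' (Fs Dl k) != r * (q * Z)) core <=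
   count (fun k => ysum Y (Fs Dl k) != r * Z) core by apply: count_le.
have w3 : count (fun j => ysum Y' (Bs Dl j) < r * (q * Z)) C <=
   count (fun j => ysum Y (Bs Dl j) < r * Z) C by apply: count_le => j jC _; apply: nf.
have [ccs [cpos _]] := bestP.
have cE : c = (p, Posz q) by rewrite qE /p; case: (c).
rewrite cE in ccs; rewrite /mu.
move: ccs; rewrite !mem_cat => /or4P[] /mapP[x xl [px gx]].
- suff: size (frac fac (q * Z) Y') < size (frac fac Z Y) by lia.
  move: xl; rewrite mem_filter => /andP[xfr xf].
  rewrite !size_filter; apply: (@count_lt _ _ _ _ x) => //.
  have := nthY' xf; rewrite -gx px -PoszM.
  have YZx := YZ x xf; rewrite negb_and -!leqNgt => e; apply/orP; right.
  by move: e; rewrite -PoszM -PoszD => -[->]; nia.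
- suff: size (frac fac (q * Z) Y') < size (frac fac Z Y) by lia.
  move: xl; rewrite mem_filter => /andP[xfr xf].
  rewrite !size_filter; apply: (@count_lt _ _ _ _ x) => //.
  have := nthY' xf; have -> : G x = (- Posz q)%R by rewrite gx opprK.
  rewrite px mulrN [X in (_ - X)%R]mulrC subrr => -[->] //.
- suff: count (fun k => ysum Y' (Fs Dl k) != r * (q * Z)) core <
    count (fun k => ysum Y (Fs Dl k) != r * Z) core by lia.
  have [xC hx] := c1 x xl.
  have nt : ysum Y (Fs Dl x) != r * Z.
    apply/eqP => e; have := g3 (k := x); rewrite mem_filter e eqxx xl => /(_ isT) z.
    by move: gx; rewrite z oppr0; lia.
  apply: (@count_lt _ _ _ _ x) => //; rewrite negbK -eqz_nat ysumY' //.
  have -> : gsum G (Fs Dl x) = (- Posz q)%R by rewrite gx opprK.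
  by apply/eqP; rewrite px -subzn // !PoszM; ring.
- suff: count (fun j => ysum Y' (Bs Dl j) < r * (q * Z)) C <
    count (fun j => ysum Y (Bs Dl j) < r * Z) C by lia.
  have hx := hB x xl.
  apply: (@count_lt _ _ _ _ x) => //; [by move=> y yC _; apply: nf | | exact: nf].
  rewrite -leqNgt -lez_nat ysumY' // -gx px -subzn // !PoszM.
  rewrite le_eqVlt; apply/orP; left; apply/eqP; ring.
Qed.

End Move.
End Rounding.

End Rounding.
Import Rounding.

(** * Directions, termination and the final state *)

Section Rounding2.
Variables (n r V W a b : nat) (C fac : seq nat) (A : nat -> seq nat).
Variables (dp d : nat -> nat -> nat) (f w : nat -> nat).
Hypotheses (r0 : 0 < r) (uC : uniq C) (ufac : uniq fac).
Hypotheses (Cn : forall j, j \in C -> j < n) (facn : forall i, i \in fac -> i < n).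
Hypothesis Afac : forall j i, i \in A j -> i \in fac.
Hypothesis uA : forall j, uniq (A j).
Hypothesis wn : w n = 0.
Hypothesis fV : forall i, i \in fac -> f i <= V.
Hypothesis dp2 : forall i j, pow20 (dp i j).
Hypothesis ddp : forall i j, d i j <= dp i j.
Hypothesis dsym : forall i j, i < n -> j < n -> d i j = d j i.
Hypothesis dtri : forall i j k, i < n -> j < n -> k < n -> d i k <= d i j + d j k.
Hypothesis dii : forall i, d i i = 0.
Hypothesis a0 : 0 < a.

Notation Fs := (Fs A dp).
Notation Bs := (Bs A dp).
Notation RI := (RI r V W a b C fac A dp d f w).
Notation rstep := (rstep n r C fac A dp f w).
Notation Phi := (Phi r C fac A dp f).
Notation Tj := (Tj r A dp).

Let nfac : n \notin fac. Proof. by apply/negP => /facn; rewrite ltnn. Qed.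

Section Cand.
Variables (Z : nat) (Y Dl core : seq nat).
Let st : rstate := ((Z, Y), (Dl, core)).
Let fr := frac fac Z Y.
Let tg := tight r A dp Z Y Dl core.

Lemma movesP x y : ((x, y) \in moves n r fac A dp st) =
  [&& x \in fr, (y == n) || (y \in fr), x != y
    & all (fun k => (x \in Fs Dl k) == (y \in Fs Dl k)) tg].
Proof.
apply/flatten_mapP/idP => [[x' x'f /mapP[y' hy' [-> ->]]]|/and4P[xf yf xy hall]].
  by move: hy'; rewrite mem_filter in_cons => /andP[/andP[-> ->] ->]; rewrite x'f.
exists x => //; apply/mapP; exists y => //.
by rewrite mem_filter in_cons xy hall.
Qed.

Lemma frfac i : i \in fr -> i \in fac. Proof. by rewrite mem_filter => /andP[]. Qed.

Lemma unit_supp x y i : (x, y) \in moves n r fac A dp st -> i \in fac ->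
  unitv (x, y) i != 0%R -> i \in fr.
Proof.
rewrite movesP => /and4P[xf yf _ _] ifc; rewrite /unitv /=.
case: (eqVneq i x) => [->|ix] //; case: (eqVneq i y) => [e|iy] // _.
case/orP: yf => [/eqP yn|yf]; last by rewrite e.
by move: ifc; rewrite e yn (negPf nfac).
Qed.

Lemma unit_w x y : (x, y) \in moves n r fac A dp st ->
  (\sum_(i <- fac) Posz (w i) * unitv (x, y) i = wt w (x, y))%R.
Proof.
rewrite movesP => /and4P[xf yf _ _]; apply: sum_wunitv => //=; first exact: frfac.
by case/orP: yf => [/eqP->|/frfac ->] //; rewrite wn orbT.
Qed.

Lemma unit_F x y k : (x, y) \in moves n r fac A dp st -> k \in tg ->
  (Posz (x \in Fs Dl k) - Posz (y \in Fs Dl k) = 0)%R.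
Proof. by rewrite movesP => /and4P[_ _ _ /allP h] /h /eqP ->; rewrite subrr. Qed.

Lemma cand_ok g : g \in cand w (moves n r fac A dp st) ->
  [/\ forall i, i \in fac -> gdir g i != 0%R -> i \in fr,
      (\sum_(i <- fac) Posz (w i) * gdir g i = 0)%R,
      forall k, k \in tg -> gsum (gdir g) (Fs Dl k) = 0%R
    & exists2 i, i \in fr & gdir g i != 0%R].
Proof.
have main (u v : nat * nat) (s t : int) : u \in moves n r fac A dp st ->
    v \in moves n r fac A dp st -> (s * wt w u + t * wt w v = 0)%R ->
    (exists2 i, i \in fr & gdir ((u, v), (s, t)) i != 0%R) ->
    [/\ forall i, i \in fac -> gdir ((u, v), (s, t)) i != 0%R -> i \in fr,
      (\sum_(i <- fac) Posz (w i) * gdir ((u, v), (s, t)) i = 0)%R,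
      forall k, k \in tg -> gsum (gdir ((u, v), (s, t))) (Fs Dl k) = 0%R
    & exists2 i, i \in fr & gdir ((u, v), (s, t)) i != 0%R].
  case: u => x y; case: v => x' y' um vm h0 hex; split=> //.
  - move=> i ifc; apply: contraNT => ifr; rewrite /gdir /=.
    have := contra (unit_supp um ifc) ifr; have := contra (unit_supp vm ifc) ifr.
    by rewrite !negbK => /eqP -> /eqP ->; rewrite !mulr0 addr0.
  - transitivity (s * wt w (x, y) + t * wt w (x', y'))%R; last exact: h0.
    rewrite -(unit_w um) -(unit_w vm) !mulr_sumr -big_split /=.
    by apply: eq_bigr => i _; rewrite /gdir /=; ring.
  - move=> k kt; rewrite gsumE /=; last exact/filter_uniq/uA.
    by rewrite (unit_F um kt) (unit_F vm kt) !mulr0 addr0.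
rewrite mem_cat => /orP[/mapP[[x y]]|/flatten_mapP[[x y] um]].
  rewrite mem_filter => /andP[/eqP w0 um] ->; apply: main => //.
    by rewrite w0 mulr0 mul0r addr0.
  move: (um); rewrite movesP => /and4P[xf _ xy _]; exists x => //.
  by rewrite /gdir /unitv /= eqxx (negPf xy) mul0r addr0 mul1r.
move=> /mapP[[x' y']]; rewrite mem_filter /= => /andP[/and3P[wu h1 h2] vm] ->.
apply: main => //; first by ring.
move: (vm); rewrite movesP => /and4P[xf _ xy _]; exists x' => //.
rewrite /gdir /unitv /= eqxx (negPf xy) (negPf h1) (negPf h2) subr0 mulr0 add0r mulr1.
by rewrite oppr_eq0.
Qed.

Lemma orient_ok g : g \in cand w (moves n r fac A dp st) ->
  let G := gdir (orient C fac A dp f Dl g) in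
  [/\ forall i, i \in fac -> G i != 0%R -> i \in fr,
      (\sum_(i <- fac) Posz (w i) * G i = 0)%R,
      forall k, k \in tg -> gsum G (Fs Dl k) = 0%R,
      exists2 i, i \in fr & G i != 0%R
    & (rate C fac A dp f Dl G <= 0)%R].
Proof.
move=> /cand_ok[h1 h2 h3 h4] /=; rewrite /orient; case: ifP => hr //.
have e i : gdir (g.1, ((- g.2.1)%R, (- g.2.2)%R)) i = (- gdir g i)%R.
  by rewrite /gdir /=; ring.
split.
- by move=> i ifc; rewrite e oppr_eq0; apply: h1.
- by under eq_bigr do rewrite e mulrN; rewrite sumrN h2 oppr0.
- by move=> k kt; rewrite /gsum; under eq_bigr do rewrite e; rewrite sumrN -/(gsum _ _) h3 ?oppr0.
- by case: h4 => i ifr gi; exists i; rewrite ?e ?oppr_eq0.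
- have -> : rate C fac A dp f Dl (gdir (g.1, ((- g.2.1)%R, (- g.2.2)%R))) =
      (- rate C fac A dp f Dl (gdir g))%R.
    rewrite /rate opprB addrC; congr (_ + _)%R.
      rewrite -sumrN; apply: eq_bigr => j _; rewrite -sumrN; apply: eq_bigr => i _.
      by rewrite e mulrN opprK.
    by rewrite -sumrN; apply: eq_bigr => i _; rewrite e mulrN.
  by rewrite oppr_le0 ltW // ltNge hr.
Qed.

End Cand.

Definition stuck (st : rstate) : Prop :=
  full r C A dp st = [::] /\ cand w (moves n r fac A dp st) = [::].

(** The number of halvings that lead to radius 0, including the one from 1 to 0. *)
Definition lgD (D : nat) : nat := if D == 0 then 0 else (trunc_log 2 D).+1.

(** Halving a radius may increase [mu], but never beyond [3 * n]; the weight [3 * n + 1] absorbs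
    this. *)
Definition Psi (st : rstate) : nat :=
  (\sum_(j <- C) lgD (nth 0 st.2.1 j)) * (3 * n + 1)
  + mu r C fac A dp st.1.1 st.1.2 st.2.1 st.2.2.

Lemma uniq_size (l : seq nat) : uniq l -> (forall i, i \in l -> i < n) -> size l <= n.
Proof.
move=> ul h; rewrite -[n in _ <= n](size_iota 0); apply: uniq_leq_size => // i /h.
by rewrite mem_iota add0n.
Qed.

Lemma mu_le Z Y Dl core : RI ((Z, Y), (Dl, core)) ->
  mu r C fac A dp Z Y Dl core <= 3 * n.
Proof.
move=> [[_ _ [cu c1 _] _ _] _]; rewrite /mu.
have h1 : size (frac fac Z Y) <= n.
  by apply: uniq_size => [|i]; [apply: filter_uniq | move=> /frfac /facn].
have h2 : count (fun k => ysum Y (Fs Dl k) != r * Z) core <= n.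
  apply: leq_trans (count_size _ _) _; apply: uniq_size => // i /c1[iC _]; exact: Cn.
have h3 : count (fun j => ysum Y (Bs Dl j) < r * Z) C <= n.
  by apply: leq_trans (count_size _ _) _; apply: uniq_size.
lia.
Qed.

Lemma lgD_half D : 0 < D -> lgD (D %/ 2) < lgD D.
Proof.
rewrite /lgD => D0; rewrite (gtn_eqF D0); case: eqP => // /eqP h; rewrite ltnS.
have h2 : 0 < D %/ 2 by rewrite lt0n.
rewrite -trunc_log2_double //; apply: leq_trunc_log.
by rewrite -muln2; lia.
Qed.

Lemma rstep_RI st : RI st ->
  RI (rstep st) /\ (stuck st /\ rstep st = st \/ Psi (rstep st) < Psi st).
Proof.
case: st => [[Z Y] [Dl core]] inv; rewrite /Rounding.rstep.
case E: (full r C A dp _) => [|j js]; last first.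
  have jf : j \in full r C A dp ((Z, Y), (Dl, core)) by rewrite E mem_head.
  have inv' : RI (shrink n A dp ((Z, Y), (Dl, core)) j) by apply: shrink_RI.
  split=> //; right.
  have h := mu_le inv'; move: h; rewrite /Psi /shrink /=.
  set Dl' := mkseq _ _; set core' := upd _ _ _ _ _; move: (mu _ _ _ _ _ _ _ _ _) => m1 hm1.
  move: (mu _ _ _ _ _ _ _ _ _) => m2.
  move: jf; rewrite mem_filter /= => /andP[jB jC].
  suff h : \sum_(k <- C) lgD (nth 0 Dl' k) < \sum_(k <- C) lgD (nth 0 Dl k).
    by move: h; move: (\sum_(k <- C) _) (\sum_(k <- C) _) => s1 s2; nia.
  have [[Z0 _ _ _ _] _] := inv.
  have D0 : 0 < nth 0 Dl j.
    rewrite lt0n; apply/eqP => e; move: jB.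
    have -> : Bs Dl j = [::] by rewrite /Rounding.Bs e; elim: (A j) => //=.
    by rewrite /ysum big_nil; nia.
  rewrite (perm_big _ (perm_to_rem jC)) [X in _ < X](perm_big _ (perm_to_rem jC)) !big_cons.
  rewrite nth_mkseq ?Cn // eqxx -addSn; apply: leq_add; first exact: lgD_half.
  rewrite big_seq [X in _ <= X]big_seq; apply: leq_sum => k; rewrite mem_rem_uniq // inE.
  by move=> /andP[/negPf kj kC]; rewrite nth_mkseq ?kj ?Cn.
case Ec: (cand w _) => [|g gs]; first by split=> //; left.
have gc : g \in cand w (moves n r fac A dp ((Z, Y), (Dl, core))) by rewrite Ec mem_head.
have [o1 o2 o3 o4 o5] := orient_ok gc.
split; first by apply: move_RI.
by right; rewrite /Psi /= ltn_add2l; apply: (@move_mu n r V W a b C fac A dp d f w).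
Qed.

Lemma rstep_iter st N : RI st -> Psi st <= N ->
  RI (iter N rstep st) /\ stuck (iter N rstep st).
Proof.
move=> inv hN.
have RIi i : RI (iter i rstep st) by elim: i => //= i IH; apply: (rstep_RI IH).1.
split=> //.
have fixp i k : stuck (iter i rstep st) -> iter (i + k) rstep st = iter i rstep st.
  move=> [s1 s2]; elim: k => [|k IH]; rewrite ?addn0 // addnS iterS IH.
  by rewrite /Rounding.rstep s1 s2.
have: forall i, (exists2 k, k <= i & stuck (iter k rstep st)) \/ Psi (iter i rstep st) + i <= Psi st.
  elim=> [|i [[k ki sk]|IH]]; first by right; rewrite addn0.
    by left; exists k => //; apply: ltnW.
  case: (rstep_RI (RIi i)) => _ [[sk _]|h]; first by left; exists i.
  by right; rewrite iterS addnS; apply: leq_trans IH; rewrite ltn_add2r.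
move=> /(_ N.+1) [[k kN sk]|]; last by lia.
have [kN'|kN'] := leqP k N; first by rewrite -(subnKC kN') fixp.
have -> : N = k.-1 by lia.
have kE : k = N.+1 by lia.
have := rstep_RI (RIi N) => -[_ [[sN _]|h]]; first by rewrite kE.
have: forall i, i <= N -> (exists2 k, k <= i & stuck (iter k rstep st)) \/ Psi (iter i rstep st) + i <= Psi st.
  elim=> [|i IH] iN; first by right; rewrite addn0.
  case: (IH (ltnW iN)) => [[l li sl]|IH']; first by left; exists l => //; apply: ltnW.
  case: (rstep_RI (RIi i)) => _ [[sl _]|h']; first by left; exists i.
  by right; rewrite iterS addnS; apply: leq_trans IH'; rewrite ltn_add2r.
move=> /(_ N (leqnn N)) [[l lN sl]|h2]; last by lia.
by rewrite kE /= -(subnKC lN) fixp.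
Qed.

Lemma asg_arith dij dik djk pik Dk Dj : dij <= dik + djk -> dik <= pik -> pik <= Dk ->
  djk + 3 * Dk <= 5 * Dj -> dij <= 5 * Dj.
Proof. lia. Qed.

Lemma near_arith dj0j dy0 dyj p0 pj D0 Dj : 8 * p0 <= D0 -> 8 * pj <= Dj -> dj0j <= dy0 + dyj ->
  dy0 <= p0 -> dyj <= pj -> Dj <= D0 -> Dj <= 2 * (D0 - 2 * dj0j).
Proof. lia. Qed.

Lemma one_arith u v m z : 0 < u -> u < z -> 0 < v -> v < z -> u + v = m * z -> m = 1.
Proof. by case: m => [|[|m]] //; [lia | rewrite !mulSn; lia]. Qed.

Lemma bs_arith z s u B v t r' : z * s + u = B + v -> v <= t -> t < z -> B < r' * z ->
  z * s < z * r'.+1.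
Proof. rewrite mulnS [z * r']mulnC; lia. Qed.

Lemma Fs_arith z s u B v t r' : z * s + u = B + v -> u <= t -> t < z -> r' * z <= B ->
  z * r' < z * s.+1.
Proof. rewrite mulnS [z * r']mulnC; lia. Qed.

Lemma cost_arith u1 u2 u3 u4 : u1 + 5 * u2 <= 5 * u3 + 5 * u4 ->
  (Posz u1 <= Posz 5 * (Posz u3 - Posz u2) + Posz (5 * u4))%R.
Proof. lia. Qed.

Lemma PoszD_sum (T : Type) (l : seq T) (P : pred T) (h : T -> nat) :
  Posz (\sum_(i <- l | P i) h i) = (\sum_(i <- l | P i) Posz (h i))%R.
Proof. exact: (big_morph Posz PoszD). Qed.

(** * The rounded solution and its cost *)

Section Final.
Variables (Z : nat) (Y Dl core : seq nat).
Let st : rstate := ((Z, Y), (Dl, core)).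
Hypothesis inv : RI st.
Hypothesis hst : stuck st.
Let fr := frac fac Z Y.
Let S := rout fac w st.

Let ufr : uniq fr. Proof. exact: filter_uniq. Qed.

Lemma fracP i : i \in fac -> (i \in fr) = (nth 0 Y i != 0) && (nth 0 Y i != Z).
Proof.
move=> ifc; rewrite mem_filter ifc andbT lt0n; have [[_ YZ _ _ _] _] := inv.
by rewrite ltn_neqAle (YZ i ifc) andbT.
Qed.

Lemma sum_mod l : uniq l -> {subset l <= fac} -> (forall i, i \in l -> i \notin fr) ->
  Z %| ysum Y l.
Proof.
move=> _ lf lfr; rewrite /ysum big_seq; apply: dvdn_sum => i il.
have := lfr i il; rewrite fracP ?lf // negb_and !negbK => /orP[/eqP->|/eqP->] //.
Qed.

(** In a tight ball the total is [r Z]; if [x] were its only fractional member, [Z] would divide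
    [Y_x]. Core balls being disjoint, an exchange inside one of them leaves the others alone.
    Outside of all tight balls [x] may move alone. *)
Lemma partner x : x \in fr -> exists y, (x, y) \in moves n r fac A dp st /\
  ((y == n) = ~~ has (fun k => x \in Fs Dl k) (tight r A dp Z Y Dl core)).
Proof.
move=> xf; have [[Z0 YZ [cu c1 c2] _ _] _] := inv.
case ht: (has _ _) => /=; last first.
  exists n; split; last by rewrite eqxx.
  rewrite movesP xf eqxx /=; apply/andP; split.
    by apply: contraNneq nfac => <-; apply: frfac xf.
  apply/allP => k kt; move/negbT/hasPn: ht => /(_ k kt) /negPf ->.
  by apply/eqP/esym/negbTE; apply: contra nfac => E; apply: (Fsfac Afac E).
move/hasP: ht => [k kt xk]; move: (kt); rewrite mem_filter => /andP[/eqP kE kc].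
have: exists2 y, y \in rem x (Fs Dl k) & y \in fr.
  apply/hasP; apply/negPn/negP => /hasPn h.
  have : Z %| ysum Y (rem x (Fs Dl k)).
    apply: sum_mod => //; first exact/rem_uniq/filter_uniq/uA.
    by move=> i /mem_rem; apply: Fsfac.
  have e : ysum Y (Fs Dl k) = nth 0 Y x + ysum Y (rem x (Fs Dl k)).
    by rewrite /ysum (perm_big _ (perm_to_rem xk)) big_cons.
  move=> hd; have : Z %| nth 0 Y x by rewrite -(dvdn_addl _ hd) -e kE dvdn_mull.
  move: xf; rewrite mem_filter => /andP[/andP[p1 p2] _] /(dvdn_leq p1); lia.
move=> [y yk yf]; exists y.
have uF : uniq (Fs Dl k) by apply/filter_uniq/uA.
move: yk; rewrite mem_rem_uniq // inE => /andP[yx yk]; split; last first.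
  by apply/negP => /eqP yn; move: (frfac yf); rewrite yn (negPf nfac).
rewrite movesP xf yf orbT eq_sym yx; apply/allP => l lt.
case: (eqVneq l k) => [->|lk]; first by rewrite xk yk.
move: lt; rewrite mem_filter => /andP[_ lc].
have dj := c2 l k lc kc lk.
have -> : (x \in Fs Dl l) = false by apply/negP => xl; apply: (dj x).
by have -> : (y \in Fs Dl l) = false by apply/negP => yl; apply: (dj y).
Qed.

(** A third fractional facility has a move of its own, and together with [(x, y)] it would provide a
    direction that preserves the weight. *)
Lemma stuck_sub x y : (x, y) \in moves n r fac A dp st -> {subset fr <= [:: x; y]}.
Proof.
move=> xy z zf; rewrite !inE; apply/negPn/negP; rewrite negb_or => /andP[zx zy].
have [e [ze _]] := partner zf; have [_ hc] := hst.
have w0 : wt w (x, y) != 0%R.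
  apply/eqP => w0; suff: (((x, y), (x, y)), (1%R, 0%R)) \in cand w (moves n r fac A dp st).
    by rewrite hc.
  rewrite mem_cat; apply/orP; left; apply/mapP; exists (x, y) => //.
  by rewrite mem_filter w0 eqxx.
suff: (((x, y), (z, e)), (wt w (z, e), (- wt w (x, y))%R)) \in cand w (moves n r fac A dp st).
  by rewrite hc.
rewrite mem_cat; apply/orP; right; apply/flatten_mapP; exists (x, y) => //.
by apply/mapP; exists (z, e) => //; rewrite mem_filter w0 zx zy.
Qed.

(* The output differs from the fractional solution by a multiple of one move. *)
Lemma rout_delta : exists t x y,
  [/\ t < Z, (y \in fac) || (t == 0), t <= nth 0 Y y, (x \in fac) || (x == n) & w x <= w y \/ t = 0] /\
  (forall i, i \in fac -> Posz (Z * (i \in S)) = (Posz (nth 0%N Y i) + Posz t * unitv (x, y) i)%R).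
Proof.
have [[Z0 YZ [cu c1 c2] _ _] _] := inv.
have off i : i \in fac -> i \notin fr -> Z * (nth 0 Y i == Z) = nth 0 Y i.
  move=> ifc; rewrite fracP // negb_and !negbK => /orP[/eqP->|/eqP->]; last by rewrite eqxx muln1.
  by rewrite eq_sym (gtn_eqF Z0) muln0.
have inS i : i \in fac -> (i \in S) = (nth 0 Y i == Z) || (i \in
    match fr with [:: x; y] => [:: if w x <= w y then x else y] | _ => [::] end).
  by move=> ifc; rewrite /S /rout /= mem_cat mem_filter ifc andbT.
case E: fr inS => [|x l] inS.
  exists 0, n, n; split; first by split=> //; rewrite ?eqxx ?orbT //; right.
  by move=> i ifc; rewrite inS // orbF off ?E // mul0r addr0.
have xf : x \in fr by rewrite E mem_head.
have [y [xy yn]] := partner xf; have sub := stuck_sub xy.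
have xfac := frfac xf; have Yx : 0 < nth 0 Y x < Z by move: xf; rewrite mem_filter => /andP[].
case: l E inS => [|y' l] E inS.
  (* Closing the only fractional facility is viewed as an exchange for the absent index [n] of
     weight 0. *)
  exists (nth 0 Y x), n, x; split.
    split; rewrite ?xfac ?eqxx ?orbT //; first by lia.
    by left; rewrite wn.
  move=> i ifc; rewrite inS // orbF /unitv /=.
  have -> : (i == n) = false by apply: contraNF nfac => /eqP <-.
  case: (eqVneq i x) => [->|ix]; first by (have -> : (nth 0 Y x == Z) = false by lia); rewrite muln0 sub0r mulrN mulr1 subrr.
  by rewrite off ?E ?mem_seq1 // mulr0 addr0.
have yf' : y' \in fr by rewrite E !inE eqxx orbT.
have uf := ufr; rewrite E /= in_cons negb_or in uf.
have /and3P[/andP[xy' xl] y'l ul] := uf.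
have y'y : y' = y by have := sub y' yf'; rewrite !inE eq_sym (negPf xy') => /eqP.
have l0 : l = [::].
  case: l E xl y'l ul uf inS => // z l E xl y'l ul uf inS.
  have := sub z; rewrite E !inE eqxx !orbT => /(_ isT).
  move: xl y'l; rewrite !inE !negb_or eq_sym => /andP[/negPf -> _] /andP[h _].
  by rewrite -y'y eq_sym (negPf h).
rewrite l0 in E inS.
have yfac := frfac yf'; rewrite y'y in yfac yf' E inS xy'.
have ynn : (y == n) = false by apply: contraNF nfac => /eqP <-.
have /negbFE/hasP[k kt xk] : ~~ has (fun k => x \in Fs Dl k) (tight r A dp Z Y Dl core) = false.
  by rewrite -yn.
have yk : y \in Fs Dl k.
  by move: xy; rewrite movesP => /and4P[_ _ _ /allP /(_ k kt)]; rewrite xk => /eqP <-.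
move: kt; rewrite mem_filter => /andP[/eqP kE _].
have Yy : 0 < nth 0 Y y < Z by move: yf'; rewrite mem_filter => /andP[].
(* The rest of the tight ball is integral, so that [Z] divides the sum of two numbers strictly
   between 0 and [Z]. *)
have sum : nth 0 Y x + nth 0 Y y = Z.
  have uF : uniq (Fs Dl k) by apply/filter_uniq/uA.
  have yk' : y \in rem x (Fs Dl k) by rewrite mem_rem_uniq // inE eq_sym xy' yk.
  have e : ysum Y (Fs Dl k) = nth 0 Y x + (nth 0 Y y + ysum Y (rem y (rem x (Fs Dl k)))).
    by rewrite /ysum (perm_big _ (perm_to_rem xk)) big_cons (perm_big _ (perm_to_rem yk')) big_cons.
  have hd : Z %| ysum Y (rem y (rem x (Fs Dl k))).
    apply: sum_mod; first by apply/rem_uniq/rem_uniq.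
      by move=> i /mem_rem /mem_rem; apply: Fsfac.
    move=> i; rewrite mem_rem_uniq ?rem_uniq // inE mem_rem_uniq // inE E !inE.
    by move=> /and3P[/negPf -> /negPf ->].
  have : Z %| nth 0 Y x + nth 0 Y y.
    by rewrite -(dvdn_addl _ hd) -addnA -e kE dvdn_mull.
  move=> /dvdnP[m mE]; have m1 : m = 1; last by rewrite mE m1 mul1n.
  by move: Yx Yy mE => /andP[? ?] /andP[? ?]; apply: one_arith.
have gen u v : (u = x /\ v = y \/ u = y /\ v = x) -> w u <= w v ->
    (forall i, i \in fac -> (i \in S) = (nth 0 Y i == Z) || (i == u)) ->
    exists t x0 y0, [/\ t < Z, (y0 \in fac) || (t == 0), t <= nth 0 Y y0,
      (x0 \in fac) || (x0 == n) & w x0 <= w y0 \/ t = 0] /\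
    (forall i, i \in fac -> Posz (Z * (i \in S)) = (Posz (nth 0%N Y i) + Posz t * unitv (x0, y0) i)%R).
  move=> huv wuv inS'; exists (nth 0 Y v), u, v; split.
    have [_ hx2] := andP Yx; have [_ hy2] := andP Yy.
    split=> //; [by case: huv => -[_ ->] | by case: huv => -[_ ->]; rewrite ?xfac ?yfac
      | by case: huv => -[-> _]; rewrite ?xfac ?yfac | by left].
  move=> i ifc; rewrite inS' // /unitv /=.
  case: (eqVneq i u) => [->|iu]; rewrite ?orbT ?orbF.
    have -> : (u == v) = false by case: huv => -[-> ->]; rewrite ?(negPf xy') // eq_sym (negPf xy').
    by rewrite subr0 mulr1 muln1 -PoszD; congr Posz; case: huv => -[-> ->]; rewrite ?sum // addnC sum.
  case: (eqVneq i v) => [->|iv].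
    have -> : (nth 0 Y v == Z) = false.
      by case: huv => -[_ ->]; apply: ltn_eqF; have [_ ?] := andP Yy; have [_ ?] := andP Yx.
    by rewrite muln0 sub0r mulrN mulr1 subrr.
  rewrite subrr mulr0 addr0 off // E !inE.
  by case: huv iu iv => -[-> ->] /negPf -> /negPf ->.
case: (leqP (w x) (w y)) => hw.
  by apply: (gen x y) => // [|i ifc]; [left | rewrite inS // hw mem_seq1].
apply: (gen y x) => [|//|i ifc]; [by right | exact: ltnW |].
by rewrite inS // leqNgt hw mem_seq1.
Qed.

Lemma sum_hunitv (l : seq nat) (h : nat -> nat) p : uniq l ->
  (\sum_(i <- l) Posz (h i) * unitv p i =
   Posz (h p.1 * (p.1 \in l)) - Posz (h p.2 * (p.2 \in l)))%R.
Proof.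
have e c : uniq l -> (\sum_(i <- l) Posz (h i) * Posz (i == c) = Posz (h c * (c \in l)))%R.
  elim: l => [|x l IH] /=; first by rewrite big_nil muln0.
  move=> /andP[xl ul]; rewrite big_cons IH // in_cons eq_sym.
  by case: eqP => [->|] //=; rewrite ?(negPf xl) ?muln0 ?muln1 ?mulr1 ?mulr0 ?addr0 ?add0r.
move=> ul; rewrite /unitv; under eq_bigr do rewrite mulrBr.
by rewrite sumrB !e.
Qed.

Lemma uniq_rout : uniq S.
Proof.
rewrite cat_uniq filter_uniq // /=.
case E: (frac fac Z Y) => [|x [|y [|]]] //=.
rewrite orbF andbT mem_filter /= negb_and; apply/orP; left.
have : (if w x <= w y then x else y) \in frac fac Z Y.
  by rewrite E; case: ifP => _; rewrite !inE eqxx ?orbT.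
by rewrite mem_filter => /andP[/andP[_ h] _]; lia.
Qed.

Lemma rout_fac : {subset S <= fac}.
Proof.
move=> i; rewrite mem_cat mem_filter => /orP[/andP[_ ->] //|] /=.
case E: (frac fac Z Y) => [|x [|y [|]]] //=; rewrite inE => /eqP ->.
have : (if w x <= w y then x else y) \in frac fac Z Y.
  by rewrite E; case: ifP => _; rewrite !inE eqxx ?orbT.
by rewrite mem_filter => /andP[].
Qed.

Lemma sum_rout (h : nat -> nat) : \sum_(i <- S) h i = \sum_(i <- fac) h i * (i \in S).
Proof.
rewrite [RHS](eq_bigr (fun i => if i \in S then h i else 0)); last first.
  by move=> i _; case E: (i \in S); rewrite ?muln1 ?muln0.
rewrite -[RHS]big_mkcond -[RHS]big_filter; apply: perm_big; apply: uniq_perm => [||i].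
- exact: uniq_rout.
- exact: filter_uniq.
- by rewrite mem_filter; case E: (i \in S) => //=; rewrite rout_fac.
Qed.

Lemma delta_arith s1 s2 t hx hy :
  (Posz s1 = Posz s2 + Posz t * (Posz hx - Posz hy))%R -> s1 + t * hy = s2 + t * hx.
Proof. lia. Qed.

Lemma w_arith s1 s2 t wx wy : wx <= wy -> s1 + t * wy = s2 + t * wx -> s1 <= s2.
Proof. nia. Qed.

Lemma le_arith s1 s2 s3 s4 s5 : s1 + s2 = s3 + s4 -> s4 <= s5 -> s1 <= s3 + s5.
Proof. lia. Qed.

Section Delta.
Variables (t x y : nat).
Hypotheses (tZ : t < Z) (yfac : (y \in fac) || (t == 0)) (tY : t <= nth 0 Y y).
Hypotheses (xfac : (x \in fac) || (x == n)) (wxy : w x <= w y \/ t = 0).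
Hypothesis delta : forall i, i \in fac ->
  Posz (Z * (i \in S)) = (Posz (nth 0%N Y i) + Posz t * unitv (x, y) i)%R.

Lemma sum_delta l (h : nat -> nat) : uniq l -> {subset l <= fac} ->
  Z * (\sum_(i <- l) h i * (i \in S)) + t * (h y * (y \in l)) =
  \sum_(i <- l) h i * nth 0 Y i + t * (h x * (x \in l)).
Proof.
move=> ul lf; have hu := sum_hunitv h (x, y) ul; rewrite /= in hu.
suff e : (Posz (Z * (\sum_(i <- l) h i * (i \in S))) =
    Posz (\sum_(i <- l) h i * nth 0%N Y i) + Posz t * \sum_(i <- l) Posz (h i) * unitv (x, y) i)%R.
  by rewrite hu in e; apply: delta_arith e.
rewrite big_distrr /= !PoszD_sum mulr_sumr -big_split /=; apply: eq_big_seq => i /lf ifc.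
have -> : Z * (h i * (i \in S)) = h i * (Z * (i \in S)) by rewrite mulnCA.
by rewrite PoszM delta // PoszM; ring.
Qed.

Lemma rout_weight : \sum_(i <- S) w i <= W.
Proof.
have [_ [_ hw _]] := inv; rewrite sum_rout.
have e := sum_delta w ufac (fun i h => h).
(* Here the strict bound by [W + 1] is divided by [Z], and integrality gives [W]. *)
suff h : Z * (\sum_(i <- fac) w i * (i \in S)) < W.+1 * Z.
  by move: h; rewrite mulnC ltn_pmul2r; last lia.
apply: leq_ltn_trans hw; move: e.
have wx : w x * (x \in fac) = w x by case/orP: xfac => [->|/eqP->]; rewrite ?muln1 ?wn.
case/orP: yfac => [-> |/eqP ->]; last by rewrite !mul0n !addn0 => ->.
by case: wxy => [h|->]; [rewrite wx muln1; apply: w_arith | rewrite !mul0n !addn0 => ->].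
Qed.

Lemma rout_fcost : Z * \sum_(i <- S) f i <= \sum_(i <- fac) f i * nth 0 Y i + Z * V.
Proof.
rewrite sum_rout; have e := sum_delta f ufac (fun i h => h).
have : t * (f x * (x \in fac)) <= Z * V.
  apply: leq_mul; first exact: ltnW.
  by case E: (x \in fac); rewrite ?muln0 // muln1 fV.
exact: le_arith e.
Qed.

Lemma full_nil j : j \in C -> ysum Y (Bs Dl j) < r * Z.
Proof.
move=> jC; rewrite ltnNge; apply/negP => h; have [hf _] := hst.
suff: j \in full r C A dp st by rewrite hf.
by rewrite mem_filter h.
Qed.

(** A witness for an upper bound on the cost of the [r] nearest facilities: the open facilities in
    the open ball of [j], completed from the closed ball of a related core client. *)
Definition asg j : seq nat :=
  let bs := [seq i <- Bs Dl j | i \in S] in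
  let k := head 0 [seq k <- core | rel d Dl j k] in
  bs ++ take (r - size bs) [seq i <- Fs Dl k | (i \in S) && (i \notin bs)].

Lemma count_S l : size [seq i <- l | i \in S] = \sum_(i <- l) 1 * (i \in S).
Proof. by elim: l => [|i l IH] /=; rewrite ?big_nil ?big_cons -?IH //; case: (i \in S). Qed.

Lemma lossj_arith Zz Dd rr nb bs X T tt hx hy : nb <= rr -> bs + X = Dd * nb ->
  Zz * X + tt * hy = T + tt * hx -> 
  Zz * (bs + (rr - nb) * (5 * Dd)) + 5 * T <= 5 * (rr * Dd * Zz) + 5 * (tt * hy).
Proof.
move=> h1 h2 h3.
have e : Zz * (bs + (rr - nb) * (5 * Dd)) <= 5 * (Zz * (bs + (rr - nb) * Dd)) by nia.
have e2 : bs + (rr - nb) * Dd + X = rr * Dd by rewrite addnAC h2 mulnC -mulnDl subnKC.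
have e3 : Zz * (bs + (rr - nb) * Dd) + Zz * X = rr * Dd * Zz by rewrite -mulnDr e2 mulnC.
nia.
Qed.

(** For the integral solution the potential of [j] bounds the cost of the assignment up to the
    factor 5. Passing from [Y] to [S] raises this potential at most by the share of the closed
    facility [y]. *)
Lemma asg_ok j : j \in C ->
  [/\ uniq (asg j), {subset asg j <= S}, size (asg j) = r &
   Z * (\sum_(i <- asg j) d i j) + 5 * (\sum_(i <- A j) (nth 0 Dl j - dp i j) * nth 0 Y i) <=
   5 * (r * nth 0 Dl j * Z) + 5 * (t * ((nth 0 Dl j - dp y j) * (y \in A j)))].
Proof.
move=> jC; have [[Z0 YZ [cu c1 c2] hB hrel] _] := inv.
have hk : exists2 k, k = head 0 [seq k <- core | rel d Dl j k] & (k \in core) && rel d Dl j k.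
  case: (hrel j jC) => k kc kr; eexists => //.
  have : k \in [seq k <- core | rel d Dl j k] by rewrite mem_filter kr kc.
  case E: [seq _ <- _ | _] => [|k' l] // _ /=.
  have : k' \in [seq k <- core | rel d Dl j k] by rewrite E mem_head.
  by rewrite mem_filter andbC.
case: hk => k kE /andP[kc kr]; rewrite /asg -kE.
set bs := [seq i <- Bs Dl j | i \in S].
have ubs : uniq bs by do 2 apply: filter_uniq; exact: uA.
(* The exchange adds at most [t < Z] to a mass below [r Z], which leaves room for fewer than [r + 1]
   open facilities. *)
have hbs : size bs <= r.
  have e := sum_delta (fun=> 1) (filter_uniq _ (uA j) : uniq (Bs Dl j)) (fun i h => Bsfac Afac h).
  rewrite /= -count_S -/bs in e; have h := full_nil jC; rewrite /ysum in h.
  have e1 : \sum_(i <- Bs Dl j) 1 * nth 0 Y i = \sum_(i <- Bs Dl j) nth 0 Y i.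
    by apply: eq_bigr => i _; rewrite mul1n.
  rewrite e1 in e; have hx : (x \in Bs Dl j) <= 1 by case: (x \in _).
  have hx2 : t * (1 * (x \in Bs Dl j)) <= t by rewrite mul1n -[X in _ <= X]muln1 leq_mul2l hx orbT.
  have : Z * size bs < Z * r.+1 by apply: bs_arith e hx2 tZ h.
  by rewrite ltn_pmul2l.
(* Here the exchange takes less than [Z] from a mass of at least [r Z]. *)
have hF : r <= size [seq i <- Fs Dl k | i \in S].
  have e := sum_delta (fun=> 1) (filter_uniq _ (uA k) : uniq (Fs Dl k)) (fun i h => Fsfac Afac h).
  rewrite /= -count_S in e; have [_ h] := c1 k kc; rewrite /ysum in h.
  have e1 : \sum_(i <- Fs Dl k) 1 * nth 0 Y i = \sum_(i <- Fs Dl k) nth 0 Y i.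
    by apply: eq_bigr => i _; rewrite mul1n.
  rewrite e1 in e; have hx : (y \in Fs Dl k) <= 1 by case: (y \in _).
  have hx2 : t * (1 * (y \in Fs Dl k)) <= t by rewrite mul1n -[X in _ <= X]muln1 leq_mul2l hx orbT.
  have : Z * r < Z * (size [seq i <- Fs Dl k | i \in S]).+1 by apply: Fs_arith e hx2 tZ h.
  by rewrite ltn_pmul2l.
set rs := [seq i <- Fs Dl k | _].
have urs : uniq rs by do 2 apply: filter_uniq; exact: uA.
have hrs : r - size bs <= size rs.
  rewrite leq_subLR; apply: leq_trans hF _; rewrite -size_cat; apply: uniq_leq_size.
    do 2 apply: filter_uniq; exact: uA.
  move=> i; rewrite mem_cat !mem_filter => /andP[iS iF]; rewrite iS iF /=.
  by case: (_ && _).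
have st2 : size (take (r - size bs) rs) = r - size bs by rewrite size_takel.
have subt i : i \in take (r - size bs) rs -> [/\ i \in S, i \notin bs & i \in Fs Dl k].
  by move=> /mem_take; rewrite mem_filter => /andP[/andP[-> ->] ->].
split.
- rewrite cat_uniq ubs take_uniq // andbT; apply/hasPn => i /subt[]//.
- by move=> i; rewrite mem_cat mem_filter => /orP[/andP[] //|/subt[]].
- by rewrite size_cat st2 subnKC.
have [kC _] := c1 k kc.
have hd1 : \sum_(i <- bs) d i j <= \sum_(i <- bs) dp i j by apply: leq_sum => i _; apply: ddp.
have hd2 : \sum_(i <- take (r - size bs) rs) d i j <= (r - size bs) * (5 * nth 0 Dl j).
  have gen (l : seq nat) c : (forall i, i \in l -> d i j <= c) -> \sum_(i <- l) d i j <= size l * c.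
    elim: l => [|i l IH] hl; rewrite ?big_nil ?big_cons // mulSn leq_add ?hl ?mem_head //.
    by apply: IH => i' i'l; apply: hl; rewrite in_cons i'l orbT.
  rewrite -[X in _ <= X * _]st2; apply: gen => i /subt[_ _ iF].
  have ifc := facn (Fsfac Afac iF).
  have h3 := dtri ifc (Cn kC) (Cn jC); rewrite (dsym (Cn kC) (Cn jC)) in h3.
  have h4 := ddp i k; move: iF kr; rewrite mem_filter /rel => /andP[h5 _]; apply: asg_arith h3 h4 h5.
have hX : \sum_(i <- bs) dp i j + \sum_(i <- A j) (nth 0 Dl j - dp i j) * (i \in S) =
    nth 0 Dl j * size bs.
  rewrite /bs /Rounding.Bs; elim: (A j) => [|i l IH] /=; first by rewrite !big_nil muln0.
  rewrite big_cons; case: ltnP => h /=; last first.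
    by move: h; rewrite -subn_eq0 => /eqP ->; rewrite mul0n add0n.
  by case: (i \in S); rewrite /= ?big_cons ?muln0 ?add0n // muln1 mulnS -IH addnACA (subnKC (ltnW h)).
have e := sum_delta (fun i => nth 0 Dl j - dp i j) (uA j) (fun i h => Afac h).
have := lossj_arith hbs hX e; rewrite big_cat /=.
have : Z * (\sum_(i <- bs) d i j + \sum_(i <- take (r - size bs) rs) d i j) <=
   Z * (\sum_(i <- bs) dp i j + (r - size bs) * (5 * nth 0 Dl j)) by rewrite leq_mul2l leq_add ?orbT.
by move=> h1 h2; apply: leq_trans h2; rewrite leq_add2r.
Qed.

Lemma asg_sub j : j \in C -> [/\ uniq (asg j), {subset asg j <= S} & size (asg j) = r].
Proof. by move=> /asg_ok[]. Qed.

Lemma far_arith D dpy Yy tt : tt <= Yy -> D <= 4 * dpy -> tt * (D - dpy) <= 3 * (dpy * Yy).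
Proof. move=> h1 h2; have : D - dpy <= 3 * dpy by lia. nia. Qed.

(** Of the fractional distances in the open ball, which are part of the potential, only the term of
    [y] is retained. *)
Lemma Tj_ge j : j \in C ->
  \sum_(i <- A j) (nth 0 Dl j - dp i j) * nth 0 Y i +
   dp y j * nth 0 Y y * (y \in Bs Dl j) <= r * nth 0 Dl j * Z.
Proof.
move=> jC; have [[_ _ _ hB _] _] := inv; have := hB j jC; rewrite /ysum => {}hB.
have h1 : \sum_(i <- A j) (nth 0 Dl j - dp i j) * nth 0 Y i + \sum_(i <- Bs Dl j) dp i j * nth 0 Y i =
    nth 0 Dl j * \sum_(i <- Bs Dl j) nth 0 Y i.
  rewrite /Rounding.Bs; elim: (A j) => [|i l IH] /=; first by rewrite !big_nil muln0.
  rewrite big_cons; case: ltnP => h /=; last first.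
    by move: h; rewrite -subn_eq0 => /eqP ->; rewrite mul0n add0n.
  by rewrite !big_cons mulnDr -IH mulnBl; have := leq_mul (ltnW h) (leqnn (nth 0 Y i)); lia.
have h2 : dp y j * nth 0 Y y * (y \in Bs Dl j) <= \sum_(i <- Bs Dl j) dp i j * nth 0 Y i.
  case E: (y \in Bs Dl j); rewrite ?muln0 // muln1.
  by rewrite (perm_big _ (perm_to_rem E)) big_cons leq_addr.
have h3 : nth 0 Dl j * \sum_(i <- Bs Dl j) nth 0 Y i <= r * nth 0 Dl j * Z.
  by rewrite mulnAC [r * Z * _]mulnC leq_mul2l hB orbT.
lia.
Qed.

(** For the other clients [D - dp <= 3 * dp], so that their loss is charged to the term of [y] in
    their own potential. The near ones, whose potential may be too small for that, are charged to
    [V]. *)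
Definition near j := (y \in A j) && (4 * dp y j < nth 0 Dl j).

Lemma argmax_seq (l : seq nat) (h : nat -> nat) : l != [::] ->
  exists2 m, m \in l & forall i, i \in l -> h i <= h m.
Proof.
elim: l => // x0 l IH _; case: l IH => [|x1 l] IH.
  by exists x0; rewrite ?mem_head // => i; rewrite inE => /eqP ->.
case: (IH isT) => m ml hm; case: (leqP (h x0) (h m)) => hx.
  exists m; first by rewrite in_cons ml orbT.
  by move=> i; rewrite in_cons => /orP[/eqP->|/hm].
exists x0; rewrite ?mem_head // => i; rewrite in_cons => /orP[/eqP->|/hm h1] //.
exact: leq_trans h1 (ltnW hx).
Qed.

(* All near clients lie within a quarter of the largest near radius of each other. *)
Lemma near_sum : \sum_(j <- [seq j <- C | near j]) nth 0 Dl j <= 4 * V.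
Proof.
have [_ [_ _ hD]] := inv.
case: (eqVneq [seq j <- C | near j] [::]) => [->|ne]; first by rewrite big_nil.
have [j0] := argmax_seq (fun j => nth 0 Dl j) ne; rewrite mem_filter => /andP[n0 j0C] mx.
have [_ hV] := hD j0 j0C.
suff: \sum_(j <- [seq j <- C | near j]) nth 0 Dl j <= 2 * \sum_(k <- C) (nth 0 Dl j0 - 2 * d j0 k) by lia.
rewrite big_distrr /= [X in _ <= X](bigID near) /= -[X in _ <= X + _]big_filter.
apply: leq_trans (leq_addr _ _); rewrite big_seq [X in _ <= X]big_seq; apply: leq_sum => j jl.
have hj := mx j jl; move: jl; rewrite mem_filter => /andP[nj jC].
move: n0 nj => /andP[y0 d0] /andP[y1 d1].
have q z : z \in C -> 4 * dp y z < nth 0 Dl z -> 8 * dp y z <= nth 0 Dl z.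
  move=> zC h; have := pow20_lt (pow20_dbl (pow20_dbl (dp2 y z))) (hD z zC).1.
  by rewrite !mulnA => /(_ h).
have yn := facn (Afac y0).
have h1 := q _ j0C d0; have h2 := q _ jC d1.
have h3 := dtri (Cn j0C) yn (Cn jC); rewrite (dsym (Cn j0C) yn) in h3.
exact: near_arith h1 h2 h3 (ddp y j0) (ddp y j) hj.
Qed.

Lemma loss_sum : (Posz (\sum_(j <- C) t * ((nth 0 Dl j - dp y j) * (y \in A j)))%N <=
  Posz 3 * (\sum_(j <- C) Tj Z Y Dl j) + Posz (Z * (4 * V)))%R.
Proof.
apply: le_trans (_ : Posz 3 * (\sum_(j <- C) Tj Z Y Dl j) +
   Posz (Z * \sum_(j <- [seq j <- C | near j]) nth 0%N Dl j) <= _)%R; last first.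
  by rewrite lerD2l lez_nat leq_mul2l near_sum orbT.
have -> : Z * (\sum_(j <- [seq j <- C | near j]) nth 0 Dl j) =
    \sum_(j <- C) Z * (if near j then nth 0 Dl j else 0).
  by rewrite big_filter big_mkcond big_distrr.
rewrite !PoszD_sum mulr_sumr -big_split /= /near.
rewrite big_seq [X in (_ <= X)%R]big_seq; apply: ler_sum => j jC.
rewrite /Rounding.Tj; have := Tj_ge jC; rewrite -PoszD_sum.
move: (\sum_(i <- A j) _) (r * nth 0 Dl j * Z) => X RD hX.
case E: (y \in A j); last first.
  by rewrite !muln0 /=; lia.
rewrite /= muln1; case: ltnP => h.
  have : t * (nth 0 Dl j - dp y j) <= Z * nth 0 Dl j.
    by apply: leq_mul; [exact: ltnW | exact: leq_subr].
  by lia.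
have [hd|hd] := leqP (nth 0 Dl j) (dp y j).
  by move: hd; rewrite -subn_eq0 => /eqP ->; lia.
have yB : y \in Bs Dl j by rewrite mem_filter hd E.
rewrite yB muln1 in hX; have := far_arith tY h; lia.
Qed.

Lemma final_arith (F T c1 c2 fy : int) (z v aa bb L : nat) : 0 < z ->
  (Posz z * c1 <= fy + Posz (z * v))%R ->
  (Posz z * c2 <= Posz 5 * T + Posz 5 * Posz L)%R ->
  (Posz L <= Posz 3 * T + Posz (z * (4 * v)))%R -> (0 <= fy)%R ->
  (Posz aa * (fy + T) <= Posz (bb * z))%R ->
  (Posz aa * (c1 + c2) <= Posz (20 * bb + 21 * aa * v))%R.
Proof.
move=> z0 h1 h2 h3 f0 h4.
have h5 : (Posz z * (c1 + c2) <= Posz 20 * (fy + T) + Posz (21 * (z * v)))%R by lia.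
have h6 : (Posz aa * (Posz z * (c1 + c2)) <= Posz aa * (Posz 20 * (fy + T) + Posz (21 * (z * v))))%R.
  by apply: ler_wpM2l h5.
have h7 : (Posz z * (Posz aa * (c1 + c2)) <= Posz z * Posz (20 * bb + 21 * aa * v))%R.
  apply: le_trans (_ : Posz 20 * Posz (bb * z) + Posz aa * Posz (21 * (z * v)) <= _)%R.
    apply: le_trans (_ : Posz 20 * (Posz aa * (fy + T)) + Posz aa * Posz (21 * (z * v)) <= _)%R.
      by move: h6; rewrite mulrCA; congr (_ <= _)%R; ring.
    by rewrite lerD2r ler_wpM2l.
  by rewrite !PoszM !PoszD !PoszM; rewrite le_eqVlt; apply/orP; left; apply/eqP; ring.
by move: h7; rewrite ler_pM2l.
Qed.

Lemma rout_cost : a * (\sum_(i <- S) f i + \sum_(j <- C) \sum_(i <- asg j) d i j) <=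
  20 * b + 21 * a * V.
Proof.
have [[Z0 _ _ _ _] [hPhi _ _]] := inv.
rewrite -lez_nat PoszM PoszD.
apply: (@final_arith 0%R (\sum_(j <- C) Tj Z Y Dl j)%R _ _ (\sum_(i <- fac) Posz (f i * nth 0%N Y i))%R
   Z _ _ _ (\sum_(j <- C) t * ((nth 0 Dl j - dp y j) * (y \in A j)))) => //.
- by rewrite -PoszD_sum -PoszM -PoszD lez_nat rout_fcost.
- rewrite !PoszD_sum !mulr_sumr -big_split /= big_seq [X in (_ <= X)%R]big_seq.
  apply: ler_sum => j jC; have [_ _ _] := asg_ok jC; rewrite /Rounding.Tj -PoszD_sum -!PoszM.
  exact: cost_arith.
- exact: loss_sum.
- by apply: sumr_ge0.
Qed.
End Delta.

Lemma rout_final : [/\ uniq S, {subset S <= fac}, \sum_(i <- S) w i <= W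
  & exists2 s : nat -> seq nat,
      forall j, j \in C -> [/\ uniq (s j), {subset s j <= S} & size (s j) = r]
    & a * (\sum_(i <- S) f i + \sum_(j <- C) \sum_(i <- s j) d i j) <= 20 * b + 21 * a * V].
Proof.
have [t [x [y [[h1 h2 h3 h4 h5] h6]]]] := rout_delta.
split; [exact: uniq_rout | exact: rout_fac | by apply: rout_weight h6 |].
exists asg; last by apply: rout_cost h6.
by move=> j jC; eapply asg_sub; eassumption.
Qed.

End Final.
End Rounding2.

(** * The algorithm for a given guess of the optimum *)

Definition gtab := (((nat * nat) * (nat * (seq nat * seq nat))) *
  ((seq (seq nat) * seq (seq nat)) * (seq (seq nat) * (seq nat * seq nat))))%type.

Definition gr (g : gtab) : nat := g.1.1.1.
Definition gW (g : gtab) : nat := g.1.1.2.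
Definition gV (g : gtab) : nat := g.1.2.1.
Definition gC (g : gtab) : seq nat := g.1.2.2.1.
Definition gF (g : gtab) : seq nat := g.1.2.2.2.
Definition gA (g : gtab) (j : nat) : seq nat := nth [::] g.2.1.1 j.
Definition gdp (g : gtab) (i j : nat) : nat := nth 0 (nth [::] g.2.1.2 i) j.
Definition gd (g : gtab) (i j : nat) : nat := nth 0 (nth [::] g.2.2.1 i) j.
Definition gf (g : gtab) (i : nat) : nat := nth 0 g.2.2.2.1 i.
Definition gw (g : gtab) (i : nat) : nat := nth 0 g.2.2.2.2 i.
Definition gn (g : gtab) : nat := size g.2.2.1.

Definition spr (d : nat) (cs : seq (nat * int)) : seq int :=
  mkseq (fun i => \sum_(c <- cs) (if c.1 == i then c.2 else 0))%R d.

Definition sval_ (cs : seq (nat * int)) (v : nat -> int) : int :=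
  (\sum_(c <- cs) c.2 * v c.1)%R.

Lemma dot_spr d cs (v : nat -> int) l : (forall i, i < d -> nth 0%R l i = v i) ->
  all (fun c => c.1 < d) cs -> dot d (spr d cs) l = sval_ cs v.
Proof.
move=> hl hc; rewrite /dot /sval_.
transitivity (\sum_(i <- iota 0 d) (\sum_(c <- cs) (if c.1 == i then c.2 else 0)) * v i)%R.
  apply: eq_big_seq => i; rewrite mem_iota add0n => /andP[_ id_].
  by rewrite nth_mkseq // hl.
elim: cs hc => [|c cs IH] /=.
  by move=> _; rewrite big_nil big1 // => i _; rewrite big_nil mul0r.
move=> /andP[hc hcs]; rewrite big_cons -IH // {IH}.
transitivity (\sum_(i <- iota 0 d) ((if c.1 == i then c.2 else 0) * v i +
    (\sum_(c <- cs) (if c.1 == i then c.2 else 0)) * v i))%R.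
  by apply: eq_bigr => i _; rewrite big_cons mulrDl.
rewrite big_split /=; congr (_ + _)%R.
have cin : c.1 \in iota 0 d by rewrite mem_iota add0n.
rewrite (bigD1_seq c.1) ?iota_uniq //= eqxx big1 ?addr0 //.
by move=> i /negPf; rewrite eq_sym => ->; rewrite mul0r.
Qed.

Lemma all_flatten (T : Type) (p : pred T) (l : seq (seq T)) :
  all p (flatten l) = all (all p) l.
Proof. by elim: l => //= a l IH; rewrite all_cat IH. Qed.

(** The smallness of the perturbation that [phi_arith] asks for; with [V], [cc] and [W], [cw]
    exchanged it also implies what [wgt_arith] asks for. *)
Lemma sE_arith r V W c1 c2 : 600 * r * V + 200 * c2 <= 1000 * (r + 1) * (1 + V + W + c1 + c2).
Proof.
apply: leq_trans (_ : 1000 * (r + 1) * (V + c2) <= _); last by rewrite leq_mul2l; lia.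
nia.
Qed.

Section Alg.
Variable g : gtab.
Notation n := (gn g).
Notation r := (gr g).

(** The slacks [cw] and [cc] make room for the interior point, which exceeds the scaled optimum by 2
    in each [y_i] and by 1 in each [x_ij]; the final 1 makes the rows positive. *)
Definition cw : nat := 2 * (\sum_(i <- gF g) gw g i) + 1.
Definition cc : nat := 2 * (\sum_(i <- gF g) gf g i)
  + \sum_(j <- gC g) \sum_(i <- gA g j) gd g i j + 1.
(* The inverse of the perturbation of the linear program. *)
Definition sE : nat := 1000 * (r + 1) * (1 + gV g + gW g + cw + cc).
(** Coordinate 0 homogenises the program, as the solver treats homogeneous strict inequalities. *)
Definition ldim : nat := 1 + n + n * n.
Definition yi (i : nat) : nat := 1 + i.
Definition xi (i j : nat) : nat := 1 + n + (i * n + j).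

Definition rW : seq (nat * int) :=
  (0, Posz (sE * gW g + cw)) :: [seq (yi i, (- Posz (sE * gw g i))%R) | i <- gF g].
Definition rV : seq (nat * int) :=
  (0, Posz (sE * gV g + cc)) :: [seq (yi i, (- Posz (sE * gf g i))%R) | i <- gF g]
  ++ flatten [seq [seq (xi i j, (- Posz (sE * gd g i j))%R) | i <- gA g j] | j <- gC g].

(** Relative to coordinate 0 the bound on [y_i] is [1 + 3 / sE], because the interior point reaches
    [1 + 2 / sE]. *)
Definition lprows : seq (seq (nat * int)) :=
  [:: [:: (0, Posz 1)]; rW; rV]
  ++ [seq [:: (yi i, Posz 1)] | i <- gF g]
  ++ [seq [:: (0, Posz (sE + 3)); (yi i, (- Posz sE)%R)] | i <- gF g]
  ++ [seq (0, (- Posz r)%R) :: [seq (xi i j, Posz 1) | i <- gA g j] | j <- gC g]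
  ++ flatten [seq [seq [:: (xi i j, Posz 1)] | i <- gF g] | j <- gC g]
  ++ flatten [seq [seq [:: (yi i, Posz 1); (xi i j, (- Posz 1)%R)] | i <- gF g] | j <- gC g].

Definition lpM : seq (seq int) := [seq spr ldim cs | cs <- lprows].
(** The squared norm of the interior point is at most [ldim * (sE + 2)^2], and the solver needs it
    multiplied by [lpB]. *)
Definition lpG : nat := lpB ldim lpM * (ldim * ((sE + 2) * (sE + 2))).
Definition lpnit : nat :=
  size lpM * lpth (size lpM) * (size lpM * bitlen lpG).+1.
Definition lpst : lpstate := lp_run ldim lpnit lpM.
Definition lpok : bool := lp_done ldim lpM lpst.
Definition lpv (i : nat) : nat := `|nth 0%R (lp_sol ldim lpst) i|%N.

Definition gZ : nat := sE * lpv 0.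
(** The perturbed program allows values slightly above 1, which are cut off. The factor
    [1 + 6 r / sE] restores what the clients lose by that, see [cov_min]. *)
Definition gY : seq nat := mkseq (fun i => minn gZ ((sE + 6 * r) * lpv (yi i))) n.
Definition okD (Z : nat) (Y : seq nat) (j v : nat) : bool :=
  r * Z <= ysum Y [seq i <- gA g j | gdp g i j <= v].
Definition selD (Z : nat) (Y : seq nat) (j : nat) : nat :=
  let cs := [seq gdp g i j | i <- gA g j] in
  head 0 [seq v <- cs | okD Z Y j v && all (fun u => ~~ okD Z Y j u || (v <= u)) cs].
Definition gDl (Z : nat) (Y : seq nat) : seq nat := mkseq (selD Z Y) n.
Definition gcore (Dl : seq nat) : seq nat := foldl (upd (gA g) (gdp g) Dl) [::] (gC g).
Definition gst0 : rstate :=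
  let Z := gZ in let Y := gY in let Dl := gDl Z Y in ((Z, Y), (Dl, gcore Dl)).
Definition gN (Dl : seq nat) : nat :=
  (\sum_(j <- gC g) bitlen (nth 0 Dl j)) * (3 * n + 1) + 3 * n.
Definition gstep : rstate -> rstate :=
  rstep n r (gC g) (gF g) (gA g) (gdp g) (gf g) (gw g).
Definition grun : rstate := iter (gN gst0.2.1) gstep gst0.
Definition gsol : seq nat := rout (gF g) (gw g) grun.

Definition gok : Prop :=
  [/\ 0 < r, uniq (gC g) /\ uniq (gF g),
      forall j, j \in gC g -> j < n, forall i, i \in gF g -> i < n
    & (forall j i, i \in gA g j -> i \in gF g) /\ forall j, uniq (gA g j)] /\
  [/\ gw g n = 0, forall i, i \in gF g -> gf g i <= gV g,
      forall i j, [/\ pow20 (gdp g i j), gd g i j <= gdp g i j & gdp g i j <= 2 * gd g i j]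
    & [/\ forall i j, i < n -> j < n -> gd g i j = gd g j i,
       forall i j k, i < n -> j < n -> k < n -> gd g i k <= gd g i j + gd g j k,
       forall i, gd g i i = 0
     & forall j i, j \in gC g -> i \in gA g j ->
        \sum_(k <- gC g) (gd g i j - gd g j k) <= gV g]].

Hypothesis G : gok.
Let r0 : 0 < r. Proof. by case: G => -[]. Qed.
Let uC : uniq (gC g). Proof. by case: G => -[_ []]. Qed.
Let ufac : uniq (gF g). Proof. by case: G => -[_ []]. Qed.
Let Cn j : j \in gC g -> j < n. Proof. by case: G => -[_ _ h _ _] _; apply: h. Qed.
Let facn i : i \in gF g -> i < n. Proof. by case: G => -[_ _ _ h _] _; apply: h. Qed.
Let Afac j i : i \in gA g j -> i \in gF g.
Proof. by case: G => -[_ _ _ _ [h _]] _; apply: h. Qed.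
Let uA j : uniq (gA g j). Proof. by case: G => -[_ _ _ _ [_ h]] _; apply: h. Qed.
Let wn : gw g n = 0. Proof. by case: G => _ []. Qed.
Let fV i : i \in gF g -> gf g i <= gV g. Proof. by case: G => _ [_ h _ _]; apply: h. Qed.
Let dp2 i j : pow20 (gdp g i j). Proof. by case: G => _ [_ _ /(_ i j) []]. Qed.
Let ddp i j : gd g i j <= gdp g i j. Proof. by case: G => _ [_ _ /(_ i j) []]. Qed.
Let dpd i j : gdp g i j <= 2 * gd g i j. Proof. by case: G => _ [_ _ /(_ i j) []]. Qed.
Let dsym i j : i < n -> j < n -> gd g i j = gd g j i.
Proof. by case: G => _ [_ _ _ [h _ _ _]]; apply: h. Qed.
Let dtri i j k : i < n -> j < n -> k < n -> gd g i k <= gd g i j + gd g j k.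
Proof. by case: G => _ [_ _ _ [_ h _ _]]; apply: h. Qed.
Let dii i : gd g i i = 0. Proof. by case: G => _ [_ _ _ [_ _ h _]]; apply: h. Qed.
Let Adef j i : j \in gC g -> i \in gA g j -> \sum_(k <- gC g) (gd g i j - gd g j k) <= gV g.
Proof. by case: G => _ [_ _ _ [_ _ _ h]]; apply: h. Qed.

Lemma ltyi i : i \in gF g -> yi i < ldim.
Proof. by move=> /facn h; rewrite /yi /ldim; lia. Qed.
Lemma ltxi i j : i \in gF g -> j \in gC g -> xi i j < ldim.
Proof.
move=> /facn hi /Cn hj; rewrite /xi /ldim ltn_add2l.
by apply: leq_trans (_ : i.+1 * n <= _); rewrite ?leq_mul2r ?hi ?orbT // mulSn; lia.
Qed.

Lemma rows_dim : all (fun cs => all (fun c : nat * int => c.1 < ldim) cs) lprows.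
Proof.
have l0 : 0 < ldim by [].
rewrite /lprows !all_cat /=.
have a1 (h : nat -> int) : all (fun c : nat * int => c.1 < ldim) [seq (yi i, h i) | i <- gF g].
  by rewrite all_map; apply/allP => i iF /=; apply: ltyi.
have a2 (h : nat -> int) j : j \in gC g ->
    all (fun c : nat * int => c.1 < ldim) [seq (xi i j, h i) | i <- gA g j].
  by move=> jC; rewrite all_map; apply/allP => i iF /=; apply: ltxi => //; apply: Afac iF.
rewrite !a1 all_cat !a1 /=.
have -> /= : all (fun c : nat * int => c.1 < ldim) (flatten
    [seq [seq (xi i j, (- Posz (sE * gd g i j))%R) | i <- gA g j] | j <- gC g]).
  by rewrite all_flatten all_map; apply/allP => j jC /=; apply: a2.
do 2 (rewrite all_map; apply/andP; split; first by apply/allP => i iF /=; rewrite ltyi // ?l0).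
rewrite all_map; apply/andP; split; first by apply/allP => j jC /=; rewrite a2.
rewrite !all_flatten !all_map; apply/andP; split; apply/allP => j jC;
  rewrite /preim /= all_map; apply/allP => i iF.
  by have h := ltxi iF jC; apply/andP; split.
by apply/and3P; split=> //; [exact: ltyi | exact: ltxi].
Qed.

Lemma lpok_pos cs : lpok -> cs \in lprows ->
  (0 < sval_ cs (fun i => nth 0 (lp_sol ldim lpst) i))%R.
Proof.
move=> ok csr; have k_ : index cs lprows < size lpM by rewrite size_map index_mem.
have := lp_done_pos ok k_; rewrite (nth_map [::]) ?index_mem // nth_index //.
by rewrite (@dot_spr _ _ (fun i => nth 0 (lp_sol ldim lpst) i)%R) // (allP rows_dim).
Qed.

Lemma lpok_feas (h : nat -> int) :
  (forall cs, cs \in lprows -> 1 <= sval_ cs h)%R ->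
  (forall i, 0 <= h i <= Posz (sE + 2))%R -> lpok.
Proof.
move=> h1 h2; rewrite /lpok /lpst /lp_run.
apply: (@lp_converges ldim (lpB ldim lpM) lpM _ (lpB_gt0 _ _) _
  (lrow ldim (mkseq h ldim)) (Posz lpG)).
- by rewrite size_map.
- by move=> k u; apply: lpB_row.
- move=> k; rewrite size_map => km; rewrite -dotE (nth_map [::]) //.
  have csr := mem_nth [::] km.
  rewrite (@dot_spr _ _ h) ?h1 // ?(allP rows_dim) // => i id_; exact: nth_mkseq.
- rewrite -dotE PoszM; apply: ler_wpM2l => //.
  apply: le_trans (_ : \sum_(i <- iota 0 ldim) Posz ((sE + 2) * (sE + 2)) <= _)%R.
    rewrite /dot big_seq [X in (_ <= X)%R]big_seq; apply: ler_sum => i.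
    rewrite mem_iota add0n => /andP[_ id_]; rewrite !nth_mkseq // PoszM.
    by have /andP[p1 p2] := h2 i; apply: ler_pM.
  by rewrite big_const_seq count_predT size_iota iter_addr addr0 -mulr_natl natz -PoszM.
- exact: leqnn.
Qed.

Lemma sval_map (I : eqType) (ix : I -> nat) (c u : I -> nat) (l : seq I) (h : nat -> int) :
  (forall i, i \in l -> h (ix i) = Posz (u i)) ->
  sval_ [seq (ix i, (- Posz (c i))%R) | i <- l] h = (- Posz (\sum_(i <- l) c i * u i))%R.
Proof.
move=> e; rewrite /sval_ big_map PoszD_sum -sumrN; apply: eq_big_seq => i il.
by rewrite /= e // mulNr PoszM.
Qed.

Lemma sval_map1 (I : eqType) (ix : I -> nat) (u : I -> nat) (l : seq I) (h : nat -> int) :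
  (forall i, i \in l -> h (ix i) = Posz (u i)) ->
  sval_ [seq (ix i, Posz 1) | i <- l] h = Posz (\sum_(i <- l) u i).
Proof.
move=> e; rewrite /sval_ big_map PoszD_sum; apply: eq_big_seq => i il.
by rewrite /= e // mul1r.
Qed.

Lemma sval_cons k c cs h : sval_ ((k, c) :: cs) h = (c * h k + sval_ cs h)%R.
Proof. by rewrite /sval_ big_cons. Qed.

Lemma sval_nil h : sval_ [::] h = 0%R. Proof. by rewrite /sval_ big_nil. Qed.

Lemma sval_cat c1 c2 h : sval_ (c1 ++ c2) h = (sval_ c1 h + sval_ c2 h)%R.
Proof. by rewrite /sval_ big_cat. Qed.

Lemma sval_rV (h : nat -> int) (t : nat) (y : nat -> nat) (x : nat -> nat -> nat) :
  h 0 = Posz t -> (forall i, i \in gF g -> h (yi i) = Posz (y i)) ->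
  (forall i j, i \in gF g -> j \in gC g -> h (xi i j) = Posz (x i j)) ->
  sval_ rV h = (Posz ((sE * gV g + cc) * t) - Posz (\sum_(i <- gF g) sE * gf g i * y i)
    - Posz (\sum_(j <- gC g) \sum_(i <- gA g j) sE * gd g i j * x i j))%R.
Proof.
move=> h0 hy hx; rewrite /rV sval_cons sval_cat /= h0 -PoszM.
rewrite (sval_map _ hy) addrA; congr (_ + _)%R.
rewrite /sval_ big_flatten /= big_map PoszD_sum -sumrN; apply: eq_big_seq => j jC.
by apply: sval_map => i iA; apply: hx => //; apply: Afac iA.
Qed.

Lemma sval_rW (h : nat -> int) (t : nat) (y : nat -> nat) :
  h 0 = Posz t -> (forall i, i \in gF g -> h (yi i) = Posz (y i)) ->
  sval_ rW h = (Posz ((sE * gW g + cw) * t) - Posz (\sum_(i <- gF g) sE * gw g i * y i))%R.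
Proof. by move=> h0 hy; rewrite /rW sval_cons /= h0 -PoszM (sval_map _ hy). Qed.

Lemma sum_mem (O l : seq nat) (h : nat -> nat) : uniq O -> uniq l -> {subset O <= l} ->
  \sum_(i <- l) h i * (i \in O) = \sum_(i <- O) h i.
Proof.
move=> uO ul sub; rewrite (eq_bigr (fun i => if i \in O then h i else 0)); last first.
  by move=> i _; case: (i \in O); rewrite ?muln1 ?muln0.
rewrite -big_mkcond -big_filter; apply: perm_big; apply: uniq_perm => // [|i].
  exact: filter_uniq.
by rewrite mem_filter; case E: (i \in O) => //=; rewrite sub.
Qed.

Lemma sE_gt0 : 0 < sE. Proof. by rewrite /sE; nia. Qed.

Lemma sum_aff (l : seq nat) (c o : nat -> nat) E k :
  \sum_(i <- l) E * c i * (E * o i + k) =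
  E * E * (\sum_(i <- l) c i * o i) + k * E * (\sum_(i <- l) c i).
Proof.
rewrite !big_distrr -big_split /=; apply: eq_bigr => i _; ring.
Qed.

Lemma feasW_arith E W wO sw : wO <= W -> 0 < E ->
  E * E * wO + 2 * E * sw < (E * W + (2 * sw + 1)) * E.
Proof.
move=> h E0; have : E * E * wO <= E * E * W by rewrite leq_mul2l h orbT.
have -> : (E * W + (2 * sw + 1)) * E = E * E * W + 2 * E * sw + E by ring.
lia.
Qed.

Lemma feasV_arith E V fO dO sf sd : fO + dO <= V -> 0 < E ->
  E * E * fO + 2 * E * sf + (E * E * dO + 1 * E * sd) < (E * V + (2 * sf + sd + 1)) * E.
Proof.
move=> h E0; have : E * E * (fO + dO) <= E * E * V by rewrite leq_mul2l h orbT.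
have -> : (E * V + (2 * sf + sd + 1)) * E = E * E * V + 2 * E * sf + 1 * E * sd + E by ring.
rewrite mulnDr; lia.
Qed.

(** * An interior point of the perturbed relaxation *)

Section Feas.
Variables (O : seq nat) (s : nat -> seq nat).
Hypotheses (uO : uniq O) (OF : {subset O <= gF g}).
Hypothesis hs : forall j, j \in gC g ->
  [/\ uniq (s j), {subset s j <= O}, {subset s j <= gA g j} & size (s j) = r].
Hypothesis hW : \sum_(i <- O) gw g i <= gW g.
Hypothesis hV : \sum_(i <- O) gf g i + \sum_(j <- gC g) \sum_(i <- s j) gd g i j <= gV g.

(** Opened facilities have [y_i] raised by 2 and assignments are raised by 1 only, so that the rows
    [y_i - x_ij] are at least 1; all other rows use the slacks of the perturbation. *)
Let h (k : nat) : int := Posz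
  (if k == 0 then sE else if k <= n then sE * (k.-1 \in O) + 2
   else sE * ((k - (1 + n)) %/ n \in s ((k - (1 + n)) %% n)) + 1).

Let hy i : i \in gF g -> h (yi i) = Posz (sE * (i \in O) + 2).
Proof. by move=> /facn iF; rewrite /h /yi add1n /= iF. Qed.

Let hx i j : i \in gF g -> j \in gC g -> h (xi i j) = Posz (sE * (i \in s j) + 1).
Proof.
move=> _ /Cn jn; rewrite /h /xi /= ifF; last by lia.
have n0 : 0 < n by lia.
by rewrite addKn divnMDl // modnMDl divn_small // modn_small // addn0.
Qed.

Lemma lp_feasible : lpok.
Proof.
apply: (@lpok_feas h); last first.
  move=> k; rewrite /h lez_nat /=.
  case: ifP => _; first by rewrite leq_addr.
  by case: ifP => _; case: (_ \in _); lia.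
have E0 := sE_gt0; have h0 : h 0 = Posz sE by [].
suff H : all (fun cs => 1 <= sval_ cs h)%R lprows by move=> cs; apply: (allP H).
rewrite /lprows !all_cat /= !andbT.
have -> /= : (1 <= sval_ [:: (0, Posz 1)] h)%R.
  by rewrite sval_cons sval_nil /= h0 mul1r addr0 lez_nat.
have -> /= : (1 <= sval_ rW h)%R.
  rewrite (sval_rW h0 hy) sum_aff sum_mem //.
  have := feasW_arith (\sum_(i <- gF g) gw g i) hW E0; rewrite -/cw; lia.
have -> /= : (1 <= sval_ rV h)%R.
  rewrite (sval_rV h0 hy hx) sum_aff sum_mem //.
  have e : \sum_(j <- gC g) \sum_(i <- gA g j) sE * gd g i j * (sE * (i \in s j) + 1) =
     sE * sE * (\sum_(j <- gC g) \sum_(i <- s j) gd g i j) +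
     1 * sE * (\sum_(j <- gC g) \sum_(i <- gA g j) gd g i j).
    rewrite !big_distrr -big_split /=; apply: eq_big_seq => j jC.
    by rewrite sum_aff sum_mem //; case: (hs jC).
  rewrite e.
  have := feasV_arith (\sum_(i <- gF g) gf g i)
    (\sum_(j <- gC g) \sum_(i <- gA g j) gd g i j) hV E0; rewrite -/cc; lia.
do 2 (rewrite all_map; apply/andP; split;
  first by apply/allP => i iF /=; rewrite !sval_cons sval_nil /= hy // ?h0; case: (i \in O); nia).
rewrite all_map; apply/andP; split.
  apply/allP => j jC /=; rewrite sval_cons /= h0.
  rewrite (@sval_map1 _ _ (fun i => sE * (i \in s j) + 1)); last first.
    by move=> i iA; apply: hx => //; apply: Afac iA.
  have [us _ sA sr] := hs jC.
  have -> : \sum_(i <- gA g j) (sE * (i \in s j) + 1) = sE * r + size (gA g j).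
    rewrite big_split /= sum1_size sum_mem //.
    by rewrite big_const_seq count_predT iter_addn_0 sr.
  have : r <= size (gA g j) by rewrite -sr; apply: uniq_leq_size.
  by move: r0; nia.
rewrite !all_flatten !all_map; apply/andP; split; apply/allP => j jC;
  rewrite /preim /= all_map; apply/allP => i iF.
  change (is_true (1 <= sval_ [:: (xi i j, Posz 1)] h)%R).
  by rewrite sval_cons sval_nil hx //; lia.
change (is_true (1 <= sval_ [:: (yi i, Posz 1); (xi i j, (- Posz 1)%R)] h)%R).
rewrite !sval_cons sval_nil (hx iF jC) (hy iF).
have [_ sO _ _] := hs jC; have := sO i; case: (i \in s j); case: (i \in O) => //; lia.
Qed.
End Feas.

(** * From a solution of the relaxation to the start of the rounding *)

Section Sol.
Hypothesis ok : lpok.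
Let E := sE.
Let t := lpv 0.
Let y i := lpv (yi i).
Let x i j := lpv (xi i j).
Let v := fun i => nth 0%R (lp_sol ldim lpst) i.

Let v0 : v 0 = Posz t /\ 0 < t.
Proof.
have : (0 < sval_ [:: (0, Posz 1)] v)%R by apply: lpok_pos; rewrite // mem_cat !inE eqxx.
rewrite sval_cons sval_nil /= mul1r addr0 /t /lpv -/(v 0) => h; split; last by rewrite absz_gt0 gt_eqF.
by rewrite gtz0_abs.
Qed.

Let vy i : i \in gF g -> v (yi i) = Posz (y i).
Proof.
move=> iF; have : (0 < sval_ [:: (yi i, Posz 1)] v)%R.
  apply: lpok_pos => //; rewrite 2!mem_cat; apply/orP; right; apply/orP; left.
  by apply/mapP; exists i.
by rewrite sval_cons sval_nil /= mul1r addr0 /y /lpv -/(v _) => h; rewrite gtz0_abs.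
Qed.

Let vx i j : i \in gF g -> j \in gC g -> v (xi i j) = Posz (x i j).
Proof.
move=> iF jC; have : (0 < sval_ [:: (xi i j, Posz 1)] v)%R.
  apply: lpok_pos => //; rewrite !mem_cat; do 4 (apply/orP; right); apply/orP; left.
  by apply/flatten_mapP; exists j => //; apply/mapP; exists i.
by rewrite sval_cons sval_nil /= mul1r addr0 /x /lpv -/(v _) => h; rewrite gtz0_abs.
Qed.

Let xy i j : i \in gF g -> j \in gC g -> x i j <= y i.
Proof.
move=> iF jC; have : (0 < sval_ [:: (yi i, Posz 1); (xi i j, (- Posz 1)%R)] v)%R.
  apply: lpok_pos => //; rewrite !mem_cat; do 5 (apply/orP; right).
  by apply/flatten_mapP; exists j => //; apply/mapP; exists i.
by rewrite !sval_cons sval_nil /= vy // vx //; lia.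
Qed.

Let yt i : i \in gF g -> E * y i <= (E + 3) * t.
Proof.
move=> iF; have : (0 < sval_ [:: (0, Posz (sE + 3)); (yi i, (- Posz sE)%R)] v)%R.
  apply: lpok_pos => //; rewrite !mem_cat; do 2 (apply/orP; right); apply/orP; left.
  by apply/mapP; exists i.
by rewrite !sval_cons sval_nil /= vy // v0.1 -/E; lia.
Qed.

Let cov j : j \in gC g -> r * t <= \sum_(i <- gA g j) x i j.
Proof.
move=> jC; have : (0 < sval_ ((0, (- Posz r)%R) :: [seq (xi i j, Posz 1) | i <- gA g j]) v)%R.
  apply: lpok_pos => //; rewrite !mem_cat; do 3 (apply/orP; right); apply/orP; left.
  by apply/mapP; exists j.
rewrite sval_cons /= (@sval_map1 _ _ (fun i => x i j)); last first.
  by move=> i iA; apply: vx => //; apply: Afac iA.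
by rewrite v0.1; move: (\sum_(i <- _) _) => S; lia.
Qed.

Let wgt : E * (\sum_(i <- gF g) gw g i * y i) < (E * gW g + cw) * t.
Proof.
have : (0 < sval_ rW v)%R by apply: lpok_pos => //; rewrite mem_cat !inE eqxx orbT.
rewrite (sval_rW v0.1 vy) big_distrr /=; under eq_bigr do rewrite -mulnA.
by move: (\sum_(i <- _) _) => S; rewrite -/E; lia.
Qed.

Let cst : E * (\sum_(i <- gF g) gf g i * y i) +
  E * (\sum_(j <- gC g) \sum_(i <- gA g j) gd g i j * x i j) <= (E * gV g + cc) * t.
Proof.
have : (0 < sval_ rV v)%R by apply: lpok_pos => //; rewrite mem_cat !inE eqxx !orbT.
rewrite (sval_rV v0.1 vy vx).
have -> : E * (\sum_(j <- gC g) \sum_(i <- gA g j) gd g i j * x i j) =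
    \sum_(j <- gC g) \sum_(i <- gA g j) sE * gd g i j * x i j.
  rewrite big_distrr /=; apply: eq_bigr => j _; rewrite big_distrr /=.
  by apply: eq_bigr => i _; rewrite mulnA.
have -> : E * (\sum_(i <- gF g) gf g i * y i) = \sum_(i <- gF g) sE * gf g i * y i.
  by rewrite big_distrr /=; apply: eq_bigr => i _; rewrite mulnA.
by move: (\sum_(j <- gC g) _) (\sum_(i <- gF g) _) => S1 S2; rewrite -/E; lia.
Qed.

Let E6 : 6 * r <= E. Proof. by rewrite /E /sE; nia. Qed.

Lemma cov_arith EE q k tt Sx Sm : 0 < q -> 6 * (q + k) <= EE ->
  EE * ((q + k) * tt) <= EE * Sx + k * ((EE + 3) * tt) ->
  k * (EE * tt) + (EE + 6 * (q + k)) * Sx <= Sm -> (q + k) * (EE * tt) <= Sm.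
Proof.
move=> q0 hE h1 h2; apply: leq_trans h2.
have E0 : 0 < EE by lia.
rewrite -(leq_pmul2l E0) mulnDr.
have h3 : (EE + 6 * (q + k)) * (EE * ((q + k) * tt)) <=
   (EE + 6 * (q + k)) * (EE * Sx + k * ((EE + 3) * tt)) by rewrite leq_mul2l h1 orbT.
have h4 : (EE + 6 * (q + k)) * (k * ((EE + 3) * tt)) <=
   EE * (k * (EE * tt)) + 6 * (q + k) * (EE * ((q + k) * tt)).
  suff: (EE + 6 * (q + k)) * (k * (EE + 3)) <= EE * (k * EE) + 6 * (q + k) * (EE * (q + k)).
    by move=> h; have := leq_mul h (leqnn tt); congr (_ <= _); ring.
  have a1 : 18 * (q + k) * k <= 3 * EE * k by rewrite leq_mul2r; apply/orP; right; lia.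
  have a2 : 3 * EE * k * 2 <= 6 * EE * (q + k) * 1 by nia.
  have a3 : 6 * EE * (q + k) * 1 <= 6 * EE * (q + k) * q by rewrite leq_mul2l q0 orbT.
  have -> : (EE + 6 * (q + k)) * (k * (EE + 3)) =
    EE * k * EE + 3 * EE * k + 6 * EE * (q + k) * k + 18 * (q + k) * k by ring.
  have -> : EE * (k * EE) + 6 * (q + k) * (EE * (q + k)) =
    EE * k * EE + 6 * EE * (q + k) * k + 6 * EE * (q + k) * q by ring.
  lia.
have e1 : EE * ((q + k) * (EE * tt)) + 6 * (q + k) * (EE * ((q + k) * tt)) =
   (EE + 6 * (q + k)) * (EE * ((q + k) * tt)) by ring.
have e2 : EE * ((EE + 6 * (q + k)) * Sx) = (EE + 6 * (q + k)) * (EE * Sx) by ring.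
rewrite e2; move: h3; rewrite mulnDr; lia.
Qed.

(** If [k >= r] terms are cut off, these alone suffice. Otherwise they carried at most
    [k (1 + 3 / E)], which leaves at least [r - k - 3 k / E] to the others. Scaling adds
    [6 r (r - k) / E >= 6 k / E]; half of this covers the deficit, the other half the second-order
    term, since [6 r <= E]. *)
Lemma cov_min (l : seq nat) (z : nat -> nat) : (forall i, i \in l -> E * z i <= (E + 3) * t) ->
  r * t <= \sum_(i <- l) z i ->
  r * (E * t) <= \sum_(i <- l) minn (E * t) ((E + 6 * r) * z i).
Proof.
move=> hz hc; pose p i := E * t <= (E + 6 * r) * z i.
set k := count p l.
have e1 : \sum_(i <- l) minn (E * t) ((E + 6 * r) * z i) =
    k * (E * t) + (E + 6 * r) * (\sum_(i <- l | ~~ p i) z i).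
  rewrite (bigID p) /= big_distrr /=; congr (_ + _).
    rewrite (eq_bigr (fun=> E * t)); last by move=> i /minn_idPl.
    by rewrite big_const_seq iter_addn_0 mulnC.
  by apply: eq_bigr => i; rewrite /p -ltnNge => /ltnW /minn_idPr.
have e2 : E * (\sum_(i <- l | p i) z i) <= k * ((E + 3) * t).
  rewrite /k -sum1_count big_distrr big_distrl /= big_seq_cond [X in _ <= X]big_seq_cond.
  by apply: leq_sum => i /andP[il _]; rewrite mul1n hz.
rewrite e1; have [rk|kr] := leqP r k.
  by apply: leq_trans (leq_addr _ _); rewrite leq_mul2r rk orbT.
have rE : r = (r - k) + k by rewrite subnK // ltnW.
rewrite rE; apply: (@cov_arith E (r - k) k t (\sum_(i <- l | ~~ p i) z i)); rewrite -?rE //.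
  by rewrite subn_gt0.
apply: leq_trans (_ : E * (\sum_(i <- l) z i) <= _); first by rewrite leq_mul2l hc orbT.
by rewrite (bigID p) /= mulnDr addnC leq_add2l.
Qed.

Let Z := gZ.
Let Y := gY.
Let Z0 : 0 < Z. Proof. by rewrite muln_gt0 sE_gt0 v0.2. Qed.
Let K := E + 6 * r.
Let nY i : i \in gF g -> nth 0 Y i = minn Z (K * y i).
Proof. by move=> /facn ii; rewrite nth_mkseq. Qed.
Let m i j := minn Z (K * x i j).
Let mY i j : i \in gF g -> j \in gC g -> m i j <= nth 0 Y i.
Proof.
move=> iF jC; rewrite nY // leq_min geq_minl /=; apply: leq_trans (geq_minr _ _) _.
by rewrite leq_mul2l xy ?orbT.
Qed.
Let mcov j : j \in gC g -> r * Z <= \sum_(i <- gA g j) m i j.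
Proof.
move=> jC; apply: cov_min; last exact: cov.
move=> i iA; have iF := Afac iA; apply: leq_trans (yt iF).
by rewrite leq_mul2l xy ?orbT.
Qed.
Let Ycov j : j \in gC g -> r * Z <= ysum Y (gA g j).
Proof.
move=> jC; apply: leq_trans (mcov jC) _; rewrite /ysum big_seq [X in _ <= X]big_seq.
by apply: leq_sum => i iA; apply: mY => //; apply: Afac iA.
Qed.

Lemma selDP j : j \in gC g -> [/\ exists2 i, i \in gA g j & selD Z Y j = gdp g i j,
  okD Z Y j (selD Z Y j) & ysum Y [seq i <- gA g j | gdp g i j < selD Z Y j] <= r * Z].
Proof.
move=> jC; rewrite /selD; set cs := [seq gdp g i j | i <- gA g j].
set L := [seq v <- cs | _].
have rZ : 0 < r * Z by rewrite muln_gt0 r0.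
have Ane : gA g j != [::].
  by apply/eqP => e; have := Ycov jC; rewrite e /ysum big_nil leqNgt rZ.
have [im imA mx] := argmax_seq (fun i => gdp g i j) Ane.
have exP : exists v, (v \in cs) && okD Z Y j v.
  exists (gdp g im j); apply/andP; split; first exact: (map_f (fun i => gdp g i j) imA).
  rewrite /okD.
  have /all_filterP -> : all (fun i => gdp g i j <= gdp g im j) (gA g j) by apply/allP.
  exact: Ycov.
have hL : head 0 L \in L.
  have : L != [::]; last by case: L => // a l _; exact: mem_head.
  case: (ex_minnP exP) => v1 /andP[v1c v1o] mn; apply/eqP => e.
  suff: v1 \in L by rewrite e.
  rewrite mem_filter v1c v1o /= andbT; apply/allP => u uc.
  by case uo: (okD Z Y j u) => //=; apply: mn; rewrite uc uo.
set D := head 0 L in hL *; move: hL; rewrite mem_filter => /andP[/andP[Do /allP mn] Dc].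
split=> //; first by case/mapP: Dc => i iA ->; exists i.
(* If the open ball had more than the required mass, the largest distance occurring in it would be a
   smaller admissible radius. *)
rewrite leqNgt; apply/negP => hgt.
have Bne : [seq i <- gA g j | gdp g i j < D] != [::].
  by apply/eqP => e; move: hgt; rewrite e /ysum big_nil.
have [i0 i0B mx0] := argmax_seq (fun i => gdp g i j) Bne.
move: (i0B); rewrite mem_filter => /andP[i0D i0A].
have := mn (gdp g i0 j) (map_f _ i0A); rewrite leqNgt i0D orbF => /negP; apply.
rewrite /okD; apply: leq_trans (ltnW hgt) _; apply: ysum_sub; first exact/filter_uniq/uA.
by move=> i iB; have := mx0 i iB; move: iB; rewrite !mem_filter => /andP[_ ->] ->.
Qed.

Let Dl := gDl Z Y.
Let nD j : j \in gC g -> nth 0 Dl j = selD Z Y j.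
Proof. by move=> /Cn jn; rewrite nth_mkseq. Qed.

Let DlP : Dok (gV g) (gC g) (gd g) Dl.
Proof.
move=> j jC; rewrite nD //; have [[i iA ->] _ _] := selDP jC; split; first exact: dp2.
apply: leq_trans (_ : 2 * \sum_(k <- gC g) (gd g i j - gd g j k) <= _); last first.
  by rewrite leq_mul2l Adef ?orbT.
rewrite big_distrr /=; apply: leq_sum => k _.
by have := dpd i j; lia.
Qed.

Lemma gcoreP : core_ok r (gC g) (gA g) (gdp g) Z Y Dl (gcore Dl) /\
  (forall i, i \in gC g -> exists2 k, k \in gcore Dl & rel (gd g) Dl i k).
Proof.
suff H C1 C2 : gC g = C1 ++ C2 ->
    let co := foldl (upd (gA g) (gdp g) Dl) [::] C1 in
    [/\ core_ok r (gC g) (gA g) (gdp g) Z Y Dl co, {subset co <= C1}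
      & forall i, i \in C1 -> exists2 k, k \in co & rel (gd g) Dl i k].
  by have [] := H (gC g) [::] (esym (cats0 _)).
elim/last_ind: C1 C2 => [|C1 j IH] C2 eC /=; first by split.
rewrite -cats1 -catA in eC; have [c1 c2 c3] := IH _ eC.
rewrite -cats1 foldl_cat /=; set co := foldl _ _ _ in c1 c2 c3 *.
have jC : j \in gC g by rewrite eC mem_cat mem_head orbT.
have jn : j \notin C1.
  by have := uC; rewrite eC cat_uniq => /and3P[_ /hasPn h _]; apply: h; exact: mem_head.
have jco : j \notin co by apply: contra jn; apply: c2.
have sub1 i : i \in C1 -> i \in gC g by rewrite eC mem_cat => ->.
have cof : [seq k <- co | k != j] = co.
  by apply/all_filterP/allP => k kc; apply: contraNneq jco => <-.
have [] := @upd_ok n r (gV g) 1 (gC g) (gF g) (gA g) (gdp g) (gd g) (gw g)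
  r0 uC ufac Cn facn Afac wn ddp dsym dtri dii isT (fun i => i \in C1) Z Y Dl co j jC DlP.
- by move=> i; apply: sub1.
- by rewrite cof.
- by rewrite /Fs nD //; have [_ h _] := selDP jC.
- by rewrite (negPf jco).
- move=> i iC ij; left; have [k kc kr] := c3 i iC; exists k => //.
  by rewrite kc; apply: contraNneq jco => <-.
move=> k1 k2; split=> //.
- move=> i; rewrite /upd cof; case: ifP => _; rewrite mem_cat ?inE.
    by move=> /c2 ->.
  by rewrite mem_filter => /orP[->|/andP[_ /c2 ->]] //; rewrite orbT.
- by move=> i; rewrite mem_cat inE; apply: k2.
Qed.

Let YK i : i \in gF g -> nth 0 Y i <= K * y i.
Proof. by move=> iF; rewrite nY // geq_minr. Qed.

(** The perturbed and scaled budget [(1 + 6 r / E) (W + c / E)] is at most [W + 1]. *)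
Lemma wgt_arith EE S SY KK r_ W c tt : SY <= KK * S -> EE * S < (EE * W + c) * tt ->
  KK = EE + 6 * r_ -> 6 * r_ * W + 2 * c <= EE -> 6 * r_ <= EE -> 0 < EE ->
  SY < W.+1 * (EE * tt).
Proof.
move=> h1 h2 eK h3 h4 E0.
rewrite -(ltn_pmul2l E0).
apply: leq_ltn_trans (_ : EE * (KK * S) < _); first by rewrite leq_mul2l h1 orbT.
have K0 : 0 < KK by lia.
apply: leq_trans (_ : KK * ((EE * W + c) * tt) <= _).
  by rewrite mulnCA ltn_pmul2l.
suff: KK * (EE * W + c) <= EE * (W.+1 * EE).
  by move=> h; have := leq_mul h (leqnn tt); congr (_ <= _); ring.
rewrite eK; have : (6 * r_ * W + 2 * c) * EE <= EE * EE by rewrite leq_mul2r h3 orbT.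
have : 6 * r_ * c <= EE * c by rewrite leq_mul2r h4 orbT.
have -> : (EE + 6 * r_) * (EE * W + c) = EE * EE * W + EE * c + 6 * r_ * W * EE + 6 * r_ * c by ring.
have -> : EE * (W.+1 * EE) = EE * EE * W + EE * EE by rewrite -addn1; ring.
rewrite mulnDl; lia.
Qed.

(** Similarly [2 (1 + 6 r / E) (V + c / E) <= 2 V + 1 / 50], the first 2 coming from the rounded
    distances. This is the origin of the values 50 and [100 V + 1] for the bound on the
    potential. *)
Lemma phi_arith EE S P KK r_ V c tt : P <= 2 * (KK * S) -> EE * S <= (EE * V + c) * tt ->
  KK = EE + 6 * r_ -> 600 * r_ * V + 200 * c <= EE -> 6 * r_ <= EE -> 0 < EE ->
  50 * P <= (100 * V + 1) * (EE * tt).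
Proof.
move=> h1 h2 eK h3 h4 E0.
rewrite -(leq_pmul2l E0).
apply: leq_trans (_ : EE * (100 * (KK * S)) <= _).
  by rewrite leq_mul2l; apply/orP; right; lia.
apply: leq_trans (_ : 100 * (KK * ((EE * V + c) * tt)) <= _).
  by rewrite !(mulnCA EE) !leq_mul2l h2 !orbT.
suff: 100 * (KK * (EE * V + c)) <= EE * ((100 * V + 1) * EE).
  by move=> h; have := leq_mul h (leqnn tt); congr (_ <= _); ring.
rewrite eK; have : (600 * r_ * V + 200 * c) * EE <= EE * EE by rewrite leq_mul2r h3 orbT.
have : 6 * r_ * c <= EE * c by rewrite leq_mul2r h4 orbT.
have -> : 100 * ((EE + 6 * r_) * (EE * V + c)) =
  100 * (EE * EE * V) + 100 * (EE * c) + 600 * r_ * V * EE + 100 * (6 * r_ * c) by ring.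
have -> : EE * ((100 * V + 1) * EE) = 100 * (EE * EE * V) + EE * EE by ring.
rewrite mulnDl; lia.
Qed.

(** The truncated assignment [m] covers [j] and lies below [Y]. In [D m], summed over the
    facilities, [D] is split into at most [dp] and the positive part of [D - dp], and the latter
    cancels. *)
Lemma Tj_le j : j \in gC g ->
  (Tj r (gA g) (gdp g) Z Y Dl j <= Posz (2 * (K * \sum_(i <- gA g j) gd g i j * x i j)))%R.
Proof.
move=> jC; rewrite /Tj -PoszD_sum lerBlDr -PoszD lez_nat.
set D := nth 0 Dl j.
apply: leq_trans (_ : D * (\sum_(i <- gA g j) m i j) <= _).
  by rewrite mulnAC [r * Z * D]mulnC leq_mul2l mcov ?orbT.
rewrite !big_distrr -big_split /= big_seq [X in _ <= X]big_seq; apply: leq_sum => i iA.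
have iF := Afac iA.
apply: leq_trans (_ : gdp g i j * m i j + (D - gdp g i j) * m i j <= _).
  by rewrite -mulnDl leq_mul2r; apply/orP; right; lia.
apply: leq_add; last by rewrite leq_mul2l mY ?orbT.
apply: leq_trans (leq_mul (dpd i j) (geq_minr Z (K * x i j))) _.
by apply: eq_leq; ring.
Qed.

Lemma gst0_RI : RI r (gV g) (gW g) 50 (100 * gV g + 1) (gC g) (gF g) (gA g) (gdp g) (gd g)
  (gf g) (gw g) gst0.
Proof.
have [c1 c2] := gcoreP; split; split=> //.
- by move=> i iF; rewrite nY // geq_minl.
- by move=> j jC; rewrite /Bs nD //; have [] := selDP jC.
- have hP : (Phi r (gC g) (gF g) (gA g) (gdp g) (gf g) Z Y Dl <=
      Posz (2 * (K * (\sum_(i <- gF g) gf g i * y i +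
       \sum_(j <- gC g) \sum_(i <- gA g j) gd g i j * x i j))))%R.
    rewrite /Phi mulnDr mulnDr PoszD; apply: lerD.
      rewrite -PoszD_sum lez_nat; apply: leq_trans (_ : K * (\sum_(i <- gF g) gf g i * y i) <= _); last by lia.
      rewrite big_distrr /= big_seq [X in _ <= X]big_seq; apply: leq_sum => i iF.
      by rewrite mulnCA leq_mul2l YK ?orbT.
    rewrite !big_distrr PoszD_sum big_seq [X in (_ <= X)%R]big_seq.
    by apply: ler_sum => j jC; apply: Tj_le.
  apply: le_trans (ler_wpM2l _ hP) _ => //; rewrite -PoszM lez_nat.
  apply: (@phi_arith E _ _ K r (gV g) cc t (leqnn _)) => //; last exact: sE_gt0.
    by rewrite mulnDr; exact: cst.
  exact: sE_arith.
- apply: (@wgt_arith E _ _ K r (gW g) cw t _ wgt) => //; last exact: sE_gt0; last first.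
    apply: leq_trans (_ : 600 * r * gW g + 200 * cw <= _); first by lia.
    have -> : E = 1000 * (r + 1) * (1 + gW g + gV g + cc + cw) by rewrite /E /sE; congr (_ * _); lia.
    exact: sE_arith.
  rewrite big_distrr /= big_seq [X in _ <= X]big_seq; apply: leq_sum => i iF.
  by rewrite mulnCA leq_mul2l YK ?orbT.
Qed.

Lemma gsolP : [/\ uniq gsol, {subset gsol <= gF g}, \sum_(i <- gsol) gw g i <= gW g
  & exists2 s : nat -> seq nat,
      forall j, j \in gC g -> [/\ uniq (s j), {subset s j <= gsol} & size (s j) = r]
    & \sum_(i <- gsol) gf g i + \sum_(j <- gC g) \sum_(i <- s j) gd g i j <= 61 * gV g].
Proof.
have hN : Psi n r (gC g) (gF g) (gA g) (gdp g) gst0 <= gN gst0.2.1.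
  rewrite /Psi /gN; apply: leq_add.
    rewrite leq_mul2r; apply/orP; right; apply: leq_sum => j _.
    by rewrite /lgD; case: eqP.
  have inv0 : RI r (gV g) (gW g) 50 (100 * gV g + 1) (gC g) (gF g) (gA g) (gdp g) (gd g)
    (gf g) (gw g) ((Z, Y), (Dl, gcore Dl)) := gst0_RI.
  by eapply mu_le; try exact: inv0; eauto.
have [] := rstep_iter r0 uC ufac Cn facn Afac uA wn dp2 ddp dsym dtri dii (isT : 0 < 50) gst0_RI hN.
rewrite -/gstep -/grun /gsol; case: grun => [[Z1 Y1] [D1 co1]] inv st.
have [h1 h2 h3 [s hs hc]] := rout_final r0 uC ufac Cn facn Afac uA wn fV dp2 ddp dsym dtri
  (isT : 0 < 50) inv st.
split=> //; exists s => //; move: hc.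
(* From [50 c <= 20 (100 V + 1) + 21 * 50 V = 3050 V + 20]: the remainder 20 is below 50, hence
   [c <= 61 V] for integers. *)
move: (\sum_(i <- _) _) (\sum_(j <- gC g) _) => S1 S2; lia.
Qed.

End Sol.
End Alg.

(** * The algorithm runs in polynomial time *)

Lemma PT_bitlen {X : Type} {eX : Enc X} (f : X -> nat) : PT f -> PT (fun x => bitlen (f x)).
Proof.
move=> pf.
have h : PT (fun x => (f x %/ 2 ^ trunc_log 2 (f x), bitlen (f x))).
  apply: (@PT_while X (nat * nat) _ _ (fun _ s => (s.1 %/ 2, s.2.+1))
    (fun _ s => 1 < s.1) (fun x => (f x, 1)) (fun x => bitlen (f x))).
  - by pt.
  - by apply: PT_ltn; pt.
  - by pt.
  - exact: (PT_sz pf).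
  - have itE x i : iter i (fun s : nat * nat => (s.1 %/ 2, s.2.+1)) (f x, 1) = (f x %/ 2 ^ i, i.+1).
      elim: i => [|i IH] /=; first by rewrite divn1.
      by rewrite IH /= -divnMA mulnC -expnS.
    exists (fun x => sz (bitlen (f x)).+1 + 2 * sz (f x) + 4).
      apply: pb_add; last exact: pb_const.
      apply: pb_add; last by apply: pb_mul; [exact: pb_const | exact: (PT_sz pf)].
      apply: pb_le (_ : pb (fun x => (bitlen (f x)).+2)); first by move=> x; apply: bitlen_self.
      have := PT_sz pf => h; by apply: pb_le (pb_add h (pb_const 2)) => x; rewrite /sz addn2.
    move=> x i hi; rewrite itE; apply: leq_trans (sz_pair _ _) _.
    apply: leq_add => //; apply: leq_add; first by apply: bitlen_mono.
    by rewrite leq_mul2l; apply/orP; right; apply: bitlen_mono; apply: leq_div.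
  - have itE x i : iter i (fun s : nat * nat => (s.1 %/ 2, s.2.+1)) (f x, 1) = (f x %/ 2 ^ i, i.+1).
      elim: i => [|i IH] /=; first by rewrite divn1.
      by rewrite IH /= -divnMA mulnC -expnS.
    move=> x; exists (trunc_log 2 (f x)); first by [].
    rewrite itE; split=> //=.
      rewrite -leqNgt -ltnS ltn_divLR ?expn_gt0 // -expnS.
      exact: trunc_log_ltn.
    move=> k kl; rewrite itE /=; case: (posnP (f x)) => [e|p].
      by move: kl; rewrite e trunc_log0.
    rewrite leq_divRL ?expn_gt0 // -expnS.
    by apply: leq_trans (trunc_logP (isT : 1 < 2) p); rewrite leq_exp2l.
by have := PT_snd h.
Qed.

Lemma PT_minn {X : Type} {eX : Enc X} (f h : X -> nat) : PT f -> PT h -> PT (fun x => minn (f x) (h x)).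
Proof. by move=> pf ph; rewrite /minn; apply: PT_if => //; apply: PT_ltn. Qed.

Lemma pb_iota {X : Type} {eX : Enc X} (n : X -> nat) : PT n -> pb n -> PT (fun x => iota 0 (n x)).
Proof. by move=> pn bn; apply: PT_iota => //; apply: PT_const. Qed.

Section Acc.
Context {X : Type} {eX : Enc X} (g : X -> gtab).
Hypothesis pg : PT g.
Lemma PT_gr : PT (fun x => gr (g x)). Proof. by rewrite /gr; pt. Qed.
Lemma PT_gW : PT (fun x => gW (g x)). Proof. by rewrite /gW; pt. Qed.
Lemma PT_gV : PT (fun x => gV (g x)). Proof. by rewrite /gV; pt. Qed.
Lemma PT_gC : PT (fun x => gC (g x)). Proof. by rewrite /gC; pt. Qed.
Lemma PT_gF : PT (fun x => gF (g x)). Proof. by rewrite /gF; pt. Qed.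
Lemma PT_gA (j : X -> nat) : PT j -> PT (fun x => gA (g x) (j x)).
Proof. by move=> pj; rewrite /gA; pt. Qed.
Lemma PT_gdp (i j : X -> nat) : PT i -> PT j -> PT (fun x => gdp (g x) (i x) (j x)).
Proof. by move=> pi pj; rewrite /gdp; pt. Qed.
Lemma PT_gd (i j : X -> nat) : PT i -> PT j -> PT (fun x => gd (g x) (i x) (j x)).
Proof. by move=> pi pj; rewrite /gd; pt. Qed.
Lemma PT_gf (i : X -> nat) : PT i -> PT (fun x => gf (g x) (i x)).
Proof. by move=> pi; rewrite /gf; pt. Qed.
Lemma PT_gw (i : X -> nat) : PT i -> PT (fun x => gw (g x) (i x)).
Proof. by move=> pi; rewrite /gw; pt. Qed.
Lemma PT_gn : PT (fun x => gn (g x)). Proof. by rewrite /gn; pt. Qed.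
Lemma PT_gni : PT (fun x => iota 0 (gn (g x))).
Proof. by rewrite /gn; apply: PT_iota_size; pt. Qed.
End Acc.

Ltac ptg := first [ simple apply PT_gr | simple apply PT_gW | simple apply PT_gV
  | simple apply PT_gC | simple apply PT_gF | simple apply PT_gA | simple apply PT_gdp
  | simple apply PT_gd | simple apply PT_gf | simple apply PT_gw | simple apply PT_gni
  | simple apply PT_gn | simple apply PT_bitlen | simple apply PT_minn | simple apply PT_mkseq
  | simple apply PT_ltn ].
Ltac ptx := repeat first [ assumption | ptg | ptstep ].

Section P6a.
Context {X : Type} {eX : Enc X}.
Lemma PT_ysum (Y l : X -> seq nat) : PT Y -> PT l -> PT (fun x => ysum (Y x) (l x)).
Proof. by move=> pY pl; rewrite /ysum; ptx. Qed.
Lemma PT_unitv (p : X -> nat * nat) (i : X -> nat) : PT p -> PT i -> PT (fun x => unitv (p x) (i x)).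
Proof. by move=> pp pi; rewrite /unitv; ptx. Qed.
End P6a.
Section P6b.
Context {X : Type} {eX : Enc X}.
Lemma PT_gdir (h : X -> dir) (i : X -> nat) : PT h -> PT i -> PT (fun x => gdir (h x) (i x)).
Proof. by move=> ph pi; rewrite /gdir; ptx; apply: PT_unitv; ptx. Qed.
Variable g : X -> gtab.
Hypothesis pg : PT g.
Lemma PT_Fs (Dl : X -> seq nat) (j : X -> nat) : PT Dl -> PT j ->
  PT (fun x => Fs (gA (g x)) (gdp (g x)) (Dl x) (j x)).
Proof. by move=> pD pj; rewrite /Fs; ptx. Qed.
Lemma PT_Bs (Dl : X -> seq nat) (j : X -> nat) : PT Dl -> PT j ->
  PT (fun x => Bs (gA (g x)) (gdp (g x)) (Dl x) (j x)).
Proof. by move=> pD pj; rewrite /Bs; ptx. Qed.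
Lemma PT_frac (Z : X -> nat) (Y : X -> seq nat) : PT Z -> PT Y ->
  PT (fun x => frac (gF (g x)) (Z x) (Y x)).
Proof. by move=> pZ pY; rewrite /frac; ptx. Qed.
Lemma PT_wt (p : X -> nat * nat) : PT p -> PT (fun x => wt (gw (g x)) (p x)).
Proof. by move=> pp; rewrite /wt; ptx. Qed.
End P6b.
Ltac pth := first [ simple apply PT_ysum | simple apply PT_gdir | simple apply PT_Fs
  | simple apply PT_Bs | simple apply PT_frac | simple apply PT_wt | simple apply PT_unitv ].
Ltac pty := repeat first [ assumption | pth | ptg | ptstep ].
Section P6c.
Context {X : Type} {eX : Enc X}.
Lemma PT_gsum (h : X -> dir) (l : X -> seq nat) : PT h -> PT l ->
  PT (fun x => gsum (gdir (h x)) (l x)).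
Proof. by move=> ph pl; rewrite /gsum; pty. Qed.
Variable g : X -> gtab.
Hypothesis pg : PT g.
Lemma PT_meet (Dl : X -> seq nat) (j k : X -> nat) : PT Dl -> PT j -> PT k ->
  PT (fun x => meet (gA (g x)) (gdp (g x)) (Dl x) (j x) (k x)).
Proof. by move=> pD pj pk; rewrite /meet; pty. Qed.
Lemma PT_tight (Z : X -> nat) (Y Dl core : X -> seq nat) : PT Z -> PT Y -> PT Dl -> PT core ->
  PT (fun x => tight (gr (g x)) (gA (g x)) (gdp (g x)) (Z x) (Y x) (Dl x) (core x)).
Proof. by move=> pZ pY pD pc; rewrite /tight; pty. Qed.
Lemma PT_rate (Dl : X -> seq nat) (h : X -> dir) : PT Dl -> PT h ->
  PT (fun x => rate (gC (g x)) (gF (g x)) (gA (g x)) (gdp (g x)) (gf (g x)) (Dl x) (gdir (h x))).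
Proof. by move=> pD ph; rewrite /rate; pty. Qed.
Lemma PT_full (st : X -> rstate) : PT st ->
  PT (fun x => full (gr (g x)) (gC (g x)) (gA (g x)) (gdp (g x)) (st x)).
Proof. by move=> ps; rewrite /full; pty. Qed.
Lemma PT_cand (ms : X -> seq (nat * nat)) : PT ms -> PT (fun x => cand (gw (g x)) (ms x)).
Proof. by move=> pm; rewrite /cand /dir; pty. Qed.
Lemma PT_best (cs : X -> seq (nat * int)) : PT cs -> PT (fun x => best (cs x)).
Proof. by move=> pc; rewrite /best; pty. Qed.
End P6c.
Ltac pti := first [ simple apply PT_gsum | simple apply PT_meet | simple apply PT_tight
  | simple apply PT_rate | simple apply PT_full | simple apply PT_cand | simple apply PT_best ].
Ltac ptz := repeat first [ assumption | pti | pth | ptg | ptstep ].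

Section P6d.
Context {X : Type} {eX : Enc X}.
Variable g : X -> gtab.
Hypothesis pg : PT g.
Lemma PT_upd (Dl core : X -> seq nat) (j : X -> nat) : PT Dl -> PT core -> PT j ->
  PT (fun x => upd (gA (g x)) (gdp (g x)) (Dl x) (core x) (j x)).
Proof. by move=> pD pc pj; rewrite /upd; ptz. Qed.
Lemma PT_moves (st : X -> rstate) : PT st ->
  PT (fun x => moves (gn (g x)) (gr (g x)) (gF (g x)) (gA (g x)) (gdp (g x)) (st x)).
Proof.
move=> ps.
pose (F := fun x : X => let s := st x in let fr := frac (gF (g x)) s.1.1 s.1.2 in
  flatten [seq [seq (a, b) | b <- [seq b <- gn (g x) :: fr | (a != b) &&
   all (fun k => (a \in Fs (gA (g x)) (gdp (g x)) s.2.1 k) == (b \in Fs (gA (g x)) (gdp (g x)) s.2.1 k))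
     (tight (gr (g x)) (gA (g x)) (gdp (g x)) s.1.1 s.1.2 s.2.1 s.2.2)]] | a <- fr]).
apply: (@PT_ext _ _ _ _ F); first by move=> x; rewrite /F /moves; case: (st x) => [[? ?] [? ?]].
by rewrite /F /=; ptz.
Qed.
Lemma PT_orient (Dl : X -> seq nat) (h : X -> dir) : PT Dl -> PT h ->
  PT (fun x => orient (gC (g x)) (gF (g x)) (gA (g x)) (gdp (g x)) (gf (g x)) (Dl x) (h x)).
Proof. by move=> pD ph; rewrite /orient /dir in ph *; ptz. Qed.
Lemma PT_slacks (st : X -> rstate) (h : X -> dir) : PT st -> PT h ->
  PT (fun x => slacks (gr (g x)) (gC (g x)) (gF (g x)) (gA (g x)) (gdp (g x)) (st x) (gdir (h x))).
Proof.
move=> ps ph.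
pose (F := fun x : X => let s := st x in
  [seq (s.1.1 - nth 0 s.1.2 i, gdir (h x) i) | i <- frac (gF (g x)) s.1.1 s.1.2] ++
  [seq (nth 0 s.1.2 i, (- gdir (h x) i)%R) | i <- frac (gF (g x)) s.1.1 s.1.2] ++
  [seq (ysum s.1.2 (Fs (gA (g x)) (gdp (g x)) s.2.1 k) - gr (g x) * s.1.1,
     (- gsum (gdir (h x)) (Fs (gA (g x)) (gdp (g x)) s.2.1 k))%R) | k <- s.2.2] ++
  [seq (gr (g x) * s.1.1 - ysum s.1.2 (Bs (gA (g x)) (gdp (g x)) s.2.1 j),
     gsum (gdir (h x)) (Bs (gA (g x)) (gdp (g x)) s.2.1 j)) | j <- gC (g x)]).
apply: (@PT_ext _ _ _ _ F); first by move=> x; rewrite /F /slacks; case: (st x) => [[? ?] [? ?]].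
by rewrite /F /=; ptz.
Qed.
Lemma PT_rout (st : X -> rstate) : PT st -> PT (fun x => rout (gF (g x)) (gw (g x)) (st x)).
Proof.
move=> ps.
pose (F := fun x : X => let s := st x in let l := frac (gF (g x)) s.1.1 s.1.2 in
  [seq i <- gF (g x) | nth 0 s.1.2 i == s.1.1] ++
  if size l == 2 then [:: if gw (g x) (nth 0 l 0) <= gw (g x) (nth 0 l 1) then nth 0 l 0 else nth 0 l 1]
  else [::]).
apply: (@PT_ext _ _ _ _ F).
  by move=> x; rewrite /F /rout /=; congr (_ ++ _); case: (frac _ _ _) => [|a [|b [|c l]]].
by rewrite /F /=; ptz.
Qed.
End P6d.
Ltac ptj := first [ simple apply PT_upd | simple apply PT_moves | simple apply PT_orient
  | simple apply PT_slacks | simple apply PT_rout ].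
Ltac ptw := repeat first [ assumption | ptj | pti | pth | ptg | ptstep ].

Section P6e.
Context {X : Type} {eX : Enc X}.
Variable g : X -> gtab.
Hypothesis pg : PT g.
Lemma PT_move (st : X -> rstate) (h : X -> dir) : PT st -> PT h ->
  PT (fun x => move (gn (g x)) (gr (g x)) (gC (g x)) (gF (g x)) (gA (g x)) (gdp (g x)) (st x) (h x)).
Proof.
move=> ps ph.
have pc : PT (fun x => best (slacks (gr (g x)) (gC (g x)) (gF (g x)) (gA (g x)) (gdp (g x)) (st x) (gdir (h x)))).
  by ptw.
rewrite /move; move: pc; set c := (X in PT X) => pc.
by change (PT (fun x => ((`|(c x).2|%N * (st x).1.1, mkseq (fun i => `|((c x).2 * Posz (nth 0%N (st x).1.2 i)
  + Posz (c x).1 * gdir (h x) i)%R|%N) (gn (g x))), (st x).2))); ptw.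
Qed.
Lemma PT_shrink (st : X -> rstate) (j : X -> nat) : PT st -> PT j ->
  PT (fun x => shrink (gn (g x)) (gA (g x)) (gdp (g x)) (st x) (j x)).
Proof.
move=> ps pj.
have pD : PT (fun x => mkseq (fun k => if k == j x then nth 0 (st x).2.1 (j x) %/ 2 else nth 0 (st x).2.1 k) (gn (g x))).
  by ptw.
by rewrite /shrink /rstate /= in ps *; ptw.
Qed.
End P6e.

Lemma PT_gstep : PT (fun p : gtab * rstate => gstep p.1 p.2).
Proof.
rewrite /gstep /rstep.
apply: (@PT_match _ _ _ _ _ _ (fun p : gtab * rstate => full (gr p.1) (gC p.1) (gA p.1) (gdp p.1) p.2)
  _ (fun p j _ => shrink (gn p.1) (gA p.1) (gdp p.1) p.2 j)).
- by ptw.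
- apply: (@PT_match _ _ _ _ _ _
    (fun p : gtab * rstate => cand (gw p.1) (moves (gn p.1) (gr p.1) (gF p.1) (gA p.1) (gdp p.1) p.2))
    (fun p => p.2) (fun p h _ => move (gn p.1) (gr p.1) (gC p.1) (gF p.1) (gA p.1) (gdp p.1) p.2
      (orient (gC p.1) (gF p.1) (gA p.1) (gdp p.1) (gf p.1) p.2.2.1 h))).
  + by ptw.
  + by ptw.
  + by apply: (@PT_move _ _ (fun p => p.1.1)); ptw.
- by apply: (@PT_shrink _ _ (fun p => p.1.1)); ptw.
Qed.

Lemma PT_spr {X : Type} {eX : Enc X} (d : X -> nat) (cs : X -> seq (nat * int)) :
  PT (fun x => iota 0 (d x)) -> PT cs -> PT (fun x => spr (d x) (cs x)).
Proof. by move=> pd pc; rewrite /spr; ptx. Qed.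

Lemma pb_gn : pb (fun g : gtab => gn g).
Proof. by apply: pb_size; ptx. Qed.

Lemma PT_ldim : PT (fun g : gtab => iota 0 (ldim g)).
Proof.
apply: pb_iota; rewrite /ldim; first by ptx.
by have := pb_gn => h; pbs.
Qed.

Section LPa.
Context {X : Type} {eX : Enc X}.
Variable g : X -> gtab.
Hypothesis pg : PT g.
Lemma PT_sE : PT (fun x => sE (g x)). Proof. by rewrite /sE /cw /cc; ptx. Qed.
Lemma PT_cw : PT (fun x => cw (g x)). Proof. by rewrite /cw; ptx. Qed.
Lemma PT_cc : PT (fun x => cc (g x)). Proof. by rewrite /cc; ptx. Qed.
Lemma PT_yi (i : X -> nat) : PT i -> PT (fun x => yi (i x)). Proof. by move=> pi; rewrite /yi; ptx. Qed.
Lemma PT_xi (i j : X -> nat) : PT i -> PT j -> PT (fun x => xi (g x) (i x) (j x)).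
Proof. by move=> pi pj; rewrite /xi; ptx. Qed.
End LPa.
Ltac ptl := repeat first [ assumption | simple apply PT_sE | simple apply PT_cw | simple apply PT_cc
  | simple apply PT_yi | simple apply PT_xi | ptg | ptstep ].

Lemma PT_rW : PT (fun g : gtab => rW g). Proof. by rewrite /rW; ptl. Qed.
Lemma PT_rV : PT (fun g : gtab => rV g). Proof. by rewrite /rV; ptl. Qed.
Lemma PT_lprows : PT (fun g : gtab => lprows g).
Proof. by have pW := PT_rW; have pV := PT_rV; rewrite /lprows; ptl. Qed.
Lemma PT_lpM : PT (fun g : gtab => lpM g).
Proof.
have pr := PT_lprows; have pd := PT_ldim; rewrite /lpM; apply: PT_map => //.
by apply: (@PT_spr _ _ (fun q : gtab * seq (nat * int) => ldim q.1)); ptl.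
Qed.
Lemma PT_lpG : PT (fun g : gtab => lpG g).
Proof.
have pM := PT_lpM; have pd := PT_ldim; have pd' := PT_of_iota pd.
by rewrite /lpG; have pB := PT_lpB pd pM; ptl.
Qed.
Lemma PT_lpnit : PT (fun g : gtab => lpnit g).
Proof. by have pM := PT_lpM; have pG := PT_lpG; rewrite /lpnit /lpth; ptl. Qed.
Lemma pb_lpnit : pb (fun g : gtab => lpnit g).
Proof.
have bM := pb_size PT_lpM; have bG : pb (fun g : gtab => bitlen (lpG g)) := PT_sz PT_lpG.
rewrite /lpnit /lpth.
have q : pb (fun g : gtab => (size (lpM g)).+1) by apply: pb_le (pb_add bM (pb_const 1)) => x; rewrite addn1.
have q2 : pb (fun g : gtab => (size (lpM g) * bitlen (lpG g)).+1).
  by apply: pb_le (pb_add (pb_mul bM bG) (pb_const 1)) => x; rewrite addn1.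
by pbs.
Qed.
Lemma PT_lpst : PT (fun g : gtab => lpst g).
Proof. by apply: PT_lp_run; [exact: PT_ldim | exact: PT_lpnit | exact: pb_lpnit | exact: PT_lpM]. Qed.
Lemma PT_lpsol : PT (fun g : gtab => lp_sol (ldim g) (lpst g)).
Proof. by have ps := PT_lpst; apply: PT_lp_u; first exact: PT_ldim; ptl. Qed.
Lemma PT_lpok : PT (fun g : gtab => lpok g).
Proof.
apply: PT_nilp; apply: PT_lp_viol; [exact: PT_ldim | exact: PT_lpM | exact: PT_lpsol].
Qed.

Lemma PT_lpv {X : Type} {eX : Enc X} (g : X -> gtab) (i : X -> nat) : PT g -> PT i ->
  PT (fun x => lpv (g x) (i x)).
Proof.
move=> pg pi; rewrite /lpv; apply: PT_absz; apply: PT_nth => //.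
exact: (PT_comp PT_lpsol pg).
Qed.

Lemma PT_gZ : PT (fun g : gtab => gZ g).
Proof. by rewrite /gZ; apply: PT_mul; [apply: PT_sE; ptl | apply: PT_lpv; ptl]. Qed.
Lemma PT_gY : PT (fun g : gtab => gY g).
Proof.
have pZ := PT_gZ; rewrite /gY; apply: PT_mkseq; first by ptl.
apply: PT_minn; first by ptl.
by apply: PT_mul; [ptl | apply: PT_lpv; ptl].
Qed.
Lemma PT_okD {X : Type} {eX : Enc X} (g : X -> gtab) (Z : X -> nat) (Y : X -> seq nat) (j v : X -> nat) :
  PT g -> PT Z -> PT Y -> PT j -> PT v -> PT (fun x => okD (g x) (Z x) (Y x) (j x) (v x)).
Proof. by move=> pg pZ pY pj pv; rewrite /okD; pty. Qed.
Lemma PT_gDl : PT (fun g : gtab => gDl g (gZ g) (gY g)).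
Proof.
have pZ := PT_gZ; have pY := PT_gY; rewrite /gDl; apply: PT_mkseq; first by ptl.
by rewrite /selD; repeat first [assumption | simple apply PT_okD | ptg | ptstep].
Qed.

Lemma sz_mem (l : seq nat) k : k \in l -> sz k <= sz l.
Proof. by move=> kl; rewrite -[k in sz k](nth_index 0 kl); apply: sz_nth; rewrite index_mem. Qed.

Lemma upd_sub A dp Dl co j k : k \in upd A dp Dl co j -> (k \in co) || (k == j).
Proof.
rewrite /upd; case: ifP => _; rewrite ?in_cons mem_filter; first by move=> /andP[_ ->].
by rewrite mem_filter => /orP[->|/and3P[_ _ ->]] //; rewrite orbT.
Qed.

Lemma upd_size A dp Dl co j : size (upd A dp Dl co j) <= (size co).+1.
Proof.
rewrite /upd; case: ifP => _ /=; rewrite size_filter.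
  exact: leq_trans (count_size _ _) (leqnSn _).
by rewrite ltnS; apply: leq_trans (count_size _ _) _; rewrite size_filter; exact: count_size.
Qed.

Lemma sz_seqnat (l : seq nat) L M : size l <= L -> (forall k, k \in l -> sz k <= M) ->
  sz l <= L * (2 * M + 4) + 1.
Proof.
move=> hL hM; apply: leq_trans (sz_le (M := M) _) _.
  by move=> i il a0; apply/hM/mem_nth.
by rewrite leq_add2r leq_mul2r hL orbT.
Qed.

Lemma gcore_bnd (g : gtab) Dl i : i <= size (gC g) ->
  let co := foldl (upd (gA g) (gdp g) Dl) [::] (take i (gC g)) in
  size co <= size (gC g) /\ forall k, k \in co -> k \in gC g.
Proof.
move=> hi /=; 
have sub k : k \in take i (gC g) -> k \in gC g by apply: mem_take.
suff [h1 h2] : size (foldl (upd (gA g) (gdp g) Dl) [::] (take i (gC g))) <= size (take i (gC g)) /\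
   forall k, k \in foldl (upd (gA g) (gdp g) Dl) [::] (take i (gC g)) -> k \in take i (gC g).
  by split; [apply: leq_trans h1 _; rewrite size_takel | move=> k /h2 /sub].
elim/last_ind: (take i (gC g)) {sub} => [|l j [IH1 IH2]] //=.
rewrite -cats1 foldl_cat size_cat addn1 /=; split; first exact: leq_trans (upd_size _ _ _ _ _) _.
by move=> k /upd_sub /orP[/IH2|/eqP ->]; rewrite mem_cat ?inE ?eqxx ?orbT // => ->.
Qed.

Lemma PT_gcore : PT (fun g : gtab => gcore g (gDl g (gZ g) (gY g))).
Proof.
have pD := PT_gDl; rewrite /gcore.
apply: (@PT_foldl gtab _ _ _ _ _ (fun g co j => upd (gA g) (gdp g) (gDl g (gZ g) (gY g)) co j) (fun=> [::]) gC).
- by apply: (@PT_upd _ _ (fun p : gtab * (seq nat * nat) => p.1)); ptl.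
- by ptl.
- by ptl.
exists (fun g => size (gC g) * (2 * sz (gC g) + 4) + 1).
  have p1 : PT (fun g : gtab => gC g) by ptl.
  have b1 := pb_size p1; have b2 : pb (fun g : gtab => sz (gC g)) := PT_sz p1; by pbs.
move=> g i hi; have [h1 h2] := gcore_bnd (gDl g (gZ g) (gY g)) hi.
by apply: sz_seqnat => // k /h2; apply: sz_mem.
Qed.

Lemma PT_gst0 : PT (fun g : gtab => gst0 g).
Proof.
have p1 := PT_gcore; have p2 := PT_gDl; have p3 := PT_gZ; have p4 := PT_gY.
by rewrite /gst0 /rstate; ptl.
Qed.

(** * Lengths of the numbers during the rounding *)

Definition bst (n m D k L : nat) (st : rstate) : Prop :=
  [/\ st.1.1 <= m, size st.1.2 = n /\ (forall i, nth 0 st.1.2 i <= m),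
      size st.2.1 = n /\ (forall i, nth 0 st.2.1 i <= D)
    & size st.2.2 <= L /\ (forall i, i \in st.2.2 -> i <= k)].

Definition gws (g : gtab) : nat := \sum_(c <- g.2.2.2.2) c.
Definition gas (g : gtab) : nat := \sum_(l <- g.2.1.1) size l.
(** A bound for the factor by which one move can enlarge [Z] and [Y]. It depends on the table only,
    as the coefficients of a direction are weights and not earlier values. *)
Definition gQ (g : gtab) : nat := (2 * gas g + 3 + gr g) * (2 * gws g + 1).

Lemma nth_le_sum (T : Type) (a0 : T) (h : T -> nat) (l : seq T) i : h a0 = 0 ->
  h (nth a0 l i) <= \sum_(c <- l) h c.
Proof.
move=> h0; elim: l i => [|c l IH] i; first by rewrite nth_nil h0.
by rewrite big_cons; case: i => [|i] /=; rewrite ?leq_addr // (leq_trans (IH i)) ?leq_addl.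
Qed.

Lemma best_mem (cs : seq (nat * int)) : best cs \in cs \/ best cs = (0, 1%R).
Proof.
rewrite /best; set l := [seq c <- _ | _].
have: {subset l <= cs} by move=> c; rewrite !mem_filter => /and3P[].
by case: l => [|c l] h; [right | left; apply: h; exact: mem_head].
Qed.

Lemma move_arith (c2 G : int) (c1 Yk m H a_ r_ : nat) : `|c2|%N <= (a_ + 1) * H ->
  `|G|%N <= H -> c1 <= (1 + a_ + r_) * m -> Yk <= m ->
  `|(c2 * Posz Yk + Posz c1 * G)%R|%N <= (2 * a_ + 3 + r_) * H * m.
Proof.
move=> h1 h2 h3 h4.
apply: leq_trans (_ : `|c2|%N * Yk + c1 * `|G|%N <= _).
  by have := abszM c2 (Posz Yk); have := abszM (Posz c1) G; rewrite !absz_nat => <- <-; lia.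
apply: leq_trans (leq_add (leq_mul h1 h4) (leq_mul h3 h2)) _.
have -> : (a_ + 1) * H * m + (1 + a_ + r_) * m * H = (2 * a_ + 2 + r_) * (H * m) by ring.
by rewrite -mulnA leq_mul2r; apply/orP; right; lia.
Qed.

Lemma gstep_bst (g : gtab) m D k L st : bst (gn g) m D k L st ->
  (forall j, j \in gC g -> j <= k) -> bst (gn g) (gQ g * m) D k L.+1 (gstep g st).
Proof.
case: st => [[Z Y] [Dl core]] [/= hZ [sY hY] [sD hD] [sc hc]] hC.
have Q1 : 1 <= gQ g by rewrite /gQ muln_gt0; apply/andP; split; lia.
have mQ : m <= gQ g * m by rewrite leq_pmull.
rewrite /gstep /rstep; case Ef: (full _ _ _ _ _) => [|j js]; last first.
  have jC : j \in gC g.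
    have : j \in full (gr g) (gC g) (gA g) (gdp g) ((Z, Y), (Dl, core)) by rewrite Ef mem_head.
    by rewrite mem_filter => /andP[].
  split=> /=; first exact: leq_trans mQ.
  - by split=> // i; apply: leq_trans mQ.
  - split; first by rewrite size_mkseq.
    move=> i; case: (ltnP i (gn g)) => hi; last by rewrite nth_default ?size_mkseq.
    by rewrite nth_mkseq //; case: ifP => _ //; apply: leq_trans (leq_div _ _) _.
  - split; first by apply: leq_trans (upd_size _ _ _ _ _) _.
    by move=> i /upd_sub /orP[/hc|/eqP ->] //; apply: hC.
case Ec: (cand _ _) => [|h0 hs].
  split=> /=; first exact: leq_trans mQ.
  - by split=> // i; apply: leq_trans mQ.
  - by [].
  - by split=> //; apply: leqW.
have hw i : gw g i <= gws g by apply: (nth_le_sum (h := id)).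
have hA j : size (gA g j) <= gas g by apply: (nth_le_sum (h := size)).
have hwt p : `|wt (gw g) p|%N <= gws g by rewrite /wt; have := hw p.1; have := hw p.2; lia.
set H := 2 * gws g + 1.
have co0 : `|h0.2.1|%N + `|h0.2.2|%N <= H.
  have : h0 \in cand (gw g) (moves (gn g) (gr g) (gF g) (gA g) (gdp g) ((Z, Y), (Dl, core))).
    by rewrite Ec mem_head.
  rewrite mem_cat => /orP[/mapP[u _ ->]|/flatten_mapP[u _ /mapP[v _ ->]]] /=.
    by rewrite /H; lia.
  by rewrite abszN; have := hwt u; have := hwt v; rewrite /H; lia.
set h := orient _ _ _ _ _ _ h0.
have co : `|h.2.1|%N + `|h.2.2|%N <= H.
  by rewrite /h /orient; case: ifP => _ //=; rewrite !abszN.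
have hG i : `|gdir h i|%N <= H.
  apply: leq_trans co; rewrite /gdir /unitv.
  by move: (h.2.1) (h.2.2) => s t; do 4 case: (_ == _); rewrite /=; lia.
have hS l : `|gsum (gdir h) l|%N <= size l * H.
  rewrite /gsum; elim: l => [|i l IH] /=; first by rewrite big_nil.
  rewrite big_cons mulSn; apply: leq_trans (leq_add (hG i) IH).
  by move: (gdir h i) (\sum_(j <- l) _)%R => u v; lia.
have hy l : ysum Y l <= size l * m.
  rewrite /ysum; elim: l => [|i l IH] /=; first by rewrite big_nil.
  by rewrite big_cons mulSn leq_add.
have fsz (p : pred nat) j : size [seq i <- gA g j | p i] <= gas g.
  by rewrite size_filter; apply: leq_trans (count_size _ _) (hA j).
rewrite /move /=; set c := best _.
have [hc1 hc2] : c.1 <= (1 + gas g + gr g) * m /\ `|c.2|%N <= (gas g + 1) * H.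
  have HH : H <= (gas g + 1) * H by rewrite leq_pmull // addn1.
  have gH j (p : pred nat) : size [seq i <- gA g j | p i] * H <= (gas g + 1) * H.
    by rewrite leq_mul2r (leq_trans (fsz p j)) ?orbT // leq_addr.
  have m1 : m <= (1 + gas g + gr g) * m by rewrite leq_pmull.
  case: (best_mem (slacks (gr g) (gC g) (gF g) (gA g) (gdp g) ((Z, Y), (Dl, core)) (gdir h))); rewrite -/c.
    rewrite !mem_cat => /or4P[] /mapP[i _ ->] /=.
    - by split; [apply: leq_trans (leq_subr _ _) _; apply: leq_trans m1 | exact: leq_trans HH].
    - by rewrite abszN; split; [exact: leq_trans m1 | exact: leq_trans HH].
    - rewrite abszN; split; last exact: leq_trans (hS _) (gH _ _).
      apply: leq_trans (leq_subr _ _) _; apply: leq_trans (hy _) _.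
      by rewrite leq_mul2r; apply/orP; right; apply: leq_trans (fsz _ _) _; lia.
    - split; last exact: leq_trans (hS _) (gH _ _).
      apply: leq_trans (leq_subr _ _) _; apply: leq_trans (leq_mul (leqnn _) hZ) _.
      by rewrite leq_mul2r; apply/orP; right; lia.
  by move=> -> /=; split=> //; apply: leq_trans HH; rewrite /H; lia.
split=> /=.
- apply: leq_trans (leq_mul hc2 hZ) _; rewrite /gQ -/H leq_mul2r; apply/orP; right.
  by rewrite leq_mul2r; apply/orP; right; lia.
- split; first by rewrite size_mkseq.
  move=> i; case: (ltnP i (gn g)) => hi; last by rewrite nth_default ?size_mkseq.
  by rewrite nth_mkseq //; apply: move_arith.
- by [].
- by split=> //; apply: leqW.
Qed.

Definition szb (n bM bD bk L : nat) : nat :=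
  (L * (2 * bk + 4) + 1 + 2 * (n * (2 * bD + 4) + 1) + 4)
  + 2 * (n * (2 * bM + 4) + 1 + 2 * bM + 4) + 4.

Lemma bst_sz n m D k L st bM : bst n m D k L st -> bitlen m <= bM ->
  sz st <= szb n bM (bitlen D) (bitlen k) L.
Proof.
case: st => [[Z Y] [Dl core]] [/= hZ [sY hY] [sD hD] [sc hc]] hM.
have z1 : sz Z <= bM by apply: leq_trans hM; apply: bitlen_mono.
have z2 : sz Y <= n * (2 * bM + 4) + 1.
  apply: sz_seqnat => [|i iY]; first by rewrite sY.
  by apply: leq_trans hM; apply: bitlen_mono; have := hY (index i Y); rewrite nth_index.
have z3 : sz Dl <= n * (2 * bitlen D + 4) + 1.
  apply: sz_seqnat => [|i iY]; first by rewrite sD.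
  by apply: bitlen_mono; have := hD (index i Dl); rewrite nth_index.
have z4 : sz core <= L * (2 * bitlen k + 4) + 1.
  by apply: sz_seqnat => // i /hc; apply: bitlen_mono.
apply: leq_trans (sz_pair (Z, Y) (Dl, core)) _; rewrite /szb leq_add2r; apply: leq_add.
  by apply: leq_trans (sz_pair Dl core) _; rewrite leq_add2r; apply: leq_add => //; rewrite leq_mul2l z3 orbT.
rewrite leq_mul2l; apply/orP; right; apply: leq_trans (sz_pair Z Y) _; rewrite leq_add2r.
by apply: leq_add => //; rewrite leq_mul2l z1 orbT.
Qed.

Definition gm0 (g : gtab) : nat := gZ g + \sum_(c <- gY g) c.
Definition gD0 (g : gtab) : nat := \sum_(c <- gDl g (gZ g) (gY g)) c.
Definition gk0 (g : gtab) : nat := \sum_(c <- gC g) c.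

Lemma gst0_bst (g : gtab) : bst (gn g) (gm0 g) (gD0 g) (gk0 g) (size (gC g)) (gst0 g).
Proof.
have [h1 h2] := gcore_bnd (gDl g (gZ g) (gY g)) (leqnn (size (gC g))).
rewrite take_size in h1 h2.
split; rewrite /gst0 /=; first exact: leq_addr.
- split; first by rewrite size_mkseq.
  by move=> i; apply: leq_trans (leq_addl _ _); apply: (nth_le_sum (h := id)).
- split; first by rewrite size_mkseq.
  by move=> i; apply: (nth_le_sum (h := id)).
- split; first exact: h1.
  by move=> i /h2 iC; rewrite -(nth_index 0 iC); apply: (nth_le_sum (h := id)).
Qed.

Lemma giter_bst (g : gtab) i :
  bst (gn g) (gQ g ^ i * gm0 g) (gD0 g) (gk0 g) (size (gC g) + i) (iter i (gstep g) (gst0 g)).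
Proof.
elim: i => [|i IH]; first by rewrite mul1n addn0; exact: gst0_bst.
rewrite iterS expnS -mulnA addnS; apply: gstep_bst => // j jC.
by rewrite -(nth_index 0 jC); apply: (nth_le_sum (h := id)).
Qed.

Lemma PT_gN : PT (fun g : gtab => gN g (gst0 g).2.1).
Proof. by have p := PT_gDl; rewrite /gN /gst0 /=; ptl. Qed.

Lemma pb_gN : pb (fun g : gtab => gN g (gst0 g).2.1).
Proof.
have pC : PT (fun g : gtab => gC g) by ptl.
have b1 := pb_size pC; have b2 := pb_gn.
have b3 : pb (fun g : gtab => sz (gDl g (gZ g) (gY g))) := PT_sz PT_gDl.
apply: pb_le (_ : pb (fun g : gtab => (size (gC g) * sz (gDl g (gZ g) (gY g))) * (3 * gn g + 1) + 3 * gn g)).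
  move=> g; rewrite /gN leq_add2r leq_mul2r; apply/orP; right.
  rewrite -sum1_size big_distrl /=; apply: leq_sum => j _; rewrite mul1n /gst0 /=.
  case: (ltnP j (size (gDl g (gZ g) (gY g)))) => hj; first exact: sz_nth.
  by rewrite nth_default // (leq_trans _ (szp _)).
by pbs.
Qed.

Lemma PT_grun : PT (fun g : gtab => grun g).
Proof.
apply: (@PT_iter gtab _ _ _ (fun g => gN g (gst0 g).2.1) gstep gst0).
- exact: PT_gN.
- exact: pb_gN.
- exact: PT_gstep.
- exact: PT_gst0.
pose (N := fun g : gtab => gN g (gst0 g).2.1).
(* Each step adds at most the length of [gQ] to the lengths, and the number of steps is
   polynomial. *)
pose (bM := fun g : gtab => N g * bitlen (gQ g) + 1 + bitlen (gm0 g)).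
exists (fun g => szb (gn g) (bM g) (bitlen (gD0 g)) (bitlen (gk0 g)) (size (gC g) + N g)).
  have bN : pb N := pb_gN; have b2 := pb_gn.
  have pC : PT (fun g : gtab => gC g) by ptl.
  have b1 := pb_size pC; have pY := PT_gY; have pD := PT_gDl; have pZ := PT_gZ.
  have pQ : PT (fun g : gtab => gQ g) by rewrite /gQ /gas /gws; ptl.
  have bQ : pb (fun g : gtab => bitlen (gQ g)) := PT_sz pQ.
  have pm : PT (fun g : gtab => gm0 g) by rewrite /gm0; ptl.
  have bm : pb (fun g : gtab => bitlen (gm0 g)) := PT_sz pm.
  have pD0 : PT (fun g : gtab => gD0 g) by rewrite /gD0; ptl.
  have bD : pb (fun g : gtab => bitlen (gD0 g)) := PT_sz pD0.
  have pk : PT (fun g : gtab => gk0 g) by rewrite /gk0; ptl.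
  have bk : pb (fun g : gtab => bitlen (gk0 g)) := PT_sz pk.
  have bbM : pb bM by rewrite /bM; pbs.
  by rewrite /szb; pbs.
move=> g i hi; apply: leq_trans (bst_sz (bM := bM g) (giter_bst g i) _) _.
  apply: leq_trans (bitlen_mul _ _) _; rewrite leq_add2r.
  apply: leq_trans (bitlen_exp _ _) _; rewrite leq_add2r leq_mul2r; apply/orP; right.
  exact: hi.
rewrite /szb !leq_add2r !leq_mul2r; apply/orP; right; rewrite leq_add2l; exact: hi.
Qed.

Lemma PT_gsol : PT (fun g : gtab => gsol g).
Proof. by have p := PT_grun; rewrite /gsol; apply: PT_rout; ptl. Qed.

(** * Guessing the optimum *)

Definition inst := (((nat * nat) * (seq nat * seq nat)) * ((seq nat * seq nat) * seq (seq nat)))%type.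

(** Distance 0 is kept, as the rounded value must not exceed twice the distance. *)
Definition dpw (c : nat) : nat := if c == 0 then 0 else pw c.

Definition fac_ (x : inst) (V : nat) : seq nat := [seq i <- x.1.2.2 | nth 0 x.2.1.1 i <= V].
Definition id_ (x : inst) (i j : nat) : nat := nth 0 (nth [::] x.2.2 i) j.
Definition At_ (x : inst) (V j : nat) : seq nat :=
  [seq i <- fac_ x V | \sum_(k <- x.1.2.1) (id_ x i j - id_ x j k) <= V].

Definition mktab (x : inst) (V : nat) : gtab :=
  ((x.1.1, (V, (x.1.2.1, fac_ x V))),
   ((mkseq (At_ x V) (size x.2.2),
     mkseq (fun i => mkseq (fun j => dpw (id_ x i j)) (size x.2.2)) (size x.2.2)),
    (x.2.2, x.2.1))).

Definition itot (x : inst) : nat :=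
  \sum_(c <- x.2.1.1) c + \sum_(l <- x.2.2) \sum_(c <- l) c.

(** The minimum changes no exponent of this list; it bounds the exponent for an arbitrary argument
    [k], which makes the power computable in polynomial time. *)
Definition Vlist (x : inst) : seq nat :=
  0 :: [seq 2 ^ minn k (bitlen (itot x)) | k <- iota 0 (bitlen (itot x)).+1].

Definition minsel (p : pred nat) (l : seq nat) : nat :=
  head 0 [seq v <- l | p v && all (fun u => ~~ p u || (v <= u)) l].

Definition Vsel (x : inst) : nat := minsel (fun V => lpok (mktab x V)) (Vlist x).

Definition solve (x : inst) : seq nat := gsol (mktab x (Vsel x)).

Section PTinst.
Context {X : Type} {eX : Enc X} (x : X -> inst).
Hypothesis px : PT x.
Lemma PT_id_ (i j : X -> nat) : PT i -> PT j -> PT (fun y => id_ (x y) (i y) (j y)).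
Proof. by move=> pi pj; rewrite /id_; ptx. Qed.
Lemma PT_dpw (c : X -> nat) : PT c -> PT (fun y => dpw (c y)).
Proof. by move=> pc; rewrite /dpw; ptx. Qed.
Lemma PT_fac_ (V : X -> nat) : PT V -> PT (fun y => fac_ (x y) (V y)).
Proof. by move=> pV; rewrite /fac_; ptx. Qed.
End PTinst.

Lemma PT_mktab {X : Type} {eX : Enc X} (x : X -> inst) (V : X -> nat) : PT x -> PT V ->
  PT (fun y => mktab (x y) (V y)).
Proof.
move=> px pV.
have pio : PT (fun y => iota 0 (size (x y).2.2)) by apply: PT_iota_size; ptx.
have pA : PT (fun y => mkseq (At_ (x y) (V y)) (size (x y).2.2)).
  apply: PT_mkseq => //; rewrite /At_.
  by repeat first [assumption | simple apply PT_fac_ | simple apply PT_id_ | ptg | ptstep].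
have pdp : PT (fun y => mkseq (fun i => mkseq (fun j => dpw (id_ (x y) i j)) (size (x y).2.2)) (size (x y).2.2)).
  by repeat first [assumption | simple apply PT_dpw | simple apply PT_id_ | ptg | ptstep].
have pF := PT_fac_ px pV.
by rewrite /mktab /gtab; ptx.
Qed.

Lemma PT_Vlist : PT Vlist.
Proof.
have pt_ : PT (fun x : inst => itot x) by rewrite /itot; ptx.
have b1 : pb (fun x : inst => bitlen (itot x)) := PT_sz pt_.
have b2 : pb (fun x : inst => (bitlen (itot x)).+1).
  by apply: pb_le (pb_add b1 (pb_const 1)) => y; rewrite addn1.
have p2 : PT (fun x : inst => iota 0 (bitlen (itot x)).+1) by apply: pb_iota => //; ptx.
rewrite /Vlist; apply: PT_cons; first by ptx.
apply: PT_map => //.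
apply: (@PT_expn _ _ (fun=> 2) (fun q : inst * nat => minn q.2 (bitlen (itot q.1)))); first by ptx.
apply: pb_iota; first by ptx.
apply: pb_le (_ : pb (fun q : inst * nat => bitlen (itot q.1))); first by move=> q; exact: geq_minr.
have pf : PT (fun q : inst * nat => itot q.1) by ptx.
exact: (PT_sz pf).
Qed.

Lemma PT_Vsel : PT Vsel.
Proof.
have pV := PT_Vlist; rewrite /Vsel /minsel.
have pm (Y : Type) (eY : Enc Y) (x : Y -> inst) (V : Y -> nat) : PT x -> PT V ->
    PT (fun y => lpok (mktab (x y) (V y))).
  by move=> px pV'; apply: (PT_comp PT_lpok); apply: PT_mktab.
by repeat first [assumption | simple apply pm | ptg | ptstep].
Qed.

Lemma PT_solve : PT solve.
Proof.
have pV := PT_Vsel; rewrite /solve; apply: (PT_comp PT_gsol); apply: PT_mktab; ptx.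
Qed.

(** * Reading the input word and packing the output *)

Definition nz1 (a : nat) : nat := if a == 0 then 1 else a.
(* Every entry of the input word, hence every denominator in it, divides this scale. *)
Definition scl (l : seq nat) : nat := foldl (fun p a => p * nz1 a) 1 l.
(** In an arbitrary word the first entry may be exponential in the length; the minimum keeps the
    tables of polynomial size. *)
Definition pn (l : seq nat) : nat := minn (nth 0 l 0) (size l).
Definition pval (l : seq nat) (k : nat) : nat := nth 0 l k * (scl l %/ nth 0 l k.+1).
Definition pC (l : seq nat) : seq nat := [seq i <- iota 0 (pn l) | nth 0 l (4 + i) != 0].
Definition pF (l : seq nat) : seq nat := [seq i <- iota 0 (pn l) | nth 0 l (4 + pn l + i) != 0].
(** Costs and weights are listed for facilities only, so that their place depends on the rank of [i]
    among the facilities. *)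
Definition prk (l : seq nat) (i : nat) : nat := 4 + 2 * pn l + 4 * size [seq k <- pF l | k < i].
Definition pD (l : seq nat) (i j : nat) : nat :=
  pval l (4 + 2 * pn l + 4 * size (pF l) + 2 * (i * pn l + j)).
Definition pfl (l : seq nat) : seq nat :=
  mkseq (fun i => if i \in pF l then pval l (prk l i) else 0) (pn l).
Definition pwl (l : seq nat) : seq nat :=
  mkseq (fun i => if i \in pF l then pval l (prk l i + 2) else 0) (pn l).
Definition parse (l : seq nat) : inst :=
  (((nth 0 l 1, pval l 2), (pC l, pF l)),
   ((pfl l, pwl l), mkseq (fun i => mkseq (pD l i) (pn l)) (pn l))).

Definition bits (l : seq nat) : seq nat :=
  let S := solve (parse l) in mkseq (fun i => nat_of_bool (i \in S)) (pn l).
(** The inner minimum equals [i] in the range of the sum; as above it serves to bound the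
    exponent. *)
Definition lowbits (k : nat) (b : seq nat) : nat :=
  \sum_(i <- iota 0 (minn k (size b))) nth 0 b i * 2 ^ minn i (size b).
(** The first [q.1] bits are packed into one number, since the registers where they belong are in
    use until the very end. *)
Definition main (q : nat * seq nat) : nat * seq nat :=
  (lowbits q.1 (bits q.2), drop q.1 (bits q.2)).

Lemma scl_bitlen l p : bitlen (foldl (fun p a => p * nz1 a) p l) <= bitlen p + \sum_(a <- l) bitlen a.
Proof.
elim: l p => [|a l IH] p /=; first by rewrite big_nil addn0.
rewrite big_cons addnA; apply: leq_trans (IH _) _; rewrite leq_add2r.
apply: leq_trans (bitlen_mul _ _) _; rewrite leq_add2l /nz1; case: eqP => [->|] //.
Qed.

Lemma sum_bitlen_sz (l : seq nat) : \sum_(a <- l) bitlen a <= sz l * sz l.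
Proof.
apply: leq_trans (_ : size l * sz l <= _); last by rewrite leq_mul2r size_sz orbT.
rewrite -sum1_size big_distrl /= big_seq [X in _ <= X]big_seq; apply: leq_sum => a al.
by rewrite mul1n; apply: sz_mem.
Qed.

Lemma PT_scl0 : PT scl.
Proof.
rewrite /scl; apply: (@PT_foldl _ _ _ _ _ _ (fun (_ : seq nat) p a => p * nz1 a) (fun=> 1) (fun l => l)).
- by rewrite /nz1; ptx.
- by ptx.
- by ptx.
exists (fun l : seq nat => 1 + sz l * sz l); first by pbs.
move=> x i hi; apply: leq_trans (scl_bitlen _ _) _; rewrite leq_add2l.
apply: leq_trans (sum_bitlen_sz x); rewrite -{2}(cat_take_drop i x) big_cat /=; exact: leq_addr.
Qed.

Lemma PT_scl {X : Type} {eX : Enc X} (l : X -> seq nat) : PT l -> PT (fun x => scl (l x)).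
Proof. exact: (PT_comp PT_scl0). Qed.

Section PTparse.
Context {X : Type} {eX : Enc X} (l : X -> seq nat).
Hypothesis pl : PT l.
Lemma PT_pn : PT (fun x => pn (l x)). Proof. by rewrite /pn; ptx. Qed.
Lemma PT_pni : PT (fun x => iota 0 (pn (l x))).
Proof.
apply: pb_iota; first exact: PT_pn.
by apply: pb_le (pb_size pl) => x; exact: geq_minr.
Qed.
Lemma PT_pval (k : X -> nat) : PT k -> PT (fun x => pval (l x) (k x)).
Proof. by move=> pk; have ps := PT_scl pl; rewrite /pval; ptx. Qed.
End PTparse.
Ltac ptp := repeat first [ assumption | simple apply PT_pn | simple apply PT_pni
  | simple apply PT_pval | ptg | ptstep ].
Section PTparse2.
Context {X : Type} {eX : Enc X} (l : X -> seq nat).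
Hypothesis pl : PT l.
Lemma PT_pC : PT (fun x => pC (l x)). Proof. by rewrite /pC; ptp. Qed.
Lemma PT_pF : PT (fun x => pF (l x)). Proof. by rewrite /pF; ptp. Qed.
End PTparse2.
Ltac ptq := repeat first [ assumption | simple apply PT_pC | simple apply PT_pF
  | simple apply PT_pn | simple apply PT_pni | simple apply PT_pval | ptg | ptstep ].

Lemma PT_parse0 : PT parse.
Proof.
have p1 : PT pfl by rewrite /pfl /prk; ptq.
have p2 : PT pwl by rewrite /pwl /prk; ptq.
have p3 : PT (fun l : seq nat => mkseq (fun i => mkseq (pD l i) (pn l)) (pn l)).
  by rewrite /pD; ptq.
by rewrite /parse /inst; ptq.
Qed.

Lemma PT_parse {X : Type} {eX : Enc X} (l : X -> seq nat) : PT l -> PT (fun x => parse (l x)).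
Proof. exact: (PT_comp PT_parse0). Qed.

Lemma PT_bits {X : Type} {eX : Enc X} (l : X -> seq nat) : PT l -> PT (fun x => bits (l x)).
Proof.
move=> pl; have ps : PT (fun x => solve (parse (l x))) by apply: (PT_comp PT_solve); apply: PT_parse.
by rewrite /bits /=; ptq.
Qed.

Lemma PT_lowbits : PT (fun q : nat * seq nat => lowbits q.1 q.2).
Proof.
have pb2 : PT (fun q : nat * seq nat => q.2) by ptx.
rewrite /lowbits; apply: PT_sum; last first.
  apply: pb_iota; first by ptx.
  by apply: pb_le (pb_size pb2) => q; exact: geq_minr.
apply: PT_mul; first by ptx.
apply: (@PT_expn _ _ (fun=> 2) (fun q : (nat * seq nat) * nat => minn q.2 (size q.1.2))); first by ptx.
apply: pb_iota; first by ptx.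
have p3 : PT (fun q : (nat * seq nat) * nat => q.1.2) by ptx.
by apply: pb_le (pb_size p3) => q; exact: geq_minr.
Qed.

Lemma PT_main : PT main.
Proof.
have p2 : PT (fun q : nat * seq nat => bits q.2) by apply: PT_bits; ptx.
rewrite /main; apply: PT_pair.
  apply: (@PT_comp _ _ _ _ _ _ (fun q : nat * seq nat => lowbits q.1 q.2) (fun q => (q.1, bits q.2)) PT_lowbits).
  by ptx.
by apply: PT_drop; ptx.
Qed.

(** * Correctness of the guessing *)

Lemma minselP (p : pred nat) (l : seq nat) v0 : v0 \in l -> p v0 ->
  p (minsel p l) /\ minsel p l <= v0.
Proof.
move=> v0l pv0; rewrite /minsel; set L := [seq v <- l | _].
have exP : exists v, (v \in l) && p v by exists v0; rewrite v0l.
have hL : head 0 L \in L.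
  have : L != [::]; last by case: L => // c s _; exact: mem_head.
  case: (ex_minnP exP) => v1 /andP[v1c v1o] mn; apply/eqP => e.
  suff: v1 \in L by rewrite e.
  rewrite mem_filter v1c v1o /= andbT; apply/allP => u uc.
  by case uo: (p u) => //=; apply: mn; rewrite uc uo.
move: hL; rewrite mem_filter => /andP[/andP[Do /allP mn] Dc]; split=> //.
by have := mn v0 v0l; rewrite pv0.
Qed.

Lemma dpwP c : [/\ pow20 (dpw c), c <= dpw c & dpw c <= 2 * c].
Proof.
rewrite /dpw; case: eqP => [->|/eqP c0] //; split.
- by have [k ->] := pwE c; rewrite /pow20 trunc_expnK // eqxx orbT.
- exact: ltnW (ltn_pw c).
- rewrite /pw (negPf c0) /bitlen expnS leq_mul2l /=; apply: trunc_logP => //.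
  by rewrite lt0n.
Qed.

Definition iok (x : inst) : Prop :=
  let n := size x.2.2 in
  [/\ 0 < x.1.1.1, uniq x.1.2.1 /\ uniq x.1.2.2,
      forall j, j \in x.1.2.1 -> j < n, forall i, i \in x.1.2.2 -> i < n
    & [/\ size x.2.1.1 = n, size x.2.1.2 = n & forall i, i < n -> size (nth [::] x.2.2 i) = n]] /\
  [/\ forall i j, i < n -> j < n -> id_ x i j = id_ x j i,
      forall i j k, i < n -> j < n -> k < n -> id_ x i k <= id_ x i j + id_ x j k
    & forall i, i < n -> id_ x i i = 0].

Section Inst.
Variable x : inst.
Hypothesis ok : iok x.
Notation n := (size x.2.2).
Let C := x.1.2.1.
Let fac := x.1.2.2.
Let r := x.1.1.1.
Let f i := nth 0 x.2.1.1 i.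
Let w i := nth 0 x.2.1.2 i.
Let d := id_ x.

Let rowsz i : i < n -> size (nth [::] x.2.2 i) = n.
Proof. by case: ok => -[_ _ _ _ [_ _ h]] _; apply: h. Qed.

Let d_out i j : ~~ ((i < n) && (j < n)) -> d i j = 0.
Proof.
rewrite /d /id_; case: (ltnP i n) => hi /=; last by move=> _; rewrite [nth [::] _ i]nth_default ?nth_nil.
by rewrite -leqNgt => hj; rewrite nth_default // rowsz.
Qed.

Let dp_out i j : gdp (mktab x 0) i j = dpw (d i j).
Proof.
rewrite /gdp /=; case: (ltnP i n) => hi; last first.
  by rewrite [nth [::] _ i]nth_default ?size_mkseq // nth_nil d_out // ltnNge hi.
rewrite nth_mkseq //; case: (ltnP j n) => hj; first by rewrite nth_mkseq.
by rewrite nth_default ?size_mkseq // d_out // [j < n]ltnNge hj andbF.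
Qed.

Lemma mktab_gA V j : gA (mktab x V) j = if j < n then At_ x V j else [::].
Proof.
rewrite /gA /=; case: ltnP => hj; first by rewrite nth_mkseq.
by rewrite nth_default // size_mkseq.
Qed.

Lemma mktab_ok V : gok (mktab x V).
Proof.
have [[r0 [uC uF] Cn facn [sf sw sD]] [dsym dtri dii]] := ok.
split; split=> //.
- by split=> //; apply: filter_uniq.
- by move=> i; rewrite mem_filter => /andP[_ /facn].
- split=> j; last by rewrite mktab_gA; case: ifP => _ //; do 2 apply: filter_uniq.
  by move=> i; rewrite mktab_gA; case: ifP => _ //; rewrite mem_filter => /andP[].
- by rewrite /gw /gn /= nth_default // sw.
- by move=> i; rewrite mem_filter => /andP[].
- move=> i j; have -> : gdp (mktab x V) i j = dpw (d i j) by exact: dp_out.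
  exact: dpwP.
split=> //.
- move=> i; case: (ltnP i n) => hi; first exact: dii.
  by apply: d_out; rewrite ltnNge hi.
- move=> j i jC; rewrite mktab_gA (Cn j jC) mem_filter => /andP[h _]; exact: h.
Qed.

Variables (O : seq nat) (s : nat -> seq nat).
Hypotheses (uO : uniq O) (OF : {subset O <= fac}).
Hypothesis hW : \sum_(i <- O) w i <= x.1.1.2.
Hypothesis hs : forall j, j \in C -> [/\ uniq (s j), {subset s j <= O} & size (s j) = r].
Hypothesis swap : forall j i i', j \in C -> i \in s j -> i' \in O -> i' \notin s j -> d i j <= d i' j.
Let c := \sum_(i <- O) f i + \sum_(j <- C) \sum_(i <- s j) d i j.

Let Cn j : j \in C -> j < n. Proof. by case: ok => -[_ _ h _ _] _; apply: h. Qed.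
Let On i : i \in O -> i < n. Proof. by move=> /OF; case: ok => -[_ _ _ h _] _; apply: h. Qed.

(* Among the r facilities serving k one is at least as far from j as i is. *)
Lemma swap_far j k i : j \in C -> k \in C -> i \in s j ->
  d i j - d j k <= \sum_(i' <- s k) d i' k.
Proof.
move=> jC kC isj; have [us so sr] := hs jC; have [us' so' sr'] := hs kC.
have [[_ _ _ _ _] [dsym dtri _]] := ok.
have [i' i'k far] : exists2 i', i' \in s k & d i j <= d i' j.
  case: (boolP (all (fun i' => i' \in s j) (s k))) => [/allP sub|/allPn[i' i'k ni']]; last first.
    by exists i' => //; apply: swap => //; apply: so'.
  have [_ e] := uniq_min_size us' sub (eq_leq (etrans sr (esym sr'))).
  by exists i; rewrite ?e.
rewrite (perm_big _ (perm_to_rem i'k)) big_cons.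
apply: leq_trans (leq_addr _ _).
have h := dtri i' k j (On (so' _ i'k)) (Cn kC) (Cn jC).
rewrite (dsym k j (Cn kC) (Cn jC)) in h.
by move: h far; rewrite /d; clear; lia.
Qed.

(** The restrictions exclude nothing that the solution uses: the opening cost of a facility is part
    of [c], and by [swap_far] the sum in the condition on a pair is at most the service cost of all
    clients. *)
Lemma lpok_opt V : c <= V -> lpok (mktab x V).
Proof.
move=> cV; apply: (lp_feasible (mktab_ok V) (O := O) (s := s)) => //.
- move=> i iO; rewrite mem_filter OF // andbT; apply: leq_trans cV.
  by rewrite /c (perm_big _ (perm_to_rem iO)) big_cons -!addnA leq_addr.
- move=> j jC; have [us so sr] := hs jC; split=> // i isj.
  rewrite mktab_gA (Cn jC) !mem_filter (OF (so _ isj)) andbT; apply/andP; split.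
    apply: leq_trans cV; apply: leq_trans (leq_addl _ _).
    by rewrite big_seq [X in _ <= X]big_seq; apply: leq_sum => k kC; apply: swap_far.
  apply: leq_trans cV.
  by rewrite /c (perm_big _ (perm_to_rem (so _ isj))) big_cons -!addnA leq_addr.
Qed.

Lemma sum_sub_nat (h : nat -> nat) (l1 l2 : seq nat) : uniq l1 -> {subset l1 <= l2} ->
  \sum_(i <- l1) h i <= \sum_(i <- l2) h i.
Proof.
elim: l1 l2 => [|i l1 IH] l2 /=; first by rewrite big_nil.
move=> /andP[il1 ul1] sub; have il2 : i \in l2 by apply: sub; exact: mem_head.
rewrite (perm_big _ (perm_to_rem il2)) !big_cons leq_add2l; apply: IH => // k kl1.
have := sub k; rewrite in_cons kl1 orbT => /(_ isT); rewrite (perm_mem (perm_to_rem il2)) in_cons.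
by case: eqP => // e; rewrite -e kl1 in il1.
Qed.

Lemma cost_itot : c <= itot x.
Proof.
have [[_ [uC _] _ _ [sf _ _]] _] := ok.
apply: leq_add.
  apply: leq_trans (_ : \sum_(i <- iota 0 n) f i <= _).
    by apply: sum_sub_nat => // i /On h; rewrite mem_iota add0n.
  by rewrite [X in _ <= X](big_nth 0) sf /index_iota subn0.
apply: leq_trans (_ : \sum_(j <- iota 0 n) \sum_(i <- iota 0 n) d i j <= _).
  apply: leq_trans (_ : \sum_(j <- C) \sum_(i <- iota 0 n) d i j <= _).
    rewrite big_seq [X in _ <= X]big_seq; apply: leq_sum => j jC.
    have [us so _] := hs jC; apply: sum_sub_nat => // i /so /On h.
    by rewrite mem_iota add0n.
  by apply: (sum_sub_nat (fun j => \sum_(i <- iota 0 n) d i j)) => // j /Cn h; rewrite mem_iota add0n.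
rewrite exchange_big /= [X in _ <= X](big_nth [::]) /index_iota subn0.
apply: eq_leq; apply: eq_big_seq => i; rewrite mem_iota add0n => /andP[_ hi].
by rewrite [RHS](big_nth 0) rowsz // /index_iota subn0.
Qed.

Lemma solveP : [/\ uniq (solve x), {subset solve x <= fac}, \sum_(i <- solve x) w i <= x.1.1.2
  & exists2 s' : nat -> seq nat,
      forall j, j \in C -> [/\ uniq (s' j), {subset s' j <= solve x} & size (s' j) = r]
    & \sum_(i <- solve x) f i + \sum_(j <- C) \sum_(i <- s' j) d i j <= 122 * c].
Proof.
have [V0 V0l [cV Vc]] : exists2 V0, V0 \in Vlist x & c <= V0 /\ V0 <= 2 * c.
  case: (posnP c) => [->|c0]; first by exists 0; rewrite ?mem_head.
  exists (2 ^ (trunc_log 2 c).+1); last first.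
    split; first exact: ltnW (trunc_log_ltn _ _).
    by rewrite expnS leq_mul2l trunc_logP.
  rewrite in_cons; apply/orP; right; apply/mapP; exists (trunc_log 2 c).+1.
    by rewrite mem_iota add0n /bitlen !ltnS leq_trunc_log // cost_itot.
  by congr (2 ^ _); apply/esym/minn_idPl; rewrite /bitlen ltnS leq_trunc_log // cost_itot.
(* The least accepted guess may lie below the optimum; the guarantee [61 V] holds for whatever guess
   is accepted, and only [V <= V0 <= 2 c] is used. *)
have [okV leV] := minselP (p := fun V => lpok (mktab x V)) V0l (lpok_opt cV).
have [h1 h2 h3 [s' hs' hc]] := gsolP (mktab_ok (Vsel x)) okV.
split=> //; first by move=> i /h2; rewrite mem_filter => /andP[].
exists s' => //; apply: leq_trans hc _.
have -> : gV (mktab x (Vsel x)) = Vsel x by [].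
by rewrite /Vsel; move: leV Vc; move: (minsel _ _) => V1; lia.
Qed.

End Inst.

(** * Running a polynomial-time function on the input word *)

Fixpoint maxr (A : prog) : nat :=
  match A with
  | Const i _ => i
  | Op _ i j k => i + j + k
  | Read i j | Write i j => i + j
  | Seq a b => maxr a + maxr b
  | If i a b => i + (maxr a + maxr b)
  | While i a => i + maxr a
  end.

Lemma exec_frame A s t s' : exec A s t s' -> nw A -> forall i, maxr A < i -> s' i = s i.
Proof.
elim=> {A s t s'} //=.
- by move=> i c s _ k h; rewrite gtn_eqF.
- by move=> o i j k s _ l h; rewrite gtn_eqF //; lia.
- by move=> i j s _ k h; rewrite gtn_eqF //; lia.
- by move=> a b s t1 s1 t2 s2 _ IHa _ IHb /andP[na nb] i h; rewrite IHb ?IHa //; lia.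
- by move=> i a b s t s' _ _ IH /andP[na nb] k h; apply: IH => //; lia.
- by move=> i a b s t s' _ _ IH /andP[na nb] k h; apply: IH => //; lia.
- by move=> i a s t1 s1 t2 s2 _ _ IHa _ IHw na k h; rewrite IHw ?IHa //; lia.
Qed.

Lemma runs_read i j s (Q : nat -> memory -> Prop) :
  (forall s', s' i = s (s j) -> (forall l, l != i -> s' l = s l) ->
     Q (bitlen i + bitlen j + bitlen (s j) + bitlen (s (s j))) s') ->
  runs (Read i j) s Q.
Proof.
move=> h; eexists; eexists; split; first exact: ExecRead.
by apply: h => [|l /negPf] /=; [rewrite eqxx | move=> ->].
Qed.

Lemma runs_write i j s (Q : nat -> memory -> Prop) :
  (forall s', s' (s i) = s j -> (forall l, l != s i -> s' l = s l) ->
     Q (bitlen i + bitlen j + bitlen (s i) + bitlen (s j)) s') ->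
  runs (Write i j) s Q.
Proof.
move=> h; eexists; eexists; split; first exact: ExecWrite.
by apply: h => [|l /negPf] /=; [rewrite eqxx | move=> ->].
Qed.

Section Steps.
Variable U : nat.
Hypothesis U4 : 4 <= U.
(** One bound for all instructions on data of length at most [U]; it is quadratic because the cost
    of [copy] is estimated by a product. *)
Definition stepc : nat := 12 * (U * U).

Lemma le_stepc a : a <= 6 * U -> a <= stepc.
Proof. by move=> h; rewrite /stepc; nia. Qed.

Lemma bit16 i : i < 16 -> bitlen i <= U.
Proof. by move=> h; apply: leq_trans U4; apply: bitlen_leS. Qed.

Lemma bRU : (bitlen 0 <= U) * (bitlen 1 <= U) * (bitlen 2 <= U) * (bitlen 3 <= U) *
  (bitlen 4 <= U) * (bitlen 5 <= U) * (bitlen 7 <= U) * (bitlen 10 <= U) * (bitlen 11 <= U).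
Proof. by rewrite !bit16. Qed.

Lemma st_const i c s (Q : nat -> memory -> Prop) : bitlen i <= U -> bitlen c <= U ->
  (forall t s', t <= stepc -> s' i = c -> (forall j, j != i -> s' j = s j) -> Q t s') ->
  runs (Const i c) s Q.
Proof. by move=> h1 h2 h; apply: runs_const => s' e f; apply: h => //; apply: le_stepc; lia. Qed.

Lemma st_op o i j k s (Q : nat -> memory -> Prop) : bitlen i <= U -> bitlen j <= U ->
  bitlen k <= U -> bitlen (s j) <= U -> bitlen (s k) <= U ->
  (forall t s', t <= stepc -> s' i = eval_arith o (s j) (s k) ->
     (forall l, l != i -> s' l = s l) -> Q t s') ->
  runs (Op o i j k) s Q.
Proof. by move=> h1 h2 h3 h4 h5 h; apply: runs_op => s' e f; apply: h => //; apply: le_stepc; lia. Qed.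

Lemma st_read i j s (Q : nat -> memory -> Prop) : bitlen i <= U -> bitlen j <= U ->
  bitlen (s j) <= U -> bitlen (s (s j)) <= U ->
  (forall t s', t <= stepc -> s' i = s (s j) -> (forall l, l != i -> s' l = s l) -> Q t s') ->
  runs (Read i j) s Q.
Proof. by move=> h1 h2 h3 h4 h; apply: runs_read => s' e f; apply: h => //; apply: le_stepc; lia. Qed.

Lemma st_write i j s (Q : nat -> memory -> Prop) : bitlen i <= U -> bitlen j <= U ->
  bitlen (s i) <= U -> bitlen (s j) <= U ->
  (forall t s', t <= stepc -> s' (s i) = s j -> (forall l, l != s i -> s' l = s l) -> Q t s') ->
  runs (Write i j) s Q.
Proof. by move=> h1 h2 h3 h4 h; apply: runs_write => s' e f; apply: h => //; apply: le_stepc; lia. Qed.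

Lemma st_copy i j s (Q : nat -> memory -> Prop) : j != i -> bitlen i <= U -> bitlen j <= U ->
  bitlen (s j) <= U ->
  (forall t s', t <= stepc -> s' i = s j -> (forall l, l != i -> s' l = s l) -> Q t s') ->
  runs (copy i j) s Q.
Proof.
move=> ji h1 h2 h3 h; apply: runs_copy => // t s' ht e f; apply: h => //.
by apply: leq_trans ht _; rewrite /ccost /stepc; nia.
Qed.
End Steps.

Lemma call_impl P A f T H s (Q : nat -> memory -> Prop) : impl P A 10 f T -> nw A -> maxr A <= H ->
  P (s 10) (s 11) ->
  (forall t s', t <= T (s 10) (s 11) -> s' 10 = f (s 10) (s 11) ->
     (forall i, i < 10 -> s' i = s i) -> (forall i, H < i -> s' i = s i) -> Q t s') ->
  runs A s Q.
Proof.
move=> im na hH p h; have [t [s' [e [e1 e2 e3]]]] := im s p.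
exists t, s'; split=> //; apply: h => // i hi; apply: (exec_frame e na).
exact: leq_ltn_trans hi.
Qed.

Fixpoint dbl0 (c : nat) : prog := if c is c'.+1 then Seq (Op Add 0 0 0) (dbl0 c') else Op Add 0 0 0.

(** A loop would need a counter while all low registers still hold input, hence the unrolled form.
    Register 0 is the moving address and register 1, whose content has been saved beforehand, the
    increment. *)
Fixpoint sv (m : nat) : prog :=
  if m is m'.+1 then Seq (sv m') (Seq (Op Add 0 0 1) (Write 0 (m' + 2))) else Const 1 1.

Fixpoint leaf (h c : nat) : prog :=
  if h is h'.+1 then Seq (Const h' (odd (c %/ 2 ^ h'))) (leaf h' c) else Const 0 (odd c).

(* The output cells below [h] overlap the scratch registers: the program branches
   over the values of the number in register 7 that codes them, and writes
   constants. *)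
Fixpoint dec (fuel h c : nat) : prog :=
  if fuel is f.+1 then If 7 (Seq (Const 1 1) (Seq (Op Defs.Sub 7 7 1) (dec f h c.+1))) (leaf h c)
  else leaf h c.

Definition leafc (h : nat) : nat := h * (bitlen h + 1) + 2.

Lemma leaf_ok h c s : runs (leaf h c) s (fun t s' =>
  (forall i, i < h \/ i = 0 -> s' i = odd (c %/ 2 ^ i)) /\
  (forall i, h <= i -> 0 < i -> s' i = s i) /\ t <= leafc h).
Proof.
elim: h s => [|h IH] s /=.
  apply: runs_const => s' e f; split; first by move=> i [|->] //; rewrite e divn1.
  by split=> [i _ i0|]; [rewrite f // -lt0n | case: (odd c)].
apply: runs_seq; apply: runs_const => s1 e1 f1.
apply: runs_mono (IH s1) => t s2 [h1 [h2 h3]]; split.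
  move=> i [|->]; last by apply: h1; right.
  rewrite ltnS leq_eqVlt => /orP[/eqP->|ih]; last by apply: h1; left.
  by case: (posnP h) => [h0|h0]; [apply: h1; right | rewrite h2].
split; first by move=> i hi i0; rewrite h2 ?f1 // ?gtn_eqF // ltnW.
rewrite /leafc in h3 *.
have : bitlen h <= bitlen h.+1 by apply: bitlen_mono.
have : bitlen (odd (c %/ 2 ^ h)) = 1 by case: (odd _).
by move: h3; clear; nia.
Qed.

Definition decc (F fuel h : nat) : nat := fuel * (20 + 2 * bitlen F) + (3 + bitlen F) + leafc h.

Lemma dec_ok F fuel h c s : 7 < h -> s 7 <= fuel -> fuel <= F ->
  runs (dec fuel h c) s (fun t s' => (forall i, i < h -> s' i = odd ((c + s 7) %/ 2 ^ i)) /\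
    (forall i, h <= i -> s' i = s i) /\ t <= decc F fuel h).
Proof.
move=> h7; elim: fuel c s => [|fuel IH] c s /= hs hF.
  apply: runs_mono (leaf_ok h c s) => t s' [h1 [h2 h3]]; split.
    by move=> i ih; rewrite h1; [move: hs; rewrite leqn0 => /eqP ->; rewrite addn0 | left].
  split; first by move=> i hi; apply: h2 => //; apply: leq_trans hi; apply: leq_trans h7.
  by rewrite /decc; apply: leq_trans h3 _; exact: leq_addl.
apply: runs_if; case: eqP => [e0|/eqP ne] /=.
  apply: runs_mono (leaf_ok h c s) => t s' [h1 [h2 h3]]; split.
    by move=> i ih; rewrite h1; [rewrite e0 addn0 | left].
  split; first by move=> i hi; apply: h2 => //; apply: leq_trans hi; apply: leq_trans h7.
  rewrite e0 /decc; have -> : bitlen 7 = 3 by []. have -> : bitlen 0 = 1 by [].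
  by move: h3 (bitlen_gt0 F); clear; lia.
apply: runs_seq; apply: runs_const => s1 e1 f1.
apply: runs_seq; apply: runs_op => s2 e2 f2.
have s7 : s2 7 = s 7 - 1 by rewrite e2 e1 f1.
have hs2 : s2 7 <= fuel by rewrite s7 leq_subLR add1n.
apply: runs_mono (IH c.+1 s2 hs2 (ltnW hF)) => t s' [h1 [h2 h3]]; split.
  by move=> i ih; rewrite h1 // s7 addSnnS -subSn ?lt0n // subn1.
split; first by move=> i hi; rewrite h2 // f2 ?f1 //; rewrite gtn_eqF //; apply: leq_trans hi; apply: leq_trans h7.
have b7 : bitlen (s 7) <= bitlen F by apply: bitlen_mono; apply: leq_trans hF.
rewrite e1 f1 // /decc in h3 *; have -> : bitlen 7 = 3 by []. have -> : bitlen 1 = 1 by [].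
by move: h3 b7; rewrite mulSn; clear; lia.
Qed.

Lemma dbl0_ok U c s : 4 <= U -> bitlen (s 0 * 2 ^ c.+1) <= U ->
  runs (dbl0 c) s (fun t s' => s' 0 = s 0 * 2 ^ c.+1 /\ (forall i, i != 0 -> s' i = s i)
    /\ t <= c.+1 * stepc U).
Proof.
move=> U4; have b0 : bitlen 0 <= U by apply: bit16.
elim: c s => [|c IH] s hU /=.
  have bs : bitlen (s 0) <= U by apply: leq_trans hU; apply: bitlen_mono; rewrite leq_pmulr.
  by apply: (st_op U4) => // t s' ht e f; rewrite e /= mul1n muln2 addnn.
have bs : bitlen (s 0) <= U by apply: leq_trans hU; apply: bitlen_mono; rewrite leq_pmulr // expn_gt0.
apply: runs_seq; apply: (st_op U4) => // t1 s1 ht1 e1 f1.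
have E : s1 0 * 2 ^ c.+1 = s 0 * 2 ^ c.+2 by rewrite e1 /= addnn -muln2 -mulnA -expnS.
rewrite -E in hU; apply: runs_mono (IH s1 hU) => t2 s2 [e2 [f2 h2]]; split; first by rewrite e2 E.
split; first by move=> i hi; rewrite f2 // f1.
by rewrite [c.+2 * _]mulSn leq_add.
Qed.

Lemma sv_ok U m s B : 4 <= U -> s 0 = B -> m.+1 < B -> bitlen (B + m) <= U -> bitlen (m + 2) <= U ->
  (forall i, i <= m -> bitlen (s i.+1) <= U) ->
  runs (sv m) s (fun t s' => [/\ s' 0 = B + m, s' 1 = 1,
    forall i, 0 < i -> i <= m -> s' (B + i) = s i.+1,
    forall i, 1 < i -> i <= B -> s' i = s i & t <= (2 * m).+1 * stepc U]).
Proof.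
move=> U4 s0; have bR := bRU U4.
elim: m => [|m IH] mB bB bm bs /=.
  apply: (st_const U4); rewrite ?bR // => t s' ht e f; split=> //.
  - by rewrite f // addn0.
  - by move=> [|i].
  - by move=> i i1 _; rewrite f // gtn_eqF.
  - by rewrite mul1n.
have bB' : bitlen (B + m) <= U by apply: leq_trans bB; apply: bitlen_mono; rewrite leq_add2l.
have bm' : bitlen (m + 2) <= U by apply: leq_trans bm; apply: bitlen_mono; rewrite leq_add2r.
apply: runs_seq; apply: runs_mono (IH (ltnW mB) bB' bm' _) => [t1 s1 [e0 e1 e2 e3 ht1]|i im]; last first.
  by apply: bs; apply: leqW.
apply: runs_seq; apply: (st_op U4); rewrite ?bR ?e0 ?e1 ?bR // => t2 s2 ht2 e4 f4.
have m2B : m + 2 <= B by rewrite addn2; apply: ltnW.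
have v2 : s2 (m + 2) = s m.+2 by rewrite addn2 f4 // e3 // -addn2.
rewrite /= in e4.
apply: (st_write U4); rewrite ?bR ?e4 ?v2 //.
- by rewrite addn1 -addnS.
- exact: bs.
move=> t3 s3 ht3 e5 f5; rewrite addn1 -addnS in e5 f5.
have ne i : i <= B -> i != B + m.+1 by move=> iB; rewrite ltn_eqF // addnS ltnS (leq_trans iB) ?leq_addr.
split.
- by rewrite f5 ?e4 ?addn1 -?addnS // ne.
- by rewrite f5 ?f4 // ne // (leq_trans _ mB).
- move=> i i0; rewrite leq_eqVlt => /orP[/eqP->|im]; first by rewrite e5.
  rewrite f5; last by rewrite eqn_add2l ltn_eqF.
  by rewrite f4 ?e2 // -lt0n addn_gt0 i0 orbT.
- by move=> i i1 iB; rewrite f5 ?ne // f4 ?e3 // gtn_eqF // ltnW.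
- rewrite mulnS addSn -/(stepc U) mulSn mulSn; move: ht1; rewrite mulSn.
  by move: ht2 ht3; clear; lia.
Qed.

Lemma tot_arith c h N mo S X D t1 t2 t3 t4 t5 t6 sh : S <= X -> t1 <= (c + 2 * h + 5) * S ->
  t2 <= 5 * S -> t3 <= N * (13 * X) + X -> t4 <= 14 * X -> sh <= mo -> t5 <= sh * (13 * X) + X ->
  t6 <= D -> t1 + (t2 + (t3 + (t4 + (t5 + t6)))) <= (c + 2 * h + 100 + 20 * N + 20 * mo) * X + D.
Proof.
move=> SX h1 h2 h3 h4 hm h5 h6.
have a1 : (c + 2 * h + 5) * S <= (c + 2 * h + 5) * X by rewrite leq_mul2l SX orbT.
have a2 : sh * (13 * X) <= mo * (13 * X) by rewrite leq_mul2r hm orbT.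
have -> : (c + 2 * h + 100 + 20 * N + 20 * mo) * X = (c + 2 * h + 5) * X + 95 * X
  + (N * (13 * X) + 7 * (N * X)) + (mo * (13 * X) + 7 * (mo * X)) by ring.
move: (N * _) (N * _) (mo * _) (mo * _) (sh * _) a1 a2 h1 h3 h5; move: (_ * X) (_ * S) => *; lia.
Qed.

(** * The complete machine program *)

Section Glue.
Variables (main : nat * seq nat -> nat * seq nat) (bits : seq nat -> seq nat) (low : nat -> seq nat -> nat).
Hypothesis mainE : forall k l, main (k, l) = (low k l, drop k (bits l)).
Hypothesis lowlt : forall k l, low k l < 2 ^ k.
Hypothesis lowE : forall k l i, i < k -> i < size (bits l) ->
  odd (low k l %/ 2 ^ i) = (nth 0 (bits l) i != 0).

Section Progs.
Variables (Am Acp A1 A2 : prog) (gm : nat -> nat) (Tm Tcp T1 T2 : nat -> nat -> nat) (cT kT : nat).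
Hypothesis im : impl (fun x _ => exists a : nat * seq nat, x = enc a) Am 10 (fun x _ => gm x) Tm.
Hypothesis gmE : forall a : nat * seq nat, gm (enc a) = enc (main a).
Hypothesis icp : impl allp Acp 10 cp Tcp.
Hypothesis i1 : impl allp A1 10 (fun x _ => c1 x) T1.
Hypothesis i2 : impl allp A2 10 (fun x _ => c2 x) T2.
Hypotheses (nm : nw Am) (ncp : nw Acp) (n1 : nw A1) (n2 : nw A2).
Hypothesis hTm : forall a : nat * seq nat, forall y, Tm (enc a) y <= cT * (bitlen (enc a) + bitlen y) ^ kT.
Hypothesis hTcp : forall x y, Tcp x y <= cT * (bitlen x + bitlen y) ^ kT.
Hypothesis hT1 : forall x y, T1 x y <= cT * (bitlen x + bitlen y) ^ kT.
Hypothesis hT2 : forall x y, T2 x y <= cT * (bitlen x + bitlen y) ^ kT.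

(** No called program touches a register above this bound, and the 20 covers the registers that the
    surrounding code addresses by name. *)
Definition HH : nat := 20 + (maxr Am + (maxr Acp + (maxr A1 + maxr A2))).
Let H := HH.
Definition cE : nat := bitlen H.+1.
Definition Bs_ (l : seq nat) : nat := size l * 2 ^ cE.+1.

(** The list is coded from its last entry on. Entry [k] is found in register [k + 1] if this is
    above [H], and otherwise in its copy at [B + k]. *)
Definition bodyB : prog :=
  Seq (Const 1 H) (Seq (Op Defs.Sub 4 2 1)
  (Seq (If 4 (copy 4 2) (Seq (Op Add 4 0 2) (Seq (Const 1 1) (Op Defs.Sub 4 4 1))))
  (Seq (Read 10 4) (Seq (copy 11 3) (Seq Acp (Seq (copy 3 10) (Seq (Const 1 1) (Op Defs.Sub 2 2 1)))))))).
(* The scratch registers overlap the input, whose first [H] cells are saved at an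
   address beyond both; this address is the input length times a constant, so
   that the length can be recovered from it. *)
Definition phA : prog := Seq (dbl0 cE) (Seq (Write 0 1) (sv H.-1)).
Definition phB : prog := Seq (Const 1 H.-1) (Seq (Op Defs.Sub 0 0 1)
  (Seq (Const 1 (2 ^ cE.+1)) (Seq (Op Div 2 0 1) (Const 3 0)))).
(** Register 11 is cleared before the one-argument calls, because the length of the second argument
    enters their time bounds. *)
Definition phC : prog :=
  Seq (Const 10 H.+1) (Seq (copy 11 3) (Seq Acp (Seq (Const 11 0) (Seq Am (Seq (copy 3 10)
  (Seq (Const 11 0) (Seq A1 (Seq (copy 7 10) (Seq (copy 10 3) (Seq (Const 11 0) (Seq A2
  (Seq (copy 3 10) (Const 4 H.+1))))))))))))).
Definition bodyD : prog :=
  Seq (copy 10 3) (Seq (Const 11 0) (Seq A1 (Seq (copy 5 10) (Seq (copy 10 3) (Seq (Const 11 0)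
  (Seq A2 (Seq (copy 3 10) (Seq (Write 4 5) (Seq (Const 1 1) (Op Add 4 4 1)))))))))).
Definition ramA : prog := Seq phA (Seq phB (Seq (While 2 bodyB) (Seq phC
  (Seq (While 3 bodyD) (dec (2 ^ H.+1) H.+1 0))))).

Section Run.
Variable l : seq nat.
Hypothesis lne : l != [::].
Let N := size l.
Let B := Bs_ l.
Let mo := bitlen (enc (main (H.+1, l))).
Definition UU : nat := 40 + bitlen (2 ^ cE.+1) + 3 * bitlen H.+1 + 2 * (sz l + 1) + 2 * mo.
Let U := UU.
Definition CB : nat := cT * (U + U) ^ kT.
Definition XX : nat := stepc U + CB + 2 * U.

Let U4 : 4 <= U. Proof. by rewrite /U /UU -!addnA. Qed.
Let b16 i : i < 16 -> bitlen i <= U. Proof. exact: bit16. Qed.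
Let bR := bRU U4.
Let N0 : 0 < N. Proof. by rewrite /N; case: (l) lne. Qed.
Let H20 : 20 <= H. Proof. by rewrite /H /HH leq_addr. Qed.
Let HB : H.+1 < B.
Proof.
rewrite /B /Bs_; apply: leq_trans (_ : 1 * 2 ^ cE.+1 <= _); last by rewrite leq_mul2r N0 orbT.
by rewrite mul1n expnS; have := bitlenP H.+1; rewrite -/cE; move: (2 ^ cE); clear; lia.
Qed.
Let NB : N < B.
Proof.
rewrite /B /Bs_ -/N -[X in X < _]muln1 ltn_mul2l N0 /=; apply: leq_trans (_ : 2 ^ 1 <= _) => //.
by rewrite leq_exp2l.
Qed.
Let bx x : x <= B + N + H.+1 -> bitlen x <= U.
Proof.
move=> h; apply: leq_trans (bitlen_mono h) _.
apply: leq_trans (bitlen_add _ _) _.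
have h1 : bitlen (B + N) <= bitlen B + bitlen N := bitlen_add _ _.
have h2 : bitlen B <= bitlen N + bitlen (2 ^ cE.+1) := bitlen_mul _ _.
have h3 : bitlen N <= sz l + 1 by rewrite addn1; apply: leq_trans (bitlen_self _) _; rewrite ltnS size_sz.
by rewrite /U /UU; move: h1 h2 h3; clear; lia.
Qed.
Let bl x : x <= sz l -> x <= U. Proof. by rewrite /U /UU => h; move: h; clear; lia. Qed.
Let bmo x : x <= mo -> x <= U. Proof. by rewrite /U /UU => h; move: h; clear; lia. Qed.
Let bnth i : bitlen (nth 0 l i) <= U.
Proof.
case: (ltnP i (size l)) => hi; first exact/bl/sz_nth.
by rewrite nth_default // b16.
Qed.

(** Register [H] may be overwritten by a call, so that entry [H - 1], which it held, is the last one
    to be read from the copy. Beyond the input both sides are 0. *)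
Definition far (s : memory) : Prop :=
  (forall i, i < H -> s (B + i) = nth 0 l i) /\
  (forall i, H < i -> i < B -> s i = nth 0 l i.-1).

Lemma far_frame s s' : (forall i, H < i -> s' i = s i) -> far s -> far s'.
Proof.
move=> f [f1 f2]; split=> i hi; last by move=> iB; rewrite f ?f2.
by rewrite f ?f1 //; apply: leq_trans (leq_addr _ _); apply: ltnW.
Qed.

Lemma hiH i j : i < 20 -> H < j -> j != i.
Proof. by move=> hi hj; rewrite gtn_eqF //; apply: leq_trans hi _; apply: leq_trans H20 (ltnW hj). Qed.

Lemma callB x y : bitlen x <= U -> bitlen y <= U -> cT * (bitlen x + bitlen y) ^ kT <= CB.
Proof. by move=> hx hy; rewrite leq_mul2l leq_exp2r_ ?orbT // leq_add. Qed.

Lemma mr : [/\ maxr Am <= H, maxr Acp <= H, maxr A1 <= H & maxr A2 <= H].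
Proof. by rewrite /H /HH; split; clear; lia. Qed.

Lemma phA_ok : runs phA (init l) (fun t s => [/\ s 0 = B + H.-1, far s & t <= (cE + 2 * H + 5) * stepc U]).
Proof.
have H0 : 0 < H by apply: leq_trans H20.
apply: runs_seq; apply: runs_mono (@dbl0_ok U cE (init l) U4 _) => [t1 s1 [e1 [f1 h1]]|]; last first.
  by apply: bx; rewrite -addnA leq_addr.
have e1' : s1 0 = B by rewrite e1.
apply: runs_seq; apply: (st_write U4); rewrite ?bR ?e1' //.
- by apply: bx; rewrite -addnA leq_addr.
- by rewrite f1 //; exact: (bnth 0).
move=> t2 s2 ht2 e2 f2; rewrite f1 // in e2.
have B1 : 1 < B by apply: leq_trans HB.
have s20 : s2 0 = B by rewrite f2 ?e1' // ltn_eqF // ltnW.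
have s2i i : 1 < i.+1 -> i.+1 < B -> s2 i.+1 = nth 0 l i.
  by move=> _ iB; rewrite f2 ?f1 // ltn_eqF.
apply: runs_mono (@sv_ok U H.-1 s2 B U4 s20 _ _ _ _).
- move=> t3 s3 [e3 e4 e5 e6 h3]; split=> //.
    split=> [[|i] hi|[|i] hi iB] //.
    + by rewrite addn0 e6 // e2.
    + have hi' : i.+1 <= H.-1 by rewrite -ltnS prednK.
      by rewrite e5 // s2i //; apply: leq_ltn_trans hi _; exact: ltnW HB.
    + have i_1 : 1 < i.+1 by apply: leq_trans hi; rewrite ltnS.
      by rewrite e6 // ?s2i // ltnW.
  have e7 : (2 * H.-1).+1 <= 2 * H by case: (H) H0 => // h _; rewrite /= mulnS.
  have : (2 * H.-1).+1 * stepc U <= 2 * H * stepc U by rewrite leq_mul2r e7 orbT.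
  by move: h1 ht2 h3; rewrite !mulnDl mulSn; clear; lia.
- by rewrite prednK // (leq_trans _ HB) // leqW.
- apply: bx; rewrite -addnA leq_add2l; apply: leq_trans (leq_addl _ _).
  exact: leq_trans (leq_pred _) (leqnSn _).
- apply: bx; apply: leq_trans (leq_addl _ _); rewrite addn2 prednK //.
- move=> i; rewrite -ltnS prednK // => hi.
  case: i hi => [|i] hi; first by rewrite f2 ?f1 // ?ltn_eqF //; exact: (bnth 0).
  by rewrite s2i //; apply: leq_ltn_trans hi _; exact: ltnW HB.
Qed.

Lemma phB_ok s : s 0 = B + H.-1 -> far s ->
  runs phB s (fun t s' => [/\ s' 0 = B, s' 2 = N, s' 3 = 0, far s' & t <= 5 * stepc U]).
Proof.
move=> s0 fs; have bH : bitlen (B + H.-1) <= U.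
  apply: bx; rewrite -addnA leq_add2l; apply: leq_trans (leq_addl _ _).
  exact: leq_trans (leq_pred _) (leqnSn _).
have bP : bitlen H.-1 <= U by apply: leq_trans bH; apply: bitlen_mono; exact: leq_addl.
have bB : bitlen B <= U by apply: bx; rewrite -addnA leq_addr.
have b2 : bitlen (2 ^ cE.+1) <= U.
  by apply: leq_trans bB; apply: bitlen_mono; rewrite /B /Bs_ leq_pmull.
apply: runs_seq; apply: (st_const U4); rewrite ?bR // => t1 s1 ht1 e1 f1.
apply: runs_seq; apply: (st_op U4); rewrite ?bR ?e1 ?f1 ?s0 // => t2 s2 ht2 e2 f2.
rewrite /= addnK in e2.
apply: runs_seq; apply: (st_const U4); rewrite ?bR // => t3 s3 ht3 e3 f3.
have s30 : s3 0 = B by rewrite f3 ?e2.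
apply: runs_seq; apply: (st_op U4); rewrite ?bR ?e3 ?s30 // => t4 s4 ht4 e4 f4.
apply: (st_const U4); rewrite ?bR // => t5 s5 ht5 e5 f5.
split=> //.
- by rewrite f5 // f4.
- by rewrite f5 // e4 /= mulnK // expn_gt0.
- apply: far_frame fs => i iH.
  by rewrite f5 ?f4 ?f3 ?f2 ?f1 // hiH.
- by move: ht1 ht2 ht3 ht4 ht5; clear; lia.
Qed.

Lemma bodyB_ok s k : k < N -> s 0 = B -> s 2 = k.+1 -> s 3 = enc (drop k.+1 l) -> far s ->
  runs bodyB s (fun t s' => [/\ s' 0 = B, s' 2 = k, s' 3 = enc (drop k l), far s' & t <= 12 * XX]).
Proof.
move=> kN s0 s2 s3 fs; have [_ mcp _ _] := mr.
have bB : bitlen B <= U by apply: bx; rewrite -addnA leq_addr.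
have bH : bitlen H <= U by apply: bx; apply: leq_trans (leq_addl _ _).
have bk : bitlen k.+1 <= U by apply: bx; apply: leq_trans (leq_addr _ _); apply: leq_trans (leq_addl _ _).
have by_ : bitlen (enc (drop k.+1 l)) <= U by apply/bl/sz_drop.
have ed : cp (nth 0 l k) (enc (drop k.+1 l)) = enc (drop k l) by rewrite (drop_nth 0 kN).
apply: runs_seq; apply: (st_const U4); rewrite ?bR // => t1 s1 ht1 e1 f1.
have s12 : s1 2 = k.+1 by rewrite f1.
apply: runs_seq; apply: (st_op U4); rewrite ?bR ?e1 ?s12 // => t2 m2 ht2 e2 f2.
rewrite /= in e2.
have m20 : m2 0 = B by rewrite f2 ?f1.
have m22 : m2 2 = k.+1 by rewrite f2.
have ba : bitlen (k.+1 - H) <= U by apply: leq_trans bk; apply: bitlen_mono; exact: leq_subr.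
pose ad := if k.+1 - H != 0 then k.+1 else B + k.
have bad : bitlen ad <= U.
  rewrite /ad; case: ifP => // _; apply: bx; rewrite -addnA leq_add2l.
  by apply: leq_trans (leq_addr _ _); apply: ltnW.
have fad : m2 ad = nth 0 l k.
  have fm : far m2 by apply: far_frame fs => i iH; rewrite f2 ?f1 // hiH.
  case: (leqP k.+1 H) => hk.
    have -> : ad = B + k by rewrite /ad subn_eq0 hk.
    by case: fm => h _; apply: h.
  have -> : ad = k.+1 by rewrite /ad -lt0n subn_gt0 hk.
  by case: fm => _ h; rewrite h //; apply: leq_ltn_trans NB.
have ad10 : ad != 10 /\ ad != 4 /\ ad != 1.
  have : H < ad.
    case: (leqP k.+1 H) => hk; last by rewrite /ad -lt0n subn_gt0 hk.
    by rewrite /ad subn_eq0 hk /=; apply: leq_trans (leq_addr _ _); apply: ltnW.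
  by move=> h; rewrite !hiH.
apply: runs_seq.
suff IFok : runs (If 4 (copy 4 2) (Seq (Op Add 4 0 2) (Seq (Const 1 1) (Op Defs.Sub 4 4 1)))) m2
   (fun t s' => [/\ s' 4 = ad, forall i, i != 4 -> i != 1 -> s' i = m2 i & t <= 3 * stepc U + 2 * U]).
  apply: runs_mono IFok => t3 m3 [e3 f3 ht3].
  apply: runs_seq; apply: (st_read U4); rewrite ?bR ?e3 // ?f3 ?ad10 // ?fad //; try by case: ad10 => _ [].
  move=> t4 m4 ht4 e4 f4.
  have e4' : m4 10 = nth 0 l k by rewrite e4; case: ad10 => _ [? ?]; rewrite ?f3 ?fad.
  have m43 : m4 3 = enc (drop k.+1 l) by rewrite f4 // f3 // f2 // f1.
  apply: runs_seq; apply: (st_copy U4); rewrite ?bR ?m43 // => t5 m5 ht5 e5 f5.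
  have m50 : m5 10 = nth 0 l k by rewrite f5.
  apply: runs_seq; apply: (call_impl icp ncp mcp) => // t6 m6 ht6 e6 f6 g6.
  rewrite m50 e5 in ht6 e6; rewrite ed in e6.
  have ct6 : t6 <= CB by apply: leq_trans ht6 _; apply: leq_trans (hTcp _ _) _; apply: callB.
  apply: runs_seq; apply: (st_copy U4); rewrite ?bR ?e6 //; first by apply/bl/sz_drop.
  move=> t7 m7 ht7 e7 f7.
  apply: runs_seq; apply: (st_const U4); rewrite ?bR // => t8 m8 ht8 e8 f8.
  have m82 : m8 2 = k.+1 by rewrite f8 // f7 // f6 // f5 // f4 // f3.
  apply: (st_op U4); rewrite ?bR ?m82 ?e8 ?bR // => t9 m9 ht9 e9 f9.
  split.
  - by rewrite f9 // f8 // f7 // f6 // f5 // f4 // f3.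
  - by rewrite e9 /= subn1.
  - by rewrite f9 // f8 // e7.
  - by apply: far_frame fs => i iH; rewrite f9 ?f8 ?f7 ?g6 ?f5 ?f4 ?f3 ?f2 ?f1 // hiH.
  - move: ht1 ht2 ht3 ht4 ht5 ct6 ht7 ht8 ht9; rewrite /XX; clear; lia.
apply: runs_if; rewrite e2.
case E: (k.+1 - H != 0) => /=.
  apply: (st_copy U4); rewrite ?bR ?m22 // => t3 m3 ht3 e3 f3.
  split; first by rewrite e3 /ad E.
    by move=> i i4 _; rewrite f3.
  by have := b16 (isT : 4 < 16); move: ht3 ba; clear; lia.
apply: runs_seq; apply: (st_op U4); rewrite ?bR ?m20 ?m22 // => t3 m3 ht3 e3 f3.
rewrite /= in e3.
apply: runs_seq; apply: (st_const U4); rewrite ?bR // => t4 m4 ht4 e4 f4.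
have m44 : m4 4 = B + k.+1 by rewrite f4.
apply: (st_op U4); rewrite ?bR ?m44 ?e4 ?bR //.
  by apply: bx; rewrite -addnA leq_add2l; apply: leq_trans (leq_addr _ _).
move=> t5 m5 ht5 e5 f5; split.
- by rewrite e5 /= /ad E addnS subn1.
- by move=> i h4 h1; rewrite f5 // f4 // f3.
- by have := b16 (isT : 4 < 16); move: ht3 ht4 ht5 ba; clear; lia.
Qed.

Lemma loopB_ok k s : k <= N -> s 0 = B -> s 2 = k -> s 3 = enc (drop k l) -> far s ->
  runs (While 2 bodyB) s (fun t s' => [/\ s' 3 = enc l, far s' & t <= k * (13 * XX) + XX]).
Proof.
elim: k s => [|k IH] s kN s0 s2 s3 fs.
  apply: runs_while_false => //; split=> //; first by rewrite s3 drop0.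
  by rewrite s2 mul0n add0n; have := b16 (isT : 2 < 16); have := b16 (isT : 0 < 16); rewrite /XX; clear; lia.
apply: runs_while_true; first by rewrite s2.
apply: runs_mono (bodyB_ok kN s0 s2 s3 fs) => t1 s1 [e0 e2 e3 f1 ht1].
apply: runs_mono (IH s1 (ltnW kN) e0 e2 e3 f1) => t2 s4 [e4 f4 ht2]; split=> //.
have bk : bitlen k.+1 <= U.
  by apply: bx; apply: leq_trans (leq_addr _ _); apply: leq_trans (leq_addl _ _).
rewrite s2 [k.+1 * _]mulSn; have := b16 (isT : 2 < 16); move: bk ht1 ht2.
have : 2 * U <= XX by rewrite /XX; clear; lia.
clear; lia.
Qed.

Let hi := drop H.+1 (bits l).
Let lo := low H.+1 l.
Let moE : enc (main (H.+1, l)) = cp lo (enc hi). Proof. by rewrite mainE. Qed.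
Let bhi i : bitlen (enc (drop i hi)) <= U.
Proof. by apply: bmo; apply: leq_trans (sz_drop _ _) _; rewrite /mo moE bitlen_cpr. Qed.
Let blo : bitlen lo <= U.
Proof. by apply: bmo; rewrite /mo moE bitlen_cpl. Qed.

Lemma phC_ok s : s 3 = enc l ->
  runs phC s (fun t s' => [/\ s' 3 = enc hi, s' 7 = lo, s' 4 = H.+1 & t <= 14 * XX]).
Proof.
move=> s3; have [mm mcp m1 m2] := mr.
have bH : bitlen H.+1 <= U by apply: bx; exact: leq_addl.
have bel : bitlen (enc l) <= U by apply/bl.
have bcp : bitlen (cp H.+1 (enc l)) <= U.
  apply: leq_trans (bitlen_cp _ _) _; rewrite /U /UU /sz; clear; lia.
have bmn : bitlen (enc (main (H.+1, l))) <= U by apply: bmo.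
apply: runs_seq; apply: (st_const U4); rewrite ?bR // => t1 s1 ht1 e1 f1.
have s13 : s1 3 = enc l by rewrite f1.
apply: runs_seq; apply: (st_copy U4); rewrite ?bR ?s13 // => t2 s2 ht2 e2 f2.
have s20 : s2 10 = H.+1 by rewrite f2.
apply: runs_seq; apply: (call_impl icp ncp mcp) => // t4 s4 ht4 e4 f4 g4.
rewrite s20 e2 in ht4 e4.
have ct4 : t4 <= CB by apply: leq_trans ht4 _; apply: leq_trans (hTcp _ _) _; apply: callB.
apply: runs_seq; apply: (st_const U4); rewrite ?bR // => t5 s5 ht5 e5 f5.
have s50 : s5 10 = enc (H.+1, l) by rewrite f5.
apply: runs_seq; apply: (call_impl im nm mm); first by rewrite s50; exists (H.+1, l).
move=> t6 s6 ht6 e6 f6 g6; rewrite s50 e5 in ht6 e6; rewrite gmE in e6.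
have ct6 : t6 <= CB.
  by apply: leq_trans ht6 _; apply: leq_trans (hTm _ _) _; apply: callB => //; exact: b16.
apply: runs_seq; apply: (st_copy U4); rewrite ?bR ?e6 // => t7 s7 ht7 e7 f7.
apply: runs_seq; apply: (st_const U4); rewrite ?bR // => t8 s8 ht8 e8 f8.
have s80 : s8 10 = enc (main (H.+1, l)) by rewrite f8 // f7 // e6.
apply: runs_seq; apply: (call_impl i1 n1 m1) => // t9 s9 ht9 e9 f9 g9.
rewrite s80 e8 in ht9 e9; rewrite moE c1_cp in e9.
have ct9 : t9 <= CB.
  by apply: leq_trans ht9 _; apply: leq_trans (hT1 _ _) _; apply: callB => //; exact: b16.
apply: runs_seq; apply: (st_copy U4); rewrite ?bR ?e9 // => t10 s10 ht10 e10 f10.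
have s103 : s10 3 = enc (main (H.+1, l)) by rewrite f10 // f9 // f8 // e7.
apply: runs_seq; apply: (st_copy U4); rewrite ?bR ?s103 // => t11 s11 ht11 e11 f11.
apply: runs_seq; apply: (st_const U4); rewrite ?bR // => t12 s12 ht12 e12 f12.
have s120 : s12 10 = enc (main (H.+1, l)) by rewrite f12 // e11.
apply: runs_seq; apply: (call_impl i2 n2 m2) => // t13 s13' ht13 e13 f13 g13.
rewrite s120 e12 in ht13 e13; rewrite moE c2_cp in e13.
have ct13 : t13 <= CB.
  by apply: leq_trans ht13 _; apply: leq_trans (hT2 _ _) _; apply: callB => //; exact: b16.
apply: runs_seq; apply: (st_copy U4); rewrite ?bR ?e13 //; first by rewrite -[hi]drop0.
move=> t14 s14 ht14 e14 f14.
apply: (st_const U4); rewrite ?bR // => t15 s15 ht15 e15 f15.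
split=> //; first by rewrite f15 // e14.
  by rewrite f15 // f14 // f13 // f12 // f11 // e10.
move: ht1 ht2 ct4 ht5 ct6 ht7 ht8 ct9 ht10 ht11 ht12 ct13 ht14 ht15; rewrite /XX; clear; lia.
Qed.

Lemma loopD_ok k i s : i + k = size hi -> s 3 = enc (drop i hi) -> s 4 = H.+1 + i -> s 7 = lo ->
  (forall j, j < i -> s (H.+1 + j) = nth 0 hi j) ->
  runs (While 3 bodyD) s (fun t s' => [/\ s' 7 = lo,
    forall j, j < size hi -> s' (H.+1 + j) = nth 0 hi j & t <= k * (13 * XX) + XX]).
Proof.
have [_ _ m1 m2] := mr.
have XU : 2 * U <= XX by rewrite /XX; clear; lia.
elim: k i s => [|k IH] i s ik s3 s4 s7 sj.
  apply: runs_while_false; first by rewrite s3 drop_oversize // -ik addn0.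
  split=> //; first by move=> j; rewrite -ik addn0; exact: sj.
  rewrite s3; have -> : enc (drop i hi) = 0 by rewrite drop_oversize // -ik addn0.
  by rewrite mul0n add0n; apply: leq_trans XU; rewrite mul2n -addnn leq_add // b16.
have ih : i < size hi by rewrite -ik -addSnnS leq_addr.
have ed : enc (drop i hi) = cp (nth 0 hi i) (enc (drop i.+1 hi)) by rewrite (drop_nth 0 ih).
have bi := bhi i.
have bnt : bitlen (nth 0 hi i) <= U by apply: leq_trans bi; rewrite ed bitlen_cpl.
have ba : bitlen (H.+1 + i) <= U.
  apply: leq_trans (bitlen_add _ _) _.
  have h1 : bitlen i <= mo + 1.
    rewrite addn1; apply: leq_trans (bitlen_self _) _; rewrite ltnS; apply: leq_trans (ltnW ih) _.
    by apply: leq_trans (size_sz _) _; rewrite /mo moE bitlen_cpr.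
  by rewrite /U /UU; move: h1; clear; lia.
apply: runs_while_true; first by rewrite s3 ed -lt0n cp_gt0.
apply: runs_seq; apply: (st_copy U4); rewrite ?bR ?s3 // => t1 q1 ht1 e1 f1.
apply: runs_seq; apply: (st_const U4); rewrite ?bR // => t2 q2 ht2 e2 f2.
have q20 : q2 10 = enc (drop i hi) by rewrite f2 // e1.
apply: runs_seq; apply: (call_impl i1 n1 m1) => // t3 q3 ht3 e3 f3 g3.
rewrite q20 e2 in ht3 e3.
have ct3 : t3 <= CB.
  by apply: leq_trans ht3 _; apply: leq_trans (hT1 _ _) _; apply: callB => //; exact: b16.
rewrite ed c1_cp in e3.
apply: runs_seq; apply: (st_copy U4); rewrite ?bR ?e3 // => t4 q4 ht4 e4 f4.
have q43 : q4 3 = enc (drop i hi) by rewrite f4 // f3 // f2 // f1.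
apply: runs_seq; apply: (st_copy U4); rewrite ?bR ?q43 // => t5 q5 ht5 e5 f5.
apply: runs_seq; apply: (st_const U4); rewrite ?bR // => t6 q6 ht6 e6 f6.
have q60 : q6 10 = enc (drop i hi) by rewrite f6 // e5.
apply: runs_seq; apply: (call_impl i2 n2 m2) => // t7 q7 ht7 e7 f7 g7.
rewrite q60 e6 in ht7 e7.
have ct7 : t7 <= CB.
  by apply: leq_trans ht7 _; apply: leq_trans (hT2 _ _) _; apply: callB => //; exact: b16.
rewrite ed c2_cp in e7.
apply: runs_seq; apply: (st_copy U4); rewrite ?bR ?e7 ?bhi // => t8 q8 ht8 e8 f8.
have q84 : q8 4 = H.+1 + i by rewrite f8 // f7 // f6 // f5 // f4 // f3 // f2 // f1.
have q85 : q8 5 = nth 0 hi i by rewrite f8 // f7 // f6 // f5.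
apply: runs_seq; apply: (st_write U4); rewrite ?bR ?q84 ?q85 // => t9 q9 ht9 e9 f9.
have lowne j : j < 20 -> j != H.+1 + i.
  by move=> j20; rewrite ltn_eqF // (leq_trans j20) // (leq_trans H20) // -addnS addSnnS -addSnnS leqW ?leq_addr.
apply: runs_seq; apply: (st_const U4); rewrite ?bR // => t10 q10 ht10 e10 f10.
have q104 : q10 4 = H.+1 + i by rewrite f10 // f9 ?q84 // lowne.
apply: (st_op U4); rewrite ?bR ?q104 ?e10 ?bR // => t11 q11 ht11 e11 f11.
have ik' : i.+1 + k = size hi by rewrite addSnnS.
apply: runs_mono (IH i.+1 q11 ik' _ _ _ _).
- move=> t12 q12 [h1 h2 ht12]; split=> //.
  rewrite [k.+1 * _]mulSn; have b3 := b16 (isT : 3 < 16).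
  move: b3 bi XU ht1 ht2 ct3 ht4 ht5 ht6 ct7 ht8 ht9 ht10 ht11 ht12.
  have : 9 * stepc U + 2 * CB <= 11 * XX by rewrite /XX; clear; lia.
  clear; lia.
- by rewrite f11 // f10 // f9 ?e8 // lowne.
- by rewrite e11 /= addn1 addnS.
- by rewrite f11 // f10 // f9 ?lowne // f8 // f7 // f6 // f5 // f4 // f3 // f2 // f1.
- move=> j; have jH : H < H.+1 + j by rewrite leq_addr.
  rewrite f11 ?f10 ?hiH // ltnS leq_eqVlt => /orP[/eqP->|ji]; first exact: e9.
  rewrite f9; last by rewrite eqn_add2l ltn_eqF.
  by rewrite f8 ?g7 ?f6 ?f5 ?f4 ?g3 ?f2 ?f1 ?hiH // sj.
Qed.

Definition TT : nat := (cE + 2 * H + 100 + 20 * size l + 20 * mo) * XX + decc (2 ^ H.+1) (2 ^ H.+1) H.+1.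

Lemma ramA_ok : runs ramA (init l) (fun t s => t <= TT /\
  forall i, i < size (bits l) -> (s i != 0) = (nth 0 (bits l) i != 0)).
Proof.
apply: runs_seq; apply: runs_mono phA_ok => t1 s1 [a0 a1 ht1].
apply: runs_seq; apply: runs_mono (phB_ok a0 a1) => t2 s2 [b0 b2 b3 bf ht2].
have b3' : s2 3 = enc (drop N l) by rewrite b3 drop_size.
apply: runs_seq; apply: runs_mono (loopB_ok (leqnn N) b0 b2 b3' bf) => t3 s3 [c3 _ ht3].
apply: runs_seq; apply: runs_mono (phC_ok c3) => t4 s4 [d3 d7 d4 ht4].
have d3' : s4 3 = enc (drop 0 hi) by rewrite drop0.
have d4' : s4 4 = H.+1 + 0 by rewrite addn0.
apply: runs_seq; apply: runs_mono (loopD_ok (add0n _) d3' d4' d7 _) => [t5 s5 [g7 gh ht5]|] //.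
have H7 : 7 < H.+1 by apply: leq_trans H20 (leqnSn _).
have l7 : s5 7 <= 2 ^ H.+1 by rewrite g7 ltnW // lowlt.
(* The low cells are decoded last, as this overwrites all scratch registers. *)
apply: runs_mono (dec_ok 0 H7 l7 (leqnn _)) => t6 s6 [o1 [o2 ht6]]; split.
  have sh : size hi <= mo by apply: leq_trans (size_sz _) _; rewrite /mo moE bitlen_cpr.
  have sX : stepc U <= XX by rewrite /XX -addnA leq_addr.
  exact: (tot_arith sX ht1 ht2 ht3 ht4 sh ht5 ht6).
move=> i ib; case: (ltnP i H.+1) => iH.
  rewrite o1 // add0n g7 lowE //; by case: (nth 0 (bits l) i != 0).
rewrite o2 // -(subnKC iH) gh; last by rewrite size_drop ltn_sub2r // (leq_ltn_trans iH).
by rewrite nth_drop.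
Qed.

End Run.
End Progs.

Theorem glue : PT main -> exists A T, @pb (seq nat) _ T /\ forall l, l != [::] ->
  runs A (init l) (fun t s => t <= T l /\
    forall i, i < size (bits l) -> (s i != 0) = (nth 0 (bits l) i != 0)).
Proof.
move=> pmain; have [gm [_ hgm] gmE] := pmain.
have [Am [Tm [[cm [km hTm]] [im nm]]]] := hgm 10.
have [_ hcp] : PT2 allp cp := PT2_cp (PT2_fst allp) (PT2_snd allp).
have [Acp [Tcp [[ccp [kcp hTcp]] [icp ncp]]]] := hcp 10.
have [_ h1] : PT2 allp (fun x _ => c1 x) := PT2_c1 (PT2_fst allp).
have [A1 [T1 [[d1 [k1 hT1]] [i1 n1]]]] := h1 10.
have [_ h2] : PT2 allp (fun x _ => c2 x) := PT2_c2 (PT2_fst allp).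
have [A2 [T2 [[d2 [k2 hT2]] [i2 n2]]]] := h2 10.
pose cT := cm + ccp + d1 + d2; pose kT := km + kcp + k1 + k2.
have up c k x y : c <= cT -> k <= kT ->
    c * (bitlen x + bitlen y) ^ k <= cT * (bitlen x + bitlen y) ^ kT.
  by move=> hc hk; apply: leq_mul => //; rewrite leq_pexp2l // sz_gt0.
exists (ramA Am Acp A1 A2), (TT Am Acp A1 A2 cT kT); split; last first.
  move=> l lne; eapply ramA_ok; eauto.
  - by move=> a y; apply: leq_trans (hTm _ _ _) _; [exists a | apply: up; rewrite /cT /kT; clear; lia].
  - by move=> x y; apply: leq_trans (hTcp _ _ _) _ => //; apply: up; rewrite /cT /kT; clear; lia.
  - by move=> x y; apply: leq_trans (hT1 _ _ _) _ => //; apply: up; rewrite /cT /kT; clear; lia.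
  - by move=> x y; apply: leq_trans (hT2 _ _ _) _ => //; apply: up; rewrite /cT /kT; clear; lia.
have b1 : pb (fun l : seq nat => size l) by apply: pb_size; exact: PT_id.
pose (Hc := (HH Am Acp A1 A2).+1).
have pm : PT (fun l : seq nat => main (Hc, l)).
  by apply: (PT_comp pmain (g := fun l : seq nat => (Hc, l))); apply: PT_pair; [exact: PT_const | exact: PT_id].
have b2 : pb (fun l : seq nat => bitlen (enc (main (Hc, l)))) := PT_sz pm.
have bU : pb (UU Am Acp A1 A2) by rewrite /UU -/Hc; pbs.
have bX : pb (XX Am Acp A1 A2 cT kT).
  rewrite /XX /stepc /CB; apply: pb_add; last by pbs.
  apply: pb_add; first by pbs.
  by apply: pb_mul; [exact: pb_const | apply: pb_exp; apply: pb_add].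
by rewrite /TT -/Hc; pbs.
Qed.

End Glue.

(** * Bits, blocks and the decoding of an instance *)

Lemma binsum (b : nat -> bool) m : \sum_(i <- iota 0 m) b i * 2 ^ i < 2 ^ m /\
  forall j, j < m -> odd ((\sum_(i <- iota 0 m) b i * 2 ^ i) %/ 2 ^ j) = b j.
Proof.
elim: m => [|m [IH1 IH2]]; first by rewrite big_nil.
rewrite -[m.+1]addn1 iotaD big_cat /= add0n big_seq1; set x := (\sum_(i <- _) _) in IH1 IH2 *.
have p2 : 0 < 2 ^ m by rewrite expn_gt0.
split.
  by rewrite addn1 expnS; clear IH2; clearbody x; case: (b m); rewrite ?mul1n ?mul0n; lia.
move=> j; rewrite addn1 ltnS leq_eqVlt => /orP[/eqP ->|jm].
  by rewrite addnC divnMDl // divn_small // addn0 oddb.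
have -> : b m * 2 ^ m = b m * 2 ^ (m - j) * 2 ^ j by rewrite -mulnA -expnD subnK // ltnW.
rewrite addnC divnMDl ?expn_gt0 // oddD IH2 // oddM oddX /= subn_eq0 leqNgt jm.
by rewrite andbF.
Qed.

Section FlattenBlocks.
Variables (S T : eqType) (x0 : T) (f : S -> seq T) (k : nat).

Lemma nth_blocks a0 (s : seq S) i c : (forall a, a \in s -> size (f a) = k) -> i < size s -> c < k ->
  nth x0 (flatten [seq f a | a <- s]) (i * k + c) = nth x0 (f (nth a0 s i)) c.
Proof.
elim: s i => // a s IH [|i] hs; rewrite /= nth_cat hs ?mem_head //.
  by move=> _ ck; rewrite mul0n add0n ck.
rewrite ltnS => hi ck; rewrite mulSn -addnA ltnNge leq_addr /= addKn IH // => b bs.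
by apply: hs; rewrite in_cons bs orbT.
Qed.

Lemma size_blocks (s : seq S) : (forall a, a \in s -> size (f a) = k) ->
  size (flatten [seq f a | a <- s]) = size s * k.
Proof.
elim: s => // a s IH hs; rewrite /= size_cat hs ?mem_head // IH ?mulSn // => b bs.
by apply: hs; rewrite in_cons bs orbT.
Qed.
End FlattenBlocks.

Lemma dvdn_scl (l : seq nat) a : a \in l -> a != 0 -> a %| scl l.
Proof.
rewrite /scl; suff H p : a \in l -> a != 0 -> a %| foldl (fun p a => p * nz1 a) p l by exact: H.
have D q s : q %| foldl (fun p a => p * nz1 a) q s.
  elim: s q => [|c s IH] q //=; exact: dvdn_trans (dvdn_mulr _ (dvdnn q)) (IH _).
elim: l p => // c l IH p; rewrite in_cons => /orP[/eqP <-|al] a0 /=; last exact: IH.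
by apply: dvdn_trans (D _ _); rewrite /nz1 (negPf a0) dvdn_mull.
Qed.

Lemma scl_gt0 l : 0 < scl l.
Proof.
rewrite /scl; suff H p : 0 < p -> 0 < foldl (fun p a => p * nz1 a) p l by exact: H.
elim: l p => //= c l IH p p0; apply: IH; rewrite muln_gt0 p0 /nz1; by case: c.
Qed.

Lemma rat_scale (q : rat) (P : nat) : (0 <= q)%R -> `|denq q|%N %| P ->
  ((`|numq q|%N * (P %/ `|denq q|%N))%:R = q * P%:R :> rat)%R.
Proof.
move=> q0.
have hq : (q = (`|numq q|%N)%:R / (`|denq q|%N)%:R)%R.
  rewrite -[LHS]divq_num_den -[numq q in LHS]gez0_abs ?numq_ge0 //.
  by rewrite -[denq q in LHS]gez0_abs ?denq_ge0.
have dq : 0 < `|denq q|%N by rewrite absz_gt0 denq_neq0.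
move: (`|numq q|%N) (`|denq q|%N) dq hq => a b b0 -> /dvdnP[c ->].
have d0 : (b%:R != 0 :> rat)%R by rewrite pnatr_eq0 -lt0n.
by rewrite mulnK // !natrM; field.
Qed.

Section Decode.
Variable I : ftkpmed.
Hypothesis vI : valid I.
Notation n := (npoints I).
Variable l : seq nat.
Hypothesis lI : l = encode I.
Notation P := (scl l).

Let L1 : seq nat := [:: n; req I] ++ encode_rat (budget I).
Let L2 : seq nat := [seq nat_of_bool (i \in clients I) | i <- enum 'I_n].
Let L3 : seq nat := [seq nat_of_bool (i \in facilities I) | i <- enum 'I_n].
Let L4 : seq nat := flatten [seq encode_rat (fcost i) ++ encode_rat (weight i) | i <- enum (facilities I)].
Let L5 : seq nat := flatten [seq encode_rat (dist i j) | i <- enum 'I_n, j <- enum 'I_n].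
Let m := #|facilities I|.

Let lE : l = L1 ++ L2 ++ L3 ++ L4 ++ L5. Proof. by rewrite lI /encode /L1 -!catA. Qed.
Let s1 : size L1 = 4. Proof. by []. Qed.
Let s2 : size L2 = n. Proof. by rewrite size_map size_enum_ord. Qed.
Let s3 : size L3 = n. Proof. by rewrite size_map size_enum_ord. Qed.
Let s4 : size L4 = m * 4.
Proof. by rewrite (@size_blocks _ _ _ 4) // -cardE. Qed.

Let n2 i : i < n -> nth 0 l (4 + i) = nth 0 L2 i.
Proof. by move=> hi; rewrite lE nth_cat s1 ltnNge leq_addr /= addKn nth_cat s2 hi. Qed.
Let n3 i : i < n -> nth 0 l (4 + n + i) = nth 0 L3 i.
Proof.
move=> hi; rewrite lE nth_cat s1 -addnA ltnNge leq_addr /= addKn.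
by rewrite nth_cat s2 ltnNge leq_addr /= addKn nth_cat s3 hi.
Qed.
Let n4 i : i < m * 4 -> nth 0 l (4 + 2 * n + i) = nth 0 L4 i.
Proof.
move=> hi; rewrite lE nth_cat s1 mul2n -addnn -!addnA ltnNge leq_addr /= addKn.
rewrite nth_cat s2 ltnNge leq_addr /= addKn nth_cat s3 ltnNge leq_addr /= addKn.
by rewrite nth_cat s4 hi.
Qed.
Let n5 i : nth 0 l (4 + 2 * n + 4 * m + i) = nth 0 L5 i.
Proof.
rewrite [4 * m]mulnC lE nth_cat s1 mul2n -addnn -!addnA ltnNge leq_addr /= addKn.
rewrite nth_cat s2 ltnNge leq_addr /= addKn nth_cat s3 ltnNge leq_addr /= addKn.
by rewrite nth_cat s4 ltnNge leq_addr /= addKn.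
Qed.

Lemma pnE : pn l = n.
Proof.
rewrite /pn; have -> : nth 0 l 0 = n by rewrite lE.
apply/minn_idPl; rewrite lE !size_cat s2 addnCA; exact: leq_addr.
Qed.

Lemma nth2 (i : 'I_n) : nth 0 l (4 + i) = (i \in clients I).
Proof. by rewrite n2 // (nth_map i) ?size_enum_ord // nth_ord_enum. Qed.
Lemma nth3 (i : 'I_n) : nth 0 l (4 + n + i) = (i \in facilities I).
Proof. by rewrite n3 // (nth_map i) ?size_enum_ord // nth_ord_enum. Qed.

Lemma mem_pC k : (k \in pC l) = (if insub k is Some i then (i : 'I_n) \in clients I else false).
Proof.
rewrite mem_filter mem_iota pnE add0n; case: insubP => [i ki <-|/negPf ->]; last by rewrite !andbF.
by rewrite leq0n ltn_ord andbT nth2; case: (i \in _).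
Qed.
Lemma mem_pF k : (k \in pF l) = (if insub k is Some i then (i : 'I_n) \in facilities I else false).
Proof.
rewrite mem_filter mem_iota pnE add0n; case: insubP => [i ki <-|/negPf ->]; last by rewrite !andbF.
by rewrite leq0n ltn_ord andbT nth3; case: (i \in _).
Qed.
Lemma mem_pC_ord (i : 'I_n) : (val i \in pC l) = (i \in clients I).
Proof. by rewrite mem_pC valK. Qed.
Lemma mem_pF_ord (i : 'I_n) : (val i \in pF l) = (i \in facilities I).
Proof. by rewrite mem_pF valK. Qed.

Lemma pFE : pF l = [seq val i | i <- enum (facilities I)].
Proof.
rewrite /pF pnE -val_enum_ord filter_map; congr map.
rewrite {2}/enum_mem -enumT; apply: eq_filter => i.
by change ((nth 0 l (4 + n + i) != 0) = (i \in facilities I)); rewrite nth3; case: (i \in _).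
Qed.

Lemma size_pF : size (pF l) = m. Proof. by rewrite pFE size_map -cardE. Qed.

Lemma pvalE k (q : rat) : (0 <= q)%R -> k.+1 < size l -> nth 0 l k = `|numq q|%N ->
  nth 0 l k.+1 = `|denq q|%N -> ((pval l k)%:R = q * P%:R :> rat)%R.
Proof.
move=> q0 kl h1 h2; rewrite /pval h1 h2; apply: rat_scale => //; rewrite -h2.
by apply: dvdn_scl; [exact: mem_nth | rewrite h2 -lt0n absz_gt0 denq_neq0].
Qed.

Lemma pW : ((pval l 2)%:R = budget I * P%:R :> rat)%R.
Proof.
have [_ _ _ b0 _] := vI; by apply: pvalE => //; rewrite lE ?size_cat ?s1.
Qed.

(** A set of ordinals is enumerated in increasing order, so that the elements listed before [i] are
    those below it. *)
Lemma rank_pF (i : 'I_n) : i \in facilities I ->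
  size [seq k <- pF l | k < i] = index i (enum (facilities I)).
Proof.
move=> iF; rewrite pFE filter_map size_map.
have: sorted ltn (map val (enum (facilities I))).
  rewrite -pFE /pF; apply: sorted_filter; [exact: ltn_trans | exact: iota_ltn_sorted].
have: i \in enum (facilities I) by rewrite mem_enum.
elim: (enum (facilities I)) => // a s IH; rewrite in_cons [sorted _ _]/= path_sortedE; last exact: ltn_trans.
move=> is_ /andP[/allP h1 h2]; move: is_; rewrite eq_sym /=.
case: (eqVneq a i) => [e|ai] /= is_.
  rewrite e ltnn (eq_in_filter (a2 := pred0)) ?filter_pred0 // => x xs /=.
  by apply/negbTE; rewrite -leqNgt ltnW // -e; apply: h1; apply: map_f.
have hai : a < i := h1 (val i) (map_f _ is_).
by rewrite hai /= IH.
Qed.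

Lemma size_l : size l = 4 + 2 * n + 4 * m + size L5.
Proof. by rewrite lE size_cat s1 size_cat s2 size_cat s3 size_cat s4; lia. Qed.

Lemma prk_lt (i : 'I_n) c : i \in facilities I -> c < 4 -> prk l i + c < size l.
Proof.
move=> iF c4; rewrite /prk pnE rank_pF // size_l.
have : index i (enum (facilities I)) < m by rewrite /m cardE index_mem mem_enum.
by move: (index _ _) => k; lia.
Qed.

Lemma prk_nth (i : 'I_n) c : i \in facilities I -> c < 4 ->
  nth 0 l (prk l i + c) = nth 0 (encode_rat (fcost i) ++ encode_rat (weight i)) c.
Proof.
move=> iF c4; rewrite /prk pnE rank_pF // -addnA n4.
  rewrite mulnC (@nth_blocks _ _ 0 _ 4 i) // ?index_mem ?mem_enum //.
  by rewrite nth_index // mem_enum.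
have : index i (enum (facilities I)) < m by rewrite /m cardE index_mem mem_enum.
by move: (index _ _) => k; lia.
Qed.

Lemma pflE (i : 'I_n) : i \in facilities I -> ((nth 0 (pfl l) i)%:R = fcost i * P%:R :> rat)%R.
Proof.
move=> iF; have [_ _ h _ _] := vI; have [f0 _] := h i iF.
rewrite nth_mkseq ?pnE // mem_pF_ord iF; apply: pvalE => //.
- by rewrite -addn1; apply: prk_lt.
- by have := prk_nth iF (isT : 0 < 4); rewrite addn0.
- by have := prk_nth iF (isT : 1 < 4); rewrite addn1.
Qed.

Lemma pwlE (i : 'I_n) : i \in facilities I -> ((nth 0 (pwl l) i)%:R = weight i * P%:R :> rat)%R.
Proof.
move=> iF; have [_ _ h _ _] := vI; have [_ f0] := h i iF.
rewrite nth_mkseq ?pnE // mem_pF_ord iF; apply: pvalE => //.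
- by rewrite -addnS; apply: prk_lt.
- by have := prk_nth iF (isT : 2 < 4).
- by have := prk_nth iF (isT : 3 < 4); rewrite addnS.
Qed.

Lemma ord_pair (i j : 'I_n) : i * n + j < n * n.
Proof. by have := ltn_ord i; have := ltn_ord j; nia. Qed.

Lemma L5_nth (i j : 'I_n) c : c < 2 ->
  nth 0 L5 (2 * (i * n + j) + c) = nth 0 (encode_rat (dist i j)) c.
Proof.
move=> c2; rewrite /L5; set L := [seq _ | _ <- _, _ <- _].
have sL : size L = n * n.
  by rewrite (@size_blocks _ _ _ n) ?size_enum_ord // => a _; rewrite size_map size_enum_ord.
have hL x : x \in L -> size x = 2 by move=> /flatten_mapP[a _ /mapP[b _ ->]].
rewrite -[L]map_id mulnC (@nth_blocks _ _ 0 id 2 [::]) ?sL ?ord_pair //.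
congr (nth 0 _ c); rewrite (@nth_blocks _ _ [::] _ n i) ?size_enum_ord //; last first.
  by move=> a _; rewrite size_map size_enum_ord.
by rewrite (nth_map j) ?size_enum_ord // !nth_ord_enum.
Qed.

Lemma pDE (i j : 'I_n) : ((pD l i j)%:R = dist i j * P%:R :> rat)%R.
Proof.
have [_ [d0 _ _ _] _ _ _] := vI.
have sL : size L5 = n * n * 2.
  rewrite -[L5]/(flatten [seq _ | _ <- _, _ <- _]) -[X in flatten X]map_id (@size_blocks _ _ _ 2).
    by rewrite (@size_blocks _ _ _ n) ?size_enum_ord // => a _; rewrite size_map size_enum_ord.
  by move=> x /flatten_mapP[a _ /mapP[b _ ->]].
rewrite /pD pnE size_pF; apply: pvalE => //.
- rewrite -addnS size_l sL ltn_add2l; have := ord_pair i j; move: (i * n + j) (n * n) => u v; lia.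
- by rewrite n5 -[2 * _]addn0 L5_nth.
- by rewrite -addnS n5 -addn1 L5_nth.
Qed.

Lemma size_parse : size (parse l).2.2 = n. Proof. by rewrite size_mkseq pnE. Qed.

Lemma idE (i j : 'I_n) : id_ (parse l) i j = pD l i j.
Proof. by rewrite /id_ /= nth_mkseq ?pnE // nth_mkseq ?pnE. Qed.

Let P0 : (0 < P%:R :> rat)%R. Proof. by rewrite ltr0n scl_gt0. Qed.

Lemma parse_ok : iok (parse l).
Proof.
have [_ [d0 di ds dt] _ _ r0] := vI.
rewrite /iok size_parse; split; split=> //.
- by rewrite lE.
- by split; apply: filter_uniq; exact: iota_uniq.
- by move=> j; rewrite mem_filter mem_iota pnE => /and3P[].
- by move=> j; rewrite mem_filter mem_iota pnE => /and3P[].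
- split; rewrite ?size_mkseq ?pnE // => i hi.
  by rewrite nth_mkseq ?pnE // size_mkseq.
- move=> i j hi hj; rewrite (idE (Ordinal hi) (Ordinal hj)) (idE (Ordinal hj) (Ordinal hi)).
  by apply/eqP; rewrite -(eqr_nat rat) !pDE ds.
- move=> i j k hi hj hk.
  rewrite (idE (Ordinal hi) (Ordinal hj)) (idE (Ordinal hj) (Ordinal hk)) (idE (Ordinal hi) (Ordinal hk)).
  by rewrite -(ler_nat rat) natrD !pDE -mulrDl ler_pM2r.
- move=> i hi; rewrite (idE (Ordinal hi) (Ordinal hi)).
  apply/eqP; rewrite -(eqr_nat rat) pDE.
  by have [_ ->] := di (Ordinal hi) (Ordinal hi); rewrite ?mul0r.
Qed.

Lemma perm_set (A : {set 'I_n}) (S : seq nat) : uniq S -> (forall k, k \in S -> k < n) ->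
  (forall i : 'I_n, (i \in A) = (val i \in S)) -> perm_eq [seq val i | i <- enum A] S.
Proof.
move=> uS Sn AS; apply: uniq_perm => //.
  by rewrite map_inj_uniq ?enum_uniq //; exact: val_inj.
move=> k; apply/mapP/idP => [[i]|kS]; first by rewrite mem_enum AS => iS ->.
by exists (Ordinal (Sn k kS)) => //; rewrite mem_enum AS.
Qed.

Lemma sum_conv (A : {set 'I_n}) (S : seq nat) (hN : nat -> nat) (h : 'I_n -> rat) :
  uniq S -> (forall k, k \in S -> k < n) -> (forall i : 'I_n, (i \in A) = (val i \in S)) ->
  (forall i, i \in A -> ((hN i)%:R = h i * P%:R)%R) ->
  ((\sum_(k <- S) hN k)%N%:R = (\sum_(i in A) h i) * P%:R :> rat)%R.
Proof.
move=> uS Sn AS e; rewrite -(perm_big _ (perm_set uS Sn AS)) big_map natr_sum big_distrl /=.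
by rewrite big_enum /=; apply: eq_bigr => i; exact: e.
Qed.

Lemma card_conv (A : {set 'I_n}) (S : seq nat) : uniq S -> (forall k, k \in S -> k < n) ->
  (forall i : 'I_n, (i \in A) = (val i \in S)) -> #|A| = size S.
Proof. by move=> uS Sn AS; rewrite -(perm_size (perm_set uS Sn AS)) size_map -cardE. Qed.

Section Opt.
Variable opt : rat.
Hypothesis hopt : is_optimum I opt.
Let S := solve (parse l).
Let A : {set 'I_n} := [set i : 'I_n | val i \in S].
Let r := req I.
Let C := pC l.

Let Cn j : j \in C -> j < n. Proof. by rewrite mem_filter mem_iota pnE => /and3P[]. Qed.
Let Fn j : j \in pF l -> j < n. Proof. by rewrite mem_filter mem_iota pnE => /and3P[]. Qed.
Let rE : (parse l).1.1.1 = r. Proof. by rewrite /= lE. Qed.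

Lemma opt_main : feasible A /\ (cost A <= 122%:R * opt)%R.
Proof.
have [[F [FF FW Fr] Fc] _] := hopt.
have [_ [d0 di ds dt] _ _ r0] := vI.
pose SM (j : 'I_n) (F' : {set 'I_n}) : rat := (\sum_(i in F') dist i j)%R.
pose PP (F' : {set 'I_n}) := (F' \subset F) && (#|F'| == r).
pose F0 : {set 'I_n} := [set i in take r (enum F)].
have F0P : r <= #|F| -> PP F0.
  move=> rF; apply/andP; split.
    by apply/subsetP => i; rewrite inE => /mem_take; rewrite mem_enum.
  rewrite cardsE (card_uniqP _) ?take_uniq ?enum_uniq //.
  by rewrite size_takel // -cardE.
have exM (j : 'I_n) : exists Fm : {set 'I_n}, j \in clients I ->
    PP Fm /\ forall F', PP F' -> (SM j Fm <= SM j F')%R.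
  case: (boolP (j \in clients I)) => jC; last by exists F0.
  have h0 := F0P (Fr j jC).
  by case: (arg_minP (SM j) h0) => Fm Pm mn; exists Fm.
have [Fm FmP] := fin_all_exists exM.
pose vl (B : {set 'I_n}) : seq nat := [seq val i | i <- enum B].
pose O := vl F.
pose s k := if insub k is Some j then vl (Fm j) else [::].
have sE (j : 'I_n) : s j = vl (Fm j) by rewrite /s valK.
have uval (B : {set 'I_n}) : uniq (vl B) by rewrite map_inj_uniq ?enum_uniq //; exact: val_inj.
have mval (B : {set 'I_n}) (i : 'I_n) : (i \in B) = (val i \in vl B).
  by rewrite mem_map ?mem_enum //; exact: val_inj.
have nval (B : {set 'I_n}) k : k \in vl B -> k < n by move=> /mapP[i _ ->]; exact: ltn_ord.
have ordC j : j \in C -> exists2 j' : 'I_n, j = j' & j' \in clients I.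
  by move=> jC; exists (Ordinal (Cn jC)) => //; rewrite -mem_pC_ord.
have OF : {subset O <= (parse l).1.2.2}.
  by move=> k /mapP[i]; rewrite mem_enum => iF ->; rewrite mem_pF_ord; apply: (subsetP FF).
have hW : \sum_(i <- O) nth 0 (parse l).2.1.2 i <= (parse l).1.1.2.
  rewrite -(ler_nat rat) (sum_conv (uval F) (@nval F) (mval F) (h := fun i => weight i)); last first.
    by move=> i iF; apply: pwlE; apply: (subsetP FF).
  by rewrite pW ler_pM2r.
have hs j : j \in (parse l).1.2.1 -> [/\ uniq (s j), {subset s j <= O} & size (s j) = (parse l).1.1.1].
  move=> /ordC[j' -> j'C]; have [/andP[sub /eqP card] _] := FmP j' j'C.
  rewrite sE rE; split=> //; last by rewrite size_map -cardE.
  move=> k /mapP[i]; rewrite mem_enum => iF ->; rewrite -mval; exact: (subsetP sub).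
have swp j i i' : j \in (parse l).1.2.1 -> i \in s j -> i' \in O -> i' \notin s j ->
    id_ (parse l) i j <= id_ (parse l) i' j.
  move=> /ordC[j' -> j'C]; have [/andP[sub /eqP card] mn] := FmP j' j'C.
  rewrite sE => /mapP[i1]; rewrite mem_enum => i1F ->.
  move=> /mapP[i2]; rewrite mem_enum => i2F ->; rewrite -mval => i2n.
  rewrite !idE -(ler_nat rat) !pDE ler_pM2r //.
  (* Replacing [i1] by [i2] yields another admissible [r]-subset, so that the minimiser compares the
     two distances. *)
  have P2 : PP (i2 |: Fm j' :\ i1).
    apply/andP; split.
      rewrite subUset sub1set i2F /=; apply: subset_trans sub; exact: subD1set.
    by rewrite cardsU1 !inE (negPf i2n) andbF /= add1n -card (cardsD1 i1 (Fm j')) i1F.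
  have := mn _ P2; rewrite /SM (big_setD1 i1 i1F) /= big_setU1; last by rewrite !inE (negPf i2n) andbF.
  by rewrite lerD2r.
have [uS SF SW [s' hs' hc]] := solveP parse_ok (uval F) OF hW hs swp.
rewrite -/S in uS SF SW hs' hc.
have Sn k : k \in S -> k < n by move=> /SF /Fn.
have AS (i : 'I_n) : (i \in A) = (val i \in S) by rewrite inE.
have AF : A \subset facilities I.
  by apply/subsetP => i; rewrite AS => /SF; rewrite mem_pF_ord.
have Crd : uniq C by exact/filter_uniq/iota_uniq.
have CA (i : 'I_n) : (i \in clients I) = (val i \in C) by rewrite mem_pC_ord.
have sub_le (j : 'I_n) (B1 B2 : {set 'I_n}) : B1 \subset B2 -> (SM j B1 <= SM j B2)%R.
  by move=> h; rewrite /SM [X in (_ <= X)%R](big_setID B1) /= (setIidPr h) lerDl sumr_ge0.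
have conv2 (j : 'I_n) (B : {set 'I_n}) (q : seq nat) : uniq q -> (forall k, k \in q -> k < n) ->
    (forall i : 'I_n, (i \in B) = (val i \in q)) ->
    ((\sum_(i <- q) id_ (parse l) i j)%N%:R = SM j B * P%:R :> rat)%R.
  move=> uq qn Bq; apply: (sum_conv uq qn Bq (h := fun i => dist i j)) => i _.
  by rewrite idE pDE.
have hc2 : ((\sum_(i <- O) nth 0 (parse l).2.1.1 i +
    \sum_(j <- (parse l).1.2.1) \sum_(i <- s j) id_ (parse l) i j)%N%:R <= opt * P%:R :> rat)%R.
  rewrite natrD (sum_conv (uval F) (@nval F) (mval F) (h := fun i => fcost i)); last first.
    by move=> i iF; apply: pflE; apply: (subsetP FF).
  rewrite (sum_conv Crd Cn CA (h := fun j => SM j (Fm j))); last first.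
    by move=> j jC; rewrite sE; apply: conv2; [exact: uval | exact: nval | exact: mval].
  rewrite -mulrDl ler_pM2r // -Fc /cost lerD2l; apply: ler_sum => j jC.
  have [/andP[sub _] mn] := FmP j jC.
  (* The default value of the minimum is the sum over the whole of [F], a superset of the
     minimiser. *)
  apply: le_bigmin; first exact: sub_le.
  by move=> F' h; apply: mn.
split.
  split=> //.
    rewrite -(ler_pM2r P0) -pW -(sum_conv uS Sn AS (hN := fun i => nth 0 (pwl l) i)) ?ler_nat //.
    by move=> i iA; apply: pwlE; apply: (subsetP AF).
  move=> j; rewrite CA => jC; have [us' ss' sr'] := hs' _ jC.
  by rewrite (card_conv uS Sn AS) -/r -rE -sr'; apply: uniq_leq_size.
rewrite -(ler_pM2r P0) -mulrA; apply: le_trans (ler_wpM2l (ler0n _ _) hc2).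
move: hc; rewrite -(ler_nat rat) natrM => hc3; apply: le_trans hc3.
rewrite natrD (sum_conv uS Sn AS (h := fun i => fcost i)); last first.
  by move=> i iA; apply: pflE; apply: (subsetP AF).
pose Bj (j : 'I_n) : {set 'I_n} := [set i : 'I_n | val i \in s' j].
rewrite (sum_conv Crd Cn CA (h := fun j => SM j (Bj j))); last first.
  move=> j; rewrite CA => jC; have [us' ss' sr'] := hs' _ jC.
  apply: conv2 => //; first by move=> k /ss' /Sn.
  by move=> i; rewrite inE.
rewrite -mulrDl ler_pM2r // /cost lerD2l; apply: ler_sum => j; rewrite CA => jC.
have [us' ss' sr'] := hs' _ jC.
apply: (@bigmin_le_cond _ _ _ _ (Bj j)); apply/andP; split.
  by apply/subsetP => i; rewrite inE => /ss'; rewrite AS.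
rewrite (card_conv us') ?sr' ?rE //; first by move=> k /ss' /Sn.
by move=> i; rewrite inE.
Qed.

End Opt.
End Decode.

(** An entry [a] contributes [2 * bitlen a + 4 <= 6 * bitlen a] to the code of the list. *)
Lemma sz_input (l : seq nat) : sz l <= 6 * input_size l + 1.
Proof.
rewrite /input_size; elim: l => [|a l IH]; first by rewrite big_nil.
rewrite big_cons; apply: leq_trans (szc a l) _.
have := bitlen_gt0 a; rewrite /sz /= in IH *; move: IH.
by move: (bitlen a) (\sum_(j <- l) _) (bitlen (enc l)) => u v z; lia.
Qed.

Lemma size_bits l : size (bits l) = pn l. Proof. by rewrite size_mkseq. Qed.

Lemma nth_bits l i : i < size (bits l) -> nth 0 (bits l) i = (i \in solve (parse l)).
Proof. by rewrite size_bits => h; rewrite nth_mkseq. Qed.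

Lemma lowbitsE k l : lowbits k (bits l) =
  \sum_(i <- iota 0 (minn k (size (bits l)))) (i \in solve (parse l)) * 2 ^ i.
Proof.
apply: eq_big_seq => i; rewrite mem_iota add0n leq_min => /and3P[_ ik ib].
by rewrite nth_bits // (minn_idPl (ltnW ib)).
Qed.

Lemma lowbits_lt k l : lowbits k (bits l) < 2 ^ k.
Proof.
rewrite lowbitsE; apply: leq_trans (binsum _ _).1 _.
by rewrite leq_exp2l // geq_minl.
Qed.

Lemma odd_lowbits k l i : i < k -> i < size (bits l) ->
  odd (lowbits k (bits l) %/ 2 ^ i) = (nth 0 (bits l) i != 0).
Proof.
move=> ik ib; rewrite lowbitsE (binsum _ _).2 ?leq_min ?ik ?ib // nth_bits //.
by case: (i \in _).
Qed.

Local Open Scope ring_scope.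

Theorem theorem13 (R : realType) :
  exists (K : R) (p : {poly {poly R}}),
  forall eps : R, 0 < eps ->
  exists A : prog,
  forall I : ftkpmed, valid I ->
  exists (t : nat) (s : memory),
    [/\ exec A (init (encode I)) t s,
        t%:R <= p.[(input_size (encode I))%:R%:P].[eps^-1]
      & forall opt : rat, is_optimum I opt ->
          feasible (output I s) /\
          ratr (cost (output I s))
            <= (143%:R + 34%:R / 100%:R + K * eps) * ratr opt].
Proof.
have [A [T [[c [k hT]] hA]]] := @glue main bits (fun k l => lowbits k (bits l))
  (fun k l => erefl) lowbits_lt odd_lowbits PT_main.
(* The ratio 122 leaves the coefficient of [eps] at 0, and the polynomial is constant in the inverse
   of [eps]. The 7 comes from [6 u + 1 <= 7 u] for the positive input size [u]. *)
exists 0, ((c * 7 ^ k)%:R%:P%:P * 'X^k) => eps eps0; exists A => I vI.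
have lne : encode I != [::] by [].
have [t [s [ex [ht hb]]]] := hA _ lne; exists t, s; split=> //.
  rewrite hornerM hornerC hornerXn hornerM hornerC horner_exp hornerC.
  rewrite -natrX -natrM ler_nat -mulnA -expnMn.
  apply: leq_trans ht _; apply: leq_trans (hT _) _; rewrite leq_mul2l; apply/orP; right.
  apply: leq_exp2r_; apply: leq_trans (sz_input _) _.
  have : (0 < input_size (encode I))%N by rewrite /input_size big_cons addn_gt0 bitlen_gt0.
  by move: (input_size _) => u; lia.
move=> opt hopt.
have [F1 F2] := opt_main vI erefl hopt.
have eO : output I s = [set i : 'I_(npoints I) | val i \in solve (parse (encode I))].
  apply/setP => i; rewrite !inE.
  have ib : (i < size (bits (encode I)))%N by rewrite size_bits (pnE erefl).
  by rewrite hb // nth_bits //; case: (_ \in _).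
rewrite eO; split=> //.
have opt0 : 0 <= opt.
  have [_ [d0 _ _ _] f0 _ _] := vI.
  have [[F [FF _ _] <-] _] := hopt; rewrite /cost addr_ge0 ?sumr_ge0 //.
    by move=> i iF; have [] := f0 i (subsetP FF i iF).
  by move=> j _; apply: le_bigmin => [|F' _]; apply: sumr_ge0.
rewrite mul0r addr0; apply: le_trans (_ : 122%:R * ratr opt <= _).
  by rewrite -[122%:R](ratr_nat R) -rmorphM ler_rat.
apply: ler_wpM2r; first by rewrite ler0q.
rewrite -[X in X <= _]addr0; apply: lerD; first by rewrite ler_nat.
by rewrite divr_ge0 ?ler0n.
Qed.
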